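(* Let $n\in\{2,3\}$, $\epsilon>0$, $0<R_1<R_2$, $q_1,q_2\in\mathbb{R}$ constants, and consider, for $R_1<|x|<R_2$, $t>0$, $x\in\mathbb{R}^n$, the system $$u_t+(u\cdot\nabla)u=\frac{\epsilon}{2}\Delta u,\qquad \rho_t+\nabla\cdot(\rho u)=0$$ with initial conditions $u(x,0)=\frac{x}{|x|}q_0(r)$, $\rho(x,0)=\rho_0(r)$, $R_1<r=|x|<R_2$, and boundary conditions $\lim_{|x|\to R_i}\frac{x}{|x|}\cdot u(x,t)=q_i$, $i=1,2$, and $\lim_{|x|\to R_i}\rho(x,t)=\rho_i(t)$ for those $i$ with $(-1)^{i+1}q_i>0$; a first order consistency condition of the initial and boundary data at $\{|x|=R_i,\ t=0\}$, $i=1,2$, is assumed. Then an explicit solution is given, with $r=|x|$, by $$u(x,t)=\frac{x}{|x|}q(r,t),\qquad q(r,t)=-\epsilon\,\frac{\int_{R_1}^{R_2}\partial_rG(r,\xi,t)\,e^{-\frac1\epsilon\int_{R_1}^\xi q_0(s)ds}\,d\xi}{\int_{R_1}^{R_2}G(r,\xi,t)\,e^{-\frac1\epsilon\int_{R_1}^\xi q_0(s)ds}\,d\xi},$$ $$\rho(x,t)=r^{-(n-1)}\,p_\Gamma\big(\beta(r,t,t_0(r,t)),t_0(r,t)\big)\,e^{-\int_{t_0(r,t)}^tq_r(\beta(r,t,s),s)\,ds},$$ where $G$ is as follows. For $n=2$, $$G(r,\xi,t)=\frac{\pi^2}{2}\sum_{m=1}^\infty\frac{\lambda_m^2}{B_m}\Big[\frac{q_2}{\epsilon}J_0(\lambda_mR_2)-\lambda_mJ_1(\lambda_mR_2)\Big]^2\xi\,H_m(r)H_m(\xi)\,e^{-\frac{\epsilon\lambda_m^2t}{2}},$$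 $$B_m=\Big(\lambda_m^2+\frac{q_2^2}{\epsilon^2}\Big)\Big[-\frac{q_1}{\epsilon}J_0(\lambda_mR_1)+\lambda_mJ_1(\lambda_mR_1)\Big]^2-\Big(\lambda_m^2+\frac{q_1^2}{\epsilon^2}\Big)\Big[\frac{q_2}{\epsilon}J_0(\lambda_mR_2)-\lambda_mJ_1(\lambda_mR_2)\Big]^2,$$ $$H_m(r)=\Big[-\frac{q_1}{\epsilon}Y_0(\lambda_mR_1)+\lambda_mY_1(\lambda_mR_1)\Big]J_0(\lambda_mr)-\Big[-\frac{q_1}{\epsilon}J_0(\lambda_mR_1)+\lambda_mJ_1(\lambda_mR_1)\Big]Y_0(\lambda_mr),$$ with $\lambda_m$ the positive roots of $$\Big[-\tfrac{q_1}{\epsilon}J_0(\lambda R_1)+\lambda J_1(\lambda R_1)\Big]\Big[\tfrac{q_2}{\epsilon}Y_0(\lambda R_2)-\lambda Y_1(\lambda R_2)\Big]-\Big[\tfrac{q_2}{\epsilon}J_0(\lambda R_2)-\lambda J_1(\lambda R_2)\Big]\Big[-\tfrac{q_1}{\epsilon}Y_0(\lambda R_1)+\lambda Y_1(\lambda R_1)\Big]=0.$$ For $n=3$, $$G(r,\xi,t)=\frac{2\xi}{r}\sum_{m=1}^\infty\frac{(b_2^2+R_2^2\lambda_m^2)\,\Psi_m(r)\Psi_m(\xi)\,e^{-\frac{\epsilon}{2}\lambda_m^2t}}{(R_2-R_1)(b_1^2+R_1^2\lambda_m^2)(b_2^2+R_2^2\lambda_m^2)+(b_1R_2+b_2R_1)(b_1b_2+R_1R_2\lambda_m^2)},$$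 $$\Psi_m(r)=b_1\sin[\lambda_m(r-R_1)]+R_1\lambda_m\cos[\lambda_m(r-R_1)],\qquad b_1=-\frac{q_1}{\epsilon}R_1+1,\quad b_2=\frac{q_2}{\epsilon}R_2-1,$$ with $\lambda_m$ the positive solutions of $$(b_1b_2-R_1R_2\lambda^2)\sin[\lambda(R_2-R_1)]+\lambda(R_1b_2+R_2b_1)\cos[\lambda(R_2-R_1)]=0.$$
   Context: $J_k$ and $Y_k$ ($k=0,1$) are the Bessel functions of the first and second kind of order $k$. Put $p_0(r)=r^{n-1}\rho_0(r)$ and $p_i(t)=R_i^{n-1}\rho_i(t)$. Let $\Gamma=\{(r,t): R_1\le r\le R_2,\ t\ge0,\ r=R_1\text{ or }r=R_2\text{ or }t=0\}$ and define $p_\Gamma$ on $\Gamma$ by $p_\Gamma(r,t)=p_0(r)$ if $t=0$ and $p_\Gamma(r,t)=p_i(t)$ if $r=R_i$. The radial velocity $q$ is smooth, and $\beta(r,t,s)$ is the characteristic of $p_t+(qp)_r=0$ through $(r,t)$: $\frac{d\beta}{ds}=q(\beta,s)$, $\beta(r,t,t)=r$; followed backward in $s<t$, it meets $\Gamma$ at a time $t_0(r,t)\ge0$.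
   Formalization: Added: the denominator of q is nonzero for R_1<r<R_2, t>0 and, for n=2, every B_m≠0 (for q_1=q_2=0, q_0=0 the formula is 0/0); the data are regular: q_0 is C^2 and ρ_0 is C^1 on [R_1,R_2], each prescribed ρ_i is C^1 on [0,∞). *)

(* Defs.v *)
From HB Require Import structures.
From mathcomp Require Import all_boot all_order all_algebra.
From mathcomp Require Import all_classical all_reals all_analysis.

Set Implicit Arguments.
Unset Strict Implicit.
Unset Printing Implicit Defensive.
Import Order.TTheory GRing.Theory Num.Theory.
Import numFieldNormedType.Exports.

Local Open Scope ring_scope.
Local Open Scope classical_set_scope.

Section bessel.
Context {R : realType}.

Definition euler_gamma : R := limn (fun n => series harmonic n - ln n%:R).

(* The digamma function at the positive integer m + 1. *)
Definition digammaS (m : nat) : R := series harmonic m - euler_gamma.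

Definition besselJ (k : nat) (x : R) : R :=
  limn (series (fun m =>
    (-1) ^+ m / (m`! * (m + k)`!)%:R * (x / 2) ^+ (2 * m + k))).

(* The classical series of the limit, as nu -> k, of                         *)
(* (cos(nu pi) J_nu(x) - J_{-nu}(x)) / sin(nu pi), for x > 0.                *)
Definition besselY (k : nat) (x : R) : R :=
  2 / pi * ln (x / 2) * besselJ k x
  - pi^-1 * \sum_(j < k)
      (k - j - 1)`!%:R / j`!%:R * ((x / 2) ^+ (2 * j) / (x / 2) ^+ k)
  - pi^-1 * limn (series (fun m =>
      (-1) ^+ m * (digammaS m + digammaS (m + k)) / (m`! * (m + k)`!)%:R
      * (x / 2) ^+ (2 * m + k))).

End bessel.

Section euclidean.
Context {R : realType} {n : nat}.

(* The library norm of 'rV[R]_n is the maximum norm. *)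
Definition enorm (x : 'rV[R]_n) : R := Num.sqrt (\sum_i x 0 i ^+ 2).

Definition evec (i : 'I_n) : 'rV[R]_n := delta_mx 0 i.

Definition annulus (R1 R2 : R) : set 'rV[R]_n := [set x | R1 < enorm x < R2].

(* The filter "|x| -> a, x in the annulus". *)
Definition enorm_to (R1 R2 a : R) : set_system 'rV[R]_n :=
  filter_from [set d : R | 0 < d]
    (fun d => annulus R1 R2 `&` [set x | `|enorm x - a| < d]).

(* The filter "(y, s) -> (x, 0), s > 0". *)
Definition to_initial (x : 'rV[R]_n) : set_system ('rV[R]_n * R) :=
  within [set p : 'rV[R]_n * R | 0 < p.2] (nbhs (x, 0 : R)).

Definition partial_t (V : normedModType R) (F : 'rV[R]_n -> R -> V)
    (x : 'rV[R]_n) (t : R) : V := (F x)^`() t.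

Definition partial_x (V : normedModType R) (i : 'I_n) (F : 'rV[R]_n -> R -> V)
    (x : 'rV[R]_n) (t : R) : V := 'D_(evec i) (F ^~ t) x.

Definition laplacian (V : normedModType R) (F : 'rV[R]_n -> R -> V)
    (x : 'rV[R]_n) (t : R) : V := \sum_i partial_x i (partial_x i F) x t.

(* (a . grad) F *)
Definition directional (V : normedModType R) (a : 'rV[R]_n)
    (F : 'rV[R]_n -> R -> V) (x : 'rV[R]_n) (t : R) : V :=
  \sum_i a 0 i *: partial_x i F x t.

Definition divergence (F : 'rV[R]_n -> R -> 'rV[R]_n) (x : 'rV[R]_n) (t : R) : R :=
  \sum_i partial_x i (fun y s => F y s 0 i) x t.

(* (x / |x|) . v(x) *)
Definition radial_component (v : 'rV[R]_n -> 'rV[R]_n) (x : 'rV[R]_n) : R :=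
  \sum_i x 0 i / enorm x * v x 0 i.

Definition jointly_continuous (V : normedModType R) (A : set 'rV[R]_n)
    (F : 'rV[R]_n -> R -> V) : Prop :=
  forall (x : 'rV[R]_n) (t : R), A x -> 0 < t ->
    {for (x, t), continuous (fun p : 'rV[R]_n * R => F p.1 p.2)}.

(* F is of class C^1 in (x, t) on A x ]0, +oo[. *)
Definition C1 (V : normedModType R) (A : set 'rV[R]_n)
    (F : 'rV[R]_n -> R -> V) : Prop :=
  [/\ forall (x : 'rV[R]_n) (t : R), A x -> 0 < t ->
        derivable (F x) t 1 /\ (forall i, derivable (F ^~ t) x (evec i)),
      jointly_continuous A F,
      jointly_continuous A (partial_t F)
    & forall i, jointly_continuous A (partial_x i F)].

(* F is of class C^1 in t and C^2 in x on A x ]0, +oo[. *)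
Definition C21 (V : normedModType R) (A : set 'rV[R]_n)
    (F : 'rV[R]_n -> R -> V) : Prop :=
  [/\ C1 A F,
      forall (x : 'rV[R]_n) (t : R) i j, A x -> 0 < t ->
        derivable (partial_x i F ^~ t) x (evec j)
    & forall i j, jointly_continuous A (partial_x j (partial_x i F))].

End euclidean.

(* C^k on an interval D; at an end point of D that belongs to D, f stands for *)
(* an extension of the data to a neighbourhood, so that its derivatives there *)
(* are the one-sided derivatives of the data.                                 *)
Definition Ck_on {R : realType} (k : nat) (D : set R) (f : R -> R) : Prop :=
  forall r, D r ->
    (forall j, (j < k)%N -> derivable (f^`(j)) r 1) /\
    (forall j, (j <= k)%N -> {for r, continuous (f^`(j))}).

Section problem.
Context {R : realType}.
Variables (n : nat) (eps R1 R2 q1 q2 : R) (q0 rho0 rho1 rho2 : R -> R).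

(* Classical solution for x in the annulus and t > 0. The data at t = 0 are   *)
(* attained as limits.                                                        *)
Record classical_solution (u : 'rV[R]_n -> R -> 'rV[R]_n)
    (rho : 'rV[R]_n -> R -> R) : Prop := {
  velocity_regular : C21 (annulus R1 R2) u;
  density_regular : C1 (annulus R1 R2) rho;
  momentum_equation : forall (x : 'rV[R]_n) (t : R), annulus R1 R2 x -> 0 < t ->
    partial_t u x t + directional (u x t) u x t
      = (eps / 2) *: laplacian u x t;
  continuity_equation : forall (x : 'rV[R]_n) (t : R), annulus R1 R2 x -> 0 < t ->
    partial_t rho x t + divergence (fun y s => rho y s *: u y s) x t = 0;
  velocity_initial : forall x : 'rV[R]_n, annulus R1 R2 x ->
    u p.1 p.2 @[p --> to_initial x] --> (q0 (enorm x) / enorm x) *: x;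
  density_initial : forall x : 'rV[R]_n, annulus R1 R2 x ->
    rho p.1 p.2 @[p --> to_initial x] --> rho0 (enorm x);
  velocity_boundary1 : forall t : R, 0 < t ->
    radial_component (u ^~ t) x @[x --> enorm_to R1 R2 R1] --> q1;
  velocity_boundary2 : forall t : R, 0 < t ->
    radial_component (u ^~ t) x @[x --> enorm_to R1 R2 R2] --> q2;
  density_boundary1 : 0 < q1 -> forall t : R, 0 < t ->
    rho x t @[x --> enorm_to R1 R2 R1] --> rho1 t;
  density_boundary2 : 0 < - q2 -> forall t : R, 0 < t ->
    rho x t @[x --> enorm_to R1 R2 R2] --> rho2 t
}.

Definition p_initial (r : R) : R := r ^+ n.-1 * rho0 r.
Definition p_boundary (a : R) (rho_ : R -> R) (t : R) : R := a ^+ n.-1 * rho_ t.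

Definition Gamma : set (R * R) :=
  [set p | [/\ R1 <= p.1 <= R2, 0 <= p.2 & [\/ p.1 = R1, p.1 = R2 | p.2 = 0]]].

(* Only evaluated on Gamma. *)
Definition p_Gamma (r t : R) : R :=
  if t == 0 then p_initial r
  else if r == R1 then p_boundary R1 rho1 t else p_boundary R2 rho2 t.

(* First order consistency at {|x| = a, t = 0} of the velocity data: the      *)
(* datum b = q_i is the value of q0, and the time derivative, 0, of the       *)
(* boundary datum is the one prescribed at t = 0 by the radial form           *)
(* q_t + q q_r = eps/2 (q_rr + (n-1)/r q_r - (n-1)/r^2 q)                     *)
(* of the equation for u = (x/|x|) q(|x|, t).                                 *)
Definition velocity_consistent (a b : R) : Prop :=
  q0 a = b /\
  0 = eps / 2 * (q0^`(2)%classic a + n.-1%:R / a * q0^`()%classic a - n.-1%:R / a ^+ 2 * q0 a)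
      - q0 a * q0^`()%classic a.

(* The same for the density, with the equation p_t + (q p)_r = 0 satisfied by *)
(* p = r^(n-1) rho.                                                           *)
Definition density_consistent (a : R) (rho_ : R -> R) : Prop :=
  rho0 a = rho_ 0 /\
  (p_boundary a rho_)^`()%classic 0 + (fun r => q0 r * p_initial r)^`()%classic a = 0.

Section annulus2.
Variable lam : R.

Definition bessel_inner (B : nat -> R -> R) : R :=
  - (q1 / eps) * B 0%N (lam * R1) + lam * B 1%N (lam * R1).

Definition bessel_outer (B : nat -> R -> R) : R :=
  q2 / eps * B 0%N (lam * R2) - lam * B 1%N (lam * R2).

Definition char2 : R :=
  bessel_inner besselJ * bessel_outer besselY
  - bessel_outer besselJ * bessel_inner besselY.

Definition B2 : R :=
  (lam ^+ 2 + q2 ^+ 2 / eps ^+ 2) * bessel_inner besselJ ^+ 2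
  - (lam ^+ 2 + q1 ^+ 2 / eps ^+ 2) * bessel_outer besselJ ^+ 2.

Definition H2 (r : R) : R :=
  bessel_inner besselY * besselJ 0 (lam * r)
  - bessel_inner besselJ * besselY 0 (lam * r).

Definition mode2 (r xi t : R) : R :=
  lam ^+ 2 / B2 * bessel_outer besselJ ^+ 2 * xi * H2 r * H2 xi
  * expR (- (eps * lam ^+ 2 * t / 2)).

End annulus2.

Section annulus3.
Variable lam : R.

Definition b1 : R := - (q1 / eps) * R1 + 1.
Definition b2 : R := q2 / eps * R2 - 1.

Definition char3 : R :=
  (b1 * b2 - R1 * R2 * lam ^+ 2) * sin (lam * (R2 - R1))
  + lam * (R1 * b2 + R2 * b1) * cos (lam * (R2 - R1)).

Definition Psi3 (r : R) : R :=
  b1 * sin (lam * (r - R1)) + R1 * lam * cos (lam * (r - R1)).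

Definition mode3 (r xi t : R) : R :=
  (b2 ^+ 2 + R2 ^+ 2 * lam ^+ 2) * Psi3 r * Psi3 xi
    * expR (- (eps / 2 * lam ^+ 2 * t))
  / ((R2 - R1) * (b1 ^+ 2 + R1 ^+ 2 * lam ^+ 2)
       * (b2 ^+ 2 + R2 ^+ 2 * lam ^+ 2)
     + (b1 * R2 + b2 * R1) * (b1 * b2 + R1 * R2 * lam ^+ 2)).

End annulus3.

(* The definitions below are meaningful for n = 2 and n = 3 only. *)
Definition characteristic_function (lam : R) : R :=
  if n == 2%N then char2 lam else char3 lam.

(* lam lists all the positive roots, each of them once; the index m of the    *)
(* series starts at 0 instead of 1.                                           *)
Definition enumerates_positive_roots (lam : nat -> R) : Prop :=
  injective lam /\
  range lam = [set l | 0 < l /\ characteristic_function l = 0].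

Section formulas.
Variable lam : nat -> R.

Definition green (r xi t : R) : R :=
  if n == 2%N then
    pi ^+ 2 / 2 * limn (series (fun m => mode2 (lam m) r xi t))
  else
    2 * xi / r * limn (series (fun m => mode3 (lam m) r xi t)).

Definition weight (xi : R) : R :=
  expR (- (eps^-1 * \int[lebesgue_measure]_(s in `[R1, xi]) q0 s)).

Definition q_denominator (r t : R) : R :=
  \int[lebesgue_measure]_(xi in `[R1, R2]) (green r xi t * weight xi).

Definition q_formula (r t : R) : R :=
  - eps * ((\int[lebesgue_measure]_(xi in `[R1, R2])
              ((fun r' => green r' xi t)^`()%classic r * weight xi))
           / q_denominator r t).

(* The quotients that occur in the formula for q have nonzero denominators    *)
(* for R1 < r < R2 and t > 0. (The denominators in mode3 never vanish at a    *)
(* positive root of char3.)                                                   *)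
Definition q_well_defined : Prop :=
  (n = 2%N -> forall m, B2 (lam m) != 0) /\
  (forall r t : R, R1 < r < R2 -> 0 < t -> q_denominator r t != 0).

(* beta r t is the characteristic through (r, t), followed backward from the  *)
(* time t to the time t0 r t at which it meets Gamma for the first time.      *)
Definition backward_characteristics (beta : R -> R -> R -> R)
    (t0 : R -> R -> R) : Prop :=
  forall r t : R, R1 < r < R2 -> 0 < t ->
  [/\ 0 <= t0 r t < t,
      beta r t t = r,
      {within `[t0 r t, t], continuous (beta r t)},
      forall s : R, t0 r t < s < t ->
        R1 < beta r t s < R2 /\
        is_derive s (1 : R) (beta r t) (q_formula (beta r t s) s)
    & Gamma (beta r t (t0 r t), t0 r t)].

Definition u_formula (x : 'rV[R]_n) (t : R) : 'rV[R]_n :=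
  (q_formula (enorm x) t / enorm x) *: x.

Definition rho_formula (beta : R -> R -> R -> R) (t0 : R -> R -> R)
    (x : 'rV[R]_n) (t : R) : R :=
  let r := enorm x in
  (r ^+ n.-1)^-1 * p_Gamma (beta r t (t0 r t)) (t0 r t)
  * expR (- \int[lebesgue_measure]_(s in `[t0 r t, t])
              (fun r' => q_formula r' s)^`()%classic (beta r t s)).

End formulas.
End problem.

(* Main.v *)
Require Import Defs.
From mathcomp Require Import all_boot all_order all_algebra.
From mathcomp Require Import all_classical all_reals all_analysis.
From mathcomp Require Import measurable_realfun.
From mathcomp Require Import ring lra zify.

Set Implicit Arguments.
Unset Strict Implicit.
Unset Printing Implicit Defensive.
Import Order.TTheory GRing.Theory Num.Theory.
Import numFieldNormedType.Exports.

Local Open Scope ring_scope.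
Local Open Scope classical_set_scope.

(* The Cole-Hopf substitution [q = - eps ph_r / ph] turns the radial momentum
   equation into the heat equation [ph_t = eps/2 r^-d (r^d ph_r)_r], [d = n - 1],
   with Robin conditions. [G] is its Green function, an eigenfunction series. That
   the series attains its initial data rests on completeness of the eigenfunctions,
   obtained from the extremal property of the resolvent; there are no nonpositive
   eigenvalues, since some positive mode does not change sign because the
   denominator of [q] has no zero. Positivity of [ph] then follows from the minimum
   principle.

   For the density, [q_r = - d q / r - 2 (ln ph)' - q^2 / eps] along a
   characteristic, where ' is the derivative along it. Hence
   [rho = P(a) ph^2 exp(V / eps)], where [a] is the position at time 0 of the
   characteristic, continued beyond the side through which it enters with the
   constant speed of that side, and [V] is the integral of [q^2] along it. The
   consistency conditions make [P] continuously differentiable, and [a] and [V]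
   are so because the velocity field, made constant outside the annulus, is
   Lipschitz and differentiable off the sides. *)

(** * Calculus of one variable *)

(** Nothing given locates the roots [lam m], and the series would miss any eigenvalue that is not
    positive. No asymptotics of the roots are used: Bessel's inequality for a coercive energy form
    bounds the sums of [eigf m r ^+ 2 / nu m], whence the squares of the [lam m] have summable
    inverses. As for the missing eigenvalues, at large times the solution looks like the slowest
    mode present; this mode inherits the absence of zeros, and Picone's identity makes it the ground
    state.

    The form of the density is dictated by a loss of regularity. The exponent of the formula
    integrates [q_r], whose own derivative in [r] is controlled at positive times only, whereas
    characteristics may reach time 0. The integral of [q^2] needs one derivative less, and the other
    factors depend on the end point or on the label [a] alone. What remains is the corner of the
    extended velocity at the sides. A characteristic meets a side, on its way from outside to
    inside, at a single instant, which bounded convergence ignores. *)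

Definition der (R : realType) (f : R -> R) (x d : R) : Prop := is_derive x (1 : R) f d.
Notation "'intR' a b f" := (\int[lebesgue_measure]_(x in `[a, b]) f x)
  (at level 10, a, b, f at level 9).

Section derivative_rules.
Context {R : realType}.
Implicit Types (f g : R -> R) (x a b c : R).

Lemma der_eq f x a b : der f x a -> a = b -> der f x b.
Proof. by move=> ? <-. Qed.

Lemma derP f x d :
  (h^-1 * (f (h + x) - f x)) @[h --> 0^'] --> d <-> der f x d.
Proof.
have e : (fun h => h^-1 *: (f (h *: 1 + x) - f x)) =
         (fun h => h^-1 * (f (h + x) - f x)).
  by apply/funext => h; rewrite /GRing.scale /= mulr1.
split=> [fd|[fd <-]].
  split; last by rewrite /derive e; exact: (cvg_lim (@Rhausdorff R) fd).
  by rewrite /derivable e; apply/cvg_ex; exists d.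
by rewrite /derive e; move: fd; rewrite /derivable e.
Qed.

Lemma der_cst x c : der (fun=> c) x 0.
Proof. exact: is_derive_cst. Qed.

Lemma der_id x : der (fun y : R => y) x 1.
Proof. exact: is_derive_id. Qed.

Lemma derD f g x a b : der f x a -> der g x b -> der (fun y => f y + g y) x (a + b).
Proof. by move=> fa gb; exact: is_deriveD. Qed.

Lemma derN f x a : der f x a -> der (fun y => - f y) x (- a).
Proof. by move=> fa; exact: is_deriveN. Qed.

Lemma derB f g x a b : der f x a -> der g x b -> der (fun y => f y - g y) x (a - b).
Proof. by move=> fa gb; exact: is_deriveB. Qed.

Lemma derM f g x a b : der f x a -> der g x b ->
  der (fun y => f y * g y) x (a * g x + f x * b).
Proof.
move=> fa gb; apply: (der_eq (is_deriveM fa gb)).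
by rewrite /GRing.scale /= addrC [g x * a]mulrC.
Qed.

Lemma derZ f x a c : der f x a -> der (fun y => c * f y) x (c * a).
Proof. by move=> fa; apply: der_eq; [apply: derM; [exact: der_cst|exact: fa]|rewrite /=; ring]. Qed.

Lemma der_comp f g x a b : der g (f x) a -> der f x b ->
  der (fun y => g (f y)) x (a * b).
Proof. by move=> ga fb; exact: is_derive1_comp. Qed.

Lemma der_expR f x a : der f x a -> der (fun y => expR (f y)) x (a * expR (f x)).
Proof.
by move=> fa; apply: der_eq; [apply: (der_comp (is_derive_expR _) fa)|rewrite mulrC].
Qed.

Lemma derX f x a n : der f x a -> der (fun y => f y ^+ n) x (n%:R * f x ^+ n.-1 * a).
Proof.
move=> fa; elim: n => [|n ih].
  by apply: der_eq; [exact: der_cst|rewrite !mul0r].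
apply: der_eq.
  have -> : (fun y => f y ^+ n.+1) = (fun y => f y * f y ^+ n).
    by apply/funext => y; rewrite exprS.
  by apply: derM; [exact: fa|exact: ih].
case: n ih => [|n] ih; first by rewrite expr0 !mul1r !mul0r mulr0 addr0 mulr1.
by rewrite /= exprS -[n.+2]addn1 natrD; ring.
Qed.

Lemma derV f x a : f x != 0 -> der f x a -> der (fun y => (f y)^-1) x (- a / f x ^+ 2).
Proof.
move=> fx0 fa; have /= h := is_deriveV fx0 fa.
by apply: (der_eq h); rewrite /GRing.scale /= !mulNr mulrC.
Qed.

Lemma der_div f g x a b : g x != 0 -> der f x a -> der g x b ->
  der (fun y => f y / g y) x ((a * g x - f x * b) / g x ^+ 2).
Proof.
move=> gx fa gb; apply: der_eq; first by apply: (derM fa (derV gx gb)).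
by rewrite /=; field.
Qed.

Lemma der_ln f x a : 0 < f x -> der f x a -> der (fun y => ln (f y)) x (a / f x).
Proof.
by move=> fx fa; apply: der_eq; [apply: (der_comp (is_derive1_ln fx) fa)|rewrite mulrC].
Qed.

Lemma der_sum (I : Type) (s : seq I) (f : I -> R -> R) x (a : I -> R) :
  (forall i, der (f i) x (a i)) ->
  der (fun y => \sum_(i <- s) f i y) x (\sum_(i <- s) a i).
Proof.
move=> fa; elim: s => [|i s ih].
  rewrite big_nil; under eq_fun do rewrite big_nil; exact: der_cst.
rewrite big_cons; under eq_fun do rewrite big_cons; exact: derD.
Qed.

Lemma der_cont f x a : der f x a -> {for x, continuous f}.
Proof. by case=> fa _; apply/differentiable_continuous/derivable1_diffP. Qed.

Lemma der_unique f x a b : der f x a -> der f x b -> a = b.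
Proof. by move=> [_ <-] [_ <-]. Qed.

Lemma der_near f g x a : (\near x, f x = g x) -> der f x a -> der g x a.
Proof. exact: near_eq_is_derive. Qed.

Lemma der_derive1 f x a : der f x a -> f^`()%classic x = a.
Proof. by rewrite derive1E => fa; exact: derive_val. Qed.

Lemma derivable_der f x : derivable f x 1 -> der f x (f^`()%classic x).
Proof. by rewrite derive1E => ?; exact: derivableP. Qed.

Lemma der_uniq_itv f g x a b c d : c < x < d ->
  (forall y, c < y < d -> f y = g y) -> der f x a -> der g x b -> a = b.
Proof.
move=> /andP[cx xd] fg fa gb; apply: (der_unique _ gb); apply: der_near fa.
by near=> y; apply: fg; apply/andP; split; near: y;
  [exact: lt_nbhsr|exact: lt_nbhsl].
Unshelve. all: by end_near. Qed.

Lemma cont_eq (T : topologicalType) (f g : T -> R) (x : T) :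
  (forall y, f y = g y) -> {for x, continuous f} -> {for x, continuous g}.
Proof. by move=> /funext ->. Qed.

Lemma contD (T : topologicalType) (f g : T -> R) (x : T) :
  {for x, continuous f} -> {for x, continuous g} ->
  {for x, continuous (fun y => f y + g y)}.
Proof. by move=> cf cg; exact: cvgD. Qed.

Lemma contN (T : topologicalType) (f : T -> R) (x : T) :
  {for x, continuous f} -> {for x, continuous (fun y => - f y)}.
Proof. by move=> cf; exact: cvgN. Qed.

Lemma contB (T : topologicalType) (f g : T -> R) (x : T) :
  {for x, continuous f} -> {for x, continuous g} ->
  {for x, continuous (fun y => f y - g y)}.
Proof. by move=> cf cg; exact: cvgB. Qed.

Lemma contM (T : topologicalType) (f g : T -> R) (x : T) :
  {for x, continuous f} -> {for x, continuous g} ->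
  {for x, continuous (fun y => f y * g y)}.
Proof. by move=> cf cg; exact: cvgM. Qed.

Lemma contV (T : topologicalType) (f : T -> R) (x : T) : f x != 0 ->
  {for x, continuous f} -> {for x, continuous (fun y => (f y)^-1)}.
Proof. by move=> fx cf; exact: cvgV. Qed.

Lemma contX (T : topologicalType) (f : T -> R) (x : T) n :
  {for x, continuous f} -> {for x, continuous (fun y => f y ^+ n)}.
Proof.
move=> cf; elim: n => [|n ih]; first exact: cvg_cst.
by apply: (cont_eq (f := fun y => f y * f y ^+ n)) => [y|]; [rewrite exprS|exact: contM].
Qed.

Lemma cont_sum (T : topologicalType) (I : Type) (s : seq I) (f : I -> T -> R) (x : T) :
  (forall i, {for x, continuous (f i)}) ->
  {for x, continuous (fun y => \sum_(i <- s) f i y)}.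
Proof.
move=> cf; elim: s => [|i s ih].
  by apply: (cont_eq (f := fun=> 0)) => [y|]; [rewrite big_nil|exact: cvg_cst].
apply: (cont_eq (f := fun y => f i y + \sum_(j <- s) f j y)) => [y|].
  by rewrite big_cons.
exact: contD.
Qed.

Lemma cont_comp (T U : topologicalType) (f : T -> U) (g : U -> R) (x : T) :
  {for f x, continuous g} -> {for x, continuous f} ->
  {for x, continuous (fun y => g (f y))}.
Proof. by move=> cg cf; exact: (@continuous_comp _ _ _ f g). Qed.

Lemma cont_near (T : topologicalType) (f g : T -> R) (x : T) :
  (\near x, f x = g x) -> {for x, continuous f} -> {for x, continuous g}.
Proof.
move=> fg cf; rewrite /prop_for /continuous_at -(nbhs_singleton fg).
by apply: cvg_trans cf; apply: near_eq_cvg.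
Qed.

Lemma MVT_der f (f' : R -> R) (a b : R) : a < b ->
  (forall x, a <= x <= b -> der f x (f' x)) ->
  exists c, [/\ a < c, c < b & f b - f a = f' c * (b - a)].
Proof.
move=> ab fd.
have [||c] := @MVT R f f' a b ab.
- by move=> x; rewrite in_itv /= => /andP[ax xb]; apply: fd; rewrite !ltW.
- apply: continuous_in_subspaceT => x; rewrite inE /= in_itv /= => xab.
  exact: der_cont (fd _ xab).
by rewrite in_itv /= => /andP[ac cb] e; exists c.
Qed.

Lemma der_ge0_le f (f' : R -> R) (a b : R) : a <= b ->
  (forall x, a <= x <= b -> der f x (f' x)) ->
  (forall x, a <= x <= b -> 0 <= f' x) -> f a <= f b.
Proof.
rewrite le_eqVlt => /predU1P[-> //|ab] fd f0.
have [c [ac cb e]] := MVT_der ab fd.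
by rewrite -subr_ge0 e mulr_ge0 ?f0 ?subr_ge0 ?ltW.
Qed.

Lemma der_0_cst f (a b : R) : a <= b ->
  (forall x, a <= x <= b -> der f x 0) -> f a = f b.
Proof.
rewrite le_eqVlt => /predU1P[-> //|ab] fd.
have [c [ac cb /eqP]] := @MVT_der f (fun=> 0) _ _ ab fd.
by rewrite mul0r subr_eq0 => /eqP ->.
Qed.

End derivative_rules.

(** * Continuity and integration on a segment *)

Section segment_integral.
Context {R : realType}.
Implicit Types (f g : R -> R) (a b c x : R).

(** Two-sided continuity at every point of the closed interval: functions are understood to be given
    a little beyond it, as in [Ck_on]. This spares one-sided limits and derivatives at the ends. *)
Definition con a b f := forall x, a <= x <= b -> {for x, continuous f}.

(** The nearest point of the interval. Composition with this 1-Lipschitz map extends a function by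
    its end values and preserves continuity and Lipschitz bounds. *)
Definition clamp a b x : R := Num.max a (Num.min x b).

Lemma clampP a b x : a <= b -> a <= clamp a b x <= b.
Proof.
by move=> ab; rewrite /clamp le_max lexx /= ge_max ab /= ge_min lexx orbT.
Qed.

Lemma clamp_id a b x : a <= x <= b -> clamp a b x = x.
Proof. by move=> /andP[ax xb]; rewrite /clamp (min_idPl xb) (max_idPr ax). Qed.

Lemma clamp_lt a b x : a <= b -> x <= a -> clamp a b x = a.
Proof.
by move=> ab xa; rewrite /clamp (min_idPl (le_trans xa ab)) (max_idPl xa).
Qed.

Lemma clamp_gt a b x : a <= b -> b <= x -> clamp a b x = b.
Proof. by move=> ab xa; rewrite /clamp (min_idPr xa) (max_idPr ab). Qed.

Lemma clamp_lip a b x y : a <= b -> `|clamp a b x - clamp a b y| <= `|x - y|.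
Proof.
move=> ab; wlog xy : x y / x <= y.
  by move=> h; have [/h//|/ltW/h] := leP x y; rewrite distrC [leRHS]distrC.
have [xa|ax] := leP x a; have [yb|yb] := leP y b.
- rewrite (clamp_lt ab xa); have [ya|/ltW ay] := leP y a.
    by rewrite (clamp_lt ab ya) subrr normr0.
  by rewrite (clamp_id (_ : a <= y <= b)) ?ay// !ler0_norm ?subr_le0 //; lra.
- by rewrite (clamp_lt ab xa) (clamp_gt ab (ltW yb)) !ler0_norm ?subr_le0 //; lra.
- rewrite (clamp_id (_ : a <= y <= b)) ?yb ?(le_trans (ltW ax) xy)//.
  by rewrite (clamp_id (_ : a <= x <= b)) ?(ltW ax) ?(le_trans xy yb).
- rewrite (clamp_gt ab (ltW yb)); have [xb|/ltW bx] := leP x b.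
    by rewrite (clamp_id (_ : a <= x <= b)) ?(ltW ax)// !ler0_norm ?subr_le0 //; lra.
  by rewrite (clamp_gt ab bx) subrr normr0.
Qed.

Lemma lip_cont (K : R) f x : (forall y, `|f y - f x| <= K * `|y - x|) ->
  {for x, continuous f}.
Proof.
move=> h; apply/cvgrPdist_le => e e0; near=> y.
rewrite distrC (le_trans (h y))//.
have K0 : 0 < `|K| + 1 by rewrite ltr_wpDl.
rewrite (@le_trans _ _ ((`|K| + 1) * `|y - x|))//.
  by rewrite ler_wpM2r// (le_trans (ler_norm _))// lerDl.
rewrite mulrC -ler_pdivlMr// distrC.
by near: y; apply: cvgr_dist_le => //; rewrite divr_gt0.
Unshelve. all: by end_near. Qed.

Lemma clamp_cont a b x : a <= b -> {for x, continuous (clamp a b)}.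
Proof. by move=> ab; apply: (@lip_cont 1) => y; rewrite mul1r clamp_lip. Qed.

Lemma con_clamp a b f : a <= b -> con a b f -> forall x,
  {for x, continuous (fun y => f (clamp a b y))}.
Proof.
move=> ab cf x; apply: cont_comp; last exact: clamp_cont.
exact/cf/clampP.
Qed.

Lemma con_within a b f : con a b f -> {within `[a, b], continuous f}.
Proof.
move=> cf; apply: continuous_in_subspaceT => x; rewrite inE /= in_itv /=.
exact: cf.
Qed.

Lemma con_integrable a b f : con a b f ->
  lebesgue_measure.-integrable `[a, b] (EFin \o f).
Proof.
move=> cf; apply: continuous_compact_integrable; first exact: segment_compact.
exact: con_within.
Qed.
Hint Resolve con_integrable : core.

Lemma con_sub a b c d f : a <= c -> d <= b -> con a b f -> con c d f.
Proof.
by move=> ac db cf x /andP[cx xd]; apply: cf; rewrite (le_trans ac)//= (le_trans xd).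
Qed.

Lemma conD a b f g : con a b f -> con a b g -> con a b (fun x => f x + g x).
Proof. by move=> cf cg x xab; apply: contD; [exact: cf|exact: cg]. Qed.
Lemma conB a b f g : con a b f -> con a b g -> con a b (fun x => f x - g x).
Proof. by move=> cf cg x xab; apply: contB; [exact: cf|exact: cg]. Qed.
Lemma conM a b f g : con a b f -> con a b g -> con a b (fun x => f x * g x).
Proof. by move=> cf cg x xab; apply: contM; [exact: cf|exact: cg]. Qed.
Lemma conN a b f : con a b f -> con a b (fun x => - f x).
Proof. by move=> cf x xab; apply: contN; exact: cf. Qed.
Lemma conX a b f n : con a b f -> con a b (fun x => f x ^+ n).
Proof. by move=> cf x xab; apply: contX; exact: cf. Qed.
Lemma con_cst a b c : con a b (fun=> c).
Proof. by move=> x _; exact: cvg_cst. Qed.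
Lemma con_id a b : con a b (fun x => x).
Proof. by move=> x _; exact: cvg_id. Qed.
Lemma con_der a b f f' : (forall x, a <= x <= b -> der f x (f' x)) -> con a b f.
Proof. by move=> df x xab; exact: der_cont (df x xab). Qed.
Lemma con_sum a b (I : Type) (s : seq I) (f : I -> R -> R) :
  (forall i, con a b (f i)) -> con a b (fun x => \sum_(i <- s) f i x).
Proof. by move=> cf x xab; apply: cont_sum => i; exact: cf. Qed.

Lemma con_eq a b f g : a < b -> con a b f -> con a b g ->
  (forall x, a < x < b -> f x = g x) -> forall x, a <= x <= b -> f x = g x.
Proof.
move=> ab cf cg fg x xab; apply/eqP; rewrite -subr_eq0; apply/eqP.
apply/eqP; rewrite -normr_eq0; apply/eqP/le_anti; rewrite normr_ge0 andbT.
apply/ler_addgt0Pr => e e0; rewrite add0r.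
have /cvgrPdist_le /(_ _ e0) := conB cf cg xab.
case=> d /= d0 dh.
(* [x] is moved towards the middle of the interval, by less than [d] and by at most a quarter of the
   length, so that [y] is an interior point. *)
pose y := if x < (a + b) / 2 then x + Num.min (d / 2) ((b - a) / 4)
          else x - Num.min (d / 2) ((b - a) / 4).
have md : Num.min (d / 2) ((b - a) / 4) <= d / 2 by rewrite ge_min lexx.
have mb : Num.min (d / 2) ((b - a) / 4) <= (b - a) / 4 by rewrite ge_min lexx orbT.
have m0 : 0 < Num.min (d / 2) ((b - a) / 4) by rewrite lt_min; apply/andP; split; lra.
move: md mb m0 @y; move: (Num.min _ _) => m md mb m0 y.
have /andP[ax xb] := xab.
have yab : a < y < b by rewrite /y; have [h|h] := ltP x ((a + b) / 2); apply/andP; split; lra.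
have : `|x - y| < d.
  by rewrite /y; have [h|h] := ltP x ((a + b) / 2);
    [rewrite opprD addNKr normrN|rewrite opprB addrC subrK]; rewrite ger0_norm; lra.
by move/dh; rewrite (fg _ yab) subrr subr0.
Qed.

Lemma FTC2 a b F f : a <= b -> (forall x, a <= x <= b -> der F x (f x)) ->
  con a b f -> intR a b f = F b - F a.
Proof.
rewrite le_eqVlt => /predU1P[<- _ _|ab dF cf].
  by rewrite set_itv1 Rintegral_set1 subrr.
rewrite /Rintegral (@continuous_FTC2 R f F a b) //.
- exact: con_within.
- split.
  + move=> x; rewrite in_itv /= => /andP[ax xb].
    by have [] := dF x _; first by rewrite !ltW.
  + apply: cvg_at_right_filter.
    by apply: (@der_cont R F a (f a)); apply: dF; rewrite lexx ltW.
  + apply: cvg_at_left_filter.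
    by apply: (@der_cont R F b (f b)); apply: dF; rewrite lexx ltW.
- move=> x; rewrite in_itv /= => /andP[ax xb].
  by apply: der_derive1; apply: dF; rewrite !ltW.
Qed.

Lemma primitive a b f : a <= b -> con a b f ->
  exists F : R -> R, F a = 0 /\ forall x, a <= x <= b -> der F x (f x).
Proof.
(* The integrand is frozen outside the interval and the integral starts at [a - 1], so that the
   derivative is two-sided at [a] and at [b]. *)
move=> ab cf; pose g y := f (clamp a b y).
pose G x := intR (a - 1) x g.
have cg : con (a - 1) (b + 1) g by move=> x _; exact: con_clamp.
have dG x : a <= x <= b -> der G x (f x).
  move=> xab; have /andP[ax xb] := xab.
  have [] := @continuous_FTC1_closed R g (a - 1) x (b + 1).
  - lra.
  - exact: con_integrable.
  - lra.
  - exact: con_clamp.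
  - move=> h1 h2; apply: (der_eq (derivable_der h1)).
    by rewrite h2 /g clamp_id.
exists (fun x => G x - G a); split; first by rewrite subrr.
by move=> x xab; apply: der_eq; [apply: derB; [exact: dG|exact: der_cst]|rewrite subr0].
Qed.

Lemma int_primitive a b f F : con a b f -> F a = 0 ->
  (forall x, a <= x <= b -> der F x (f x)) ->
  forall x, a <= x <= b -> intR a x f = F x.
Proof.
move=> cf Fa dF x /andP[ax xb]; rewrite (@FTC2 a x F) ?Fa ?subr0 //.
  by move=> y /andP[ay yx]; apply: dF; rewrite ay (le_trans yx).
exact: con_sub cf.
Qed.

Lemma intD a b f g : con a b f -> con a b g ->
  intR a b (fun x => f x + g x) = intR a b f + intR a b g.
Proof. by move=> cf cg; rewrite RintegralD //; exact: con_integrable. Qed.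

Lemma intB a b f g : con a b f -> con a b g ->
  intR a b (fun x => f x - g x) = intR a b f - intR a b g.
Proof. by move=> cf cg; rewrite RintegralB //; exact: con_integrable. Qed.

Lemma intZ a b c f : con a b f -> intR a b (fun x => c * f x) = c * intR a b f.
Proof. by move=> cf; rewrite RintegralZl //; exact: con_integrable. Qed.

Lemma eq_int a b f g : (forall x, a <= x <= b -> f x = g x) ->
  intR a b f = intR a b g.
Proof.
by move=> fg; apply: eq_Rintegral => x; rewrite inE /= in_itv /=; exact: fg.
Qed.

Lemma int_cst a b c : a <= b -> intR a b (fun=> c) = c * (b - a).
Proof.
move=> ab; rewrite (@FTC2 a b (fun x => c * x)) ?mulrBr//; last exact: con_cst.
by move=> x _; apply: der_eq; [apply: derZ; exact: der_id|rewrite mulr1].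
Qed.

Lemma int_sum a b (I : Type) (s : seq I) (f : I -> R -> R) : a <= b ->
  (forall i, con a b (f i)) ->
  intR a b (fun x => \sum_(i <- s) f i x) = \sum_(i <- s) intR a b (f i).
Proof.
move=> ab cf; elim: s => [|i s ih].
  rewrite big_nil (eq_int (g := fun=> 0)) => [|x _]; last by rewrite big_nil.
  by rewrite int_cst// mul0r.
rewrite big_cons -ih -intD//; last exact: con_sum.
by apply: eq_int => x _; rewrite big_cons.
Qed.

Lemma int_ge0 a b f : (forall x, a <= x <= b -> 0 <= f x) -> 0 <= intR a b f.
Proof. by move=> f0; apply: Rintegral_ge0 => x /=; rewrite in_itv /=; exact: f0. Qed.

Lemma le_int a b f g : con a b f -> con a b g ->
  (forall x, a <= x <= b -> f x <= g x) -> intR a b f <= intR a b g.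
Proof.
move=> cf cg fg; rewrite -subr_ge0 -intB//; apply: int_ge0 => x xab.
by rewrite subr_ge0 fg.
Qed.

Lemma int_bound a b f (M : R) : a <= b -> con a b f ->
  (forall x, a <= x <= b -> `|f x| <= M) -> `|intR a b f| <= M * (b - a).
Proof.
move=> ab cf fM; have h x : a <= x <= b -> - M <= f x /\ f x <= M.
  by move=> /fM; rewrite ler_norml => /andP[].
rewrite ler_norml -mulNr -!int_cst//; apply/andP; split;
  apply: le_int => //; try exact: con_cst; by move=> x /h[].
Qed.

(** The primitive vanishing at [a] is nondecreasing and vanishes at [b] as well. It is therefore
    zero, and so is its derivative [f], at the ends by continuity. *)
Lemma int_eq0 a b f : a < b -> con a b f -> (forall x, a <= x <= b -> 0 <= f x) ->
  intR a b f = 0 -> forall x, a <= x <= b -> f x = 0.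
Proof.
move=> ab cf f0 If; have [F [Fa dF]] := primitive (ltW ab) cf.
have F0 x : a <= x <= b -> F x = 0.
  move=> /andP[ax xb]; apply/le_anti/andP; split.
    have bab : a <= b <= b by rewrite lexx ltW.
    rewrite -[leRHS]If (int_primitive cf Fa dF bab).
    by apply: (@der_ge0_le _ F f) => // y /andP[xy yb]; [apply: dF|apply: f0];
       rewrite yb (le_trans ax).
  rewrite -Fa; apply: (@der_ge0_le _ F f) => // y /andP[ay yx]; [apply: dF|apply: f0];
    by rewrite ay (le_trans yx).
apply: con_eq => //; first exact: con_cst.
move=> x xab; have /andP[ax xb] := xab.
apply: (@der_uniq_itv _ F (fun=> 0) x _ _ a b) => //.
- by move=> y /andP[ay yb]; apply: F0; rewrite !ltW.
- by apply: dF; rewrite !ltW.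
- exact: der_cst.
Qed.

Lemma con_bounded a b f : a <= b -> con a b f ->
  exists M : R, 0 < M /\ forall x, a <= x <= b -> `|f x| <= M.
Proof.
move=> ab cf.
have [|c _ hc] := @EVT_max R (fun x => `|f x|) a b ab.
  apply: con_within => x xab; apply: cont_comp; last exact: cf.
  exact: norm_continuous.
exists (`|f c| + 1); split; first by rewrite ltr_wpDl.
by move=> x xab; rewrite (le_trans (hc x _)) ?in_itv//= lerDl.
Qed.

(** The discriminant inequality behind every Cauchy-Schwarz estimate below. The form may degenerate:
    [C = 0] is allowed. *)
Lemma quad_CS (A B C : R) : 0 <= C ->
  (forall t, 0 <= A + 2 * B * t + C * t ^+ 2) -> B ^+ 2 <= A * C.
Proof.
move=> C0 h; have [C0'|Cn0] := eqVneq C 0.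
  have [B0|Bn0] := eqVneq B 0; first by rewrite B0 C0' mulr0 expr2 mulr0.
  (* With [C = 0] the polynomial is affine with nonzero slope; this is the point where it takes the
     value -1. *)
  have := h (- (A + 1) / (2 * B)); rewrite C0' mul0r addr0.
  suff -> : A + 2 * B * (- (A + 1) / (2 * B)) = -1 by lra.
  by field.
have Cp : 0 < C by rewrite lt_neqAle eq_sym Cn0.
have := h (- B / C).
have -> : A + 2 * B * (- B / C) + C * (- B / C) ^+ 2 = (A * C - B ^+ 2) / C by field.
by rewrite pmulr_lge0 ?invr_gt0 // subr_ge0.
Qed.

End segment_integral.

(** * Series and Bessel functions *)

Section function_series.
Context {R : realType}.
Implicit Types (u v b : nat -> R).

Definition nsum u : R := limn (series u).

Lemma cvg_bounded_series u (C : R) : (forall n, 0 <= u n) ->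
  (forall N, \sum_(0 <= k < N) u k <= C) -> cvgn (series u).
Proof.
move=> u0 uC; apply: nondecreasing_is_cvgn; first exact: nondecreasing_series.
by exists C => _ [n _ <-]; exact: uC.
Qed.

Lemma dom_ncvg u b : (forall n, `|u n| <= b n) -> cvgn (series b) ->
  cvgn [normed series u].
Proof.
move=> ub cb; apply: (@series_le_cvg R _ b) => // n; first exact: normr_ge0.
exact: le_trans (normr_ge0 _) (ub n).
Qed.

Lemma dom_cvg u b : (forall n, `|u n| <= b n) -> cvgn (series b) -> cvgn (series u).
Proof. by move=> ub cb; apply/normed_cvg/(dom_ncvg ub). Qed.

Lemma nsum_le_norm u b : (forall n, `|u n| <= b n) -> cvgn (series b) ->
  `|nsum u| <= nsum b.
Proof.
move=> ub cb; have cn := dom_ncvg ub cb.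
by rewrite (le_trans (lim_series_norm cn))// lim_series_le.
Qed.

Lemma nsum_split u N : cvgn (series u) ->
  nsum u = series u N + nsum (fun n => u (n + N)%N).
Proof.
move=> cu; apply/esym; rewrite /nsum.
have h : series (fun n => u (n + N)%N) @ \oo --> limn (series u) - series u N.
  have -> : series (fun n => u (n + N)%N) = (fun n => series u (n + N)%N - series u N).
    apply/funext => n; rewrite sub_series_geq ?leq_addl// /series /=.
    by rewrite -{2}[N]add0n big_addn addnK.
  by apply: cvgB; [rewrite (cvg_shiftn N)|exact: cvg_cst].
by rewrite (cvg_lim (@Rhausdorff R) h) addrC subrK.
Qed.

Lemma cvg_shift_series u N : cvgn (series u) -> cvgn (series (fun n => u (n + N)%N)).
Proof.
move=> cu; apply/cvg_ex; exists (limn (series u) - series u N).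
have -> : series (fun n => u (n + N)%N) = (fun n => series u (n + N)%N - series u N).
  apply/funext => n; rewrite sub_series_geq ?leq_addl// /series /=.
    by rewrite -{2}[N]add0n big_addn addnK.
by apply: cvgB; [rewrite (cvg_shiftn N)|exact: cvg_cst].
Qed.

(** The rank [N] depends on the majorant [b] and on [e] only, not on the dominated sequence: this
    uniformity yields continuity and termwise integration. *)
Lemma dom_tail b (e : R) : cvgn (series b) -> 0 < e -> exists N, forall M u,
  (N <= M)%N -> (forall n, `|u n| <= b n) -> `|nsum u - \sum_(0 <= k < M) u k| <= e.
Proof.
move=> cb e0; have /cvgrPdist_le /(_ _ e0) [N _ hN] := cb.
exists N => M u NM ub; have cu := dom_cvg ub cb.
rewrite (nsum_split M cu) addrC /series /= addKr.
rewrite (le_trans (@nsum_le_norm _ (fun n => b (n + M)%N) _ (cvg_shift_series (N := M) cb)))//.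
have := hN M NM; rewrite /= -/(nsum b) (nsum_split M cb) addrC addKr.
exact: le_trans (ler_norm _).
Qed.

Lemma nsumD u v : cvgn (series u) -> cvgn (series v) ->
  nsum (fun n => u n + v n) = nsum u + nsum v.
Proof. by move=> cu cv; rewrite /nsum -lim_seriesD. Qed.

Lemma nsumB u v : cvgn (series u) -> cvgn (series v) ->
  nsum (fun n => u n - v n) = nsum u - nsum v.
Proof. by move=> cu cv; rewrite /nsum -lim_seriesB. Qed.

Lemma nsumZ u c : cvgn (series u) -> nsum (fun n => c * u n) = c * nsum u.
Proof. by move=> cu; rewrite /nsum -[RHS]lim_seriesZ. Qed.

Lemma nsumN u : cvgn (series u) -> nsum (fun n => - u n) = - nsum u.
Proof. by move=> cu; rewrite /nsum -lim_seriesN. Qed.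

Lemma cvg_seriesZ u c : cvgn (series u) -> cvgn (series (fun n => c * u n)).
Proof. move=> cu; have -> : series (fun n => c * u n) = (fun n => c * series u n).
  by apply/funext => n; rewrite /series /= mulr_sumr.
apply/cvg_ex; exists (c * limn (series u)).
by apply: cvgM; [exact: cvg_cst|exact: cu]. Qed.

Lemma eq_nsum u v : (forall n, u n = v n) -> nsum u = nsum v.
Proof. by move=> /funext ->. Qed.

Lemma nsum0 : nsum (fun=> 0) = 0.
Proof.
rewrite /nsum; have -> : series (fun=> 0 : R) = fun=> 0.
  by apply/funext => n; rewrite /series /= big1_eq.
exact: lim_cst.
Qed.

(** Tannery's theorem. The filter is arbitrary, since the limit is taken at points, in one or two
    variables, as well as along integers tending to infinity. *)
Lemma nsum_cvg (T : Type) (F : set_system T) (FF : ProperFilter F)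
    (f : nat -> T -> R) (l : nat -> R) b :
  cvgn (series b) -> (\forall y \near F, forall n, `|f n y| <= b n) ->
  (forall n, `|l n| <= b n) -> (forall n, f n y @[y --> F] --> l n) ->
  nsum (fun n => f n y) @[y --> F] --> nsum l.
Proof.
move=> cb fb lb fl; apply/cvgrPdist_le => e e0.
have e3 : 0 < e / 3 by rewrite divr_gt0.
have [N hN] := dom_tail cb e3.
have : (\sum_(0 <= k < N) f k y) @[y --> F] --> \sum_(0 <= k < N) l k.
  elim: (N) => [|M ih].
    under eq_fun do rewrite big_geq//.
    by rewrite big_geq//; exact: cvg_cst.
  rewrite big_nat_recr//=; apply: cvg_trans (cvgD ih (fl M)).
  by apply: near_eq_cvg; near=> y; rewrite big_nat_recr.
move=> /cvgrPdist_le /(_ _ e3) hs; near=> y.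
have h1 : forall n, `|f n y| <= b n by near: y.
have h2 : `|\sum_(0 <= k < N) l k - \sum_(0 <= k < N) f k y| <= e / 3 by near: y.
have := hN N _ (leqnn N) lb; have := hN N _ (leqnn N) h1; move: h2.
move: (nsum l) (nsum _) (\sum_(_ <= _ < _) l _) (\sum_(_ <= _ < _) f _ y) => A B C D.
rewrite !ler_norml => /andP[? ?] /andP[? ?] /andP[? ?].
by apply/andP; split; lra.
Unshelve. all: by end_near. Qed.

Lemma nsum_cont (T : topologicalType) (f : nat -> T -> R) (x : T) b :
  cvgn (series b) -> (\forall y \near x, forall n, `|f n y| <= b n) ->
  (forall n, {for x, continuous (f n)}) ->
  {for x, continuous (fun y => nsum (fun n => f n y))}.
Proof.
move=> cb fb fc; apply: (nsum_cvg _ cb) => // n.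
by have := nbhs_singleton fb; exact.
Qed.

(** The difference quotients [g n h], completed by [f' n x] at [h = 0], are dominated by [b n]
    through the mean value theorem; their sum is thus continuous at [h = 0]. *)
Lemma nsum_der (f f' : nat -> R -> R) (x d : R) b : 0 < d ->
  cvgn (series b) ->
  (forall n y, `|y - x| < d -> der (f n) y (f' n y)) ->
  (forall n y, `|y - x| < d -> `|f' n y| <= b n) ->
  (forall y, `|y - x| < d -> cvgn (series (fun n => f n y))) ->
  der (fun y => nsum (fun n => f n y)) x (nsum (fun n => f' n x)).
Proof.
move=> d0 cb fd f'b fc.
pose g n h := if h == 0 then f' n x else h^-1 * (f n (h + x) - f n x).
have xx : `|x - x| < d by rewrite subrr normr0.
have gb n h : `|h| < d -> `|g n h| <= b n.
  move=> hd; rewrite /g; have [_|h0] := eqVneq h 0; first exact: f'b.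
  suff [c [cd e]] : exists c, `|c - x| < d /\ f n (h + x) - f n x = f' n c * h.
    by rewrite e mulrC mulfK// f'b.
  move: hd; rewrite ltr_norml => /andP[hd1 hd2].
  have [hp|hn] := ltP 0 h.
    have [||c [c1 c2 e]] := @MVT_der R (f n) (f' n) x (h + x).
    - lra.
    - by move=> y /andP[? ?]; apply: fd; rewrite ltr_norml; apply/andP; split; lra.
    exists c; split; last by rewrite e addrK.
    by rewrite ltr_norml; apply/andP; split; lra.
  have [||c [c1 c2 e]] := @MVT_der R (f n) (f' n) (h + x) x.
  - by rewrite -subr_gt0 opprD addrC addrNK oppr_gt0 lt_neqAle h0.
  - by move=> y /andP[? ?]; apply: fd; rewrite ltr_norml; apply/andP; split; lra.
  exists c; split; first by rewrite ltr_norml; apply/andP; split; lra.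
  by rewrite -opprB e; ring.
have gc n : {for 0, continuous (g n)}.
  apply/continuous_withinNx; rewrite /g eqxx.
  have /derP := fd n x xx; apply: cvg_trans; apply: near_eq_cvg; near=> h.
  by rewrite ifF//; apply/negbTE; near: h; exact: nbhs_dnbhs_neq.
have nd : \forall h \near (0 : R), `|h| < d.
  by exact: nbhs0_lt.
have := nsum_cont cb (x := 0) (f := g) _ gc.
have h1 : \forall h \near (0 : R), forall n, `|g n h| <= b n.
  by apply: filterS nd => h hd n; exact: gb.
move=> /(_ h1) /continuous_withinNx; rewrite {2}/g eqxx => G.
apply/derP; apply: cvg_trans G; apply: near_eq_cvg; near=> h.
have h0 : h != 0 by near: h; exact: nbhs_dnbhs_neq.
have hd : `|h| < d by near: h; apply: nbhs_dnbhs; exact: nd.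
rewrite /g (negbTE h0) nsumZ; last first.
  apply: is_cvg_seriesB; apply: fc => //.
  by rewrite addrK.
by rewrite nsumB//; apply: fc => //; rewrite addrK.
Unshelve. all: by end_near. Qed.

Lemma nsum_int (a b : R) (f : nat -> R -> R) (B : nat -> R) : a <= b ->
  cvgn (series B) -> (forall n, con a b (f n)) ->
  (forall n x, a <= x <= b -> `|f n x| <= B n) ->
  con a b (fun x => nsum (fun n => f n x)) ->
  intR a b (fun x => nsum (fun n => f n x)) = nsum (fun n => intR a b (f n)).
Proof.
move=> ab cB fc fB sc.
apply/esym/cvg_lim; first exact: Rhausdorff.
apply/cvgrPdist_le => e e0.
have e1 : 0 < e / (b - a + 1) by rewrite divr_gt0// ltr_wpDl// subr_ge0.
have [N hN] := dom_tail cB e1; exists N => // M NM.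
rewrite /series /= -int_sum// -intB//; last exact: con_sum.
rewrite (le_trans (@int_bound _ _ _ _ (e / (b - a + 1)) ab _ _))//.
- by apply: conB => //; exact: con_sum.
- by move=> x xab; apply: hN => // n; exact: fB.
- rewrite mulrAC ler_pdivrMr ?ltr_wpDl ?subr_ge0// ler_wpM2l ?(ltW e0)//.
  by rewrite lerDl.
Qed.

End function_series.

(** * Power series with factorially decreasing coefficients *)

Section entire_series.
Context {R : realType}.
Implicit Types (c : nat -> R) (x y : R).

(** This bound gives convergence on the whole line and is inherited by the coefficients of the
    derivative. *)
Definition fact_bd c := exists C : R, forall m, `|c m| <= C / m`!%:R.

Definition psum c y := nsum (fun m => c m * y ^+ m).

Lemma fact_bd_cvg c y : fact_bd c -> cvgn (series (fun m => c m * y ^+ m)).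
Proof.
move=> [C hC]; apply: (@dom_cvg _ _ (fun m => C * exp_coeff `|y| m)).
  move=> m; rewrite normrM normrX exp_coeffE mulrA.
  by rewrite ler_wpM2r ?exprn_ge0.
by apply: cvg_seriesZ; exact: is_cvg_series_exp_coeff.
Qed.

Lemma fact_bd_diffs c : fact_bd c -> fact_bd (pseries_diffs c).
Proof.
move=> [C hC]; exists C => m; rewrite /pseries_diffs normrM normr_nat.
rewrite (le_trans (ler_wpM2l _ (hC m.+1)))// factS natrM invfM.
by rewrite mulrCA mulVKf// pnatr_eq0.
Qed.

Lemma psum_der c y : fact_bd c -> der (psum c) y (psum (pseries_diffs c) y).
Proof.
move=> bc; apply: (@pseries_snd_diffs R c (`|y| + 1)).
- exact: fact_bd_cvg.
- exact/fact_bd_cvg/fact_bd_diffs.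
- exact/fact_bd_cvg/fact_bd_diffs/fact_bd_diffs.
- by rewrite [ltRHS]ger0_norm ?addr_ge0// ltrDl.
Qed.

Definition pshift c m := if m is m'.+1 then c m' else 0.

Lemma pshift_cvg c y : fact_bd c -> cvgn (series (fun m => pshift c m * y ^+ m)).
Proof.
move=> bc; have cc := fact_bd_cvg (y := y) bc.
have h := @cvg_seriesZ _ _ y cc.
apply/cvg_ex; exists (limn (series (fun n => y * (c n * y ^+ n)))).
rewrite -(cvg_shiftn 1); apply: cvg_trans h; apply: near_eq_cvg; near=> n.
rewrite /= /series /= addn1 big_nat_recl//= mul0r add0r.
by apply: eq_bigr => i _; rewrite exprS; ring.
Unshelve. all: by end_near. Qed.

Lemma psum_shift c y : fact_bd c -> psum (pshift c) y = y * psum c y.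
Proof.
move=> bc; rewrite /psum (nsum_split 1 (pshift_cvg bc)) /series /=.
rewrite big_nat1 mul0r add0r -nsumZ; last exact: fact_bd_cvg.
by apply: eq_nsum => n; rewrite addn1 /= exprS; ring.
Qed.

Lemma psum0 c : fact_bd c -> psum c 0 = c 0%N.
Proof.
move=> bc; rewrite /psum (nsum_split 1 (fact_bd_cvg (y := 0) bc)) /series /= big_nat1.
rewrite mulr1 (eq_nsum (v := fun=> 0)) ?nsum0 ?addr0// => n.
by rewrite addn1 expr0n mulr0.
Qed.

Lemma psum_recl c y : fact_bd c ->
  psum c y = c 0%N + psum (pshift (fun m => c m.+1)) y.
Proof.
move=> bc; have cc := fact_bd_cvg (y := y) bc.
have cs : cvgn (series (fun m => pshift (fun m => c m.+1) m * y ^+ m)).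
  apply: pshift_cvg; have [C hC] := bc; exists C => m; rewrite (le_trans (hC _))//.
  have C0 : 0 <= C by have := hC 0%N; rewrite fact0 divr1; apply: le_trans.
  rewrite ler_wpM2l// lef_pV2 ?posrE ?ltr0n ?fact_gt0// ler_nat factS leq_pmull//.
rewrite /psum (nsum_split 1 cc) (nsum_split 1 cs) /series /= !big_nat1 mulr1.
by rewrite mul0r add0r; congr (_ + _); apply: eq_nsum => n; rewrite addn1.
Qed.

Lemma psumD c d y : cvgn (series (fun m => c m * y ^+ m)) ->
  cvgn (series (fun m => d m * y ^+ m)) ->
  psum (fun m => c m + d m) y = psum c y + psum d y.
Proof.
move=> bc bd; rewrite -nsumD//.
by apply: eq_nsum => m; rewrite mulrDl.
Qed.

Lemma psumN c y : fact_bd c -> psum (fun m => - c m) y = - psum c y.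
Proof.
move=> bc; rewrite -nsumN; last exact: fact_bd_cvg.
by apply: eq_nsum => m; rewrite mulNr.
Qed.

End entire_series.

(** * Bessel functions of orders 0 and 1 *)

Section bessel_functions.
Context {R : realType}.
Implicit Types (x y : R) (k m : nat).

(** Coefficients, as power series in [y = (x / 2) ^+ 2], of J_k and, up to the factor [- pi^-1], of
    the part of Y_k without logarithm and pole, the common factor [(x / 2) ^+ k] being removed. *)
Let a k m : R := (-1) ^+ m / (m`! * (m + k)`!)%:R.
Let b k m : R := (-1) ^+ m * (digammaS m + digammaS (m + k)) / (m`! * (m + k)`!)%:R.

Let factR (m : nat) : (m`!%:R : R) != 0.
Proof. by rewrite pnatr_eq0 -lt0n fact_gt0. Qed.

Let S1R (m : nat) : (m.+1%:R : R) != 0.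
Proof. by rewrite pnatr_eq0. Qed.

Let norm_sgn m : `|(-1) ^+ m : R| = 1.
Proof. by rewrite normrX normrN1 expr1n. Qed.

Let bd_a k : fact_bd (a k).
Proof.
exists 1 => m; rewrite normrM norm_sgn mul1r mul1r normfV normr_nat.
by rewrite lef_pV2 ?posrE ?ltr0n ?muln_gt0 ?fact_gt0// ler_nat leq_pmulr// fact_gt0.
Qed.

Let digammaSS m : @digammaS R m.+1 = digammaS m + (m.+1%:R)^-1.
Proof. by rewrite /digammaS seriesSr /=; ring. Qed.

Let digamma_bd m : `|@digammaS R m| <= m%:R + `|euler_gamma|.
Proof.
rewrite /digammaS (le_trans (ler_normB _ _))// lerD2r.
elim: m => [|m ih]; first by rewrite /series /= big_geq// normr0.
rewrite seriesSr (le_trans (ler_normD _ _))// -natr1 lerD//.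
by rewrite /harmonic /= ger0_norm// invf_le1// ler1n.
Qed.

(** The digamma values grow at most linearly, and one of the two factorials absorbs them. *)
Let bd_b k : (k <= 1)%N -> fact_bd (b k).
Proof.
move=> k1; exists (3 + 2 * `|euler_gamma|) => m.
rewrite !normrM norm_sgn mul1r normfV normr_nat natrM invfM mulrA.
have f1 : 0 < ((m + k)`!%:R : R) by rewrite ltr0n fact_gt0.
rewrite mulrAC ler_wpM2r ?invr_ge0// ler_pdivrMr//.
rewrite (le_trans (ler_normD _ _))//.
rewrite (le_trans (lerD (digamma_bd _) (digamma_bd _)))//.
have h : (m%:R + (m + k)%:R <= 3 * (m + k)`!%:R :> R).
  rewrite -natrD -natrM ler_nat; case: k k1 {f1} => [|[|//]] _.
    rewrite addn0; case: m => [//|m].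
    have : (m.+1 <= m.+1`!)%N by rewrite factS leq_pmulr// fact_gt0.
    by lia.
  rewrite addn1 factS; have : (0 < m`!)%N by exact: fact_gt0.
  nia.
have g1 : 1 <= ((m + k)`!%:R : R) by rewrite ler1n fact_gt0.
have g0 : 0 <= `|@euler_gamma R| by [].
nra.
Qed.

Let bd_sa1 : fact_bd (pshift (a 1)).
Proof.
exists 1 => -[|m] /=; first by rewrite normr0 mul1r invr_ge0.
rewrite normrM norm_sgn mul1r mul1r normfV normr_nat addn1.
by rewrite lef_pV2 ?posrE ?ltr0n ?muln_gt0 ?fact_gt0// ler_nat leq_pmull// fact_gt0.
Qed.

Let bd_sb1 : fact_bd (pshift (b 1)).
Proof.
exists (3 + 2 * `|euler_gamma|) => -[|m] /=.
  by rewrite normr0 divr_ge0// addr_ge0// mulr_ge0.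
rewrite !normrM norm_sgn mul1r normfV normr_nat natrM invfM mulrA addn1.
have f1 : 0 < (m`!%:R : R) by rewrite ltr0n fact_gt0.
rewrite ler_wpM2r ?invr_ge0// ler_pdivrMr//.
rewrite (le_trans (ler_normD _ _))//.
rewrite (le_trans (lerD (digamma_bd _) (digamma_bd _)))//.
have h : (m%:R + m.+1%:R <= 3 * m`!%:R :> R).
  rewrite -natrD -natrM ler_nat; case: m {f1} => [//|m].
  rewrite factS; have : (0 < m`!)%N by exact: fact_gt0.
  case: m => [//|m]; rewrite factS; move: (_`!) => N; nia.
have g1 : 1 <= (m`!%:R : R) by rewrite ler1n fact_gt0.
have g0 : 0 <= `|@euler_gamma R| by [].
nra.
Qed.

Let P k := psum (a k).
Let S k := psum (b k).

Let dP0 y : der (P 0%N) y (- P 1%N y).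
Proof.
apply: (der_eq (psum_der y (bd_a 0))); rewrite -psumN//.
apply: eq_nsum => m; congr (_ * _).
rewrite /pseries_diffs /a addn0 addn1 exprS factS !natrM.
by move: (S1R m) (factR m); move: (m.+1%:R) (m`!%:R) => u v u0 v0; field; rewrite u0 v0.
Qed.

Let dyP1 y : der (fun y => y * P 1%N y) y (P 0%N y).
Proof.
have -> : (fun y => y * P 1%N y) = psum (pshift (a 1)).
  by apply/funext => z; rewrite psum_shift.
apply: (der_eq (psum_der y bd_sa1)).
apply: eq_nsum => m; congr (_ * _).
rewrite /pseries_diffs /a /= addn0 addn1 factS !natrM.
by move: (S1R m) (factR m); move: (m.+1%:R) (m`!%:R) => u v u0 v0; field; rewrite u0 v0.
Qed.

(** The increments of the digamma factors turn the derivative into [- S 1 + (P 0 - 1) / y]. The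
    identity is multiplied by [y], so that it makes sense at [y = 0] too. *)
Let dS0 y : exists2 s, der (S 0%N) y s & y * s = - (y * S 1%N y) + P 0%N y - 1.
Proof.
exists (psum (pseries_diffs (b 0)) y); first exact/psum_der/bd_b.
have bd0 : fact_bd (pseries_diffs (b 0)) by exact/fact_bd_diffs/bd_b.
rewrite -psum_shift// -psum_shift; last exact: bd_b.
rewrite /P (psum_recl y (bd_a 0)).
have -> : a 0 0 = 1 by rewrite /a expr0 addn0 fact0 muln1 divr1.
rewrite [1 + _]addrC addrA addrK addrC; apply/eqP; rewrite -subr_eq addrC opprK; apply/eqP.
rewrite -psumD; [|exact/pshift_cvg/bd_b|exact: pshift_cvg].
apply: eq_nsum => -[|m]; rewrite /= ?addr0//; congr (_ * _).
rewrite /pseries_diffs /a /b !addn0 addn1 !digammaSS exprS factS !natrM.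
move: (S1R m) (factR m); move: (m.+1%:R) (m`!%:R) => u v u0 v0.
by field; rewrite u0 v0.
Qed.

Let dyS1 y : der (fun y => y * S 1%N y) y (S 0%N y + P 1%N y).
Proof.
have -> : (fun y => y * S 1%N y) = psum (pshift (b 1)).
  by apply/funext => z; rewrite psum_shift//; exact: bd_b.
apply: (der_eq (psum_der y bd_sb1)).
rewrite -psumD; [|exact/fact_bd_cvg/bd_b|exact: fact_bd_cvg].
apply: eq_nsum => m; congr (_ * _).
rewrite /pseries_diffs /a /b /= addn0 addn1 !digammaSS factS !natrM.
by move: (S1R m) (factR m); move: (m.+1%:R) (m`!%:R) => u v u0 v0; field; rewrite u0 v0.
Qed.

Let J0E x : besselJ 0 x = P 0%N ((x / 2) ^+ 2).
Proof.
by rewrite /P /S /psum /nsum /besselJ; congr (limn (series _)); apply/funext => m; rewrite /a /b !addn0 exprM.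
Qed.

Let J1E x : besselJ 1 x = x / 2 * P 1%N ((x / 2) ^+ 2).
Proof.
rewrite /P /psum -nsumZ; last exact: fact_bd_cvg.
by rewrite /nsum /besselJ; congr (limn (series _)); apply/funext => m; rewrite exprD exprM expr1 /a /b; ring.
Qed.

Let Y0E x : besselY 0 x = 2 / pi * ln (x / 2) * besselJ 0 x - pi^-1 * S 0%N ((x / 2) ^+ 2).
Proof.
rewrite /besselY big_ord0 mulr0 subr0; congr (_ - _ * _).
by rewrite /P /S /psum /nsum /besselJ; congr (limn (series _)); apply/funext => m; rewrite /a /b !addn0 exprM.
Qed.

Let Y1E x : besselY 1 x = 2 / pi * ln (x / 2) * besselJ 1 x - pi^-1 * (x / 2)^-1
  - pi^-1 * (x / 2 * S 1%N ((x / 2) ^+ 2)).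
Proof.
rewrite /besselY big_ord1 subn0 subnn fact0 muln0 expr0 expr1 divr1 !mul1r.
congr (_ - _ * _); rewrite /S /psum -nsumZ; last exact/fact_bd_cvg/bd_b.
by rewrite /nsum /besselJ; congr (limn (series _)); apply/funext => m; rewrite exprD exprM expr1 /a /b; ring.
Qed.

Let dsq x : der (fun x : R => (x / 2) ^+ 2) x (x / 2).
Proof.
have h : der (fun x : R => x / 2) x 2^-1.
  by apply: der_eq; [apply: derM; [exact: der_id|exact: der_cst]|rewrite /=; ring].
by apply: (der_eq (derX 2 h)); rewrite /= expr1; field.
Qed.

Let dln x : 0 < x -> der (fun x : R => ln (x / 2)) x x^-1.
Proof.
move=> x0; have h : der (fun x : R => x / 2) x 2^-1.
  by apply: der_eq; [apply: derM; [exact: der_id|exact: der_cst]|rewrite /=; ring].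
apply: (der_eq (der_ln _ h)); first by rewrite divr_gt0.
by field; rewrite gt_eqF.
Qed.

Lemma besselJ0_der x : der (besselJ 0) x (- besselJ 1 x).
Proof.
rewrite (funext J0E) J1E; apply: (der_eq (der_comp (dP0 _) (dsq x))).
by ring.
Qed.

Lemma besselJ1_der x : der (fun x => x * besselJ 1 x) x (x * besselJ 0 x).
Proof.
have -> : (fun x => x * besselJ 1 x) = (fun x => 2 * ((x / 2) ^+ 2 * P 1%N ((x / 2) ^+ 2))).
  by apply/funext => z; rewrite J1E; field.
rewrite J0E; apply: (der_eq (derZ 2 (der_comp (dyP1 _) (dsq x)))).
by field.
Qed.

Lemma besselY0_der x : 0 < x -> der (besselY 0) x (- besselY 1 x).
Proof.
move=> x0; have [s ds es] := dS0 ((x / 2) ^+ 2).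
rewrite (funext Y0E) Y1E; apply: der_eq.
  apply: derB.
    by apply: derM; [apply: derZ; exact: dln|exact: besselJ0_der].
  by apply: derZ; exact: (der_comp (f := fun x => (x / 2) ^+ 2) ds (dsq x)).
rewrite /= -J0E in es *.
have xn : x != 0 by rewrite gt_eqF.
have -> : s = (- ((x / 2) ^+ 2 * S 1%N ((x / 2) ^+ 2)) + besselJ 0 x - 1) / (x / 2) ^+ 2.
  by rewrite -es mulrAC mulfV ?mul1r// expf_neq0// mulf_neq0// invr_neq0.
have pi0 : (pi : R) != 0 by rewrite gt_eqF// pi_gt0.
by move: (S 1%N _) (ln _) pi0; generalize (pi : R) => p A B p0; field; rewrite xn p0.
Qed.

Lemma besselY1_der x : 0 < x -> der (fun x => x * besselY 1 x) x (x * besselY 0 x).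
Proof.
move=> x0; have pi0 : (pi : R) != 0 by rewrite gt_eqF// pi_gt0.
(* Multiplication by [x] removes the pole of Y_1; what is left besides the logarithmic term is a
   power series in [(x / 2) ^+ 2]. *)
apply: (@der_near _ (fun x => 2 / pi * ln (x / 2) * (x * besselJ 1 x)
   - 2 / pi * (1 + (x / 2) ^+ 2 * S 1%N ((x / 2) ^+ 2)))).
  near=> z; have z0 : z != 0 by rewrite gt_eqF//; near: z; exact: lt_nbhsr.
  rewrite Y1E; move: (S 1%N _) (ln _) pi0; generalize (pi : R) => p A B p0.
  by field; rewrite z0 p0.
apply: der_eq.
  apply: derB.
    by apply: derM; [apply: derZ; exact: dln|exact: besselJ1_der].
  apply: derZ; apply: derD; first exact: der_cst.
  exact: (der_comp (dyS1 _) (dsq x)).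
rewrite /= Y0E J1E; have xn : x != 0 by rewrite gt_eqF.
by move: (S 0%N _) (P 1%N _) (ln _) pi0; generalize (pi : R) => p A B C p0; field; rewrite xn p0.
Unshelve. all: by end_near. Qed.

(* Multiplied by [x], the Wronskian loses the logarithms, extends continuously
   to [x = 0] with value [2 / pi], and has derivative [0] for [x > 0]. *)
Lemma bessel_wronskian x : 0 < x ->
  besselJ 1 x * besselY 0 x - besselJ 0 x * besselY 1 x = 2 / (pi * x).
Proof.
move=> x0; have pi0 : (pi : R) != 0 by rewrite gt_eqF// pi_gt0.
pose w x := x * besselJ 1 x * besselY 0 x - besselJ 0 x * (x * besselY 1 x).
pose v x := - pi^-1 * (2 * ((x / 2) ^+ 2 * P 1%N ((x / 2) ^+ 2)) * S 0%N ((x / 2) ^+ 2))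
  + 2 / pi * besselJ 0 x * (1 + (x / 2) ^+ 2 * S 1%N ((x / 2) ^+ 2)).
have wv z : 0 < z -> w z = v z.
  move=> z0; rewrite /w /v Y0E Y1E J1E; have zn : z != 0 by rewrite gt_eqF.
  by move: (S 0%N _) (S 1%N _) (P 1%N _) (ln _) pi0; generalize (pi : R) => p A B C D p0; field; rewrite zn p0.
have dw z : 0 < z -> der w z 0.
  move=> z0; apply: der_eq.
    apply: derB; apply: derM.
    - exact: besselJ1_der.
    - exact: besselY0_der.
    - exact: besselJ0_der.
    - exact: besselY1_der.
  by rewrite /=; ring.
have cv : {for 0, continuous v}.
  have c2 : {for 0, continuous (fun x : R => (x / 2) ^+ 2)}.
    exact: (der_cont (dsq 0)).
  have cy k (f : R -> R) d : der f ((0 / 2) ^+ 2) d ->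
      {for 0, continuous (fun x : R => f ((x / 2) ^+ 2))}.
    by move=> fd; apply: (cont_comp (g := f)) => //; exact: der_cont fd.
  apply: contD; apply: contM; first exact: cvg_cst.
  - apply: contM; last by have [s ds _] := dS0 ((0 / 2) ^+ 2); apply: (cy 0%N _ _ ds).
    by apply: contM; [exact: cvg_cst|exact: (cy 0%N (fun y => y * P 1%N y) _ (dyP1 _))].
  - by apply: contM; [exact: cvg_cst|exact: der_cont (besselJ0_der 0)].
  - apply: contD; first exact: cvg_cst.
    exact: (cy 0%N (fun y => y * S 1%N y) _ (dyS1 _)).
have wc z : 0 < z -> z <= x -> v z = v x.
  move=> z0 zx; rewrite -!wv//; apply: (@der_0_cst _ w) => // y /andP[zy _].
  by apply: dw; rewrite (lt_le_trans z0).
have v0 : v 0 = 2 / pi.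
  rewrite /v J0E /P !mul0r !expr0n /= !mul0r mulr0 mul0r mulr0 add0r addr0 mulr1.
  by rewrite psum0// /a expr0 addn0 fact0 muln1 divr1 mulr1.
suff vx : v x = 2 / pi.
  have := wv _ x0; rewrite vx /w => e; have xn : x != 0 by rewrite gt_eqF.
  rewrite invfM mulrA -e; field; exact: xn.
rewrite -v0; apply/eqP; rewrite -subr_eq0 -normr_le0; apply/ler_addgt0Pr => e e0.
have /cvgrPdist_le /(_ _ e0) [d /= d0 hd] := cv.
(* A positive point, at most [x] and within [d] of 0: there [v] has the value [v x]. *)
have m0 : 0 < Num.min (d / 2) x by rewrite lt_min x0 divr_gt0.
rewrite add0r -(wc (Num.min (d / 2) x)) ?ge_min ?lexx ?orbT// distrC; apply: hd => /=.
by rewrite sub0r normrN gtr0_norm// gt_min; apply/orP; left; lra.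
Qed.

End bessel_functions.

(** * Radial eigenfunctions *)

(* [Phi l] solves the radial equation [r^-d (r^d Phi')' = - l ^+ 2 * Phi] and the Robin
   condition at [R1]; it satisfies the one at [R2] when [l] is some [lam m]. *)
Record radial_system {R : realType} (d : nat) (R1 R2 k1 k2 : R) (lam : nat -> R)
    (Phi dPhi : R -> R -> R) : Prop := {
  rs_R1 : 0 < R1;
  rs_R12 : R1 < R2;
  rs_der : forall l r, 0 < l -> 0 < r -> der (Phi l) r (dPhi l r);
  rs_der2 : forall l r, 0 < l -> 0 < r ->
    der (dPhi l) r (- (d%:R / r) * dPhi l r - l ^+ 2 * Phi l r);
  rs_left : forall l, 0 < l -> dPhi l R1 = k1 * Phi l R1;
  rs_second : forall l, 0 < l -> exists Th dTh : R -> R,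
    forall r, 0 < r -> [/\ der Th r (dTh r),
      der dTh r (- (d%:R / r) * dTh r - l ^+ 2 * Th r) &
      r ^+ d * (Phi l r * dTh r - dPhi l r * Th r) = 1];
  rs_pos : forall m, 0 < lam m;
  rs_inj : injective lam;
  rs_root : forall l, 0 < l -> dPhi l R2 = - k2 * Phi l R2 <-> exists m, lam m = l
}.

Section fundamental_systems.
Context {R : realType}.
Implicit Types (r l : R).

(* A nontrivial combination of two solutions with constant nonzero Wronskian
   is completed by the orthogonal combination. *)
Lemma second_solution (d : nat) (l w a c : R) (A dA C dC : R -> R) :
  w != 0 -> a ^+ 2 + c ^+ 2 != 0 ->
  (forall r, 0 < r -> [/\ der A r (dA r), der C r (dC r),
     der dA r (- (d%:R / r) * dA r - l ^+ 2 * A r),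
     der dC r (- (d%:R / r) * dC r - l ^+ 2 * C r) &
     r ^+ d * (A r * dC r - dA r * C r) = w]) ->
  exists Th dTh : R -> R, forall r, 0 < r ->
   [/\ der Th r (dTh r), der dTh r (- (d%:R / r) * dTh r - l ^+ 2 * Th r) &
     r ^+ d * ((a * A r + c * C r) * dTh r - (a * dA r + c * dC r) * Th r) = 1].
Proof.
move=> w0 ac0 h; pose k := (w * (a ^+ 2 + c ^+ 2))^-1.
exists (fun r => k * (a * C r - c * A r)), (fun r => k * (a * dC r - c * dA r)).
move=> r r0; have [h1 h2 h3 h4 h5] := h r r0; split.
- by apply: derZ; apply: derB; apply: derZ.
- apply: der_eq; first by apply: derZ; apply: derB; apply: derZ; [exact: h4|exact: h3].
  by rewrite /=; ring.
- transitivity (k * (a ^+ 2 + c ^+ 2) * (r ^+ d * (A r * dC r - dA r * C r))); first by ring.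
  by rewrite h5 /k; field; rewrite w0 ac0.
Qed.

Lemma der_scale l (f : R -> R) r a : der f (l * r) a -> der (fun r => f (l * r)) r (l * a).
Proof.
move=> fa; apply: der_eq; first apply: (der_comp (f := fun r => l * r) fa).
  by apply: derZ; exact: der_id.
by ring.
Qed.

Lemma bessel_ode (B0 B1 : R -> R) l r : 0 < l -> 0 < r ->
  (forall x, 0 < x -> der B0 x (- B1 x)) ->
  (forall x, 0 < x -> der (fun x => x * B1 x) x (x * B0 x)) ->
  der (fun r => B0 (l * r)) r (- (l * B1 (l * r))) /\
  der (fun r => - (l * B1 (l * r))) r
    (- (1%:R / r) * - (l * B1 (l * r)) - l ^+ 2 * B0 (l * r)).
Proof.
move=> l0 r0 h0 h1; have lr0 : 0 < l * r by rewrite mulr_gt0.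
split; first by apply: (der_eq (der_scale (h0 _ lr0))); ring.
have rn : r != 0 by rewrite gt_eqF.
apply: (@der_near _ (fun r => - ((l * r * B1 (l * r)) / r))).
  near=> z; have z0 : z != 0 by rewrite gt_eqF//; near: z; exact: lt_nbhsr.
  by field.
apply: der_eq.
  apply: derN; apply: (der_div rn _ (der_id r)).
  exact: (der_scale (f := fun x => x * B1 x) (h1 _ lr0)).
by rewrite /=; field.
Unshelve. all: by end_near. Qed.

(** * Dimension 2: Bessel eigenfunctions *)

Section dimension_2.
Variables (eps R1 R2 q1 q2 : R) (lam : nat -> R).
Hypotheses (heps : 0 < eps) (hR1 : 0 < R1) (hR12 : R1 < R2).

Definition dH2 l r := - l * (bessel_inner eps R1 q1 l besselY * besselJ 1 (l * r)
  - bessel_inner eps R1 q1 l besselJ * besselY 1 (l * r)).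

Let bJ x : 0 < x -> der (@besselJ R 0) x (- besselJ 1 x).
Proof. by move=> _; exact: besselJ0_der. Qed.
Let bJ1 x : 0 < x -> der (fun x : R => x * besselJ 1 x) x (x * besselJ 0 x).
Proof. by move=> _; exact: besselJ1_der. Qed.

Let hR2 : 0 < R2. Proof. exact: lt_trans hR12. Qed.

Let wron l r : 0 < l -> 0 < r ->
  l * (besselJ 1 (l * r) * besselY 0 (l * r) - besselJ 0 (l * r) * besselY 1 (l * r))
    = 2 / (pi * r).
Proof.
move=> l0 r0; rewrite bessel_wronskian ?mulr_gt0//.
have pin : (pi : R) != 0 by rewrite gt_eqF// pi_gt0.
by move: pin; generalize (pi : R) => p p0; field; rewrite p0 !gt_eqF.
Qed.

Let w0 r : 0 < r -> 2 / (pi * r) != 0 :> R.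
Proof.
by move=> r0; rewrite mulf_neq0// invr_neq0// mulf_neq0// gt_eqF// pi_gt0.
Qed.

Lemma H2_der l r : 0 < l -> 0 < r -> der (H2 eps R1 q1 l) r (dH2 l r).
Proof.
move=> l0 r0; have [hJ _] := bessel_ode l0 r0 bJ bJ1.
have [hY _] := bessel_ode l0 r0 (@besselY0_der R) (@besselY1_der R).
apply: der_eq; first by apply: derB; apply: derZ; [exact: hJ|exact: hY].
by rewrite /dH2; ring.
Qed.

Lemma H2_der2 l r : 0 < l -> 0 < r ->
  der (dH2 l) r (- (1%:R / r) * dH2 l r - l ^+ 2 * H2 eps R1 q1 l r).
Proof.
move=> l0 r0; have [_ hJ] := bessel_ode l0 r0 bJ bJ1.
have [_ hY] := bessel_ode l0 r0 (@besselY0_der R) (@besselY1_der R).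
have -> : dH2 l = fun r => bessel_inner eps R1 q1 l besselY * - (l * besselJ 1 (l * r))
  - bessel_inner eps R1 q1 l besselJ * - (l * besselY 1 (l * r)).
  by apply/funext => z; rewrite /dH2; ring.
apply: der_eq; first by apply: derB; apply: derZ; [exact: hJ|exact: hY].
by rewrite /H2; ring.
Qed.

(** The value at [R1] is a Wronskian of J_0 and Y_0, hence depends on neither [l] nor [q1]. *)
Lemma H2_left l : 0 < l -> H2 eps R1 q1 l R1 = - (2 / (pi * R1)).
Proof. by move=> l0; rewrite -(wron l0 hR1) /H2 /bessel_inner; ring. Qed.

Lemma dH2_left l : 0 < l -> dH2 l R1 = - (q1 / eps) * H2 eps R1 q1 l R1.
Proof. by move=> l0; rewrite /dH2 /H2 /bessel_inner; ring. Qed.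

(** Up to sign the characteristic function is the defect of the Robin condition at [R2], so that its
    positive roots are the positive eigenfrequencies. *)
Lemma char2_right l :
  dH2 l R2 + q2 / eps * H2 eps R1 q1 l R2 = - char2 eps R1 R2 q1 q2 l.
Proof. by rewrite /dH2 /H2 /char2 /bessel_outer; ring. Qed.

Lemma radial_system_2 : enumerates_positive_roots 2 eps R1 R2 q1 q2 lam ->
  radial_system 1 R1 R2 (- (q1 / eps)) (q2 / eps) lam (H2 eps R1 q1) dH2.
Proof.
move=> [lam_inj lam_root].
have lamP l : (exists m, lam m = l) <-> 0 < l /\ char2 eps R1 R2 q1 q2 l = 0.
  have e : range lam l <-> 0 < l /\ char2 eps R1 R2 q1 q2 l = 0 by rewrite lam_root.
  by rewrite -e; split => [[m lm]|[m _ lm]]; exists m.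
split.
- exact: hR1.
- exact: hR12.
- exact: H2_der.
- exact: H2_der2.
- exact: dH2_left.
- move=> l l0.
  have [|||Th [dTh h]] := @second_solution 1 l (2 / pi)
     (bessel_inner eps R1 q1 l besselY) (- bessel_inner eps R1 q1 l besselJ)
     (fun r => besselJ 0 (l * r)) (fun r => - (l * besselJ 1 (l * r)))
     (fun r => besselY 0 (l * r)) (fun r => - (l * besselY 1 (l * r))).
  + by rewrite mulf_neq0// invr_neq0// gt_eqF// pi_gt0.
  (* If both coefficients vanished, so would the Wronskian of J_0 and Y_0 at [R1], which is a
     combination of them. *)
  + rewrite sqrrN paddr_eq0 ?sqr_ge0// !sqrf_eq0; apply/negP => /andP[/eqP a0 /eqP b0].
    have := w0 hR1; rewrite -(wron l0 hR1).
    have -> : l * (besselJ 1 (l * R1) * besselY 0 (l * R1) - besselJ 0 (l * R1) * besselY 1 (l * R1))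
      = bessel_inner eps R1 q1 l besselJ * besselY 0 (l * R1)
        - bessel_inner eps R1 q1 l besselY * besselJ 0 (l * R1).
      by rewrite /bessel_inner; ring.
    by rewrite a0 b0 !mul0r subrr eqxx.
  + move=> r r0; have [hJ hJ'] := bessel_ode l0 r0 bJ bJ1.
    have [hY hY'] := bessel_ode l0 r0 (@besselY0_der R) (@besselY1_der R).
    split => //; rewrite expr1.
    transitivity (r * (2 / (pi * r)) : R); first by rewrite -(wron l0 r0); ring.
    have pin : (pi : R) != 0 by rewrite gt_eqF// pi_gt0.
    by move: pin; generalize (pi : R) => p p0; field; rewrite p0 !gt_eqF.
  exists Th, dTh => r r0; have [h1 h2 h3] := h r r0; split => //.
  by rewrite -h3 /H2 /dH2; ring.
- by move=> m; have [] := (lamP (lam m)).1 (ex_intro _ m erefl).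
- exact: lam_inj.
- move=> l l0; have e := char2_right l; rewrite lamP; split => [h|[_ h]].
    by split => //; apply/eqP; rewrite -oppr_eq0 -e h mulNr addNr.
  by move/eqP: e; rewrite h oppr0 addr_eq0 mulNr => /eqP.
Qed.

(** Lommel's integral: by the radial equation [F] is a primitive of [r H^2]. The Robin conditions
    eliminate the derivatives at the ends, and the remaining end values are Wronskians; this is how
    [B2] and the factor [pi ^+ 2 / 2] arise. *)
Lemma H2_norm l : 0 < l -> char2 eps R1 R2 q1 q2 l = 0 ->
  B2 eps R1 R2 q1 q2 l != 0 ->
  pi ^+ 2 / 2 * (l ^+ 2 / B2 eps R1 R2 q1 q2 l * bessel_outer eps R2 q2 l besselJ ^+ 2)
  = (intR R1 R2 (fun r => r ^+ 1 * H2 eps R1 q1 l r ^+ 2))^-1.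
Proof.
move=> l0 ch B0.
have ln : l != 0 by rewrite gt_eqF.
pose F r := r ^+ 2 * (dH2 l r ^+ 2 + l ^+ 2 * H2 eps R1 q1 l r ^+ 2) / (2 * l ^+ 2).
have dF r : R1 <= r <= R2 -> der F r (r ^+ 1 * H2 eps R1 q1 l r ^+ 2).
  move=> /andP[r1 _]; have r0 : 0 < r by rewrite (lt_le_trans hR1).
  have rn : r != 0 by rewrite gt_eqF.
  apply: der_eq.
    apply: derM; last exact: der_cst.
    apply: derM; first exact: (derX 2 (der_id r)).
    apply: derD; first exact: (derX 2 (H2_der2 l0 r0)).
    by apply: derZ; exact: (derX 2 (H2_der l0 r0)).
  by rewrite /=; field; rewrite ln rn.
rewrite (FTC2 (ltW hR12) dF); last first.
  apply: conM; first by apply: conX; exact: con_id.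
  apply: conX; apply: (con_der (f' := dH2 l)) => r /andP[r1 _]; apply: H2_der => //.
  exact: lt_le_trans hR1 r1.
rewrite /F (dH2_left l0) (H2_left l0).
have dR : dH2 l R2 = - (q2 / eps) * H2 eps R1 q1 l R2.
  by apply/eqP; rewrite mulNr -addr_eq0 char2_right ch oppr0.
have pin : (pi : R) != 0 by rewrite gt_eqF// pi_gt0.
rewrite dR; move: B0; rewrite /B2.
set iJ := bessel_inner eps R1 q1 l besselJ; set oJ := bessel_outer eps R2 q2 l besselJ.
move=> B0.
(* At a root the pairs of coefficients belonging to [R1] and [R2] are proportional, which turns the
   value at [R2] into a Wronskian as well. *)
have hH : oJ * H2 eps R1 q1 l R2 = iJ * (2 / (pi * R2)).
  have e : oJ * bessel_inner eps R1 q1 l besselY = iJ * bessel_outer eps R2 q2 l besselY.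
    by apply/eqP; rewrite eq_sym -subr_eq0; apply/eqP; exact: ch.
  transitivity (oJ * bessel_inner eps R1 q1 l besselY * besselJ 0 (l * R2)
    - oJ * iJ * besselY 0 (l * R2)); first by rewrite /H2 -/iJ; ring.
  by rewrite e -(wron l0 hR2) /oJ /bessel_outer; ring.
(* By [hH], [oJ = 0] would entail [iJ = 0], and [B2] would vanish with them. *)
have oJ0 : oJ != 0.
  apply/negP => /eqP o0; move: B0; rewrite o0 expr0n /= mulr0 subr0.
  suff -> : iJ = 0 by rewrite expr0n mulr0 eqxx.
  move: hH; rewrite o0 mul0r => /esym/eqP; rewrite mulf_eq0 => /orP[/eqP//|].
  by rewrite (negbTE (w0 hR2)).
have -> : H2 eps R1 q1 l R2 = iJ * (2 / (pi * R2)) / oJ.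
  by rewrite -hH mulrAC mulfV ?mul1r.
have R1n : R1 != 0 by rewrite gt_eqF.
have R2n : R2 != 0 by rewrite gt_eqF.
have en : eps != 0 by rewrite gt_eqF.
rewrite -[LHS]invrK; congr (_^-1).
move: pin B0; generalize (pi : R) => p p0 B0.
field.
rewrite en ln p0 oJ0 R1n R2n /=.
set A := (X in X != 0); suff -> : A = eps ^+ 2 * ((l ^+ 2 + q2 ^+ 2 / eps ^+ 2) * iJ ^+ 2 -
    (l ^+ 2 + q1 ^+ 2 / eps ^+ 2) * oJ ^+ 2) by rewrite mulf_neq0// expf_neq0.
by rewrite /A; field.
Qed.

End dimension_2.

(** * Dimension 3: trigonometric eigenfunctions *)

Section dimension_3.
Variables (eps R1 R2 q1 q2 : R) (lam : nat -> R).
Hypotheses (heps : 0 < eps) (hR1 : 0 < R1) (hR12 : R1 < R2).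

Let hR2 : 0 < R2. Proof. exact: lt_trans hR12. Qed.

Definition dPsi3 l r := b1 eps R1 q1 * (l * cos (l * (r - R1)))
  - R1 * l * (l * sin (l * (r - R1))).

(** Multiplication by [r] turns the radial operator of dimension 3 into the plain second derivative;
    the eigenfunctions are therefore sines and cosines divided by [r]. *)
Definition Phi3 l r := Psi3 eps R1 q1 l r / r.
Definition dPhi3 l r := dPsi3 l r / r - Psi3 eps R1 q1 l r / r ^+ 2.

Let dlin l r : der (fun r => l * (r - R1)) r l.
Proof.
by apply: der_eq; [apply: derZ; apply: derB; [exact: der_id|exact: der_cst]|ring].
Qed.

Let dsin l r : der (fun r => sin (l * (r - R1))) r (l * cos (l * (r - R1))).
Proof.
by apply: der_eq; [exact: (der_comp (is_derive_sin _) (dlin l r))|rewrite mulrC].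
Qed.

Let dcos l r : der (fun r => cos (l * (r - R1))) r (- (l * sin (l * (r - R1)))).
Proof.
by apply: der_eq; [exact: (der_comp (is_derive_cos _) (dlin l r))|ring].
Qed.

Lemma Psi3_der l r : der (Psi3 eps R1 q1 l) r (dPsi3 l r).
Proof.
by apply: der_eq; [apply: derD; apply: derZ; [exact: dsin|exact: dcos]|rewrite /dPsi3; ring].
Qed.

Lemma Psi3_der2 l r : der (dPsi3 l) r (- (l ^+ 2 * Psi3 eps R1 q1 l r)).
Proof.
apply: der_eq.
  by apply: derB; do 2!apply: derZ; [exact: dcos|exact: dsin].
by rewrite /Psi3; ring.
Qed.

Lemma div_der (l r a : R) (f f' : R -> R) : 0 < r -> der f r (f' r) ->
  der (fun r => f r / r) r (f' r / r - f r / r ^+ 2).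
Proof.
move=> r0 fd; have rn : r != 0 by rewrite gt_eqF.
by apply: (der_eq (der_div rn fd (der_id r))); field.
Qed.

Lemma div_der2 (l r : R) (f f' : R -> R) : 0 < r -> der f r (f' r) ->
  der f' r (- (l ^+ 2 * f r)) ->
  der (fun r => f' r / r - f r / r ^+ 2) r
    (- (2%:R / r) * (f' r / r - f r / r ^+ 2) - l ^+ 2 * (f r / r)).
Proof.
move=> r0 fd fd'; have rn : r != 0 by rewrite gt_eqF.
apply: der_eq.
  apply: derB; first exact: (der_div rn fd' (der_id r)).
  by apply: der_div; [rewrite expf_neq0|exact: fd|exact: (derX 2 (der_id r))].
by rewrite /=; field.
Qed.

Lemma Psi3_left l : Psi3 eps R1 q1 l R1 = R1 * l.
Proof. by rewrite /Psi3 subrr mulr0 sin0 cos0; ring. Qed.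

Lemma dPsi3_left l : dPsi3 l R1 = b1 eps R1 q1 * l.
Proof. by rewrite /dPsi3 subrr mulr0 sin0 cos0; ring. Qed.

Lemma dPsi3_right l :
  R2 * dPsi3 l R2 + b2 eps R2 q2 * Psi3 eps R1 q1 l R2 = char3 eps R1 R2 q1 q2 l.
Proof. by rewrite /dPsi3 /Psi3 /char3; ring. Qed.

Lemma radial_system_3 : enumerates_positive_roots 3 eps R1 R2 q1 q2 lam ->
  radial_system 2 R1 R2 (- (q1 / eps)) (q2 / eps) lam Phi3 dPhi3.
Proof.
have R1n : R1 != 0 by rewrite gt_eqF.
have R2n : R2 != 0 by rewrite gt_eqF.
have en : eps != 0 by rewrite gt_eqF.
move=> [lam_inj lam_root].
have lamP l : (exists m, lam m = l) <-> 0 < l /\ char3 eps R1 R2 q1 q2 l = 0.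
  have e : range lam l <-> 0 < l /\ char3 eps R1 R2 q1 q2 l = 0 by rewrite lam_root.
  by rewrite -e; split => [[m lm]|[m _ lm]]; exists m.
split.
- exact: hR1.
- exact: hR12.
- by move=> l r l0 r0; apply: (@div_der l r 0 (Psi3 eps R1 q1 l) (dPsi3 l)) => //; exact: Psi3_der.
- by move=> l r l0 r0; apply: (@div_der2 l r (Psi3 eps R1 q1 l) (dPsi3 l)) => //;
    [exact: Psi3_der|exact: Psi3_der2].
- by move=> l l0; rewrite /dPhi3 /Phi3 Psi3_left dPsi3_left /b1; field; rewrite R1n en.
- move=> l l0; have ln : l != 0 by rewrite gt_eqF.
  have [|||Th [dTh h]] := @second_solution 2 l (- l) (b1 eps R1 q1) (R1 * l)
     (fun r => sin (l * (r - R1)) / r)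
     (fun r => (l * cos (l * (r - R1))) / r - sin (l * (r - R1)) / r ^+ 2)
     (fun r => cos (l * (r - R1)) / r)
     (fun r => - (l * sin (l * (r - R1))) / r - cos (l * (r - R1)) / r ^+ 2).
  + by rewrite oppr_eq0.
  + rewrite paddr_eq0 ?sqr_ge0// !sqrf_eq0 negb_and; apply/orP; right.
    by rewrite mulf_neq0.
  + move=> r r0; have rn : r != 0 by rewrite gt_eqF.
    split.
    * exact: (@div_der l r 0 (fun r => sin (l * (r - R1))) (fun r => l * cos (l * (r - R1)))).
    * exact: (@div_der l r 0 (fun r => cos (l * (r - R1))) (fun r => - (l * sin (l * (r - R1))))).
    * apply: (@div_der2 l r (fun r => sin (l * (r - R1))) (fun r => l * cos (l * (r - R1)))) => //.
      by apply: (der_eq (derZ l (dcos l r))); ring.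
    * apply: (@div_der2 l r (fun r => cos (l * (r - R1))) (fun r => - (l * sin (l * (r - R1))))) => //.
      by apply: (der_eq (derN (derZ l (dsin l r)))); ring.
    * have := cos2Dsin2 (l * (r - R1)).
      move: (sin _) (cos _) => S C h.
      transitivity (- l * (C ^+ 2 + S ^+ 2)); last by rewrite h mulr1.
      by field.
  exists Th, dTh => r r0; have [h1 h2 h3] := h r r0; split => //.
  rewrite -h3 /Phi3 /dPhi3 /Psi3 /dPsi3.
  have rn : r != 0 by rewrite gt_eqF.
  by move: (Th r) (dTh r) (sin _) (cos _) => T dT S C; field.
- by move=> m; have [] := (lamP (lam m)).1 (ex_intro _ m erefl).
- exact: lam_inj.
- move=> l l0; have e := dPsi3_right l; rewrite lamP.
  have e2 : dPhi3 l R2 - (- (q2 / eps) * Phi3 l R2) = char3 eps R1 R2 q1 q2 l / R2 ^+ 2.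
    by rewrite -e /dPhi3 /Phi3 /b2; field; rewrite R2n en.
  split => [h|[_ h]].
    split => //; apply/eqP; move/eqP: e2; rewrite h subrr eq_sym mulf_eq0 invr_eq0.
    by rewrite expf_eq0 (negbTE R2n) andbF orbF.
  by apply/eqP; rewrite -subr_eq0 e2 h mul0r.
Qed.

(** The energy [Psi'^2 + l^2 Psi^2] is a constant [K], which provides the primitive [F] of [Psi^2].
    Together with the Robin condition at [R2], [K] also determines [Psi^2] there. *)
Lemma Psi3_norm l : 0 < l -> char3 eps R1 R2 q1 q2 l = 0 ->
  2 * (b2 eps R2 q2 ^+ 2 + R2 ^+ 2 * l ^+ 2) /
    ((R2 - R1) * (b1 eps R1 q1 ^+ 2 + R1 ^+ 2 * l ^+ 2) * (b2 eps R2 q2 ^+ 2 + R2 ^+ 2 * l ^+ 2)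
     + (b1 eps R1 q1 * R2 + b2 eps R2 q2 * R1) * (b1 eps R1 q1 * b2 eps R2 q2 + R1 * R2 * l ^+ 2))
  = (intR R1 R2 (fun r => r ^+ 2 * Phi3 l r ^+ 2))^-1.
Proof.
move=> l0 ch; have ln : l != 0 by rewrite gt_eqF.
have R2n : R2 != 0 by rewrite gt_eqF.
have l2 : 2 * l ^+ 2 != 0 by rewrite mulf_neq0// expf_neq0.
set a := b1 eps R1 q1; set c := b2 eps R2 q2.
pose K := l ^+ 2 * (a ^+ 2 + R1 ^+ 2 * l ^+ 2).
pose F r := (r * K - Psi3 eps R1 q1 l r * dPsi3 l r) / (2 * l ^+ 2).
have KE r : dPsi3 l r ^+ 2 + l ^+ 2 * Psi3 eps R1 q1 l r ^+ 2 = K.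
  rewrite /K /dPsi3 /Psi3 -/a; have := cos2Dsin2 (l * (r - R1)).
  move: (sin _) (cos _) => S C h.
  by transitivity (l ^+ 2 * (a ^+ 2 + R1 ^+ 2 * l ^+ 2) * (C ^+ 2 + S ^+ 2)); [ring|rewrite h mulr1].
have dF r : R1 <= r <= R2 -> der F r (Psi3 eps R1 q1 l r ^+ 2).
  move=> _; apply: der_eq.
    apply: derM; last exact: der_cst.
    apply: derB; first by apply: derM; [exact: der_id|exact: der_cst].
    by apply: derM; [exact: Psi3_der|exact: Psi3_der2].
  by rewrite /= -(KE r); field.
rewrite (eq_int (g := fun r => Psi3 eps R1 q1 l r ^+ 2)); last first.
  move=> r /andP[r1 _]; have rn : r != 0 by rewrite gt_eqF// (lt_le_trans hR1).
  by rewrite /Phi3; field.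
rewrite (FTC2 (ltW hR12) dF); last first.
  by apply: conX; apply: (con_der (f' := dPsi3 l)) => r _; exact: Psi3_der.
rewrite /F Psi3_left dPsi3_left -/a.
have cp : 0 < c ^+ 2 + R2 ^+ 2 * l ^+ 2.
  by rewrite ltr_wpDl ?sqr_ge0// mulr_gt0// exprn_gt0.
have e1 : dPsi3 l R2 = - c * Psi3 eps R1 q1 l R2 / R2.
  have := dPsi3_right l; rewrite ch => /eqP; rewrite addr_eq0 => /eqP e.
  by rewrite mulNr -e mulrC mulKf.
have e2 : Psi3 eps R1 q1 l R2 ^+ 2 = K * R2 ^+ 2 / (c ^+ 2 + R2 ^+ 2 * l ^+ 2).
  apply: (canRL (mulfK _)); first by rewrite gt_eqF.
  by rewrite -(KE R2) e1; field.
have -> : Psi3 eps R1 q1 l R2 * dPsi3 l R2 = - c * Psi3 eps R1 q1 l R2 ^+ 2 / R2.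
  by rewrite e1; ring.
rewrite e2 /K -[LHS]invrK; congr (_^-1).
have cn : c ^+ 2 + (R2 * l) ^+ 2 != 0 by rewrite exprMn gt_eqF.
by rewrite invf_div exprMn in cn *; field; rewrite ?exprMn ?cn ?ln ?R2n.

Qed.

End dimension_3.
End fundamental_systems.

(** [con_auto] decomposes a function along sums, opposites, products and powers. The leaves are
    closed by a hypothesis or by the hint database [conb]. *)
Ltac con_leaf :=
  match goal with
  | H : con _ _ ?f |- con _ _ ?f => exact H
  | H : con _ _ ?f |- con _ _ (fun x => ?f x) => exact H
  | |- _ => solve [auto 1 with conb nocore]
  end.
Ltac con_rec :=
  lazymatch goal with
  | |- con _ _ (fun x => @?f x + @?g x) => apply (@conD _ _ _ f g); cbv beta; con_rec
  | |- con _ _ (fun x => - (@?f x)) => apply (@conN _ _ _ f); cbv beta; con_rec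
  | |- con _ _ (fun x => @?f x * @?g x) => apply (@conM _ _ _ f g); cbv beta; con_rec
  | |- con _ _ (fun x => (@?f x) ^+ ?n) => apply (@conX _ _ _ f n); cbv beta; con_rec
  | |- con _ _ (fun x => x) => exact (@con_id _ _ _)
  | |- con _ _ (fun x => ?f x) => change (fun x => f x) with f; con_leaf
  | |- _ => first [exact: con_cst | con_leaf]
  end.
Ltac con_auto :=
  match goal with
  | |- @con ?R ?a ?b ?f => change (@con R a b (fun x : Real.sort R => f x)); cbv beta; con_rec
  end.

(** * The Robin eigenvalue problem: energy form, summability, uniform bounds *)

Section sturm_liouville.
Context {R : realType}.
Variables (d : nat) (R1 R2 k1 k2 : R) (lam : nat -> R) (Phi dPhi : R -> R -> R).
Hypothesis rs : radial_system d R1 R2 k1 k2 lam Phi dPhi.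
Implicit Types (f g w z : R -> R) (r s : R) (m k N : nat).

Let R1p : 0 < R1 := rs_R1 rs.
Let R12 : R1 < R2 := rs_R12 rs.
Let R12' : R1 <= R2 := ltW R12.
Let lamp m : 0 < lam m := rs_pos rs m.

Let rp r : R1 <= r <= R2 -> 0 < r.
Proof. by move=> /andP[h _]; exact: lt_le_trans h. Qed.
Let rn r : R1 <= r <= R2 -> r != 0.
Proof. by move=> h; rewrite gt_eqF ?rp. Qed.

(** The weight [r ^+ d] is the radial density of Lebesgue measure; with it the radial operator with
    Robin conditions is symmetric. *)
Definition wip f g := intR R1 R2 (fun r => r ^+ d * (f r * g r)).

Definition C1f f f' := (forall r, R1 <= r <= R2 -> der f r (f' r)) /\ con R1 R2 f'.

(* [w] satisfies the Robin conditions and [- r^-d (r^d w')' = f]. *)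
Definition robin w w' f := [/\ forall r, R1 <= r <= R2 -> der w r (w' r),
  forall r, R1 <= r <= R2 -> der w' r (- (d%:R / r) * w' r - f r), con R1 R2 f,
  w' R1 = k1 * w R1 & w' R2 = - k2 * w R2].

Lemma con_inv : con R1 R2 (fun r => r^-1).
Proof. by move=> r h; apply: contV; [exact: rn|exact: cvg_id]. Qed.
Hint Resolve con_inv con_id con_cst : conb.

Lemma C1f_con f f' : C1f f f' -> con R1 R2 f.
Proof. by move=> [fd _]; exact: con_der fd. Qed.

Lemma robin_C1 w w' f : robin w w' f -> C1f w w'.
Proof. by move=> [wd wd' _ _ _]; split => //; exact: con_der wd'. Qed.

Lemma robin_con w w' f : robin w w' f -> con R1 R2 f.
Proof. by case. Qed.

Lemma ipC f g : wip f g = wip g f.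
Proof. by apply: eq_int => r _; rewrite [f r * _]mulrC. Qed.

Lemma ipDl f g z : con R1 R2 f -> con R1 R2 g -> con R1 R2 z ->
  wip (fun r => f r + g r) z = wip f z + wip g z.
Proof.
move=> cf cg cz; rewrite /wip -intD; [|by con_auto|by con_auto].
by apply: eq_int => r _; ring.
Qed.

Lemma ipZl c f g : con R1 R2 f -> con R1 R2 g -> wip (fun r => c * f r) g = c * wip f g.
Proof.
move=> cf cg; rewrite /wip -intZ; last by con_auto.
by apply: eq_int => r _; ring.
Qed.

Lemma ipDr f g z : con R1 R2 f -> con R1 R2 g -> con R1 R2 z ->
  wip z (fun r => f r + g r) = wip z f + wip z g.
Proof. by move=> *; rewrite ipC ipDl// [wip f _]ipC [wip g _]ipC. Qed.

Lemma ipZr c f g : con R1 R2 f -> con R1 R2 g -> wip g (fun r => c * f r) = c * wip g f.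
Proof. by move=> *; rewrite ipC ipZl// [wip f _]ipC. Qed.

Lemma ip_sum N (a : nat -> R) (F : nat -> R -> R) g : (forall m, con R1 R2 (F m)) -> con R1 R2 g ->
  wip g (fun r => \sum_(0 <= m < N) a m * F m r) = \sum_(0 <= m < N) a m * wip g (F m).
Proof.
move=> cF cg; have cF' m := cF m.
transitivity (\sum_(0 <= m < N) intR R1 R2 (fun r => a m * (r ^+ d * (g r * F m r)))); last first.
  by apply: eq_bigr => m _; rewrite intZ//; have cFm := cF m; con_auto.
rewrite -int_sum//; last by move=> m; have cFm := cF m; con_auto.
by apply: eq_int => r _; rewrite !mulr_sumr; apply: eq_bigr => m _; ring.
Qed.

Lemma ip_ge0 f : 0 <= wip f f.
Proof.
apply: int_ge0 => r h; rewrite mulr_ge0 ?exprn_ge0 ?(ltW (rp h))//.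
by rewrite -expr2 sqr_ge0.
Qed.

Lemma ip_eq0 f : con R1 R2 f -> wip f f = 0 -> forall r, R1 <= r <= R2 -> f r = 0.
Proof.
move=> cf h r hr.
have cc : con R1 R2 (fun r => r ^+ d * (f r * f r)) by con_auto.
have := int_eq0 R12 cc _ h hr.
have h0 s : R1 <= s <= R2 -> 0 <= s ^+ d * (f s * f s).
  by move=> hs; rewrite mulr_ge0 ?exprn_ge0 ?(ltW (rp hs))// -expr2 sqr_ge0.
move=> /(_ h0) /eqP; rewrite mulf_eq0 expf_eq0 (negbTE (rn hr)) andbF /= mulf_eq0 orbb.
by move/eqP.
Qed.

Lemma ip_CS f g : con R1 R2 f -> con R1 R2 g -> wip f g ^+ 2 <= wip f f * wip g g.
Proof.
move=> cf cg; apply: quad_CS; first exact: ip_ge0.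
move=> t; have := ip_ge0 (fun r => f r + t * g r).
rewrite ipDl ?ipDr ?ipZl ?ipZr; try by con_auto.
by rewrite [wip g f]ipC; congr (_ <= _); ring.
Qed.

Lemma pd_der r : R1 <= r <= R2 -> der (fun r => r ^+ d) r (d%:R / r * r ^+ d).
Proof.
move=> h; apply: (der_eq (derX d (der_id r))).
by case: d => [|d']; rewrite ?mul0r//= exprS; field; rewrite rn.
Qed.

(* Energy identity: differentiate [r^d f (w' - v w)]. *)
Lemma energy v v' f f' w w' g : (forall r, R1 <= r <= R2 -> der v r (v' r)) ->
  con R1 R2 v' -> v R1 = k1 -> v R2 = - k2 -> C1f f f' -> robin w w' g ->
  intR R1 R2 (fun r => r ^+ d * ((f' r - v r * f r) * (w' r - v r * w r)))
   = wip f g + wip (fun r => (v r ^+ 2 + v' r + d%:R / r * v r) * f r) w.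
Proof.
move=> vd cv' v1 v2 [fd cf'] rw; have [wd wd' cg w1 w2] := rw.
have cv := con_der vd; have cf := con_der fd; have cw := con_der wd; have cw' := con_der wd'.
apply/eqP; rewrite eq_sym -subr_eq0 -oppr_eq0 opprB.
rewrite /wip -intD; [|by con_auto|by con_auto].
rewrite -intB; [|by con_auto|by con_auto].
rewrite (@FTC2 _ _ _ (fun r => r ^+ d * (f r * (w' r - v r * w r)))) //.
- by rewrite w1 w2 v1 v2 !subrr !mulr0 subrr.
- move=> r h; apply: der_eq.
    apply: derM; first exact: pd_der.
    apply: derM; first exact: fd.
    apply: derB; first exact: wd'.
    by apply: derM; [exact: vd|exact: wd].
  by rewrite /=; ring.
- by con_auto.
Qed.

(** The difference of the two integrands is the derivative of [r^d (w z' - w' z)], which vanishes at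
    both ends because [w] and [z] satisfy the same Robin conditions. *)
Lemma green_identity w w' f z z' g : robin w w' f -> robin z z' g -> wip f z = wip w g.
Proof.
move=> rw rz; have [wd wd' cf w1 w2] := rw; have [zd zd' cg z1 z2] := rz.
have cw := con_der wd; have cw' := con_der wd'.
have cz := con_der zd; have cz' := con_der zd'.
apply/eqP; rewrite -subr_eq0 /wip -intB; [|by con_auto|by con_auto].
rewrite (@FTC2 _ _ _ (fun r => r ^+ d * (w r * z' r - w' r * z r))) //.
- by rewrite w1 w2 z1 z2; apply/eqP; ring.
- move=> r h; apply: der_eq.
    apply: derM; first exact: pd_der.
    by apply: derB; apply: derM; [exact: wd|exact: zd'|exact: wd'|exact: zd].
  by rewrite /=; ring.
- by con_auto.
Qed.

Definition enrm m := intR R1 R2 (fun r => r ^+ d * Phi (lam m) r ^+ 2).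
Definition eigf m r := Phi (lam m) r / Num.sqrt (enrm m).
Definition deg m r := dPhi (lam m) r / Num.sqrt (enrm m).

Lemma Phi_con l : 0 < l -> con R1 R2 (Phi l).
Proof. by move=> l0; apply: (con_der (f' := dPhi l)) => r h; apply: (rs_der rs l0); exact: rp. Qed.

(** A common zero of the solution and its derivative would annihilate the Wronskian with the second
    solution, which is normalised to 1. *)
Lemma Phi_neq0 l r : 0 < l -> 0 < r -> Phi l r = 0 -> dPhi l r = 0 -> False.
Proof.
move=> l0 r0 h1 h2; have [Th [dTh /(_ r r0) [_ _]]] := rs_second rs l0.
by rewrite h1 h2 !mul0r subrr mulr0 => /esym/eqP; rewrite oner_eq0.
Qed.

Lemma enrm_gt0 m : 0 < enrm m.
Proof.
have l0 := lamp m; have cP := Phi_con l0.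
have e : enrm m = wip (Phi (lam m)) (Phi (lam m)).
  by apply: eq_int => r _; rewrite expr2.
rewrite lt_neqAle e ip_ge0 andbT eq_sym; apply/negP => /eqP h.
have h0 := ip_eq0 cP h; have h1 : R1 <= R1 <= R2 by rewrite lexx.
by apply: (Phi_neq0 l0 R1p (h0 _ h1)); rewrite (rs_left rs l0) h0// mulr0.
Qed.

Let sN m : Num.sqrt (enrm m) != 0.
Proof. by rewrite gt_eqF// sqrtr_gt0 enrm_gt0. Qed.

Lemma eg_der m r : 0 < r -> der (eigf m) r (deg m r).
Proof.
move=> r0; apply: der_eq; first by apply: derM; [exact: (rs_der rs (lamp m) r0)|exact: der_cst].
by rewrite mulr0 addr0.
Qed.

Lemma deg_der m r : 0 < r -> der (deg m) r (- (d%:R / r) * deg m r - lam m ^+ 2 * eigf m r).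
Proof.
move=> r0; apply: der_eq; first by apply: derM; [exact: (rs_der2 rs (lamp m) r0)|exact: der_cst].
by rewrite /deg /eigf; ring.
Qed.

Lemma eg_con m : con R1 R2 (eigf m).
Proof. by apply: (con_der (f' := deg m)) => r h; apply: eg_der; exact: rp. Qed.
Hint Resolve eg_con : conb.

Lemma eg_robin m : robin (eigf m) (deg m) (fun r => lam m ^+ 2 * eigf m r).
Proof.
split.
- by move=> r h; apply: eg_der; exact: rp.
- by move=> r h; apply: deg_der; exact: rp.
- by con_auto.
- by rewrite /deg (rs_left rs (lamp m)) mulrA.
- have [_ h] := rs_root rs (lamp m).
  by rewrite /deg h ?mulrA//; exists m.
Qed.

Lemma deg_con m : con R1 R2 (deg m).
Proof. by have [] := robin_C1 (eg_robin m). Qed.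
Hint Resolve deg_con : conb.

Lemma eg_orth m k : wip (eigf m) (eigf k) = (m == k)%:R.
Proof.
have [->|mk] := eqVneq m k.
  have -> : wip (eigf k) (eigf k) = (enrm k)^-1 * enrm k.
    rewrite /enrm -intZ; last first.
      by have cP := Phi_con (lamp k); con_auto.
    apply: eq_int => r _; rewrite /eigf.
    have := sqr_sqrtr (ltW (enrm_gt0 k)).
    move=> e; rewrite -/(enrm k) -[X in _ = X^-1 * _]e; field; exact: sN.
  by rewrite mulVf// gt_eqF// enrm_gt0.
have := green_identity (eg_robin m) (eg_robin k).
rewrite ipZl ?ipZr; try exact: eg_con.
move=> /eqP; rewrite -subr_eq0 -mulrBl mulf_eq0 subr_eq0 => /orP[|/eqP ->//].
rewrite eqrXn2 ?(ltW (lamp _))// => /eqP /(rs_inj rs) e.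
by rewrite e eqxx in mk.
Qed.

Definition comb N (a : nat -> R) r := \sum_(0 <= m < N) a m * eigf m r.
Definition dcomb N (a : nat -> R) r := \sum_(0 <= m < N) a m * deg m r.

Lemma comb_con N a : con R1 R2 (comb N a).
Proof. by apply: con_sum => m; con_auto. Qed.
Hint Resolve comb_con : conb.

Lemma comb_robin N a : robin (comb N a) (dcomb N a) (comb N (fun m => a m * lam m ^+ 2)).
Proof.
split.
- by move=> r h; apply: der_sum => m; apply: derZ; apply: eg_der; exact: rp.
- move=> r h; apply: der_eq.
    by apply: der_sum => m; apply: derZ; apply: deg_der; exact: rp.
  rewrite /dcomb /comb mulr_sumr -sumrB; apply: eq_bigr => m _; ring.
- by con_auto.
- rewrite /dcomb /comb mulr_sumr; apply: eq_bigr => m _.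
  by have [_ _ _ -> _] := eg_robin m; ring.
- rewrite /dcomb /comb mulr_sumr; apply: eq_bigr => m _.
  by have [_ _ _ _ ->] := eg_robin m; ring.
Qed.

Lemma dcomb_con N a : con R1 R2 (dcomb N a).
Proof. by have [] := robin_C1 (comb_robin N a). Qed.
Hint Resolve dcomb_con : conb.

Lemma ip_comb N a f : con R1 R2 f -> wip f (comb N a) = \sum_(0 <= m < N) a m * wip f (eigf m).
Proof. by move=> cf; rewrite /comb ip_sum// => m; exact: eg_con. Qed.

Lemma ip_comb_eg N a m : (m < N)%N -> wip (comb N a) (eigf m) = a m.
Proof.
move=> mN; rewrite ipC ip_comb; last by con_auto.
rewrite (bigD1_seq m) ?mem_index_iota ?iota_uniq//= eg_orth eqxx mulr1.
rewrite big1 ?addr0// => k km; rewrite eg_orth eq_sym (negbTE km) mulr0 //.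
Qed.

(** * Energy form with absorbed boundary terms *)

Section energy_form.
Variables (v v' : R -> R) (sig : R).
Hypothesis vd : forall r, R1 <= r <= R2 -> der v r (v' r).
Hypothesis cv' : con R1 R2 v'.
Hypothesis v1 : v R1 = k1.
Hypothesis v2 : v R2 = - k2.

Let V r := v r ^+ 2 + v' r + d%:R / r * v r.
Hypothesis sigV : forall r, R1 <= r <= R2 -> V r + 1 <= sig.

Let cv : con R1 R2 v. Proof. exact: con_der vd. Qed.
Let cV : con R1 R2 V. Proof. by rewrite /V; con_auto. Qed.
Hint Resolve cv cV cv' : conb.

(** The form of the operator shifted by [sig]. Replacing [f'] by [f' - v f], where [v] takes the
    Robin coefficients at the ends, makes the boundary terms vanish; [sig] then outweighs the
    potential [V]. The signs of [k1] and [k2] are free. *)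
Definition qform f f' w w' := intR R1 R2 (fun r => r ^+ d *
  ((f' r - v r * f r) * (w' r - v r * w r) + (sig - V r) * (f r * w r))).

Definition nu m := lam m ^+ 2 + sig.

Lemma qform_robin f f' w w' g : C1f f f' -> robin w w' g ->
  qform f f' w w' = wip f g + sig * wip f w.
Proof.
move=> Cf rw; have cf := C1f_con Cf; have [_ cf'] := Cf.
have cw := C1f_con (robin_C1 rw); have [_ cw'] := robin_C1 rw.
have cg := robin_con rw.
have := energy vd cv' v1 v2 Cf rw; rewrite -/V => e.
have -> : wip f g = intR R1 R2 (fun r => r ^+ d * ((f' r - v r * f r) * (w' r - v r * w r)))
   - wip (fun r => V r * f r) w by rewrite e addrK.
rewrite /qform -intZ; last by con_auto.
rewrite -intB; [|by con_auto|by con_auto].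
rewrite -intD; [|by con_auto|by con_auto].
by apply: eq_int => r _; ring.
Qed.

Lemma qform_ge f f' : C1f f f' ->
  intR R1 R2 (fun r => r ^+ d * ((f' r - v r * f r) ^+ 2 + f r ^+ 2)) <= qform f f' f f'.
Proof.
move=> Cf; have cf := C1f_con Cf; have [_ cf'] := Cf.
apply: le_int; [by con_auto|by con_auto|] => r h.
rewrite ler_wpM2l ?exprn_ge0 ?(ltW (rp h))// expr2 lerD2l expr2.
by rewrite ler_peMl -?expr2 ?sqr_ge0// lerBrDl sigV.
Qed.

Lemma qform_ge0 f f' : C1f f f' -> 0 <= qform f f' f f'.
Proof.
move=> Cf; rewrite (le_trans _ (qform_ge Cf))//; apply: int_ge0 => r h.
by rewrite mulr_ge0 ?exprn_ge0 ?(ltW (rp h))// addr_ge0 ?sqr_ge0.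
Qed.

Lemma qform_comb N a f f' : C1f f f' ->
  qform f f' (comb N a) (dcomb N a) = \sum_(0 <= m < N) a m * nu m * wip f (eigf m).
Proof.
move=> Cf; have cf := C1f_con Cf.
rewrite (qform_robin Cf (comb_robin N a)) !ip_comb//.
by rewrite mulr_sumr -big_split /=; apply: eq_bigr => m _; rewrite /nu; ring.
Qed.

(** Bessel's inequality for the energy form, in which the [eigf m] are orthogonal with squares
    [nu m]: expand the nonnegative form at [f] minus its projection onto the first [N]
    eigenfunctions. *)
Lemma bessel_energy N f f' : C1f f f' ->
  \sum_(0 <= m < N) nu m * wip f (eigf m) ^+ 2 <= qform f f' f f'.
Proof.
move=> Cf; have cf := C1f_con Cf; have [fd cf'] := Cf.
pose a m := wip f (eigf m).
have Cw := robin_C1 (comb_robin N a); have [wd cw'] := Cw; have cw := C1f_con Cw.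
have Cfw : C1f (fun r => f r - comb N a r) (fun r => f' r - dcomb N a r).
  by split; [move=> r h; apply: derB; [exact: fd|exact: wd]|con_auto].
have := qform_ge0 Cfw.
have -> : qform (fun r => f r - comb N a r) (fun r => f' r - dcomb N a r)
    (fun r => f r - comb N a r) (fun r => f' r - dcomb N a r)
  = qform f f' f f' + (-2) * qform f f' (comb N a) (dcomb N a)
    + qform (comb N a) (dcomb N a) (comb N a) (dcomb N a).
  rewrite /qform -intZ; last by con_auto.
  rewrite -intD; [|by con_auto|by con_auto].
  rewrite -intD; [|by con_auto|by con_auto].
  by apply: eq_int => r _; ring.
rewrite !qform_comb//.
have -> : \sum_(0 <= m < N) a m * nu m * wip (comb N a) (eigf m) =
  \sum_(0 <= m < N) a m * nu m * wip f (eigf m).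
  by apply: eq_big_nat => m /andP[_ mN]; rewrite ip_comb_eg.
have -> : \sum_(0 <= m < N) a m * nu m * wip f (eigf m) = \sum_(0 <= m < N) nu m * wip f (eigf m) ^+ 2.
  by apply: eq_bigr => m _; rewrite /a; ring.
lra.
Qed.

(** The one-dimensional Sobolev inequality: [f^2] varies by at most the integral [J] of
    [f^2 + f'^2], and its mean value is controlled by [J] as well. *)
Lemma sobolev : exists2 C : R, 0 < C & forall f f', C1f f f' -> forall r, R1 <= r <= R2 ->
  f r ^+ 2 <= C * intR R1 R2 (fun r => r ^+ d * ((f' r - v r * f r) ^+ 2 + f r ^+ 2)).
Proof.
have [M [M0 vM]] := con_bounded R12' cv.
have L0 : 0 < R2 - R1 by rewrite subr_gt0.
(* From [f'^2 <= 2 (f' - v f)^2 + 2 v^2 f^2] and [|v| <= M]. *)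
pose K := 2 + 2 * M ^+ 2; have K0 : 0 < K by rewrite /K; have := sqr_ge0 M; lra.
have p0 : 0 < R1 ^+ d by rewrite exprn_gt0.
exists ((1 / (R2 - R1) + 1) * K / R1 ^+ d); first by rewrite divr_gt0// mulr_gt0// addr_gt0// divr_gt0.
move=> f f' Cf r hr; have cf := C1f_con Cf; have [fd cf'] := Cf.
pose J := intR R1 R2 (fun r => f r ^+ 2 + f' r ^+ 2).
set I := (X in _ <= _ * X).
have JI : J <= K / R1 ^+ d * I.
  rewrite /J /I -intZ; last by con_auto.
  apply: le_int; [by con_auto|by con_auto|] => s hs.
  have h1 : v s ^+ 2 <= M ^+ 2.
    by rewrite -[v s ^+ 2]ger0_norm ?sqr_ge0// normrX lerXn2r ?nnegrE ?(ltW M0)// vM.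
  have h2 : R1 ^+ d <= s ^+ d.
    by case/andP: hs => hs _; rewrite lerXn2r ?nnegrE ?(ltW R1p)// (le_trans (ltW R1p)).
  set A := (f' s - v s * f s) ^+ 2 + f s ^+ 2.
  have A0 : 0 <= A by rewrite addr_ge0 ?sqr_ge0.
  have h3 : f s ^+ 2 + f' s ^+ 2 <= K * A.
    rewrite /K /A; have := sqr_ge0 (f s); have := sqr_ge0 (f' s - 2 * (v s * f s)).
    have := mulr_ge0 (sqr_ge0 M) (sqr_ge0 (f' s - v s * f s)).
    have : v s ^+ 2 * f s ^+ 2 <= M ^+ 2 * f s ^+ 2 by rewrite ler_wpM2r ?sqr_ge0.
    by nra.
  rewrite (le_trans h3)// -mulrA ler_wpM2l ?(ltW K0)// mulrC -mulrA.
  have h4 : A * R1 ^+ d <= s ^+ d * A by rewrite mulrC ler_wpM2r.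
  by rewrite mulrA ler_pdivlMr.
(* By [2 |f f'| <= f^2 + f'^2], adding or subtracting [f^2] to the primitive [G] keeps it
   monotone. *)
have J1 s : R1 <= s <= R2 -> f r ^+ 2 <= f s ^+ 2 + J.
  have cJ : con R1 R2 (fun r => f r ^+ 2 + f' r ^+ 2) by con_auto.
  have [G [Ga dG]] := primitive R12' cJ.
  have Gm a b : R1 <= a -> a <= b -> b <= R2 -> G a <= G b.
    move=> Ra ab bR; apply: (@der_ge0_le _ G _ _ _ ab) => x /andP[ax xb].
      by apply: dG; rewrite (le_trans Ra)//= (le_trans xb).
    by rewrite addr_ge0 ?sqr_ge0.
  have JE : J = G R2 by rewrite /J (int_primitive cJ Ga dG)// lexx R12'.
  have df x : R1 <= x <= R2 -> der (fun r => f r ^+ 2) x (2 * f x * f' x).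
    by move=> hx; apply: (der_eq (derX 2 (fd _ hx))); rewrite /= expr1.
  have /andP[r1 r2] := hr; move=> /andP[s1 s2]; rewrite JE.
  have [sr|/ltW rs'] := leP s r.
    have := @der_ge0_le _ (fun r => G r - f r ^+ 2)
      (fun x => f x ^+ 2 + f' x ^+ 2 - 2 * f x * f' x) s r sr.
    have h x : s <= x <= r -> R1 <= x <= R2.
      by move=> /andP[a b]; rewrite (le_trans s1)//= (le_trans b).
    move=> /(_ _ _)/= H; have := H _ _; rewrite -lerBlDr.
    have := Gm _ _ s1 sr r2; have := Gm _ _ r1 r2 (lexx _); have := Gm _ _ (lexx _) s1 s2; rewrite Ga.
    have : G s - f s ^+ 2 <= G r - f r ^+ 2.
      apply: H => x /h hx; first by apply: derB; [exact: dG|exact: df].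
      by have := sqr_ge0 (f x - f' x); rewrite sqrrB; lra.
    lra.
  have h x : r <= x <= s -> R1 <= x <= R2.
    by move=> /andP[a b]; rewrite (le_trans r1)//= (le_trans b).
  have : G r + f r ^+ 2 <= G s + f s ^+ 2.
    apply: (@der_ge0_le _ (fun r => G r + f r ^+ 2)
      (fun x => f x ^+ 2 + f' x ^+ 2 + 2 * f x * f' x) r s rs') => x /h hx.
      by apply: derD; [exact: dG|exact: df].
    by have := sqr_ge0 (f x + f' x); rewrite sqrrD; lra.
  by have := Gm _ _ s1 s2 (lexx _); have := Gm _ _ (lexx _) r1 r2; rewrite Ga; lra.
(* [J1] is integrated over [s]; the integral of [f s ^+ 2] is at most [J]. *)
have : f r ^+ 2 * (R2 - R1) <= J + J * (R2 - R1).
  rewrite -!int_cst//.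
  have -> : J + intR R1 R2 (fun=> J) = intR R1 R2 (fun s => f s ^+ 2 + f' s ^+ 2 + J).
    by rewrite intD; [|by con_auto|by con_auto].
  apply: le_int; [by con_auto|by con_auto|] => s hs.
  by rewrite (le_trans (J1 s hs))// lerD2r lerDl sqr_ge0.
rewrite -ler_pdivlMr// => h; rewrite (le_trans h)//.
have -> : (J + J * (R2 - R1)) / (R2 - R1) = (1 / (R2 - R1) + 1) * J.
  by field; rewrite gt_eqF.
rewrite -!mulrA ler_wpM2l//; first by rewrite addr_ge0// divr_ge0 // ltW.
by rewrite mulrA.
Qed.

Lemma nu_gt0 m : 0 <= sig -> 0 < nu m.
Proof. by move=> s0; rewrite /nu ltr_wpDr// exprn_gt0. Qed.

(* The finite sum [w] of [eigf m r / nu m * eigf m] satisfies [w r = Q(w)], so the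
   Sobolev bound [w r ^+ 2 <= C Q(w)] bounds [Q(w)] itself. *)
Lemma kernel_bound : 0 <= sig -> exists2 C : R, 0 < C & forall r N, R1 <= r <= R2 ->
  \sum_(0 <= m < N) eigf m r ^+ 2 / nu m <= C.
Proof.
move=> s0; have [C C0 hC] := sobolev; exists C => // r N hr.
pose a m := eigf m r / nu m.
have Cw := robin_C1 (comb_robin N a).
have e1 : comb N a r = \sum_(0 <= m < N) eigf m r ^+ 2 / nu m.
  by apply: eq_bigr => m _; rewrite /a expr2; ring.
have e2 : qform (comb N a) (dcomb N a) (comb N a) (dcomb N a) = \sum_(0 <= m < N) eigf m r ^+ 2 / nu m.
  rewrite qform_comb//; apply: eq_big_nat => m /andP[_ mN].
  by rewrite ip_comb_eg// /a; field; rewrite gt_eqF ?nu_gt0.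
have := hC _ _ Cw r hr.
have := qform_ge Cw; rewrite e2 e1; set S := \sum_(_ <= _ < _) _.
move=> IS SC.
have S0 : 0 <= S by apply: sumr_ge0 => m _; rewrite divr_ge0 ?sqr_ge0 ?ltW ?nu_gt0.
have [->|Sn] := eqVneq S 0; first exact: ltW.
have Sp : 0 < S by rewrite lt_neqAle eq_sym Sn.
by rewrite -(ler_pM2r Sp) -expr2 (le_trans SC)// ler_wpM2l// ltW.
Qed.

(** [kernel_bound] is integrated with the weight [r ^+ d]: since each [eigf m] has norm 1, the
    integral of the partial kernel on the diagonal is the partial sum of the [(nu m)^-1], the trace
    of the resolvent. *)
Lemma nu_summable : 0 <= sig -> cvgn (series (fun m => (nu m)^-1)).
Proof.
move=> s0; have [C C0 hC] := kernel_bound s0.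
apply: (@cvg_bounded_series _ _ (intR R1 R2 (fun r => r ^+ d * C))).
  by move=> m; rewrite invr_ge0 ltW// nu_gt0.
move=> N.
have -> : \sum_(0 <= m < N) (nu m)^-1 =
    intR R1 R2 (fun r => \sum_(0 <= m < N) (nu m)^-1 * (r ^+ d * (eigf m r * eigf m r))).
  rewrite int_sum//; last by move=> m; con_auto.
  apply: eq_bigr => m _; rewrite intZ; last by con_auto.
  by rewrite -/(wip _ _) eg_orth eqxx mulr1.
apply: le_int; [by apply: con_sum => m; con_auto|by con_auto|] => r hr.
have -> : \sum_(0 <= m < N) (nu m)^-1 * (r ^+ d * (eigf m r * eigf m r)) =
  r ^+ d * \sum_(0 <= m < N) eigf m r ^+ 2 / nu m.
  by rewrite mulr_sumr; apply: eq_bigr => m _; rewrite expr2; ring.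
by rewrite ler_wpM2l ?exprn_ge0 ?(ltW (rp hr))// hC.
Qed.

End energy_form.

(** The affine choice of [v], interpolating the two Robin coefficients. *)
Definition rv r := k1 + (- k2 - k1) / (R2 - R1) * (r - R1).

Lemma rv_der r : der rv r ((- k2 - k1) / (R2 - R1)).
Proof.
apply: der_eq; first by apply: derD; [exact: der_cst|apply: derZ; apply: derB; [exact: der_id|exact: der_cst]].
by ring.
Qed.

Lemma rv_left : rv R1 = k1. Proof. by rewrite /rv subrr mulr0 addr0. Qed.
Lemma rv_right : rv R2 = - k2.
Proof. by rewrite /rv mulfVK ?subr_eq0 ?gt_eqF//; ring. Qed.

Let rvd r : R1 <= r <= R2 -> der rv r ((- k2 - k1) / (R2 - R1)).
Proof. by move=> _; exact: rv_der. Qed.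

Let rv_con : con R1 R2 rv. Proof. exact: con_der rvd. Qed.
Hint Resolve rv_con : conb.

Lemma exists_sig : exists2 sig : R, 0 <= sig & forall r, R1 <= r <= R2 ->
  rv r ^+ 2 + (- k2 - k1) / (R2 - R1) + d%:R / r * rv r + 1 <= sig /\ rv r ^+ 2 <= sig.
Proof.
have [M [M0 hM]] := con_bounded R12' rv_con.
have [C [C0 hC]] : exists C : R, 0 < C /\ forall r, R1 <= r <= R2 ->
    `|rv r ^+ 2 + (- k2 - k1) / (R2 - R1) + d%:R / r * rv r + 1| <= C.
  by apply: con_bounded => //; con_auto.
exists (C + M ^+ 2); first by rewrite addr_ge0 ?sqr_ge0// ltW.
move=> r hr; split; first by rewrite (le_trans (ler_norm _))// (le_trans (hC r hr))// lerDl sqr_ge0.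
rewrite -[leLHS]ger0_norm ?sqr_ge0// normrX (@le_trans _ _ (M ^+ 2))//.
  by rewrite lerXn2r ?nnegrE ?(ltW M0)// hM.
by rewrite lerDr ltW.
Qed.

(** The summable terms [(nu m)^-1] tend to 0, so that all but finitely many [lam m] are at least 1;
    the remaining ones are finitely many positive numbers. *)
Lemma lam_bounds : exists2 l0 : R, 0 < l0 & forall m, l0 <= lam m.
Proof.
have [sig s0 hs] := exists_sig.
have /cvg_series_cvg_0 := nu_summable rvd (@con_cst _ _ _ _) rv_left rv_right
   (fun r h => (hs r h).1) s0.
have h1 : 0 < (1 + sig)^-1 by rewrite invr_gt0 ltr_wpDr.
move=> /cvgrPdist_lt /(_ _ h1) [N _ hN].
have big m : (N <= m)%N -> 1 <= lam m.
  move=> /hN; rewrite /= sub0r normrN gtr0_norm ?invr_gt0 ?nu_gt0//.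
  move=> h; have h2 : 1 + sig < nu sig m.
    by move: h; rewrite ltf_pV2// posrE ?nu_gt0// ltr_wpDr.
  move: h2; rewrite /nu ltrD2r => h2; have [//|h3] := leP 1 (lam m).
  by have := lamp m; nra.
have : exists2 l0 : R, 0 < l0 & forall m, (m < N)%N -> l0 <= lam m.
  elim: (N) => [|M [l l0 hl]]; first by exists 1.
  exists (Num.min l (lam M)); first by rewrite lt_min l0 lamp.
  move=> m; rewrite ltnS leq_eqVlt => /predU1P[->|/hl h]; rewrite ge_min ?lexx ?orbT//.
  by rewrite h.
move=> [l l0 hl]; exists (Num.min l 1); first by rewrite lt_min l0 ltr01.
move=> m; rewrite ge_min; have [/hl ->//|/big ->] := ltnP m N.
by rewrite orbT.
Qed.

Lemma lam_summable : cvgn (series (fun m => (lam m ^+ 2)^-1)).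
Proof.
have [sig s0 hs] := exists_sig; have [l l0 hl] := lam_bounds.
have := nu_summable rvd (@con_cst _ _ _ _) rv_left rv_right (fun r h => (hs r h).1) s0.
(* The factor bounds [nu sig m / lam m ^+ 2], because [lam m >= l]. *)
move=> /(@cvg_seriesZ _ _ (1 + sig / l ^+ 2)); apply: dom_cvg => m.
have lm : 0 < lam m ^+ 2 by rewrite exprn_gt0.
rewrite gtr0_norm ?invr_gt0// ler_pdivlMr ?nu_gt0// mulrC ler_pdivrMr// /nu.
rewrite mulrDl mul1r lerD2l -mulrA ler_peMr// ler_pdivlMl ?exprn_gt0// mulr1.
by rewrite lerXn2r ?hl// nnegrE ltW// ?lamp.
Qed.

(** Energy of the oscillation. The first order term of the equation makes it decrease in [r], while
    [r ^+ (2 * d)] times it increases; its values at different points are therefore comparable, and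
    its mean bounds them all. *)
Definition een m r := deg m r ^+ 2 + lam m ^+ 2 * eigf m r ^+ 2.

Lemma een_ge0 m r : 0 <= een m r.
Proof. by rewrite addr_ge0 ?sqr_ge0// mulr_ge0 ?sqr_ge0. Qed.

Lemma een_der m r : 0 < r -> der (een m) r (- (2 * d%:R / r) * deg m r ^+ 2).
Proof.
move=> r0; apply: der_eq.
  apply: derD; first exact: (derX 2 (deg_der m r0)).
  by apply: derZ; exact: (derX 2 (eg_der m r0)).
by rewrite /= !expr1; field; rewrite gt_eqF.
Qed.

Lemma een_nincr m r s : 0 < r -> r <= s -> een m s <= een m r.
Proof.
move=> r0 rs'; rewrite -lerN2.
apply: (@der_ge0_le _ (fun x => - een m x) (fun x => - (- (2 * d%:R / x) * deg m x ^+ 2)) r s rs').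
  by move=> x /andP[rx _]; apply: derN; apply: een_der; exact: lt_le_trans rx.
move=> x /andP[rx _]; rewrite mulNr opprK mulr_ge0 ?sqr_ge0// divr_ge0 ?mulr_ge0//.
by rewrite ltW// (lt_le_trans r0).
Qed.

Lemma een_ndecr m r s : 0 < r -> r <= s -> r ^+ (2 * d) * een m r <= s ^+ (2 * d) * een m s.
Proof.
move=> r0 rs'.
pose g x := (2 * d)%:R * x ^+ (2 * d).-1 * een m x + x ^+ (2 * d) * (- (2 * d%:R / x) * deg m x ^+ 2).
apply: (@der_ge0_le _ (fun x => x ^+ (2 * d) * een m x) g r s rs').
  move=> x /andP[rx _]; have x0 : 0 < x by exact: lt_le_trans rx.
  apply: der_eq; first by apply: derM; [exact: (derX (2 * d) (der_id x))|exact: een_der].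
  by rewrite /= mulr1.
move=> x /andP[rx _]; have x0 : 0 < x by exact: lt_le_trans rx.
have -> : g x = (2 * d)%:R * x ^+ (2 * d).-1 * (lam m ^+ 2 * eigf m x ^+ 2).
  rewrite /g /een; case: (d) => [|d']; first by rewrite !mul0r mulr0 !mul0r oppr0 mul0r mulr0 addr0.
  have -> : x ^+ (2 * d'.+1) = x * x ^+ (2 * d'.+1).-1 by rewrite -exprS.
  by rewrite [X in X * _ * (_ + _)]natrM [X in _ = X * _ * _]natrM; field; rewrite gt_eqF.
apply: mulr_ge0; last by apply: mulr_ge0; exact: sqr_ge0.
by apply: mulr_ge0; [exact: ler0n|exact/exprn_ge0/ltW].
Qed.

(* The [eigf m] extend with the same bounds to the left of [R1], so that
   every derivative at the ends of the interval is two-sided. *)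
Lemma eg_bounds : exists2 C : R, 0 < C & forall m r, R1 / 2 <= r ->
  `|eigf m r| <= C /\ `|deg m r| <= C * lam m.
Proof.
have [sig s0 hs] := exists_sig; have [l l0 hl] := lam_bounds.
have p0 : 0 < R1 ^+ d by rewrite exprn_gt0.
have L0 : 0 < R2 - R1 by rewrite subr_gt0.
(* [q] bounds the ratio of the energies at [R1] and elsewhere in the interval. In [K],
   [2 ^+ (2 * d)] allows for the growth from [R1] down to [R1 / 2], and the last factor comes from
   the bound on the integral of the energy by [lam m ^+ 2]. *)
pose q : R := (R2 / R1) ^+ (2 * d).
have q0 : 0 < q by rewrite exprn_gt0// divr_gt0// (lt_trans R1p).
pose K := 2 ^+ (2 * d) * (q / (R2 - R1) / R1 ^+ d * (3 * (1 + 2 * sig / l ^+ 2))).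
have K0 : 0 < K.
  have h1 : 0 <= 2 * sig / l ^+ 2.
    by apply: divr_ge0; [exact: mulr_ge0|exact: sqr_ge0].
  by rewrite mulr_gt0 ?exprn_gt0// mulr_gt0 ?divr_gt0// mulr_gt0// ltr_wpDr.
have hE m r : R1 / 2 <= r -> een m r <= K * lam m ^+ 2.
  move=> r1; have r0 : 0 < r by rewrite (lt_le_trans _ r1)// divr_gt0.
  have e1 : een m r <= 2 ^+ (2 * d) * een m R1.
    have [h|/ltW h] := leP r R1.
      have := een_ndecr m r0 h.
      have : (R1 / 2) ^+ (2 * d) * een m r <= r ^+ (2 * d) * een m r.
        by rewrite ler_wpM2r ?een_ge0// lerXn2r ?nnegrE// ?ltW// divr_gt0.
      move=> a b; have := le_trans a b.
      rewrite exprMn exprVn mulrAC ler_pdivrMr ?exprn_gt0// -mulrA ler_pM2l ?exprn_gt0//.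
      by rewrite mulrC.
    rewrite (le_trans (een_nincr m R1p h))// ler_peMl ?een_ge0//.
    by rewrite exprn_ege1// ler1n.
  rewrite (le_trans e1)// /K -[in leRHS]mulrA ler_wpM2l ?exprn_ge0//.
  have e2 s : R1 <= s <= R2 -> een m R1 <= q * een m s.
    move=> /andP[s1 s2]; have := een_ndecr m R1p s1.
    rewrite mulrC -ler_pdivlMr ?exprn_gt0// => /le_trans; apply.
    rewrite mulrAC ler_wpM2r ?een_ge0// /q exprMn exprVn ler_wpM2r ?invr_ge0 ?exprn_ge0 ?(ltW R1p)//.
    by rewrite lerXn2r ?nnegrE ?(le_trans (ltW R1p))//.
  have cde := @eg_con m; have cdd := @deg_con m.
  (* The energy form at an eigenfunction is [lam m ^+ 2 + sig]; passing from [deg - rv eg] back to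
     [deg] costs a factor 2 and the bound [rv ^+ 2 <= sig]. *)
  have e3 : intR R1 R2 (fun r => r ^+ d * een m r) <= 3 * (1 + 2 * sig / l ^+ 2) * lam m ^+ 2.
    have Ce := robin_C1 (eg_robin m).
    have := qform_ge rvd (@con_cst _ _ _ _) (fun r h => (hs r h).1) Ce.
    rewrite (qform_robin sig rvd (@con_cst _ _ _ _) rv_left rv_right Ce (eg_robin m)).
    rewrite ipZr; try by con_auto.
    rewrite eg_orth eqxx !mulr1.
    set I := (X in X <= _) => hI.
    have hs1 : intR R1 R2 (fun r => r ^+ d * (eigf m r * eigf m r)) = 1 by rewrite -/(wip _ _) eg_orth eqxx.
    have lm2 : l ^+ 2 <= lam m ^+ 2 by rewrite lerXn2r ?nnegrE ?(ltW l0)// ltW.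
    have : intR R1 R2 (fun r => r ^+ d * een m r) <= 2 * I + (2 * sig + lam m ^+ 2) * 1.
      rewrite -[in leRHS]hs1 /I -intZ; last by con_auto.
      rewrite -intZ; last by con_auto.
      rewrite -intD; [|by con_auto|by con_auto].
      apply: le_int; [by rewrite /een; con_auto|by con_auto|] => s h.
      have [_ hv] := hs s h; have ps : 0 <= s ^+ d by rewrite exprn_ge0// ltW// rp.
      rewrite ![_ * (s ^+ d * _)]mulrCA -mulrDr ler_wpM2l// /een.
      have := sqr_ge0 (deg m s - 2 * (rv s * eigf m s)).
      have : rv s ^+ 2 * eigf m s ^+ 2 <= sig * eigf m s ^+ 2 by rewrite ler_wpM2r ?sqr_ge0.
      by have := sqr_ge0 (eigf m s); nra.
    move=> /le_trans; apply; rewrite mulr1.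
    have : 2 * sig <= 2 * sig / l ^+ 2 * lam m ^+ 2.
      rewrite -[X in _ <= X]mulrA ler_peMr ?mulr_ge0// ler_pdivlMl ?exprn_gt0// mulr1 //.
    lra.
  have e4 : een m R1 * (R2 - R1) <= q / R1 ^+ d * (3 * (1 + 2 * sig / l ^+ 2) * lam m ^+ 2).
    have qp : 0 <= q / R1 ^+ d by rewrite divr_ge0// ltW.
    rewrite -int_cst// (le_trans _ (ler_wpM2l qp e3))// -intZ; last by rewrite /een; con_auto.
    apply: le_int; [by con_auto|by rewrite /een; con_auto|] => s h.
    rewrite (le_trans (e2 s h))// -mulrA ler_wpM2l ?(ltW q0)// ler_pdivlMl// ler_wpM2r ?een_ge0//.
    by rewrite lerXn2r ?nnegrE ?(ltW R1p) ?(ltW (rp h))//; case/andP: h.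
  rewrite -(ler_pM2r L0) (le_trans e4)// le_eqVlt; apply/orP; left; apply/eqP.
  by field; rewrite !gt_eqF.
exists (Num.sqrt K); first by rewrite sqrtr_gt0.
move=> m r r1; have h := hE m r r1; have lm := lamp m.
split.
  rewrite -sqrtr_sqr ler_wsqrtr// -(ler_pM2l (x := lam m ^+ 2)) ?exprn_gt0//.
  by rewrite [X in _ <= X]mulrC (le_trans _ h)// /een lerDr sqr_ge0.
have -> : Num.sqrt K * lam m = Num.sqrt (K * lam m ^+ 2).
  by rewrite (sqrtrM _ (ltW K0)) sqrtr_sqr ger0_norm// ltW.
by rewrite -sqrtr_sqr ler_wsqrtr// (le_trans _ h)// /een lerDl mulr_ge0 ?sqr_ge0.
Qed.

(** By Green's identity, [lam m ^+ 2] times the coefficient of [f] is the coefficient [x] of [g],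
    and [|x| <= nu x^2 + nu^-1]. Both terms are summable: the first by Bessel's inequality for the
    energy of [g], the second by [nu_summable]. *)
Lemma coef_summable f f' g g' : robin f f' g -> C1f g g' ->
  cvgn (series (fun m => `|wip f (eigf m)| * lam m ^+ 2)).
Proof.
move=> rf Cg; have [sig s0 hs] := exists_sig.
have cg := C1f_con Cg; have cf := C1f_con (robin_C1 rf).
have be N := bessel_energy rvd (@con_cst _ _ _ _) rv_left rv_right (fun r h => (hs r h).1) N Cg.
have e m : wip f (eigf m) * lam m ^+ 2 = wip g (eigf m).
  have := green_identity rf (eg_robin m); rewrite ipZr => [->||//]; [ring|by con_auto].
have ns := nu_summable rvd (@con_cst _ _ _ _) rv_left rv_right (fun r h => (hs r h).1) s0.
have cs : cvgn (series (fun m => nu sig m * wip g (eigf m) ^+ 2)).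
  apply: (cvg_bounded_series _ be) => m.
  by rewrite mulr_ge0 ?sqr_ge0// ltW// nu_gt0.
apply: (@dom_cvg _ _ (fun m => nu sig m * wip g (eigf m) ^+ 2 + (nu sig m)^-1)).
  move=> m; rewrite normrM normr_id [`|lam m ^+ 2|]ger0_norm ?sqr_ge0//.
  have -> : `|wip f (eigf m)| * lam m ^+ 2 = `|wip g (eigf m)|.
    by rewrite -e normrM [`|lam m ^+ 2|]ger0_norm ?sqr_ge0.
  have n0 := nu_gt0 m s0; rewrite -[wip g (eigf m) ^+ 2]ger0_norm ?sqr_ge0// normrX.
  move: (`|_|) (nu sig m) n0 => x y y0.
  rewrite -(ler_pM2r y0) mulrDl mulVf ?gt_eqF//.
  by have := sqr_ge0 (y * x - 1); have := mulr_ge0 (ltW y0) (ltW y0); nra.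
exact: (is_cvg_seriesD cs ns).
Qed.

End sturm_liouville.

(** * Completeness of the eigenfunctions *)

Section completeness.
Context {R : realType}.
Variables (d : nat) (R1 R2 k1 k2 : R) (lam : nat -> R) (Phi dPhi : R -> R -> R).
Hypothesis rs : radial_system d R1 R2 k1 k2 lam Phi dPhi.
Implicit Types (f g h w z : R -> R) (r s l : R) (m k N : nat).

Local Notation ip := (wip d R1 R2).
Local Notation eg := (eigf d R1 R2 lam Phi).
Local Notation deg := (deg d R1 R2 lam Phi dPhi).
Local Notation robin := (robin d R1 R2 k1 k2).
Local Notation C1f := (C1f R1 R2).

Let R1p : 0 < R1 := rs_R1 rs.
Let R12 : R1 < R2 := rs_R12 rs.
Let R12' : R1 <= R2 := ltW R12.
Let lamp m : 0 < lam m := rs_pos rs m.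
Let I1 : R1 <= R1 <= R2. Proof. by rewrite lexx R12'. Qed.
Let I2 : R1 <= R2 <= R2. Proof. by rewrite lexx R12'. Qed.
Let rp r : R1 <= r <= R2 -> 0 < r.
Proof. by move=> /andP[h _]; exact: lt_le_trans h. Qed.
Let rn r : R1 <= r <= R2 -> r != 0.
Proof. by move=> h; rewrite gt_eqF ?rp. Qed.
Hint Resolve con_id con_cst : conb.
Let cinv : con R1 R2 (fun r => r^-1) := con_inv rs.
Hint Resolve cinv : conb.
Let ceg m : con R1 R2 (eg m) := @eg_con _ _ _ _ _ _ _ _ _ rs m.
Let cdeg m : con R1 R2 (deg m) := @deg_con _ _ _ _ _ _ _ _ _ rs m.
Hint Resolve ceg cdeg : conb.

Variable j : nat.
Hypothesis ej : forall r, R1 <= r <= R2 -> eg j r != 0.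

(* With [v = e'/e] for the nonvanishing eigenfunction [e], the potential
   [v^2 + v' + (d/r) v] is the constant [- lam j ^+ 2] (Picone). *)
Lemma picone w w' g : robin w w' g -> lam j ^+ 2 * ip w w <= ip w g.
Proof.
move=> rw; have Cw := robin_C1 rw; have cw := C1f_con Cw; have [_ cw'] := Cw.
pose v r := deg j r / eg j r.
pose v' r := - (d%:R / r) * v r - lam j ^+ 2 - v r ^+ 2.
have vd r : R1 <= r <= R2 -> der v r (v' r).
  move=> hr; have e0 := ej hr; apply: der_eq.
    by apply: (der_div e0); [exact: (deg_der rs j (rp hr))|exact: (eg_der rs j (rp hr))].
  by rewrite /v' /v; field; rewrite e0 rn.
have cv := con_der vd.
have cv' : con R1 R2 v' by rewrite /v'; con_auto.
have [_ _ _ e1 e2] := eg_robin rs j.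
have v1 : v R1 = k1 by rewrite /v e1 mulfK// ej.
have v2 : v R2 = - k2 by rewrite /v e2 mulfK// ej.
have := energy rs vd cv' v1 v2 Cw rw.
have -> : ip (fun r => (v r ^+ 2 + v' r + d%:R / r * v r) * w r) w = - lam j ^+ 2 * ip w w.
  rewrite -ipZl//; apply: eq_int => r _; rewrite /v'; ring.
have : 0 <= intR R1 R2 (fun r => r ^+ d * ((w' r - v r * w r) * (w' r - v r * w r))).
  by apply: int_ge0 => r hr; rewrite mulr_ge0 ?exprn_ge0 ?(ltW (rp hr))// -expr2 sqr_ge0.
move=> h1 h2; move: h1; rewrite h2; lra.
Qed.

Lemma Phi_robin_left l r : 0 < l -> R1 <= r <= R2 ->
  der (Phi l) r (dPhi l r) /\ der (dPhi l) r (- (d%:R / r) * dPhi l r - l ^+ 2 * Phi l r).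
Proof.
by move=> l0 hr; split; [apply: (rs_der rs l0)|apply: (rs_der2 rs l0)]; exact: rp.
Qed.

(** Half the ground frequency. By [picone], [l0 ^+ 2] lies strictly below all [lam m ^+ 2] and the
    resolvent there is positive, while [l0 > 0] keeps the solutions [Phi l0] available. *)
Let l0 := lam j / 2.
Let l0p : 0 < l0. Proof. by rewrite divr_gt0. Qed.

Lemma not_eigen l : 0 < l -> l < lam j -> dPhi l R2 + k2 * Phi l R2 != 0.
Proof.
move=> lp ll; apply/negP; rewrite addr_eq0 -mulNr => /eqP /(rs_root rs lp) [m lm].
have := picone (eg_robin rs m); rewrite ipZr// (eg_orth rs) eqxx !mulr1.
rewrite lm leNgt ltrXn2r ?nnegrE ?(ltW lp)// ?ltW// ll//.
Qed.

Lemma lam_neq m : lam m ^+ 2 - l0 ^+ 2 != 0.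
Proof.
have := picone (eg_robin rs m); rewrite ipZr// (eg_orth rs) eqxx !mulr1 => h.
rewrite gt_eqF// subr_gt0 (lt_le_trans _ h)// ltrXn2r ?nnegrE ?(ltW l0p)// ?ltW//.
by rewrite /l0 ltr_pdivrMr// ltr_pMr// ltr1n.
Qed.

(* Variation of parameters between the solutions satisfying the left and the
   right Robin condition. *)
Lemma green_operator f : con R1 R2 f ->
  exists w w', robin w w' (fun r => l0 ^+ 2 * w r + f r).
Proof.
move=> cf; have [Th [dTh hTh]] := rs_second rs l0p.
(* [a] and [- c] are the defects of [Th] and [Phi l0] in the Robin condition at [R2], so that the
   combination [X] satisfies it; [c], its Wronskian with [Phi l0], is nonzero because [l0] is not an
   eigenfrequency. *)
pose a := dTh R2 + k2 * Th R2; pose c := - (dPhi l0 R2 + k2 * Phi l0 R2).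
have c0 : c != 0.
  rewrite oppr_eq0 not_eigen// /l0 ltr_pdivrMr// ltr_pMr// ltr1n//.
pose X r := a * Phi l0 r + c * Th r; pose X' r := a * dPhi l0 r + c * dTh r.
have dX r : R1 <= r <= R2 -> der X r (X' r).
  move=> hr; have [h1 _ _] := hTh r (rp hr); have [p1 _] := Phi_robin_left l0p hr.
  by apply: derD; apply: derZ.
have dX' r : R1 <= r <= R2 -> der X' r (- (d%:R / r) * X' r - l0 ^+ 2 * X r).
  move=> hr; have [_ h1 _] := hTh r (rp hr); have [_ p1] := Phi_robin_left l0p hr.
  apply: der_eq; first by apply: derD; apply: derZ; [exact: p1|exact: h1].
  by rewrite /X /X'; ring.
have WX r : R1 <= r <= R2 -> r ^+ d * (Phi l0 r * X' r - dPhi l0 r * X r) = c.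
  move=> hr; have [_ _ h1] := hTh r (rp hr); rewrite -[RHS]mulr1 -h1 /X /X'; ring.
have X2 : X' R2 = - k2 * X R2 by rewrite /X /X' /a /c; ring.
have cP := Phi_con rs l0p; have cX := con_der dX.
have cpf : con R1 R2 (fun r => r ^+ d * (f r * Phi l0 r)) by con_auto.
have cxf : con R1 R2 (fun r => r ^+ d * (f r * X r)) by con_auto.
have [A [A1 dA]] := primitive R12' cpf; have [B [B1 dB]] := primitive R12' cxf.
pose w r := - c^-1 * (X r * A r + Phi l0 r * (B R2 - B r)).
pose w' r := - c^-1 * (X' r * A r + dPhi l0 r * (B R2 - B r)).
have dw r : R1 <= r <= R2 -> der w r (w' r).
  move=> hr; have [p1 _] := Phi_robin_left l0p hr; apply: der_eq.
    apply: derZ; apply: derD; apply: derM; [exact: dX|exact: dA|exact: p1|].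
    by apply: derB; [exact: der_cst|exact: dB].
  by rewrite /w' /=; ring.
have cw := con_der dw.
exists w, w'; split; first exact: dw.
- move=> r hr; have [_ p1] := Phi_robin_left l0p hr; apply: der_eq.
    apply: derZ; apply: derD; apply: derM; [exact: dX'|exact: dA|exact: p1|].
    by apply: derB; [exact: der_cst|exact: dB].
  rewrite /= /w /w'; have W := WX r hr.
  transitivity (- (d%:R / r) * (- c^-1 * (X' r * A r + dPhi l0 r * (B R2 - B r)))
    - l0 ^+ 2 * (- c^-1 * (X r * A r + Phi l0 r * (B R2 - B r)))
    - c^-1 * (r ^+ d * (Phi l0 r * X' r - dPhi l0 r * X r)) * f r); first by ring.
  by rewrite W mulVf//; ring.
- by con_auto.
- by rewrite /w /w' A1 (rs_left rs l0p); ring.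
- by rewrite /w /w' subrr X2; ring.
Qed.

Definition orthX f := con R1 R2 f /\ forall m, ip f (eg m) = 0.

(** The graph of the resolvent at [l0 ^+ 2]: datum [f], solution [w]. *)
Definition KR f w := exists w', robin w w' (fun r => l0 ^+ 2 * w r + f r).

Lemma KR_con f w : KR f w -> con R1 R2 w.
Proof. by move=> [w' rw]; exact: C1f_con (robin_C1 rw). Qed.

Lemma KR_sym f w g z : con R1 R2 f -> con R1 R2 g -> KR f w -> KR g z -> ip f z = ip w g.
Proof.
move=> cf cg kf kg; have cw := KR_con kf; have cz := KR_con kg.
have [w' rw] := kf; have [z' rz] := kg.
have := green_identity rs rw rz.
rewrite ipDl; [|by con_auto..]. rewrite ipDr; [|by con_auto..].
by rewrite ipZl// ipZr// => /addrI.
Qed.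

Lemma KR_orth f w : orthX f -> KR f w -> orthX w.
Proof.
move=> [cf fo] kf; have cw := KR_con kf; split => // m; have [w' rw] := kf.
have := green_identity rs rw (eg_robin rs m).
rewrite ipDl; [|by con_auto..].
rewrite ipZl// ipZr// fo addr0 => /eqP.
rewrite eq_sym -subr_eq0 -mulrBl mulf_eq0 (negbTE (lam_neq m)) /=.
by move/eqP.
Qed.

Lemma KR_comb t f w g z : con R1 R2 f -> con R1 R2 g -> KR f w -> KR g z ->
  KR (fun r => f r + t * g r) (fun r => w r + t * z r).
Proof.
move=> cf cg kf kg; have cw := KR_con kf; have cz := KR_con kg.
have [w' [a1 a2 a3 a4 a5]] := kf; have [z' [b1 b2 b3 b4 b5]] := kg.
exists (fun r => w' r + t * z' r); split.
- by move=> r hr; apply: derD; [exact: a1|apply: derZ; exact: b1].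
- move=> r hr; apply: der_eq.
    by apply: derD; [exact: a2|apply: derZ; exact: b2].
  by ring.
- by con_auto.
- by rewrite a4 b4; ring.
- by rewrite a5 b5; ring.
Qed.

Let dl := lam j ^+ 2 - l0 ^+ 2.
Let dlp : 0 < dl.
Proof.
rewrite /dl /l0 expr_div_n; have := exprn_gt0 2 (lamp j); lra.
Qed.

Lemma KR_coercive f w : con R1 R2 f -> KR f w -> dl * ip w w <= ip w f.
Proof.
move=> cf kf; have cw := KR_con kf; have [w' rw] := kf.
have := picone rw; rewrite ipDr; [|by con_auto..].
by rewrite ipZr// /dl; lra.
Qed.

(** Coercivity and Cauchy-Schwarz: the resolvent is bounded by the inverse of the spectral gap
    [dl]. *)
Lemma KR_bounded f w : con R1 R2 f -> KR f w -> ip w f <= ip f f / dl.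
Proof.
move=> cf kf; have cw := KR_con kf; have h1 := KR_coercive cf kf.
have h2 := ip_CS rs cw cf; have w0 := ip_ge0 rs w; have f0 := ip_ge0 rs f.
rewrite ler_pdivlMr//; have [//|a0] := ltP (ip w f) 0.
  by move=> h; rewrite (le_trans _ f0)// ltW// nmulr_rlt0.
have [->|an] := eqVneq (ip w f) 0; first by rewrite mul0r.
have ap : 0 < ip w f by rewrite lt_neqAle eq_sym an.
rewrite -(ler_pM2l ap) mulrA -expr2.
have := ler_wpM2r (ltW dlp) h2; have := ler_wpM2r f0 h1; lra.
Qed.

(** Cauchy-Schwarz for the form that pairs the resolvent of one datum with another datum; it is
    symmetric by [KR_sym] and positive by [KR_coercive]. *)
Lemma KR_CS f w g z : con R1 R2 f -> con R1 R2 g -> KR f w -> KR g z ->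
  ip w g ^+ 2 <= ip w f * ip z g.
Proof.
move=> cf cg kf kg; have cw := KR_con kf; have cz := KR_con kg.
have pos f' w' : con R1 R2 f' -> KR f' w' -> 0 <= ip w' f'.
  move=> cf' k; rewrite (le_trans _ (KR_coercive cf' k))// mulr_ge0 ?(ltW dlp)//.
  exact: (ip_ge0 rs).
apply: quad_CS; first exact: pos.
move=> t; have cft : con R1 R2 (fun r => f r + t * g r) by con_auto.
have := pos _ _ cft (KR_comb t cf cg kf kg).
rewrite ipDl; [|by con_auto..]. rewrite !ipDr; try by con_auto.
rewrite !ipZl; try by con_auto. rewrite !ipZr; try by con_auto.
have := KR_sym cg cf kg kf; rewrite [ip g w](ipC d R1 R2) => e.
by rewrite -e; congr (_ <= _); ring.
Qed.

(** Cauchy-Schwarz on the part of the interval to the left of [r]: [F + 2 A t + G t^2] is the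
    primitive of [r^d (f + t g)^2]. *)
Lemma prim_CS f g A : con R1 R2 f -> con R1 R2 g -> A R1 = 0 ->
  (forall r, R1 <= r <= R2 -> der A r (r ^+ d * (f r * g r))) ->
  forall r, R1 <= r <= R2 -> A r ^+ 2 <= ip f f * ip g g.
Proof.
move=> cf cg A1 dA r hr; have /andP[r1 r2] := hr.
have cff : con R1 R2 (fun r => r ^+ d * (f r * f r)) by con_auto.
have cgg : con R1 R2 (fun r => r ^+ d * (g r * g r)) by con_auto.
have [F [F1 dF]] := primitive R12' cff; have [G [G1 dG]] := primitive R12' cgg.
have sub (x y z : R) : R1 <= x -> z <= R2 -> x <= y <= z -> R1 <= y <= R2.
  by move=> a b /andP[c e]; rewrite (le_trans a c) (le_trans e b).
have pos x : R1 <= x <= R2 -> 0 <= x ^+ d by move=> hx; rewrite exprn_ge0// ltW// rp.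
have FG t s : R1 <= s <= R2 -> 0 <= F s + 2 * A s * t + G s * t ^+ 2.
  move=> /andP[s1 s2]; pose Q x := F x + 2 * A x * t + G x * t ^+ 2.
  have <- : Q R1 = 0 by rewrite /Q F1 A1 G1; ring.
  apply: (@der_ge0_le _ Q (fun x => x ^+ d * (f x + t * g x) ^+ 2) _ _ s1) => x.
    move=> /(sub _ _ _ (lexx R1) s2) hx; apply: der_eq.
      apply: derD; first apply: derD; first exact: dF.
        by apply: derM; [apply: derZ; exact: dA|exact: der_cst].
      by apply: derM; [exact: dG|exact: der_cst].
    by rewrite /=; ring.
  by move=> /(sub _ _ _ (lexx R1) s2) hx; rewrite mulr_ge0 ?sqr_ge0 ?pos.
have mono (H h : R -> R) : (forall x, R1 <= x <= R2 -> der H x (x ^+ d * (h x * h x))) ->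
    forall x y, R1 <= x -> x <= y -> y <= R2 -> H x <= H y.
  move=> dH x y x1 xy y2; apply: (@der_ge0_le _ H _ _ _ xy) => z /(sub _ _ _ x1 y2) hz.
    exact: dH.
  by rewrite mulr_ge0 ?pos// -expr2 sqr_ge0.
have F0 : 0 <= F r by rewrite -F1; apply: (mono _ _ dF).
have G0 : 0 <= G r by rewrite -G1; apply: (mono _ _ dG).
rewrite (le_trans (quad_CS G0 (fun t => FG t r hr)))//.
have -> : ip f f = F R2 by exact: (@int_primitive _ R1 R2 _ F cff F1 dF R2 I2).
have -> : ip g g = G R2 by exact: (@int_primitive _ R1 R2 _ G cgg G1 dG R2 I2).
by apply: ler_pM => //; [apply: (mono _ _ dF)|apply: (mono _ _ dG)].
Qed.

(* [w] is recovered from [h] through its Wronskians with the two solutions of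
   the homogeneous equation. *)
Lemma apriori l : 0 < l -> exists2 C : R, 0 < C & forall w w' h, con R1 R2 h -> orthX w ->
  robin w w' (fun r => l ^+ 2 * w r + h r) -> ip w w <= C * ip h h.
Proof.
move=> lp; have [Th [dTh hTh]] := rs_second rs lp.
have cP := Phi_con rs lp.
have cT : con R1 R2 Th.
  by apply: (con_der (f' := dTh)) => r hr; have [] := hTh r (rp hr).
have [M1 [M10 hM1]] := con_bounded R12' cP; have [M2 [M20 hM2]] := con_bounded R12' cT.
pose a := ip (Phi l) (Phi l); pose b := ip Th Th.
have a0 : 0 <= a by exact: (ip_ge0 rs).
have b0 : 0 <= b by exact: (ip_ge0 rs).
pose P := intR R1 R2 (fun r => r ^+ d).
have P0 : 0 <= P by apply: int_ge0 => r hr; rewrite exprn_ge0// ltW// rp.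
have cp : con R1 R2 (fun r => r ^+ d) by con_auto.
pose beta := dPhi l R2 + k2 * Phi l R2; pose tau := dTh R2 + k2 * Th R2.
pose Cu := 2 * (M1 ^+ 2 * b + M2 ^+ 2 * a).
have Cu0 : 0 <= Cu by rewrite mulr_ge0// addr_ge0// mulr_ge0// sqr_ge0.
pose Cc := 2 * (b + (tau / beta) ^+ 2 * a).
have Cc0 : 0 <= Cc by rewrite mulr_ge0// addr_ge0// mulr_ge0// sqr_ge0.
pose C := (2 * (M1 ^+ 2 * Cc) + 2 * Cu) * P + 1.
exists C.
  apply: ltr_wpDl => //; apply: mulr_ge0 => //; apply: addr_ge0; last exact: mulr_ge0.
  by apply: mulr_ge0 => //; apply: mulr_ge0 => //; exact: sqr_ge0.
move=> w w' h ch [cw wo] rw; have [_ cw'] := robin_C1 rw.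
have [dw dw' _ w1 w2] := rw.
have H0 := ip_ge0 rs h.
have cph : con R1 R2 (fun r => r ^+ d * (h r * Phi l r)) by con_auto.
have cth : con R1 R2 (fun r => r ^+ d * (h r * Th r)) by con_auto.
have [A [A1 dA]] := primitive R12' cph; have [B [B1 dB]] := primitive R12' cth.
pose Z1 r := r ^+ d * (w' r * Phi l r - w r * dPhi l r).
pose Z2 r := r ^+ d * (w' r * Th r - w r * dTh r).
have ZA r : R1 <= r <= R2 -> Z1 r + A r = 0.
  move=> /andP[r1 r2]; have <- : Z1 R1 + A R1 = 0.
    by rewrite /Z1 A1 w1 (rs_left rs lp); ring.
  apply/esym; apply: (@der_0_cst _ (fun r => Z1 r + A r)) => // x /andP[x1 x2].
  have hx : R1 <= x <= R2 by rewrite x1 (le_trans x2).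
  have [p1 p2] := Phi_robin_left lp hx; apply: der_eq.
    apply: derD; last exact: dA.
    apply: derM; first exact: (pd_der rs).
    by apply: derB; apply: derM; [exact: dw'|exact: p1|exact: dw|exact: p2].
  by rewrite /=; ring.
have ZB r : R1 <= r <= R2 -> Z2 r + B r = Z2 R1.
  move=> /andP[r1 r2]; rewrite -[RHS]addr0 -B1.
  apply/esym; apply: (@der_0_cst _ (fun r => Z2 r + B r)) => // x /andP[x1 x2].
  have hx : R1 <= x <= R2 by rewrite x1 (le_trans x2).
  have [p1 p2 _] := hTh x (rp hx); apply: der_eq.
    apply: derD; last exact: dB.
    apply: derM; first exact: (pd_der rs).
    by apply: derB; apply: derM; [exact: dw'|exact: p1|exact: dw|exact: p2].
  by rewrite /=; ring.
pose c0 := Z2 R1; pose u r := Phi l r * B r - Th r * A r.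
have cA := con_der dA; have cB := con_der dB.
have cu : con R1 R2 u by rewrite /u; con_auto.
(* Cramer's rule: [w] is a combination of [Th] and [Phi l] whose coefficients are its Wronskians
   with them. *)
have wE r : R1 <= r <= R2 -> w r = - c0 * Phi l r + u r.
  move=> hr; have [_ _ W] := hTh r (rp hr).
  rewrite -[LHS]mulr1 -W.
  transitivity (Th r * (Z1 r + A r) - Phi l r * (Z2 r + B r) + u r).
    by rewrite /u /Z1 /Z2; ring.
  by rewrite ZA// ZB// /c0; ring.
have hA r : R1 <= r <= R2 -> A r ^+ 2 <= a * ip h h.
  by move=> hr; rewrite mulrC; apply: prim_CS hr.
have hB r : R1 <= r <= R2 -> B r ^+ 2 <= b * ip h h.
  by move=> hr; rewrite mulrC; apply: prim_CS hr.
have sqb x M : `|x| <= M -> x ^+ 2 <= M ^+ 2 :> R.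
  by move=> xM; rewrite -[x ^+ 2]ger0_norm ?sqr_ge0// normrX lerXn2r ?nnegrE// (le_trans _ xM).
have hu r : R1 <= r <= R2 -> u r ^+ 2 <= Cu * ip h h.
  move=> hr; have s1 := sqb _ _ (hM1 r hr); have s2 := sqb _ _ (hM2 r hr).
  have e1 : (Phi l r * B r) ^+ 2 <= M1 ^+ 2 * (b * ip h h).
    by rewrite exprMn; apply: ler_pM; rewrite ?sqr_ge0// hB.
  have e2 : (Th r * A r) ^+ 2 <= M2 ^+ 2 * (a * ip h h).
    by rewrite exprMn; apply: ler_pM; rewrite ?sqr_ge0// hA.
  have e3 := sqr_ge0 (Phi l r * B r + Th r * A r).
  have -> : u r ^+ 2 = 2 * (Phi l r * B r) ^+ 2 + 2 * (Th r * A r) ^+ 2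
      - (Phi l r * B r + Th r * A r) ^+ 2 by rewrite /u; ring.
  by rewrite /Cu mulrAC -mulrA mulrDr; move: e1 e2 e3; lra.
have ipb f K : con R1 R2 f -> (forall r, R1 <= r <= R2 -> f r ^+ 2 <= K) -> ip f f <= K * P.
  move=> cf fK; rewrite /P -intZ//; apply: le_int; [by con_auto|by con_auto|] => r hr.
  by rewrite mulrC -expr2 ler_wpM2r ?fK// exprn_ge0// ltW// rp.
have ipu := ipb _ _ cu hu.
have H1 : 2 * (M1 ^+ 2 * Cc) * P * ip h h >= 0.
  by apply: mulr_ge0 => //; apply: mulr_ge0 => //; do 2!apply: mulr_ge0 => //; exact: sqr_ge0.
have H2 : 0 <= Cu * P * ip h h by apply: mulr_ge0 => //; apply: mulr_ge0.
(* If the defect [beta] at [R2] vanishes, [l] is an eigenfrequency. The equation then leaves the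
   component of [w] along [Phi l] free, but orthogonality to the eigenfunctions removes it. *)
have [be0|be0] := eqVneq beta 0.
  have [m lm] : exists m, lam m = l.
    by apply/(rs_root rs lp)/eqP; rewrite mulNr -addr_eq0; apply/eqP.
  have wP : ip (Phi l) w = 0.
    have := wo m; rewrite /eigf lm ipC => h0.
    have : (Num.sqrt (enrm d R1 R2 lam Phi m))^-1 * ip (Phi l) w = 0.
      rewrite -ipZl// -[RHS]h0; apply: eq_int => r _; rewrite mulrC //.
      by rewrite [_^-1 * _]mulrC mulrC.
    move/eqP; rewrite mulf_eq0 invr_eq0 gt_eqF/=; first by move/eqP.
    by rewrite sqrtr_gt0 (enrm_gt0 rs).
  have : ip w w = ip u w.
    transitivity (ip (fun r => - c0 * Phi l r + u r) w).
      by apply: eq_int => r hr; rewrite -wE.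
    by rewrite ipDl; [rewrite ipZl// wP mulr0 add0r|con_auto..].
  have := ip_CS rs cu cw; have := ip_ge0 rs w; have := ip_ge0 rs u.
  move: (ip w w) (ip u w) (ip u u) ipu => ww uw uu ipu uu0 ww0 cs e.
  have : ww <= uu.
    have [->//|wn] := eqVneq ww 0.
    have wp : 0 < ww by rewrite lt_neqAle eq_sym wn.
    by rewrite -(ler_pM2r wp) -expr2 {1}e.
  move=> h1; rewrite (le_trans h1)// (le_trans ipu)// /C.
  move: H1 H2; move: (2 * (M1 ^+ 2 * Cc)) => X H1 H2; nra.
(* Otherwise the Robin condition at [R2] determines [w R2], and with it the coefficient [c0]. *)
have hw2 : R2 ^+ d * w R2 = A R2 / beta.
  apply: (canRL (mulfK be0)); have := ZA R2 I2; rewrite /Z1 w2 /beta => e.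
  by apply/eqP; rewrite -subr_eq0 -oppr_eq0 -e; apply/eqP; ring.
have hc0 : c0 = B R2 - tau / beta * A R2.
  have := ZB R2 I2; rewrite -/c0 => <-; rewrite /Z2 w2.
  have -> : R2 ^+ d * (- k2 * w R2 * Th R2 - w R2 * dTh R2) = - (tau * (R2 ^+ d * w R2)).
    by rewrite /tau; ring.
  by rewrite hw2; field.
have hc : c0 ^+ 2 <= Cc * ip h h.
  have := hA R2 I2; have := hB R2 I2; rewrite hc0 /Cc.
  have : (tau / beta * A R2) ^+ 2 <= (tau / beta) ^+ 2 * (a * ip h h).
    by rewrite exprMn ler_wpM2l ?sqr_ge0// hA.
  have := sqr_ge0 (B R2 + tau / beta * A R2); rewrite sqrrD sqrrB.
  by move: (tau / beta * A R2) ((tau / beta) ^+ 2) => X Y; rewrite -!(mulr_natr (_ * X)); lra.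
have : ip w w <= ((2 * (M1 ^+ 2 * Cc) + 2 * Cu) * ip h h) * P.
  apply: ipb => // r hr; rewrite wE//.
  have e1 : (c0 * Phi l r) ^+ 2 <= Cc * ip h h * M1 ^+ 2.
    by rewrite exprMn; apply: ler_pM; rewrite ?sqr_ge0// sqb// hM1.
  have e2 := hu r hr; have := sqr_ge0 (c0 * Phi l r + u r).
  by rewrite mulNr; move: (c0 * Phi l r) (u r) e1 e2 => X Y; lra.
by move=> /le_trans; apply; rewrite /C; move: H0; lra.
Qed.

(* The supremum [M] of the Rayleigh quotients of the resolvent over the orthogonal
   complement of the eigenfunctions would make [L - (l0^2 + 1/M)] singular
   there, which [apriori] excludes; no compactness is needed. *)
Theorem eigenfunctions_complete f : con R1 R2 f -> (forall m, ip f (eg m) = 0) ->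
  forall r, R1 <= r <= R2 -> f r = 0.
Proof.
move=> cf fo; apply: (ip_eq0 rs cf); apply/eqP; apply/negPn/negP => f0.
have fp : 0 < ip f f by rewrite lt_neqAle eq_sym f0 (ip_ge0 rs).
have [w kf] : exists w, KR f w.
  by have [w [w' rw]] := green_operator cf; exists w, w'.
have cw := KR_con kf.
(* This makes the supremum [M] positive. If [w] vanished, so would its derivatives and, by the
   equation, [f]; coercivity does the rest. *)
have wfp : 0 < ip w f.
  apply: lt_le_trans (KR_coercive cf kf); rewrite mulr_gt0// lt_neqAle (ip_ge0 rs) andbT eq_sym.
  apply/negP => /eqP w0; have w00 := ip_eq0 rs cw w0.
  move: f0; rewrite (_ : ip f f = 0) ?eqxx//.
  have [w' rw] := kf; have := green_identity rs rw rw.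
  have cwf : con R1 R2 (fun r => l0 ^+ 2 * w r + f r) by con_auto.
  have [dw dw' _ _ _] := rw.
  have w'0 r : R1 <= r <= R2 -> w' r = 0.
    apply: (con_eq R12) => //; [exact: con_der dw'|exact: con_cst|] => x hx.
    have /andP[x1 x2] := hx.
    apply: (@der_uniq_itv _ w (fun=> 0) x _ _ R1 R2) => //.
    - by move=> y /andP[y1 y2]; apply: w00; rewrite !ltW.
    - by apply: dw; rewrite !ltW.
    - exact: der_cst.
  have f00 r : R1 <= r <= R2 -> f r = 0.
    apply: (con_eq R12) => //; [exact: con_cst|] => x hx.
    have /andP[x1 x2] := hx; have hx' : R1 <= x <= R2 by rewrite (ltW x1) (ltW x2).
    have H := @der_uniq_itv _ w' (fun=> 0) x _ _ R1 R2 hx _ (dw' _ hx') (der_cst _ _).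
    have e : - (d%:R / x) * w' x - (l0 ^+ 2 * w x + f x) = 0.
      by apply: H => y /andP[y1 y2]; apply: w'0; rewrite (ltW y1) (ltW y2).
    by move: e; rewrite w'0// w00//; lra.
  move=> _; rewrite -[RHS](mul0r (R2 - R1)) -(int_cst 0 R12').
  by apply: eq_int => r hr; rewrite f00// !mul0r mulr0.
pose E := [set x : R | exists g z, [/\ orthX g, KR g z, 0 < ip g g & x = ip z g / ip g g]].
have E0 : E (ip w f / ip f f) by exists f, w.
have Eub : ubound E dl^-1.
  move=> _ [g [z [[cg _] kg gp ->]]]; rewrite ler_pdivrMr// mulrC; exact: KR_bounded.
have sE : has_sup E by split; [exists (ip w f / ip f f)|exists dl^-1].
pose M := sup E.
have Mp : 0 < M.
  apply: (@lt_le_trans _ _ (ip w f / ip f f)); first by rewrite divr_gt0.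
  exact: sup_upper_bound.
have MX g z : orthX g -> KR g z -> ip z g <= M * ip g g.
  move=> og kg; have cg := og.1; have [g0|gn] := eqVneq (ip g g) 0.
    by rewrite g0 mulr0 (le_trans (KR_bounded cg kg))// g0 mul0r.
  have gp : 0 < ip g g by rewrite lt_neqAle eq_sym gn (ip_ge0 rs).
  by rewrite -ler_pdivrMr//; apply: sup_upper_bound => //; exists g, z.
(* The frequency of a would-be maximiser: a datum that the resolvent multiplies by [M] is an
   eigenfunction for [l0 ^+ 2 + M^-1]. *)
pose l := Num.sqrt (l0 ^+ 2 + M^-1).
have mup : 0 < l0 ^+ 2 + M^-1 by rewrite addr_gt0 ?exprn_gt0 ?invr_gt0.
have lp : 0 < l by rewrite sqrtr_gt0.
have l2 : l ^+ 2 = l0 ^+ 2 + M^-1 by rewrite sqr_sqrtr// ltW.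
have [C C0 hC] := apriori lp.
(* With [A = ip z g] and [G = ip g g], the first bound ensures [A > (M / 2) G] for a near-maximiser;
   the second one, through [apriori], forces [A^2 < (M / 2)^2 G^2]. *)
pose eta := Num.min (M / 2) (M ^+ 3 / (4 * C)).
have C4 : 0 < 4 * C by rewrite mulr_gt0.
have etap : 0 < eta by rewrite lt_min !divr_gt0 ?exprn_gt0.
have [x [g [z [og kg gp ->]]]] := sup_adherent etap sE; rewrite -/M ltr_pdivlMr// => hA.
have cg := og.1; have oz := KR_orth og kg; have cz := oz.1.
have [y ky] : exists y, KR z y.
  by have [y [y' ry]] := green_operator cz; exists y, y'.
have W := KR_CS cg cz kg ky; have Y := MX _ _ oz ky; have CS := ip_CS rs cz cg.
(* The residual of the near-maximiser: [z] solves the equation at frequency [l] with datum [h], so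
   that [apriori] bounds [z] by [h]. *)
pose h r := g r - M^-1 * z r.
have ch : con R1 R2 h by rewrite /h; con_auto.
have [z' rz] := kg.
have rzh : robin z z' (fun r => l ^+ 2 * z r + h r).
  have [a1 a2 a3 a4 a5] := rz; split => //; last by con_auto.
  by move=> r hr; apply: der_eq (a2 r hr) _; rewrite l2 /h; ring.
have := hC _ _ _ ch oz rzh.
have -> : ip h h = ip g g - 2 * M^-1 * ip z g + M^-2 * ip z z.
  have cnz : con R1 R2 (fun r => - M^-1 * z r) by con_auto.
  transitivity (ip (fun r => g r + - M^-1 * z r) (fun r => g r + - M^-1 * z r)).
    by apply: eq_int => r _; rewrite /h; ring.
  rewrite ipDl//; last by con_auto.
  rewrite !ipDr// !ipZl// ?ipZr//; first by rewrite [ip g z]ipC -exprVn; ring.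
move: W Y CS hA gp (ip_ge0 rs z).
move: (ip z z) (ip z g) (ip g g) (ip y z) => W A G Y h1 h2 h3 h4 G0 W0 h5.
have Me : M / 2 <= M - eta.
  by have : eta <= M / 2; [rewrite ge_min lexx|lra].
have Ce : C * eta * M^-1 <= M ^+ 2 / 4.
  have : eta <= M ^+ 3 / (4 * C) by rewrite ge_min lexx orbT.
  move/(ler_wpM2l (ltW C0))/(ler_wpM2r (ltW (_ : 0 < M^-1))); rewrite invr_gt0 => /(_ Mp) /le_trans; apply.
  have -> : C * (M ^+ 3 / (4 * C)) / M = M ^+ 2 / 4 by field; rewrite (gt_eqF C0) (gt_eqF Mp).
  by [].
have hA : M / 2 * G < A by rewrite (le_lt_trans _ h4)// ler_wpM2r// ltW.
have Ap : 0 < A by rewrite (le_lt_trans _ hA)// mulr_ge0 ?(ltW G0)// divr_ge0// ltW.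
(* Cauchy-Schwarz for the resolvent form gives [W^2 <= A Y], and [Y <= M W] by the choice of [M]. *)
have WA : W <= A * M.
  have [//|H] := leP W (A * M); have Wp : 0 < W by rewrite (lt_trans _ H)// mulr_gt0.
  move: h1; rewrite leNgt (le_lt_trans (ler_wpM2l (ltW Ap) h2))//.
  by rewrite mulrA expr2 ltr_pM2r.
have m0 : 0 < M^-1 by rewrite invr_gt0.
have WC : W <= C * (G - A / M).
  apply: (le_trans h5); rewrite ler_pM2l//.
  have : M^-2 * W <= M^-2 * (A * M) by rewrite ler_wpM2l// -exprVn sqr_ge0.
  have -> : M^-2 * (A * M) = A / M by field; rewrite (gt_eqF Mp).
  by have -> : 2 / M * A = 2 * (A / M); [ring|lra].
have h6 : G - A / M < G * eta / M.
  rewrite -subr_gt0.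
  have -> : G * eta / M - (G - A / M) = (A - (M - eta) * G) / M by field; rewrite (gt_eqF Mp).
  by rewrite divr_gt0// subr_gt0.
have h7 : A ^+ 2 < G ^+ 2 * (M ^+ 2 / 4).
  apply: (le_lt_trans h3); rewrite mulrC expr2 -mulrA ltr_pM2l// (le_lt_trans WC)//.
  apply: (@lt_le_trans _ _ (C * (G * eta / M))); first by rewrite ltr_pM2l.
  by rewrite (_ : C * _ = G * (C * eta / M)); [rewrite ler_pM2l|ring].
move: h7; rewrite ltNge => /negP; apply.
have -> : G ^+ 2 * (M ^+ 2 / 4) = (M / 2 * G) ^+ 2 by field.
by rewrite lerXn2r ?nnegrE ?(ltW hA) ?(ltW Ap)// mulr_ge0 ?(ltW G0)// divr_ge0// ltW.
Qed.

End completeness.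

(** * The radial heat equation *)

Section heat_series.
Context {R : realType}.
Variables (d : nat) (R1 R2 k1 k2 : R) (lam : nat -> R) (Phi dPhi : R -> R -> R).
Hypothesis rs : radial_system d R1 R2 k1 k2 lam Phi dPhi.
Variables (eps : R) (f0 f0' f1 f1' : R -> R).
Hypothesis eps0 : 0 < eps.
Hypothesis rf0 : robin d R1 R2 k1 k2 f0 f0' f1.
Hypothesis Cf1 : C1f R1 R2 f1 f1'.
Implicit Types (g : nat -> R -> R) (r s t : R) (m k a j : nat).

Local Notation ip := (wip d R1 R2).
Local Notation eg := (eigf d R1 R2 lam Phi).
Local Notation deg := (deg d R1 R2 lam Phi dPhi).

Let R1p : 0 < R1 := rs_R1 rs.
Let R12 : R1 < R2 := rs_R12 rs.
Let R12' : R1 <= R2 := ltW R12.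
Let lamp m : 0 < lam m := rs_pos rs m.
Let hR1 : 0 < R1 / 2. Proof. by rewrite divr_gt0. Qed.

Definition heat_coef m := ip f0 (eg m).
Definition heat_decay m t := expR (- (eps / 2 * lam m ^+ 2 * t)).
Local Notation c := heat_coef.
Local Notation E := heat_decay.

Definition mode_sum g r t := nsum (fun m => c m * (g m r * E m t)).

(** Summable by [coef_summable]: down to time 0 a mode may therefore grow like [lam m ^+ 2]. *)
Definition cbd m := `|c m| * lam m ^+ 2.

Lemma cbd_summable : cvgn (series cbd).
Proof. exact: (coef_summable rs rf0 Cf1). Qed.

Definition growth a g :=
  (exists2 C : R, 0 < C & forall m r, R1 / 2 <= r -> `|g m r| <= C * lam m ^+ a) /\
  forall m r, R1 / 2 < r -> {for r, continuous (g m)}.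

(** At positive times the exponential beats every power of [lam m]; down to time 0 only the decay of
    the coefficients is available, and it pays for two powers. *)
Definition summable_time a t := 0 < t \/ (0 <= t /\ (a <= 2)%N).

(** With [k] the exponent divided by [b], the inequality [x / k <= expR (x / k)] is raised to that
    exponent. *)
Lemma pow_expR_bound (a : nat) (b : R) : 0 < b ->
  exists2 K : R, 0 < K & forall x, 0 <= x -> x ^+ a * expR (- (b * x)) <= K.
Proof.
move=> b0; case: a => [|a].
  by exists 1 => // x x0; rewrite mul1r -expR0 ler_expR oppr_le0 mulr_ge0// ltW.
pose k : R := a.+1%:R / b; have kp : 0 < k by rewrite divr_gt0.
exists (k ^+ a.+1); first exact: exprn_gt0.
move=> x x0; rewrite expRN ler_pdivrMr ?expR_gt0//.
have -> : b * x = a.+1%:R * (x / k).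
  by rewrite /k; move: (a.+1%:R : R) (ltr0Sn R a) => A A0; field; rewrite (gt_eqF b0) (gt_eqF A0).
rewrite mulr_natl -[(x / k) *+ _]mulr_natl mulrC expRM_natl -exprMn.
have h : x / k <= expR (x / k) by rewrite (le_trans _ (expR_ge1Dx _))// lerDr.
rewrite lerXn2r ?nnegrE//; first by apply: mulr_ge0; [exact: expR_ge0|exact: ltW].
by rewrite -ler_pdivrMr.
Qed.

Lemma decay_le m s t : s <= t -> E m t <= E m s.
Proof. by move=> st; rewrite ler_expR lerN2 ler_wpM2l// mulr_ge0 ?sqr_ge0// divr_ge0// ltW. Qed.

Lemma decay_ge0 m t : 0 <= E m t. Proof. exact: expR_ge0. Qed.

Lemma decay_bound a s : 0 < s -> exists2 K : R, 0 < K & forall m t, s <= t ->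
  lam m ^+ a * E m t <= K.
Proof.
move=> s0; have [l0 l0p hl] := lam_bounds rs.
have [K K0 hK] := @pow_expR_bound a (eps / 2 * s) (ltac:(by rewrite mulr_gt0// divr_gt0)).
(* [pow_expR_bound] is applied to [lam m ^+ 2], and [lam m ^+ a] is at most
   [l0 ^- a * lam m ^+ (2 * a)]. *)
exists (l0 ^- a * K); first by rewrite mulr_gt0// invr_gt0 exprn_gt0.
move=> m t st; apply: (@le_trans _ _ (lam m ^+ a * E m s)).
  by rewrite ler_wpM2l ?decay_le// exprn_ge0// ltW.
rewrite ler_pdivlMl ?exprn_gt0// mulrA -exprMn (le_trans _ (hK (lam m ^+ 2) _)) ?sqr_ge0//.
rewrite /E mulrAC ler_wpM2r ?expR_ge0// lerXn2r ?nnegrE ?mulr_ge0 ?sqr_ge0 ?(ltW l0p) ?(ltW (lamp m))//.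
by rewrite expr2 ler_wpM2r// ltW.
Qed.

Lemma coef_bound a s : summable_time a s -> exists2 K : R, 0 < K &
  forall m t, s <= t -> `|c m| * (lam m ^+ a * E m t) <= K * cbd m.
Proof.
have [l0 l0p hl] := lam_bounds rs; case=> [s0|[s0 a2]].
  have [K K0 hK] := decay_bound a s0; exists (K / l0 ^+ 2).
    by rewrite divr_gt0// exprn_gt0.
  move=> m t st; rewrite /cbd [leRHS]mulrCA ler_wpM2l//.
  rewrite -mulrA (le_trans (hK m t st))// ler_peMr ?(ltW K0)// ler_pdivlMl ?exprn_gt0// mulr1.
  by rewrite lerXn2r ?nnegrE// ?(ltW l0p) ?(ltW (lamp m)).
exists (l0 ^- (2 - a)); first by rewrite invr_gt0 exprn_gt0.
move=> m t st; rewrite /cbd [leRHS]mulrCA ler_wpM2l//.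
apply: (@le_trans _ _ (lam m ^+ a)).
  rewrite ler_piMr ?exprn_ge0 ?(ltW (lamp m))//.
  rewrite -expR0 ler_expR oppr_le0; apply: mulr_ge0; last exact: le_trans st.
  by apply: mulr_ge0; [rewrite divr_ge0// ltW|exact: sqr_ge0].
rewrite ler_pdivlMl ?exprn_gt0//.
rewrite -{2}(subnK a2) exprD ler_wpM2r ?exprn_ge0 ?(ltW (lamp m))//.
by rewrite lerXn2r ?nnegrE// ?(ltW l0p) ?(ltW (lamp m)).
Qed.

Lemma mode_bound a g s : growth a g -> summable_time a s ->
  exists2 b : nat -> R, cvgn (series b) &
    forall m r t, R1 / 2 <= r -> s <= t -> `|c m * (g m r * E m t)| <= b m.
Proof.
move=> [[C C0 hC] _] /coef_bound[K K0 hK].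
exists (fun m => C * K * cbd m); first exact: cvg_seriesZ cbd_summable.
move=> m r t hr st; rewrite !normrM [`|E _ _|]ger0_norm ?decay_ge0//.
apply: (@le_trans _ _ (C * (`|c m| * (lam m ^+ a * E m t)))).
  rewrite [leRHS]mulrCA ler_wpM2l// mulrA ler_wpM2r ?decay_ge0// hC//.
by rewrite -mulrA ler_pM2l// hK.
Qed.

Lemma mode_cvg a g r t : growth a g -> summable_time a t -> R1 / 2 <= r ->
  cvgn (series (fun m => c m * (g m r * E m t))).
Proof.
move=> gg st hr; have [b cb hb] := mode_bound gg st.
by apply: dom_cvg cb => m; apply: hb.
Qed.

Lemma decay_cont m t : {for t, continuous (E m)}.
Proof.
apply: der_cont; apply: der_expR; apply: derN; apply: derZ; exact: der_id.
Qed.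

Lemma max_cont s t : {for t, continuous (fun y => Num.max y s)}.
Proof.
apply: (@lip_cont _ 1) => y; rewrite mul1r.
have H := ler_norm (y - t); have := ler_norm (t - y); rewrite distrC => H'.
by have [h1|h1] := leP y s; have [h2|h2] := leP t s; rewrite ler_norml; apply/andP; split; lra.
Qed.

(** Cutting the time off from below by [Num.max p.2 s] expresses continuity up to the initial time
    [s] as continuity in a full neighbourhood. *)
Lemma mode_sum_cont a g s r t : growth a g -> summable_time a s -> R1 / 2 < r ->
  {for (r, t), continuous (fun p : R * R => mode_sum g p.1 (Num.max p.2 s))}.
Proof.
move=> gg ss hr; have [b cb hb] := mode_bound gg ss; have [_ gc] := gg.
apply: (nsum_cont cb).
  have : \forall p \near ((r, t) : R * R), R1 / 2 < p.1.
    by exists ([set y | R1 / 2 < y], setT) => [|p []//]; split; [exact: lt_nbhsr|exact: filterT].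
  by apply: filterS => p hp m; apply: hb; rewrite ?le_max ?lexx ?orbT// ltW.
move=> m; apply: contM; first exact: cvg_cst.
apply: contM; first by apply: cont_comp; [exact: gc|exact: cvg_fst].
apply: (cont_comp (g := E m)); first exact: decay_cont.
apply: (cont_comp (g := fun y => Num.max y s)); last exact: cvg_snd.
exact: max_cont.
Qed.

Lemma mode_sum_der_r a a' g g' r t : growth a g -> growth a' g' ->
  (forall m r, R1 / 2 < r -> der (g m) r (g' m r)) ->
  summable_time a t -> summable_time a' t -> R1 / 2 < r ->
  der (fun r => mode_sum g r t) r (mode_sum g' r t).
Proof.
move=> gg gg' dg st st' hr; have [b cb hb] := mode_bound gg' st'.
have hy y : `|y - r| < r - R1 / 2 -> R1 / 2 < y by rewrite ltr_norml => /andP[h _]; lra.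
apply: (@nsum_der _ (fun m r => c m * (g m r * E m t)) (fun m r => c m * (g' m r * E m t))
  r (r - R1 / 2) b _ cb).
- by rewrite subr_gt0.
- move=> m y /hy h; apply: derZ; apply: der_eq; first by apply: derM; [exact: dg|exact: der_cst].
  by rewrite mulr0 addr0.
- by move=> m y /hy h; apply: hb; [exact: ltW|exact: lexx].
- by move=> y /hy h; apply: mode_cvg gg st _; exact: ltW.
Qed.

Lemma growthM a k g : growth a g -> growth (a + k) (fun m r => lam m ^+ k * g m r).
Proof.
move=> [[C C0 hC] gc]; split; last first.
  by move=> m r hr; apply: contM; [exact: cvg_cst|exact: gc].
exists C => // m r hr; rewrite normrM ger0_norm ?exprn_ge0 ?(ltW (lamp m))//.
by rewrite addnC exprD mulrCA ler_wpM2l ?hC// exprn_ge0// ltW.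
Qed.

Lemma mode_sum_der_t a g r t : growth a g -> 0 < t -> R1 / 2 < r ->
  der (mode_sum g r) t (- (eps / 2) * mode_sum (fun m r => lam m ^+ 2 * g m r) r t).
Proof.
move=> gg t0 hr; have gg2 := growthM 2 gg.
have th : 0 < t / 2 by rewrite divr_gt0.
have [b cb hb] := mode_bound gg2 (or_introl th).
have hy y : `|y - t| < t / 2 -> t / 2 < y by rewrite ltr_norml => /andP[h _]; lra.
rewrite /mode_sum -nsumZ; last by apply: mode_cvg gg2 _ _; [left|exact: ltW].
have epn : 0 <= eps / 2 by rewrite divr_ge0// ltW.
apply: (@nsum_der _ (fun m t => c m * (g m r * E m t))
  (fun m t => - (eps / 2) * (c m * (lam m ^+ 2 * g m r * E m t)))
  t (t / 2) (fun m => eps / 2 * b m) th).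
- exact: cvg_seriesZ.
- move=> m y _; apply: der_eq.
    apply: derZ; apply: derZ; apply: der_expR; apply: derN; apply: derZ; exact: der_id.
  by rewrite /heat_decay; ring.
- move=> m y /hy h; rewrite normrM normrN (ger0_norm epn) ler_wpM2l// hb ?ltW//.
- move=> y /hy h; apply: mode_cvg gg _ _; last exact: ltW.
  by left; exact: lt_trans h.
Qed.

(** [heatS j] is the [j]-th iterate of the operator [- r^-d (r^d w')'] applied to the solution, and
    [heatT j] is the derivative of [heatS j] in [r]. *)
Definition heatS j := mode_sum (fun m r => lam m ^+ (2 * j) * eg m r).
Definition heatT j := mode_sum (fun m r => lam m ^+ (2 * j) * deg m r).
Local Notation S := heatS.
Local Notation T := heatT.

Let half_pos r : R1 / 2 < r -> 0 < r. Proof. exact: lt_trans. Qed.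

Lemma growth_eg : growth 0 eg.
Proof.
have [C C0 hC] := eg_bounds rs; split.
  by exists C => // m r hr; rewrite mulr1; have [] := hC m r hr.
by move=> m r /half_pos hr; apply: der_cont; exact: (eg_der rs).
Qed.

Lemma growth_deg : growth 1 deg.
Proof.
have [C C0 hC] := eg_bounds rs; split.
  by exists C => // m r hr; have [] := hC m r hr.
by move=> m r /half_pos hr; apply: der_cont; exact: (deg_der rs).
Qed.

Lemma growthS j : growth (2 * j) (fun m r => lam m ^+ (2 * j) * eg m r).
Proof. exact: growthM growth_eg. Qed.

Lemma growthT j : growth (2 * j).+1 (fun m r => lam m ^+ (2 * j) * deg m r).
Proof. exact: growthM growth_deg. Qed.

Lemma heatS_der_r j r t : summable_time (2 * j).+1 t -> R1 / 2 < r ->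
  der (fun r => S j r t) r (T j r t).
Proof.
move=> st hr; apply: (mode_sum_der_r (growthS j) (growthT j)) => //.
  by move=> m s /half_pos hs; apply: derZ; exact: (eg_der rs).
by case: st => [|[? ?]]; [left|right; split => //; exact: ltnW].
Qed.

Lemma growth_deg2 j : growth (2 * j.+1)
  (fun m r => lam m ^+ (2 * j) * (- (d%:R / r) * deg m r - lam m ^+ 2 * eg m r)).
Proof.
have [C C0 hC] := eg_bounds rs; have [l0 l0p hl] := lam_bounds rs; split; last first.
  move=> m r /half_pos hr; apply: contM; first exact: cvg_cst.
  apply: contB; apply: contM; try exact: cvg_cst.
  - apply: contN; apply: contM; first exact: cvg_cst.
    by apply: contV; [rewrite gt_eqF|exact: cvg_id].
  - by apply: der_cont; exact: (deg_der rs).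
  - by apply: der_cont; exact: (eg_der rs).
pose K := d%:R / (R1 / 2).
have K0 : 0 <= K by rewrite divr_ge0// ltW.
exists ((K / l0 + 1) * C).
  by rewrite mulr_gt0// ltr_wpDl// divr_ge0// ltW.
move=> m r hr; have [h1 h2] := hC m r hr; have rp : 0 < r := lt_le_trans hR1 hr.
rewrite /=; move: (eg m r) (deg m r) h1 h2 => e e' h1 h2.
rewrite mulnS addnC exprD normrM ger0_norm ?exprn_ge0 ?(ltW (lamp m))// [leRHS]mulrCA.
rewrite ler_wpM2l ?exprn_ge0 ?(ltW (lamp m))//.
apply: (le_trans (ler_normB _ _)); rewrite mulNr normrN !normrM (gtr0_norm (lamp m)) -expr2 mulrDl mulrDl mul1r lerD//; last first.
  by rewrite mulrC ler_wpM2r// sqr_ge0.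
apply: (@le_trans _ _ (K * (C * lam m))).
  apply: ler_pM => //; rewrite -normrM ger0_norm ?divr_ge0 ?(ltW rp)//.
  by rewrite /K ler_wpM2l// lef_pV2 ?posrE.
have -> : K / l0 * C * lam m ^+ 2 = K * (C * (l0^-1 * lam m ^+ 2)) by ring.
by rewrite ler_wpM2l// (ler_pM2l C0) ler_pdivlMl// expr2 ler_wpM2r ?hl// ltW.
Qed.

Lemma heatT_der_r j r t : summable_time (2 * j.+1) t -> R1 / 2 < r ->
  der (fun r => T j r t) r (- (d%:R / r) * T j r t - S j.+1 r t).
Proof.
move=> st hr; have st' : summable_time (2 * j).+1 t.
  by case: st => [|[? h]]; [left|right; split => //; apply: leq_trans h; lia].
have cT := mode_cvg (growthT j) st' (ltW hr).
have cS := mode_cvg (growthS j.+1) st (ltW hr).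
apply: der_eq.
  apply: (mode_sum_der_r (growthT j) (growth_deg2 j) _ st' st hr).
  by move=> m s /half_pos hs; apply: derZ; exact: (deg_der rs).
rewrite /T /S /mode_sum -nsumZ// -nsumB//; last exact: cvg_seriesZ.
apply: eq_nsum => m; rewrite mulnS addnC exprD; ring.
Qed.

Lemma mode_sum_shift (h : nat -> R -> R) j r t :
  mode_sum (fun m r => lam m ^+ 2 * (lam m ^+ (2 * j) * h m r)) r t =
  mode_sum (fun m r => lam m ^+ (2 * j.+1) * h m r) r t.
Proof. by apply: eq_nsum => m; rewrite mulnS exprD; ring. Qed.

Lemma heatS_der_t j r t : 0 < t -> R1 / 2 < r ->
  der (S j r) t (- (eps / 2) * S j.+1 r t).
Proof. by move=> t0 hr; rewrite /S -mode_sum_shift; exact: (mode_sum_der_t (growthS j)). Qed.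

Lemma heatT_der_t j r t : 0 < t -> R1 / 2 < r ->
  der (T j r) t (- (eps / 2) * T j.+1 r t).
Proof. by move=> t0 hr; rewrite /T -mode_sum_shift; exact: (mode_sum_der_t (growthT j)). Qed.

Lemma heatS_cont j s r t : summable_time (2 * j) s -> R1 / 2 < r ->
  {for (r, t), continuous (fun p : R * R => S j p.1 (Num.max p.2 s))}.
Proof. by move=> ss hr; rewrite /heatS; apply: mode_sum_cont (growthS j) ss hr. Qed.

Lemma heatT_cont j s r t : summable_time (2 * j).+1 s -> R1 / 2 < r ->
  {for (r, t), continuous (fun p : R * R => T j p.1 (Num.max p.2 s))}.
Proof. by move=> ss hr; rewrite /heatT; apply: mode_sum_cont (growthT j) ss hr. Qed.

End heat_series.

(** * Local minima and sign changes *)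

Section calculus.
Context {R : realType}.
Implicit Types (f : R -> R) (x a b : R).

Lemma dnbhs_radius (P : R -> Prop) (e : R) : 0 < e -> (\forall h \near 0^', P h) ->
  exists d, [/\ 0 < d, d < e & forall h, h != 0 -> `|h| <= d -> P h].
Proof.
move=> e0; rewrite /dnbhs /within /= => /nbhs_ballP [d /= d0 hb].
have m0 : 0 < Num.min d e by rewrite lt_min d0.
have m2 : Num.min d e / 2 < Num.min d e by rewrite ltr_pdivrMr// ltr_pMr// ltr1n.
exists (Num.min d e / 2); split.
- by rewrite divr_gt0.
- by rewrite (lt_le_trans m2)// ge_min lexx orbT.
- move=> h h0 hd; apply: hb => //; rewrite /ball/= sub0r normrN (le_lt_trans hd)//.
  by rewrite (lt_le_trans m2)// ge_min lexx.
Qed.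

Lemma sign_change f x c e : der f x c -> f x = 0 -> c != 0 -> 0 < e ->
  exists y z, [/\ x - e < y, y < x, x < z, z < x + e & f y * f z < 0].
Proof.
move=> /derP hd fx c0 e0.
have h2 : c * (h^-1 * (f (h + x) - f x)) @[h --> 0^'] --> c * c.
  by apply: cvgM => //; exact: cvg_cst.
have cc : 0 < c * c by rewrite -expr2 exprn_even_gt0.
have [d [d0 de hb]] := dnbhs_radius e0 (cvgr_gt _ h2 _ cc).
have p1 : 0 < c * (d^-1 * (f (d + x) - f x)) by apply: hb; rewrite ?gt_eqF// gtr0_norm.
have p2 : 0 < c * ((- d)^-1 * (f (- d + x) - f x)).
  by apply: hb; rewrite ?lt_eqF ?oppr_lt0// normrN gtr0_norm.
exists (- d + x), (d + x); split; try lra.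
have := mulr_gt0 p1 p2; rewrite !fx !subr0 invrN.
set A := f _; set B := f _; have -> : (c * (d^-1 * A)) * (c * (- d^-1 * B)) =
  (c * d^-1) ^+ 2 * - (B * A) by ring.
by rewrite pmulr_rgt0 ?oppr_gt0// exprn_even_gt0//= mulf_neq0// invr_eq0 gt_eqF.
Qed.

(** If [c] were negative, [f'] would be negative just to the right of [x] and [f] would drop below
    [f x]. The test is one-sided because the minimum may lie at an end of the interval, where a
    Neumann condition provides [f' x = 0]. *)
Lemma second_order_right f (f' : R -> R) x a c : x < a ->
  (forall y, x <= y <= a -> der f y (f' y)) -> der f' x c -> f' x = 0 ->
  (forall y, x <= y <= a -> f x <= f y) -> 0 <= c.
Proof.
move=> xa df /derP d' f'0 fm; rewrite leNgt; apply/negP => c0.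
have ax : 0 < a - x by rewrite subr_gt0.
have [d [d0 de hb]] := dnbhs_radius ax (cvgr_lt _ d' _ c0).
have hb' h : 0 < h -> h <= d -> f' (h + x) < 0.
  move=> h0 hd; have := hb h; rewrite gt_eqF// gtr0_norm// f'0 subr0 => /(_ isT hd).
  by rewrite pmulr_rlt0// invr_gt0.
have xd : x < d + x by lra.
have [|z [z1 z2 e]] := @MVT_der _ f f' _ _ xd.
  by move=> y /andP[y1 y2]; apply: df; rewrite y1 (le_trans y2)//; lra.
have fz : f' z < 0 by rewrite -(subrK x z); apply: hb'; lra.
have : f x <= f (d + x) by apply: fm; apply/andP; split; lra.
by rewrite -subr_ge0 e addrK leNgt nmulr_rlt0// d0.
Qed.

Lemma second_order_left f (f' : R -> R) x a c : a < x ->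
  (forall y, a <= y <= x -> der f y (f' y)) -> der f' x c -> f' x = 0 ->
  (forall y, a <= y <= x -> f x <= f y) -> 0 <= c.
Proof.
move=> ax df d' f'0 fm.
have dN y : der (fun y : R => - y) y (-1) by apply: derN; exact: der_id.
apply: (@second_order_right (fun y => f (- y)) (fun y => - f' (- y)) (- x) (- a)).
- by rewrite ltrN2.
- move=> y /andP[y1 y2]; apply: der_eq.
    by apply: (der_comp (g := f)); [apply: df; rewrite lerNr y2 lerNl y1|exact: dN].
  by rewrite mulrN1.
- apply: der_eq; first by apply: derN; apply: (der_comp (g := f')); [rewrite opprK; exact: d'|exact: dN].
  by rewrite mulrN1 opprK.
- by rewrite opprK f'0 oppr0.
- by move=> y /andP[y1 y2]; rewrite opprK; apply: fm; rewrite lerNr y2 lerNl y1.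
Qed.

Lemma der_le0_left f x a c : a < x -> der f x c ->
  (forall y, a <= y <= x -> f x <= f y) -> c <= 0.
Proof.
move=> ax /derP d fm; rewrite leNgt; apply/negP => c0.
have xa : 0 < x - a by rewrite subr_gt0.
have [e [e0 ea hb]] := dnbhs_radius xa (cvgr_gt _ d _ c0).
have := hb (- e); rewrite lt_eqF ?oppr_lt0// normrN (gtr0_norm e0) => /(_ isT (lexx _)).
rewrite invrN mulNr oppr_gt0 pmulr_rlt0 ?invr_gt0// subr_lt0.
by rewrite ltNge fm//; apply/andP; split; lra.
Qed.

Lemma der_interior_min f x a b c : a < x < b -> der f x c ->
  (forall y, a <= y <= b -> f x <= f y) -> c = 0.
Proof.
move=> /andP[ax xb] d fm; apply/eqP; rewrite eq_le; apply/andP; split.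
  by apply: (der_le0_left ax d) => y /andP[y1 y2]; apply: fm; rewrite y1 (le_trans y2)// ltW.
rewrite -oppr_le0; apply: (@der_le0_left (fun y => f (- y)) (- x) (- b)); first by rewrite ltrN2.
  have dN : der (fun y : R => - y) (- x) (-1) by apply: derN; exact: der_id.
  apply: der_eq (mulrN1 c); apply: (der_comp (g := f)); last exact: dN.
  by rewrite opprK.
move=> y /andP[y1 y2]; rewrite opprK; apply: fm.
by rewrite lerNl y1 lerNr andbT (le_trans y2)// lerN2 ltW.
Qed.

Lemma nsum_delta (u : nat -> R) k : nsum (fun m => u m * (m == k)%:R) = u k.
Proof.
rewrite (@nsum_split _ _ k.+1).
  rewrite (_ : (fun n => u (n + _)%N * _) = fun=> 0) ?nsum0 ?addr0.
    rewrite /series/= big_nat_recr//= eqxx mulr1 big1_seq ?add0r// => i.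
    by rewrite mem_index_iota => /andP[_ /andP[_ ik]]; rewrite ltn_eqF// mulr0.
  by apply/funext => n; rewrite gtn_eqF ?mulr0// ltn_addl.
apply: (@dom_cvg _ _ (fun m => `|u m| * (m == k)%:R)).
  by move=> n; rewrite normrM [`|_%:R|]ger0_norm.
apply: (@cvg_bounded_series _ _ (`|u k|)) => [n|N]; first by rewrite mulr_ge0.
have [kN|Nk] := ltnP k N.
  rewrite (bigD1_seq k)//= ?iota_uniq ?mem_index_iota// eqxx mulr1 big1 ?addr0//.
  by move=> i /negbTE ->; rewrite mulr0.
rewrite big1_seq// => i; rewrite mem_index_iota => /andP[_ /andP[_ iN]].
by rewrite ltn_eqF ?mulr0// (leq_trans iN).
Qed.

Lemma pair_contl (U V : topologicalType) (x : U) (y : V) :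
  {for x, continuous (fun z => (z, y))}.
Proof.
move=> A [[P Q] [/= hP hQ] PQ]; apply: filterS hP => z Pz; apply: PQ; split => //.
exact: nbhs_singleton hQ.
Qed.

Lemma pair_contr (U V : topologicalType) (x : U) (y : V) :
  {for y, continuous (fun z => (x, z))}.
Proof.
move=> A [[P Q] [/= hP hQ] PQ]; apply: filterS hQ => z Qz; apply: PQ; split => //.
exact: nbhs_singleton hP.
Qed.

End calculus.

(** * Sign of the solution and its initial values *)

Section positivity.
Context {R : realType}.
Variables (d : nat) (R1 R2 k1 k2 : R) (lam : nat -> R) (Phi dPhi : R -> R -> R).
Hypothesis rs : radial_system d R1 R2 k1 k2 lam Phi dPhi.
Variables (eps : R) (f0 f0' f1 f1' : R -> R).
Hypothesis eps0 : 0 < eps.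
Hypothesis rf0 : robin d R1 R2 k1 k2 f0 f0' f1.
Hypothesis Cf1 : C1f R1 R2 f1 f1'.
Implicit Types (g : nat -> R -> R) (r s t : R) (m k a j : nat).

Local Notation ip := (wip d R1 R2).
Local Notation eg := (eigf d R1 R2 lam Phi).
Local Notation deg := (deg d R1 R2 lam Phi dPhi).
Local Notation c := (heat_coef d R1 R2 lam Phi f0).
Local Notation S := (heatS d R1 R2 lam Phi eps f0).
Local Notation T := (heatT d R1 R2 lam Phi dPhi eps f0).
Local Notation decay := (heat_decay lam eps).

Let R1p : 0 < R1 := rs_R1 rs.
Let R12 : R1 < R2 := rs_R12 rs.
Let R12' : R1 <= R2 := ltW R12.
Let lamp m : 0 < lam m := rs_pos rs m.
Let hR1 : 0 < R1 / 2. Proof. by rewrite divr_gt0. Qed.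
Let rp r : R1 <= r <= R2 -> 0 < r.
Proof. by move=> /andP[h _]; exact: lt_le_trans h. Qed.
Let half r : R1 <= r <= R2 -> R1 / 2 < r.
Proof. by move=> /andP[h _]; apply: lt_le_trans h; rewrite ltr_pdivrMr// ltr_pMr// ltr1n. Qed.
Let ke : 0 < eps / 2. Proof. by rewrite divr_gt0. Qed.
Let time0 a : (a <= 2)%N -> summable_time a (0 : R). Proof. by right. Qed.

Hypothesis S_neq0 : forall r t, R1 < r < R2 -> 0 < t -> S 0 r t != 0.

Lemma lam_unbounded (x : R) : exists N, forall m, (N <= m)%N -> x < lam m.
Proof.
have x1 : 0 < `|x| + 1 by rewrite ltr_wpDl.
have := cvg_series_cvg_0 (lam_summable rs) => h.
have : \forall m \near \oo, (lam m ^+ 2)^-1 < ((`|x| + 1) ^+ 2)^-1.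
  by apply: (cvgr_lt _ h); rewrite invr_gt0 exprn_gt0.
move=> [N _ hN]; exists N => m /hN /=.
rewrite ltf_pV2 ?posrE ?exprn_gt0// ltr_pXn2r ?nnegrE ?(ltW x1) ?(ltW (lamp m))//.
by move=> h1; rewrite (le_lt_trans (ler_norm x))// (lt_trans _ h1)// ltrDl ltr01.
Qed.

(** Some coefficient is nonzero, since the solution is; the [lam m] tend to infinity, so that the
    minimum is taken over finitely many modes. *)
Lemma leading_mode : exists j, c j != 0 /\ forall m, c m != 0 -> lam j <= lam m.
Proof.
have [m0 cm0] : exists m, c m != 0.
  apply: contrapT => /forallNP h; have := @S_neq0 ((R1 + R2) / 2) 1 _ ltr01.
  rewrite /heatS /mode_sum (_ : (fun m => _) = fun=> 0) ?nsum0 ?eqxx.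
    by have := R12; rewrite ltr_pdivlMr ?ltr_pdivrMr// => h1 /(_ (ltac:(apply/andP; split; lra))).
  by apply/funext => m; have /negP/negPn/eqP -> := h m; rewrite mul0r.
have [N hN] := lam_unbounded (lam m0).
have m0N : (m0 < N)%N by rewrite ltnNge; apply/negP => /hN; rewrite ltxx.
have [i ci imin] := @arg_minP _ _ _ (Ordinal m0N) (fun i : 'I_N => c i != 0) (fun i => lam i) cm0.
exists i; split => // m cm; have [mN|Nm] := ltnP m N; first exact: (imin (Ordinal mN)).
by rewrite (le_trans (imin (Ordinal m0N) cm0))// ltW// hN.
Qed.

(** After multiplication by the growth that offsets mode [j], every other mode present decays. The
    exponents are nonpositive for the modes present, and the majorant of time 0 serves for all
    [n]. *)
Lemma heat_large_time j r : c j != 0 -> (forall m, c m != 0 -> lam j <= lam m) ->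
  R1 / 2 <= r -> S 0 r n%:R * expR (eps / 2 * lam j ^+ 2 * n%:R) @[n --> \oo] --> c j * eg j r.
Proof.
move=> cj jmin hr; have G := growthS rs 0.
have [b cb hb] := mode_bound rs eps0 rf0 Cf1 G (time0 (leq0n 2 : 2 * 0 <= 2)%N).
pose k m := eps / 2 * (lam m ^+ 2 - lam j ^+ 2).
pose F m n := c m * (eg m r * expR (- (k m * n%:R))).
have -> : (fun n => S 0 r n%:R * expR (eps / 2 * lam j ^+ 2 * n%:R)) =
    (fun n => nsum (fun m => F m n)).
  apply/funext => n; rewrite /heatS /mode_sum mulrC -nsumZ; last first.
    by apply: (mode_cvg rs eps0 rf0 Cf1 G) hr; right; split.
  apply: eq_nsum => m; rewrite /F /heat_decay mul1r mulrCA; congr (_ * _).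
  rewrite mulrCA; congr (_ * _); rewrite -expRD; congr expR; rewrite /k; ring.
have -> : c j * eg j r = nsum (fun m => c m * (eg m r * (m == j)%:R)).
  apply: etrans (esym (nsum_delta (fun m => c m * eg m r) j)) _.
  by apply: eq_nsum => m; exact/esym/mulrA.
have kge m : c m != 0 -> 0 <= k m.
  move=> cm; rewrite mulr_ge0 ?(ltW ke)// subr_ge0 lerXn2r ?nnegrE ?(ltW (lamp _))//.
  exact: jmin.
have hb' m : `|c m * eg m r| <= b m.
  have := hb m r 0 hr (lexx 0); rewrite /heat_decay mulr0 oppr0 expR0 mul1r mulr1 //.
apply: (@nsum_cvg _ _ _ _ (fun m n => F m n) _ b cb).
- apply: nearW => n m; apply: le_trans (hb' m); rewrite /F mulrA normrM.
  have [->|cm] := eqVneq (c m) 0; first by rewrite !mul0r normr0 mul0r.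
  rewrite ler_piMr// ger0_norm ?expR_ge0// -expR0 ler_expR oppr_le0 mulr_ge0 ?kge//.
- move=> m; apply: le_trans (hb' m); rewrite mulrA normrM.
  by case: (m == j); rewrite ?normr1 ?mulr1// normr0 mulr0.
move=> m; rewrite /F; have [->|mj] := eqVneq m j.
  apply: cvg_near_cst; apply: nearW => n.
  by rewrite /k subrr mulr0 mul0r oppr0 expR0.
have [->|cm] := eqVneq (c m) 0.
  by apply: cvg_near_cst; apply: nearW => n; rewrite !mul0r.
have kp : 0 < k m.
  rewrite mulr_gt0// subr_gt0 ltrXn2r ?nnegrE ?(ltW (lamp _))//=.
  by rewrite lt_neqAle jmin// andbT; apply/eqP => /(rs_inj rs) e; rewrite e eqxx in mj.
apply: cvgM; first exact: cvg_cst.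
apply: cvgM; first exact: cvg_cst.
have -> : (fun n => expR (- (k m * n%:R))) = (fun n => expR (- k m) ^+ n).
  by apply/funext => n; rewrite -mulNr mulr_natr -expRM_natl mulr_natl.
by apply: cvg_expr; rewrite ger0_norm ?expR_ge0// -expR0 ltr_expR oppr_lt0.
Qed.

Lemma S_con j t : (2 * j <= 2)%N -> 0 <= t -> con R1 R2 (fun r => S j r t).
Proof.
move=> j1 t0 r /half hr.
have := heatS_cont rs eps0 rf0 Cf1 (t := t) (or_intror (conj (lexx 0) j1)) hr.
move=> h; apply: (cont_eq (f := fun r => S j r (Num.max t 0))).
  by move=> y; congr (S j y _); apply/max_idPl.
apply: (cont_comp (f := fun y => (y, t)) h).
exact: pair_contl.
Qed.

(** At large times the solution has the sign of [c j * eg j r]. A zero of [eg j] is simple: inside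
    the interval it would be a change of sign, which the intermediate value theorem turns into a
    zero of the solution; at an end the Robin condition excludes it. *)
Lemma nonvanishing_mode : exists j, forall r, R1 <= r <= R2 -> eg j r != 0.
Proof.
have [j [cj jmin]] := leading_mode; exists j => r hr; apply/eqP => er.
have [n0 n1] : eg j r = 0 /\ deg j r != 0.
  split => //; apply/eqP => dr.
  have h : 0 < Num.sqrt (enrm d R1 R2 lam Phi j) by rewrite sqrtr_gt0 (enrm_gt0 rs).
  apply: (Phi_neq0 rs (lamp j) (rp hr)).
    by move: er => /eqP; rewrite mulf_eq0 invr_eq0 (gt_eqF h) orbF => /eqP.
  by move: dr => /eqP; rewrite mulf_eq0 invr_eq0 (gt_eqF h) orbF => /eqP.
have [_ _ _ e1 e2] := eg_robin rs j.
have [r1|r1] := eqVneq r R1; first by move: er n1; rewrite r1 e1 => ->; rewrite mulr0 eqxx.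
have [r2|r2] := eqVneq r R2; first by move: er n1; rewrite r2 e2 => ->; rewrite mulr0 eqxx.
have {r1 r2 hr} /andP[r1 r2] : R1 < r < R2 by rewrite !lt_neqAle eq_sym r1 r2.
have hr : R1 <= r <= R2 by rewrite !ltW.
have e0 : 0 < Num.min (r - R1) (R2 - r) by rewrite lt_min !subr_gt0 r1.
have [y [z [y1 y2 z1 z2 yz]]] := sign_change (eg_der rs j (rp hr)) n0 n1 e0.
have hy : R1 < y by have := ge_min (r - R1) (r - R1) (R2 - r); rewrite lexx/= => h; lra.
have hz : z < R2 by have := ge_min (R2 - r) (r - R1) (R2 - r); rewrite lexx orbT => h; lra.
have hy' : R1 / 2 <= y by apply/ltW/half; rewrite ltW// ltW// (lt_trans y2)//.
have hz' : R1 / 2 <= z by rewrite (le_trans hy')// ltW// (lt_trans y2).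
have L := cvgM (heat_large_time cj jmin hy') (heat_large_time cj jmin hz').
have Ln : c j * eg j y * (c j * eg j z) < 0.
  by rewrite mulrACA pmulr_rlt0// -expr2 exprn_even_gt0.
have [n] : exists n, (0 < n)%N /\ S 0 y n%:R * S 0 z n%:R < 0.
  have := cvgr_lt _ (L _) _ Ln => -[N _ hN]; exists N.+1; split => //.
  have := hN N.+1 (leqnSn N); rewrite /= mulrACA pmulr_llt0//.
  by rewrite mulr_gt0 ?expR_gt0.
move=> [n00 h].
have np : 0 < n%:R :> R by rewrite ltr0n.
have yz' : y <= z by rewrite ltW// (lt_trans y2).
have := @IVT _ (fun r => S 0 r n%:R) y z 0 yz'.
case.
- apply: con_within; apply: (@con_sub _ R1 R2 y z) (ltW hy) (ltW hz) _.
  exact: (S_con (leq0n 2 : 2 * 0 <= 2)%N (ltW np)).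
- have [a|a] := ltP (S 0 y n%:R) (S 0 z n%:R).
    by move: h a; move: (S 0 y _) (S 0 z _) => u v h a; apply/andP; split; nra.
  by move: h a; move: (S 0 y _) (S 0 z _) => u v h a; apply/andP; split; nra.
- move=> x; rewrite in_itv/= => /andP[x1 x2] Sx; have := @S_neq0 x n%:R.
  rewrite Sx eqxx (lt_le_trans hy x1) (le_lt_trans x2 hz) => h1.
  by have := h1 isT np.
Qed.

Let ceg m : con R1 R2 (eg m) := @eg_con _ _ _ _ _ _ _ _ _ rs m.

Let cpow : con R1 R2 (fun r => r ^+ d). Proof. by move=> r _; apply: contX; exact: cvg_id. Qed.

Lemma decay0 m : decay m 0 = 1.
Proof. by rewrite /heat_decay mulr0 oppr0 expR0. Qed.

(** Termwise integration against [r ^+ d * eg k r], where orthonormality leaves one term. *)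
Lemma ip_heatS k : ip (fun r => S 0 r 0) (eg k) = c k.
Proof.
have G := growthS rs 0.
have [b cb hb] := mode_bound rs eps0 rf0 Cf1 G (time0 (leq0n 2 : 2 * 0 <= 2)%N).
pose w r := r ^+ d * eg k r.
have cw : con R1 R2 w by apply: conM; [exact: cpow|exact: ceg].
have [M [M0 hM]] := con_bounded R12' cw.
pose F m r := w r * (c m * (1 * eg m r * decay m 0)).
have cF m : con R1 R2 (F m).
  apply: conM => //; apply: conM; first exact: con_cst.
  apply: conM; last exact: con_cst.
  by apply: conM; [exact: con_cst|exact: ceg].
have sc r : R1 <= r <= R2 -> cvgn (series (fun m => c m * (1 * eg m r * decay m 0))).
  move=> hr; apply: (mode_cvg rs eps0 rf0 Cf1 G (time0 (leq0n 2 : 2 * 0 <= 2)%N)).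
  by apply/ltW/half.
have E r : R1 <= r <= R2 -> r ^+ d * (S 0 r 0 * eg k r) = nsum (fun m => F m r).
  move=> hr; transitivity (w r * S 0 r 0).
    by rewrite /w; move: (eg k r) (S 0 r 0) => u v; ring.
  by rewrite /F nsumZ//; exact: sc.
rewrite /wip (eq_int E) (@nsum_int _ _ _ _ (fun m => M * b m)) //.
- apply: etrans (nsum_delta c k); apply: eq_nsum => m.
  rewrite -(eg_orth rs m k) /wip -intZ.
    by apply: eq_int => r _; rewrite /F decay0 /w; move: (eg m r) (eg k r) => a e; ring.
  by apply: conM; [exact: cpow|apply: conM; exact: ceg].
- exact: cvg_seriesZ.
- move=> m r hr; rewrite normrM ler_pM ?hM//; apply: (hb m r 0) => //.
  by apply/ltW/half.
have cS := S_con (leq0n 2 : 2 * 0 <= 2)%N (lexx 0).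
move=> r hr; have rh := half hr.
have : {for r, continuous (fun r => w r * S 0 r 0)} by apply: contM; [exact: cw|exact: cS].
have hn : \near r, w r * S 0 r 0 = nsum (fun m => F m r).
  near=> y; rewrite /F nsumZ//.
  apply: (mode_cvg rs eps0 rf0 Cf1 G (time0 (leq0n 2 : 2 * 0 <= 2)%N)).
  by apply: ltW; near: y; exact: lt_nbhsr.
exact: cont_near hn.
Unshelve. all: by end_near.
Qed.

Lemma heatS_initial r : R1 <= r <= R2 -> S 0 r 0 = f0 r.
Proof.
move=> hr; have [j ej] := nonvanishing_mode.
have cS := S_con (leq0n 2 : 2 * 0 <= 2)%N (lexx 0).
have cf0 : con R1 R2 f0 := C1f_con (robin_C1 rf0).
have cnf : con R1 R2 (fun r => -1 * f0 r) by apply: conM => //; exact: con_cst.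
apply/eqP; rewrite -subr_eq0 -mulN1r; apply/eqP.
apply: (eigenfunctions_complete rs ej (f := fun r => S 0 r 0 + -1 * f0 r)) => //.
  exact: conD.
move=> m; rewrite ipDl ?ip_heatS// ipZl// /heat_coef; ring.
Qed.

Lemma heatT_initial r : R1 <= r <= R2 -> T 0 r 0 = f0' r.
Proof.
move=> hr; have [df df' _ _ _] := rf0; have h1 := time0 (isT : (2 * 0).+1 <= 2)%N.
move: hr; apply: (con_eq R12 (f := fun r => T 0 r 0)).
- move=> x hx; apply: der_cont.
  by apply: (heatT_der_r rs eps0 rf0 Cf1 (time0 (isT : 2 * 1 <= 2)%N)); exact: half.
- exact: (con_der df').
- move=> x hx; have /andP[x1 x2] := hx; have hx' : R1 <= x <= R2 by rewrite !ltW.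
  apply: (der_uniq_itv hx _ (heatS_der_r rs eps0 rf0 Cf1 h1 (half hx')) (df x hx')).
  by move=> y /andP[y1 y2]; apply: heatS_initial; rewrite !ltW.
Qed.

Lemma heat_robin j t : summable_time (2 * j).+1 t ->
  T j R1 t = k1 * S j R1 t /\ T j R2 t = - k2 * S j R2 t.
Proof.
move=> st; have st' : summable_time (2 * j) t.
  by case: st => [|[? ?]]; [left|right; split => //; exact: ltnW].
have h1 : R1 / 2 <= R1 by apply/ltW/half; rewrite lexx.
have h2 : R1 / 2 <= R2 by apply/ltW/half; rewrite lexx ltW.
split; rewrite /heatT /heatS /mode_sum -nsumZ.
- apply: eq_nsum => m; have [_ _ _ -> _] := eg_robin rs m; ring.
- exact: (mode_cvg rs eps0 rf0 Cf1 (growthS rs j)).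
- apply: eq_nsum => m; have [_ _ _ _ ->] := eg_robin rs m; ring.
- exact: (mode_cvg rs eps0 rf0 Cf1 (growthS rs j)).
Qed.

(** Multiplication by its value at [R1] makes the nonvanishing eigenfunction positive. *)
Lemma positive_mode : exists l e e', [/\ 0 < l, forall r, R1 <= r <= R2 -> 0 < e r,
  forall r, R1 <= r <= R2 -> der e r (e' r) /\
    der e' r (- (d%:R / r) * e' r - l ^+ 2 * e r),
  e' R1 = k1 * e R1 & e' R2 = - k2 * e R2].
Proof.
have [j ej] := nonvanishing_mode; have hl : R1 <= R1 <= R2 by rewrite lexx R12'.
have [_ _ _ e1 e2] := eg_robin rs j.
exists (lam j), (fun r => eg j R1 * eg j r), (fun r => eg j R1 * deg j r); split.
- exact: lamp.
- move=> r hr; have /andP[r1 r2] := hr; rewrite ltNge; apply/negP => h.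
  have := @IVT _ (eg j) R1 r 0 r1; case.
  + by have cj := con_sub (lexx R1) r2 (@ceg j); exact: con_within cj.
  + have := ej _ hl; move: h; move: (eg j R1) (eg j r) => u v h u0.
    have u2 : 0 < u ^+ 2 by rewrite exprn_even_gt0.
    by have [a|a] := ltP u v; apply/andP; split; nra.
  + move=> x; rewrite in_itv/= => /andP[x1 x2]; apply/eqP/ej.
    by rewrite x1 (le_trans x2).
- move=> r /rp hr; split; first by apply: derZ; exact: (eg_der rs).
  by apply: der_eq; [apply: derZ; exact: (deg_der rs)|move: (eg j R1) (eg j r) (deg j r) => u v w; ring].
- by rewrite e1; move: (eg j R1) => u; ring.
- by rewrite e2; move: (eg j R1) (eg j R2) => u v; ring.
Qed.

(* Minimum principle for the ratio of the solution and a positive mode, which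
   satisfies Neumann conditions and an equation without zeroth order term. *)
Theorem heat_positive : (forall r, R1 <= r <= R2 -> 0 < f0 r) ->
  forall r t, R1 <= r <= R2 -> 0 <= t -> 0 < S 0 r t.
Proof.
move=> f0p r1 t1 hr1 t10; rewrite ltNge; apply/negP => Sneg.
have [l [e [e' [l0 ep de e1 e2]]]] := positive_mode.
have en r : R1 <= r <= R2 -> e r != 0 by move=> /ep/gt_eqF ->.
have t1p : 0 < t1.
  rewrite lt_neqAle t10 andbT; apply/eqP => h; move: Sneg.
  by rewrite -h heatS_initial// leNgt f0p.
have cf0 : con R1 R2 f0 := C1f_con (robin_C1 rf0).
have ce : con R1 R2 e by apply: (con_der (f' := e')) => r /de[].
have cq : con R1 R2 (fun r => e r / f0 r).
  move=> r hr; apply: contM; [exact: ce|apply: contV; [by rewrite gt_eqF ?f0p|exact: cf0]].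
have [M [M0 hM]] := con_bounded R12' cq.
(* [M^-1] is a lower bound of the ratio at time 0, and [dl * t1] is half of it. As the ratio is
   nonpositive at [(r1, t1)], the minimum occurs at a positive time. *)
pose dl := (2 * M * t1)^-1.
have dl0 : 0 < dl by rewrite invr_gt0 !mulr_gt0.
pose mu := eps / 2 * l ^+ 2.
pose X t := expR (mu * t).
have Xp t : 0 < X t by exact: expR_gt0.
have dX t : der X t (mu * X t).
  apply: der_eq; first by apply: der_expR; apply: derZ; exact: der_id.
  by rewrite mulr1.
(* [X] offsets the decay of the mode, which removes the zeroth order term; [dl * p.2] makes the
   inequality at the minimum strict. *)
pose v (p : R * R) := S 0 p.1 (Num.max p.2 0) / e p.1 * X p.2 + dl * p.2.
have vE r t : 0 <= t -> v (r, t) = S 0 r t / e r * X t + dl * t.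
  by move=> t0; rewrite /v /= max_l.
pose A := `[R1, R2] `*` `[0, t1].
have cA : compact A by apply: compact_setX; exact: segment_compact.
have A0 : A !=set0 by exists (R1, 0); split; rewrite /= in_itv/= lexx ?R12' ?t10.
have cv : {within A, continuous v}.
  apply: continuous_in_subspaceT => -[r t] /set_mem[/= hr ht].
  have {}hr : R1 <= r <= R2 by move: hr; rewrite in_itv.
  change {for ((r, t) : R * R), continuous (fun p : R * R =>
    S 0 p.1 (Num.max p.2 0) / e p.1 * X p.2 + dl * p.2)}.
  apply: contD; last by apply: contM; [exact: cvg_cst|exact: cvg_snd].
  apply: contM; last first.
    by apply: (cont_comp (g := X)); [exact: der_cont (dX t)|exact: cvg_snd].
  apply: contM; first exact: (heatS_cont rs eps0 rf0 Cf1 (time0 (leq0n 2 : 2 * 0 <= 2)%N) (half hr)).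
  apply: contV; first exact: en.
  by apply: (cont_comp (g := e)); [exact: ce|exact: cvg_fst].
have [[rs0 ts] /set_mem[/=]] := compact_EVT_min A0 cA cv.
rewrite !in_itv/= => hr /andP[ts0 ts1] vmin.
have {}vmin r t : R1 <= r <= R2 -> 0 <= t <= t1 -> v (rs0, ts) <= v (r, t).
  by move=> h1 h2; apply: vmin; apply/mem_set; split; rewrite /= in_itv.
have vs : v (rs0, ts) < M^-1.
  apply: le_lt_trans (vmin r1 t1 hr1 _) _; first by rewrite t10 lexx.
  rewrite vE//; apply: (@le_lt_trans _ _ (dl * t1)).
    by rewrite gerDr pmulr_lle0// pmulr_lle0 ?invr_gt0 ?ep.
  have -> : dl * t1 = M^-1 / 2 by rewrite /dl; field; rewrite (gt_eqF M0) (gt_eqF t1p).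
  by rewrite ltr_pdivrMr// ltr_pMr ?invr_gt0// ltr1n.
have tsp : 0 < ts.
  rewrite lt_neqAle ts0 andbT; apply/eqP => h; move: vs; rewrite ltNge -h vE// => /negP; apply.
  rewrite /X mulr0 expR0 mulr1 mulr0 addr0 heatS_initial//.
  rewrite -[f0 _ / _]invf_div lef_pV2 ?posrE ?divr_gt0 ?ep ?f0p//.
  by rewrite (le_trans (ler_norm _))// hM.
have st a : summable_time a ts by left.
pose f r := X ts * (S 0 r ts / e r) + dl * ts.
pose f' r := X ts * ((T 0 r ts * e r - S 0 r ts * e' r) / e r ^+ 2).
have fE r : f r = v (r, ts) by rewrite vE// /f [X ts * _]mulrC.
have df r : R1 <= r <= R2 -> der f r (f' r).
  move=> hy; have [d1 _] := de r hy; apply: der_eq.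
    apply: derD; last exact: der_cst.
    apply: derZ; apply: (der_div (en r hy)) d1.
    exact: (heatS_der_r rs eps0 rf0 Cf1 (st _) (half hy)).
  by rewrite addr0.
have fmin r : R1 <= r <= R2 -> f rs0 <= f r.
  by move=> hy; rewrite !fE; apply: vmin => //; rewrite ts0 ts1.
(* Inside the interval this is Fermat's rule; at the ends the solution and the mode satisfy the same
   Robin condition, so that their ratio has derivative 0. *)
have f'0 : f' rs0 = 0.
  have [b1 b2] := heat_robin (st (2 * 0).+1).
  have [->|n1] := eqVneq rs0 R1; first by rewrite /f' e1 b1; move: (e R1) (S 0 R1 ts) => u w; ring.
  have [->|n2] := eqVneq rs0 R2; first by rewrite /f' e2 b2; move: (e R2) (S 0 R2 ts) => u w; ring.
  apply: (der_interior_min (a := R1) (b := R2) _ (df _ hr) fmin).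
  by case/andP: hr => h1 h2; rewrite !lt_neqAle eq_sym n1 n2 h1.
pose f'' := X ts * ((l ^+ 2 * S 0 rs0 ts - S 1 rs0 ts) / e rs0).
have W : T 0 rs0 ts * e rs0 - S 0 rs0 ts * e' rs0 = 0.
  move: f'0; rewrite /f' => /eqP; rewrite mulf_eq0 (gt_eqF (Xp _)) mulf_eq0 invr_eq0.
  by rewrite sqrf_eq0 (negbTE (en _ hr)) orbF => /eqP.
have df' : der f' rs0 f''.
  have [d1 d2] := de _ hr; apply: der_eq.
    apply: derZ; apply: der_div; first by rewrite sqrf_eq0 en.
    - apply: derB; apply: derM; [|exact: d1| |exact: d2].
      + exact: (heatT_der_r rs eps0 rf0 Cf1 (st _) (half hr)).
      + exact: (heatS_der_r rs eps0 rf0 Cf1 (st _) (half hr)).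
    - exact: (derX 2 d1).
  rewrite /f'' W mul0r subr0; have := en _ hr; move: W.
  move: (T 0 rs0 ts) (S 0 rs0 ts) (S 1 rs0 ts) (e rs0) (e' rs0) => t s s1 u u' W u0.
  transitivity (X ts * ((- (d%:R / rs0) * (t * u - s * u') + (l ^+ 2 * s - s1) * u) * u ^+ 2 / (u ^+ 2) ^+ 2)).
    by congr (_ * (_ / _)); ring.
  by rewrite W mulr0 add0r; congr (_ * _); field.
have f2 : 0 <= f''.
  case/andP: (hr) => h1 h2; have [e2'|n2] := eqVneq rs0 R2.
    have hlt : R1 < rs0 by rewrite e2'.
    apply: (second_order_left hlt _ df' f'0) => y /andP[y1 y2]; [apply: df|apply: fmin];
      by rewrite y1 (le_trans y2).
  have hlt : rs0 < R2 by rewrite lt_neqAle n2.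
  apply: (second_order_right hlt _ df' f'0) => y /andP[y1 y2]; [apply: df|apply: fmin];
    by rewrite (le_trans h1).
(* The left side is the derivative in time at the minimum, nonpositive since earlier values are not
   smaller; but [f''] is nonnegative and [dl] positive. *)
have : eps / 2 * f'' + dl <= 0.
  apply: (@der_le0_left _ (fun t => S 0 rs0 t / e rs0 * X t + dl * t) ts 0 _ tsp).
    apply: der_eq.
      apply: derD; last by apply: derZ; exact: der_id.
      apply: derM; last exact: dX.
      apply: derM; last exact: der_cst.
      exact: (heatS_der_t rs eps0 rf0 Cf1 _ tsp (half hr)).
    by rewrite /f'' /mu; move: (S 0 _ _) (S _ _ _) (X ts) (e rs0)^-1 => u w x y; ring.
  move=> y /andP[y1 y2]; rewrite -!vE//; apply: vmin => //.
  by rewrite y1 (le_trans y2).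
by rewrite leNgt ltr_wpDl// mulr_ge0// ltW.
Qed.

End positivity.

(** * The eigenfunction expansion of the kernel *)

Section kernel.
Context {R : realType}.
Variables (d : nat) (R1 R2 k1 k2 : R) (lam : nat -> R) (Phi dPhi : R -> R -> R).
Hypothesis rs : radial_system d R1 R2 k1 k2 lam Phi dPhi.
Variables (eps : R) (f0 : R -> R).
Hypothesis eps0 : 0 < eps.
Hypothesis cf0 : con R1 R2 f0.
Implicit Types (g : nat -> R -> R) (r s t xi : R) (m k a j : nat).

Local Notation ip := (wip d R1 R2).
Local Notation eg := (eigf d R1 R2 lam Phi).
Local Notation deg := (deg d R1 R2 lam Phi dPhi).
Local Notation E := (heat_decay lam eps).
Local Notation growth := (growth R1 lam).

Let R1p : 0 < R1 := rs_R1 rs.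
Let R12 : R1 < R2 := rs_R12 rs.
Let R12' : R1 <= R2 := ltW R12.
Let lamp m : 0 < lam m := rs_pos rs m.
Let hR1 : 0 < R1 / 2. Proof. by rewrite divr_gt0. Qed.
Let hR1' : R1 / 2 < R1. Proof. by rewrite ltr_pdivrMr// ltr_pMr// ltr1n. Qed.

Definition kernel_term g r xi t m := g m r * (xi ^+ d * eg m xi) * E m t.
Definition kernel g r xi t := nsum (kernel_term g r xi t).

(** Two spare powers of [lam m] are taken from the exponential, which leaves a majorant proportional
    to the summable [(lam m ^+ 2)^-1]. The range of [xi] exceeds the interval, so that continuity in
    [xi] at its ends is two-sided. *)
Lemma kernel_term_bound a g s : growth a g -> 0 < s -> exists2 b : nat -> R, cvgn (series b) &
  forall m r xi t, R1 / 2 <= r -> R1 / 2 <= xi <= R2 + 1 -> s <= t ->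
  `|kernel_term g r xi t m| <= b m.
Proof.
move=> [[C C0 hC] _] s0; have [[D D0 hD] _] := growth_eg rs.
have [K K0 hK] := decay_bound rs eps0 (a + 2) s0.
have R20 : 0 < R2 + 1 by rewrite ltr_pwDr// ltW// (lt_trans R1p).
pose M := C * ((R2 + 1) ^+ d * D) * K.
exists (fun m => M * (lam m ^+ 2)^-1); first exact: cvg_seriesZ (lam_summable rs).
move=> m r xi t hr /andP[x1 x2] st; rewrite /kernel_term normrM normrM [`|xi ^+ d * _|]normrM.
have xp : 0 < xi := lt_le_trans hR1 x1.
rewrite [`|xi ^+ d|]ger0_norm ?exprn_ge0 ?(ltW xp)// [`|E _ _|]ger0_norm ?decay_ge0//.
have h1 := hC m r hr; have := hD m xi x1; rewrite mulr1 => h2.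
have h3 : xi ^+ d * `|eg m xi| <= (R2 + 1) ^+ d * D.
  by apply: ler_pM => //; [rewrite exprn_ge0// ltW|rewrite lerXn2r ?nnegrE ?(ltW xp) ?(ltW R20)].
have h4 := hK m t st.
apply: (@le_trans _ _ (C * lam m ^+ a * ((R2 + 1) ^+ d * D) * E m t)).
  rewrite ler_wpM2r ?decay_ge0//; apply: ler_pM => //.
  by rewrite mulr_ge0// exprn_ge0// ltW.
have -> : M / lam m ^+ 2 = C * ((R2 + 1) ^+ d * D) * (K / lam m ^+ 2) by rewrite /M; ring.
have -> : C * lam m ^+ a * ((R2 + 1) ^+ d * D) * E m t =
  C * ((R2 + 1) ^+ d * D) * (lam m ^+ a * E m t) by ring.
rewrite ler_pM2l ?mulr_gt0 ?exprn_gt0// ler_pdivlMr ?exprn_gt0//.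
by rewrite mulrAC -exprD.
Qed.

Lemma kernel_int a g r t : growth a g -> 0 < t -> R1 / 2 <= r ->
  intR R1 R2 (fun xi => kernel g r xi t * f0 xi) =
  mode_sum d R1 R2 lam Phi eps f0 g r t.
Proof.
move=> gg t0 hr; have [b cb hb] := kernel_term_bound gg t0.
have ceg m : con R1 R2 (eg m) := @eg_con _ _ _ _ _ _ _ _ _ rs m.
have cpow : con R1 R2 (fun r => r ^+ d) by move=> x _; apply: contX; exact: cvg_id.
have [M [M0 hM]] := con_bounded R12' cf0.
have hb' m xi : R1 / 2 <= xi <= R2 + 1 -> `|kernel_term g r xi t m| <= b m.
  by move=> hx; apply: hb.
have hx xi : R1 <= xi <= R2 -> R1 / 2 <= xi <= R2 + 1.
  by move=> /andP[x1 x2]; apply/andP; split; [exact: le_trans (ltW hR1') x1|lra].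
have cvk xi : R1 <= xi <= R2 -> cvgn (series (kernel_term g r xi t)).
  by move=> /hx h; apply: dom_cvg cb => m; exact: hb'.
pose F m xi := f0 xi * kernel_term g r xi t m.
have cF m : con R1 R2 (F m).
  apply: conM => //; apply: conM; last exact: con_cst.
  by apply: conM; [exact: con_cst|apply: conM].
transitivity (intR R1 R2 (fun xi => nsum (fun m => F m xi))).
  by apply: eq_int => xi h; rewrite /F nsumZ; [exact: mulrC|exact: cvk].
rewrite (@nsum_int _ _ _ _ (fun m => M * b m))//.
- apply: eq_nsum => m; rewrite /heat_coef /wip mulrC -intZ; last first.
    by apply: conM => //; apply: conM.
  apply: eq_int => xi _; rewrite /F /kernel_term.
  by move: (eg m xi) (E m t) => x y; ring.
- exact: cvg_seriesZ.
- by move=> m xi h; rewrite normrM ler_pM ?hM// hb'// hx.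
move=> xi h; have h1 : {for xi, continuous (fun xi => f0 xi * kernel g r xi t)}.
  apply: contM; first exact: cf0.
  apply: (nsum_cont cb).
    have /andP[x1 x2] := h.
    near=> y => m; apply: hb'; apply/andP; split.
      by apply: ltW; near: y; apply: lt_nbhsr; exact: lt_le_trans x1.
    by apply: ltW; near: y; apply: lt_nbhsl; rewrite (le_lt_trans x2)// ltrDl.
  move=> m; apply: contM; last exact: cvg_cst.
  by apply: contM; [exact: cvg_cst|apply: contM; [exact: cpow|exact: ceg]].
apply: cont_near h1; have /andP[x1 x2] := h.
near=> y; rewrite /F nsumZ//; apply: dom_cvg cb => m; apply: hb'; apply/andP; split.
  by apply: ltW; near: y; apply: lt_nbhsr; exact: lt_le_trans x1.
by apply: ltW; near: y; apply: lt_nbhsl; rewrite (le_lt_trans x2)// ltrDl.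
Unshelve. all: by end_near.
Qed.

Lemma kernel_der r xi t : 0 < t -> R1 / 2 < r -> R1 <= xi <= R2 ->
  der (fun r => kernel eg r xi t) r (kernel deg r xi t).
Proof.
move=> t0 hr /andP[x1 x2].
have hx : R1 / 2 <= xi <= R2 + 1 by apply/andP; split; [exact: le_trans (ltW hR1') x1|lra].
have [b cb hb] := kernel_term_bound (growth_deg rs) t0.
have [b' cb' hb'] := kernel_term_bound (growth_eg rs) t0.
have hy y : `|y - r| < r - R1 / 2 -> R1 / 2 < y by rewrite ltr_norml => /andP[h _]; lra.
apply: (@nsum_der _ (fun m r => kernel_term eg r xi t m) (fun m r => kernel_term deg r xi t m)
  r (r - R1 / 2) b _ cb).
- by rewrite subr_gt0.
- move=> m y /hy h; apply: der_eq.
    apply: derM; last exact: der_cst.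
    apply: derM; last exact: der_cst.
    by apply: (eg_der rs); exact: lt_trans h.
  by rewrite /kernel_term !mulr0 !addr0.
- by move=> m y /hy /ltW h; apply: hb.
- by move=> y /hy /ltW h; apply: dom_cvg cb' => m; apply: hb'.
Qed.

Lemma kernel_cvg r xi t : 0 < t -> R1 / 2 <= r -> R1 <= xi <= R2 ->
  cvgn (series (kernel_term eg r xi t)).
Proof.
move=> t0 hr /andP[x1 x2]; have [b cb hb] := kernel_term_bound (growth_eg rs) t0.
apply: dom_cvg cb => m; apply: hb => //; apply/andP; split; last lra.
exact: le_trans (ltW hR1') x1.
Qed.

Lemma eg_mul m r xi : eg m r * eg m xi =
  (enrm d R1 R2 lam Phi m)^-1 * (Phi (lam m) r * Phi (lam m) xi).
Proof.
rewrite /eigf mulrACA -invfM -expr2 sqr_sqrtr; last exact: (ltW (enrm_gt0 rs m)).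
by rewrite mulrC.
Qed.

End kernel.

(** * The explicit Green functions and the initial potential *)

Section velocity_formula.
Context {R : realType}.
Variables (n : nat) (eps R1 R2 q1 q2 : R) (q0 : R -> R) (lam : nat -> R).
Hypothesis hn : n = 2%N \/ n = 3%N.
Hypothesis eps0 : 0 < eps.
Hypothesis R1p : 0 < R1.
Hypothesis R12 : R1 < R2.
Hypothesis hlam : enumerates_positive_roots n eps R1 R2 q1 q2 lam.
Hypothesis hq : q_well_defined n eps R1 R2 q1 q2 q0 lam.
Implicit Types (r s t xi : R) (m : nat).

Local Notation k1 := (- (q1 / eps)).
Local Notation k2 := (q2 / eps).
Local Notation w0 := (weight eps R1 q0).

(** The constants in the two series are the inverse squared norms of the eigenfunctions, by
    [H2_norm] and [Psi3_norm]. For [n = 3] the factor [xi / r] collects the weight [xi ^+ 2] and the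
    denominators of [Phi3]. *)
Lemma green_kernel : exists Phi dPhi, radial_system n.-1 R1 R2 k1 k2 lam Phi dPhi /\
  forall r xi t, R1 / 2 < r -> R1 <= xi <= R2 -> 0 < t ->
  green n eps R1 R2 q1 q2 lam r xi t =
  kernel n.-1 R1 R2 lam Phi eps (eigf n.-1 R1 R2 lam Phi) r xi t.
Proof.
have hR1 : 0 < R1 / 2 by rewrite divr_gt0.
have root m : characteristic_function n eps R1 R2 q1 q2 (lam m) = 0.
  have [_ e] := hlam; have : range lam (lam m) by exists m.
  by rewrite e => -[].
case: hn => nE; move: hlam hq root; rewrite nE => hl [hB _] root.
- have rs := radial_system_2 R1p R12 hl.
  exists (H2 eps R1 q1), (dH2 eps R1 q1); split => // r xi t hr hx t0.
  have cv := kernel_cvg rs eps0 t0 (ltW hr) hx.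
  have p0 : pi ^+ 2 / 2 != 0 :> R by rewrite mulf_neq0// expf_neq0// gt_eqF ?pi_gt0.
  rewrite /green eqxx /kernel; transitivity (pi ^+ 2 / 2 * nsum (fun m => (pi ^+ 2 / 2)^-1 *
    kernel_term 1 R1 R2 lam (H2 eps R1 q1) eps (eigf 1 R1 R2 lam (H2 eps R1 q1)) r xi t m));
    last by rewrite (nsumZ _ cv) mulVKf.
  congr (_ * _); apply: eq_nsum => m.
  apply: (mulfI p0); rewrite mulVKf//.
  have N := H2_norm eps0 R1p R12 (rs_pos rs m) (root m) (hB erefl m).
  rewrite /kernel_term.
  transitivity (xi * (eigf 1 R1 R2 lam (H2 eps R1 q1) m r * eigf 1 R1 R2 lam (H2 eps R1 q1) m xi)
      * heat_decay lam eps m t); last first.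
    by move: (eigf _ _ _ _ _ _ _) (eigf _ _ _ _ _ _ _) (heat_decay _ _ _ _) => x y z; rewrite expr1; ring.
  rewrite (eg_mul rs) /enrm -N /mode2 /heat_decay.
  have -> : eps * lam m ^+ 2 * t / 2 = eps / 2 * lam m ^+ 2 * t by ring.
  ring.
- have rs := radial_system_3 eps0 R1p R12 hl.
  exists (Phi3 eps R1 q1), (dPhi3 eps R1 q1); split => // r xi t hr hx t0.
  have cv := kernel_cvg rs eps0 t0 (ltW hr) hx.
  have rp : 0 < r := lt_trans hR1 hr.
  have xp : 0 < xi by case/andP: hx => h _; exact: lt_le_trans h.
  have p0 : 2 * xi / r != 0 by rewrite gt_eqF// divr_gt0// mulr_gt0.
  rewrite /green /= /kernel; transitivity (2 * xi / r * nsum (fun m => (2 * xi / r)^-1 *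
    kernel_term 2 R1 R2 lam (Phi3 eps R1 q1) eps (eigf 2 R1 R2 lam (Phi3 eps R1 q1)) r xi t m));
    last by rewrite (nsumZ _ cv) mulVKf.
  congr (_ * _); apply: eq_nsum => m.
  apply: (mulfI p0); rewrite mulVKf//.
  have N := Psi3_norm R1p R12 (rs_pos rs m) (root m).
  rewrite /kernel_term.
  transitivity (xi ^+ 2 * (eigf 2 R1 R2 lam (Phi3 eps R1 q1) m r * eigf 2 R1 R2 lam (Phi3 eps R1 q1) m xi)
      * heat_decay lam eps m t); last first.
    by move: (eigf _ _ _ _ _ _ _) (eigf _ _ _ _ _ _ _) (heat_decay _ _ _ _) => x y z; ring.
  rewrite (eg_mul rs) /enrm -N /mode3 /heat_decay /Phi3.
  set D := ((R2 - R1) * _ * _ + _); move: D^-1 => iD; field.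
  by rewrite (gt_eqF rp) (gt_eqF xp).
Qed.

Hypothesis hq0 : Ck_on 2 `[R1, R2] q0.
Hypothesis hc1 : q0 R1 = q1.
Hypothesis hc2 : q0 R2 = q2.

Local Notation d := n.-1.
Local Notation dq0 := (q0^`()%classic).
Local Notation ddq0 := (q0^`(2)%classic).

Let R12' : R1 <= R2 := ltW R12.
Let rn r : R1 <= r <= R2 -> r != 0.
Proof. by move=> /andP[h _]; rewrite gt_eqF// (lt_le_trans R1p). Qed.

Lemma q0_der r : R1 <= r <= R2 -> der q0 r (dq0 r) /\ der dq0 r (ddq0 r).
Proof.
move=> hr; have hr' : `[R1, R2]%classic r by rewrite /= in_itv.
have [h _] := hq0 hr'.
by split; apply: derivable_der; [exact: (h 0%N)|exact: (h 1%N)].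
Qed.

Lemma q0_con : [/\ con R1 R2 q0, con R1 R2 dq0 & con R1 R2 ddq0].
Proof.
split; [by apply: con_der => r /q0_der[]; eauto|by apply: con_der => r /q0_der[]; eauto|].
move=> r hr; have hr' : `[R1, R2]%classic r by rewrite /= in_itv.
have [_ h] := hq0 hr'.
exact: (h 2%N).
Qed.

(** [f0] is the exponential weight itself. Its Robin conditions say that [q0] takes the values [q1]
    and [q2] at the ends, and its image [f1 = H f0] under the radial operator is continuously
    differentiable because [q0] is of class C^2. *)
Lemma initial_profile : exists f0 f0' f1 f1', [/\ robin d R1 R2 k1 k2 f0 f0' f1,
  C1f R1 R2 f1 f1', forall r, R1 <= r <= R2 -> 0 < f0 r,
  forall r, R1 <= r <= R2 -> w0 r = f0 r &
  forall r, R1 <= r <= R2 -> - eps * f0' r = q0 r * f0 r].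
Proof.
have [c0 c1 c2] := q0_con; have [F [F1 dF]] := primitive R12' c0.
have en : eps != 0 by rewrite gt_eqF.
pose f0 r := expR (- (eps^-1 * F r)); pose f0' r := - (q0 r / eps) * f0 r.
pose H r := d%:R / r * (q0 r / eps) + dq0 r / eps - (q0 r / eps) ^+ 2.
pose H' r := - (d%:R / r ^+ 2) * (q0 r / eps) + d%:R / r * (dq0 r / eps) + ddq0 r / eps
  - 2 * (q0 r / eps) * (dq0 r / eps).
have df0 r : R1 <= r <= R2 -> der f0 r (f0' r).
  move=> hr; apply: der_eq; first by apply: der_expR; apply: derN; apply: derZ; exact: dF.
  by rewrite /f0' /f0; congr (_ * _); ring.
have dq r : R1 <= r <= R2 -> der (fun r => q0 r / eps) r (dq0 r / eps).
  move=> hr; have [h _] := q0_der hr.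
  by apply: der_eq; [apply: derM; [exact: h|exact: der_cst]|rewrite mulr0 addr0].
have ddq r : R1 <= r <= R2 -> der (fun r => dq0 r / eps) r (ddq0 r / eps).
  move=> hr; have [_ h] := q0_der hr.
  by apply: der_eq; [apply: derM; [exact: h|exact: der_cst]|rewrite mulr0 addr0].
have dinv r : R1 <= r <= R2 -> der (fun r => d%:R / r) r (- (d%:R / r ^+ 2)).
  move=> hr; apply: der_eq; first by apply: derZ; apply: (derV (rn hr)); exact: der_id.
  by rewrite mulN1r mulrN.
have dH r : R1 <= r <= R2 -> der H r (H' r).
  move=> hr; apply: der_eq.
    apply: derB; first apply: derD; first apply: derM.
    - exact: dinv.
    - exact: dq.
    - exact: ddq.
    - by apply: (derX 2); exact: dq.
  by rewrite /H' /= expr1; ring.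
pose f1 r := H r * f0 r; pose f1' r := H' r * f0 r + H r * f0' r.
have df1 r : R1 <= r <= R2 -> der f1 r (f1' r).
  by move=> hr; apply: derM; [exact: dH|exact: df0].
have cf0 := con_der df0; have cH := con_der dH.
have cf0' : con R1 R2 f0'.
  by apply: conM => //; apply: conN; apply: conM => //; exact: con_cst.
have cinv : con R1 R2 (fun r => r^-1).
  by move=> r hr; apply: contV; [exact: rn|exact: cvg_id].
have cH' : con R1 R2 H'.
  have ci k : con R1 R2 (fun r => k / r ^+ 2).
    move=> r hr; apply: contM; first exact: cvg_cst.
    by apply: contV; [rewrite expf_neq0// rn|apply: contX; exact: cvg_id].
  have ce (f : R -> R) : con R1 R2 f -> con R1 R2 (fun r => f r / eps).
    by move=> cf; apply: conM => //; exact: con_cst.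
  apply: conB; last by apply: conM; [apply: conM; [exact: con_cst|exact: ce]|exact: ce].
  apply: conD; last exact: ce.
  apply: conD; first by apply: conM; [apply: conN; exact: ci|exact: ce].
  by apply: conM; [apply: conM => //; exact: con_cst|exact: ce].
exists f0, f0', f1, f1'; split.
- split; [exact: df0| |exact: con_der df1|by rewrite /f0' hc1|by rewrite /f0' hc2].
  move=> r hr; apply: der_eq.
    by apply: derM; [apply: derN; exact: dq|exact: df0].
  by rewrite /f1 /H /f0'; field; rewrite en rn.
- split; first exact: df1.
  by apply: conD; apply: conM.
- by move=> r _; exact: expR_gt0.
- by move=> r hr; rewrite /weight (int_primitive c0 F1 dF hr).
- by move=> r _; rewrite /f0'; field.
Qed.

End velocity_formula.

(* [ph] is the Cole-Hopf potential of [q], [ps = ph_r], [ch = - r^-d (r^d ph_r)_r],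
   [th = ch_r]. *)
Record heat_profile {R : realType} (n : nat) (eps R1 R2 q1 q2 : R) (q0 : R -> R)
    (q ph ps ch th : R -> R -> R) : Prop := {
  hp_eps : 0 < eps;
  hp_R1 : 0 < R1;
  hp_R12 : R1 < R2;
  hp_q : forall r t, R1 / 2 < r -> 0 < t -> q r t = - eps * (ps r t / ph r t);
  hp_pos : forall r t, R1 <= r <= R2 -> 0 <= t -> 0 < ph r t;
  hp_r : forall r t, R1 / 2 < r -> 0 <= t -> der (fun r => ph r t) r (ps r t);
  hp_rr : forall r t, R1 / 2 < r -> 0 <= t ->
    der (fun r => ps r t) r (- (n.-1%:R / r) * ps r t - ch r t);
  hp_rrr : forall r t, R1 / 2 < r -> 0 < t -> der (fun r => ch r t) r (th r t);
  hp_t : forall r t, R1 / 2 < r -> 0 < t -> der (ph r) t (- (eps / 2) * ch r t);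
  hp_rt : forall r t, R1 / 2 < r -> 0 < t -> der (ps r) t (- (eps / 2) * th r t);
  hp_cont : forall r t, R1 / 2 < r ->
    {for (r, t), continuous (fun p : R * R => ph p.1 (Num.max p.2 0))};
  hp_cont_r : forall r t, R1 / 2 < r ->
    {for (r, t), continuous (fun p : R * R => ps p.1 (Num.max p.2 0))};
  hp_cont_rr : forall r t, R1 / 2 < r ->
    {for (r, t), continuous (fun p : R * R => ch p.1 (Num.max p.2 0))};
  hp_cont_rrr : forall r t, R1 / 2 < r -> 0 < t ->
    {for (r, t), continuous (fun p : R * R => th p.1 p.2)};
  hp_left : forall t, 0 <= t -> - eps * ps R1 t = q1 * ph R1 t;
  hp_right : forall t, 0 <= t -> - eps * ps R2 t = q2 * ph R2 t;
  hp_init : forall r, R1 <= r <= R2 -> - eps * ps r 0 = q0 r * ph r 0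
}.

Lemma near_snd_gt {R : realType} (r t s : R) : s < t -> \forall p \near ((r, t) : R * R), s < p.2.
Proof.
move=> st; exists (setT, [set y | s < y]) => [|p []//].
by split; [exact: filterT|exact: lt_nbhsr].
Qed.

Theorem velocity_heat_profile {R : realType} (n : nat) (eps R1 R2 q1 q2 : R) (q0 : R -> R)
    (lam : nat -> R) : n = 2%N \/ n = 3%N -> 0 < eps -> 0 < R1 -> R1 < R2 ->
  enumerates_positive_roots n eps R1 R2 q1 q2 lam ->
  q_well_defined n eps R1 R2 q1 q2 q0 lam ->
  Ck_on 2 `[R1, R2] q0 -> q0 R1 = q1 -> q0 R2 = q2 ->
  exists ph ps ch th, heat_profile n eps R1 R2 q1 q2 q0
    (q_formula n eps R1 R2 q1 q2 q0 lam) ph ps ch th.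
Proof.
move=> hn eps0 R1p R12 hlam hq hq0 hc1 hc2.
have [Phi [dPhi [rs gk]]] := green_kernel hn eps0 R1p R12 hlam hq.
have [f0 [f0' [f1 [f1' [rf0 Cf1 f0p wf f0q]]]]] := initial_profile n eps0 R1p R12 hq0 hc1 hc2.
have R12' := ltW R12.
have I1 : R1 <= R1 <= R2 by rewrite lexx.
have I2 : R1 <= R2 <= R2 by rewrite lexx R12'.
have en : eps != 0 by rewrite gt_eqF.
have hR1 : R1 / 2 < R1 by rewrite ltr_pdivrMr// ltr_pMr// ltr1n.
have half r : R1 <= r <= R2 -> R1 / 2 < r by move=> /andP[h _]; exact: lt_le_trans h.
have cf0 : con R1 R2 f0 := C1f_con (robin_C1 rf0).
pose S := heatS n.-1 R1 R2 lam Phi eps f0; pose T := heatT n.-1 R1 R2 lam Phi dPhi eps f0.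
have den r t : R1 / 2 < r -> 0 < t -> q_denominator n eps R1 R2 q1 q2 q0 lam r t = S 0%N r t.
  move=> hr t0; rewrite /q_denominator.
  transitivity (intR R1 R2 (fun xi => kernel n.-1 R1 R2 lam Phi eps (eigf n.-1 R1 R2 lam Phi) r xi t * f0 xi)).
    by apply: eq_int => xi hx; rewrite wf// gk.
  rewrite (kernel_int rs eps0 cf0 (growth_eg rs) t0 (ltW hr)).
  by apply: eq_nsum => m; rewrite mul1r.
have num r t : R1 / 2 < r -> 0 < t -> intR R1 R2 (fun xi =>
    (fun r' => green n eps R1 R2 q1 q2 lam r' xi t)^`()%classic r * weight eps R1 q0 xi) = T 0%N r t.
  move=> hr t0.
  transitivity (intR R1 R2 (fun xi => kernel n.-1 R1 R2 lam Phi eps (deg n.-1 R1 R2 lam Phi dPhi) r xi t * f0 xi)).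
    apply: eq_int => xi hx; rewrite wf//; congr (_ * _); apply: der_derive1.
    apply: (der_near _ (kernel_der rs eps0 t0 hr hx)).
    by near=> y; rewrite gk//; near: y; exact: lt_nbhsr.
  rewrite (kernel_int rs eps0 cf0 (growth_deg rs) t0 (ltW hr)).
  by apply: eq_nsum => m; rewrite mul1r.
have S0 r t : R1 < r < R2 -> 0 < t -> S 0%N r t != 0.
  move=> hr t0; have [_ h] := hq; rewrite -den ?h//.
  by case/andP: hr => h1 _; exact: lt_trans h1.
have tm a t : (a <= 2)%N -> 0 <= t -> summable_time a t by right.
have tp a t : 0 < t -> summable_time a t by left.
exists (S 0%N), (T 0%N), (S 1%N), (T 1%N); split => //.
- by move=> r t hr t0; rewrite /q_formula num// den.
- exact: (heat_positive rs eps0 rf0 Cf1 S0 f0p).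
- by move=> r t hr t0; apply: (heatS_der_r rs eps0 rf0 Cf1) => //; exact: tm.
- by move=> r t hr t0; apply: (heatT_der_r rs eps0 rf0 Cf1) => //; exact: tm.
- by move=> r t hr t0; apply: (heatS_der_r rs eps0 rf0 Cf1) => //; exact: tp.
- by move=> r t hr t0; apply: (heatS_der_t rs eps0 rf0 Cf1).
- by move=> r t hr t0; apply: (heatT_der_t rs eps0 rf0 Cf1).
- by move=> r t hr; apply: (heatS_cont rs eps0 rf0 Cf1) => //; exact: tm.
- by move=> r t hr; apply: (heatT_cont rs eps0 rf0 Cf1) => //; exact: tm.
- by move=> r t hr; apply: (heatS_cont rs eps0 rf0 Cf1) => //; exact: tm.
(* [T 1] carries three powers of [lam m], one too many for time 0; the time is cut off at [t / 2]
   instead. *)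
- move=> r t hr t0; have th : 0 < t / 2 by rewrite divr_gt0.
  have C := heatT_cont rs eps0 rf0 Cf1 (t := t) (tp R (2 * 1).+1 _ th) hr.
  apply: (cont_near (f := fun p : R * R => T 1%N p.1 (Num.max p.2 (t / 2))) _ C).
  have ht : t / 2 < t by rewrite ltr_pdivrMr// ltr_pMr// ltr1n.
  by apply: filterS (near_snd_gt r ht) => p /ltW hp; congr (T _ _ _); apply/max_idPl.
- move=> t t0; have [] := heat_robin rs eps0 rf0 Cf1 (tm R (2 * 0).+1 t isT t0); rewrite /S /T => e1 e2; rewrite ?e1 ?e2.
  by field.
- move=> t t0; have [] := heat_robin rs eps0 rf0 Cf1 (tm R (2 * 0).+1 t isT t0); rewrite /S /T => e1 e2; rewrite ?e1 ?e2.
  by field.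
- move=> r hr; rewrite /S /T (heatS_initial rs eps0 rf0 Cf1 S0 hr).
  by rewrite (heatT_initial rs eps0 rf0 Cf1 S0 hr) f0q.
Unshelve. all: by end_near.
Qed.

(** * Characteristics *)

Section flow_tools.
Context {R : realType}.
Implicit Types (f g c : R -> R) (a b x y s t : R).

(** Reduces a limit of difference quotients to sequences, for which dominated convergence is
    available; they may be assumed to stay within [e] of [x]. *)
Lemma seq_dnbhs f x (l e : R) : 0 < e -> (forall u : nat -> R, (forall n, u n != x) ->
  (forall n, `|x - u n| < e) ->
  u n @[n --> \oo] --> x -> f (u n) @[n --> \oo] --> l) -> f y @[y --> x^'] --> l.
Proof.
move=> e0 H; apply/cvgrPdist_le => d d0; apply: contrapT => nH.
have ex n : exists y, [/\ y != x, `|x - y| < Num.min e n.+1%:R^-1 & d < `|l - f y|].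
  apply: contrapT => /forallNP h; apply: nH.
  rewrite /dnbhs /within /=; apply/nbhs_ballP; exists (Num.min e n.+1%:R^-1).
    by rewrite /= lt_min e0 invr_gt0 ltr0Sn.
  move=> y /= yb yx; rewrite leNgt; apply/negP => h1; exact: (h y).
have [u hu] := choice ex.
have un n : u n != x by have [] := hu n.
have ue n : `|x - u n| < e by have [_ h _] := hu n; rewrite (lt_le_trans h)// ge_min lexx.
have ux : u n @[n --> \oo] --> x.
  apply/cvgrPdist_lt => c c0; near=> n; have [_ h _] := hu n; apply: (lt_trans (lt_le_trans h _)).
    by rewrite ge_min; apply/orP; right; exact: lexx.
  by near: n; exact: near_infty_natSinv_lt (PosNum c0).
have /cvgrPdist_le /(_ _ d0) [N _ hN] := H u un ue ux.
by have [_ _] := hu N; rewrite ltNge (hN N)//=.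
Unshelve. all: by end_near.
Qed.

Lemma squeeze_cont (T : topologicalType) (f G : T -> R) (x0 : T) :
  (\forall z \near x0, `|f z - f x0| <= G z) -> {for x0, continuous G} -> G x0 = 0 ->
  {for x0, continuous f}.
Proof.
move=> fG cG G0; apply/cvgrPdist_le => e e0.
have /cvgrPdist_le /(_ _ e0) := cG; apply: filterS2 fG => z h1; rewrite G0 sub0r normrN => h2.
by rewrite distrC (le_trans h1)// (le_trans _ h2)// ler_norm.
Qed.

Lemma der_seq f x (d : R) (y : nat -> R) : der f x d -> (forall n, y n != x) ->
  y n @[n --> \oo] --> x -> (f (y n) - f x) / (y n - x) @[n --> \oo] --> d.
Proof.
move=> /derP hd yx cy.
have h0 : (y n - x) @[n --> \oo] --> 0^'.
  move=> A; rewrite /dnbhs /within /= => hA.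
  have : y n - x @[n --> \oo] --> (0 : R).
    by rewrite -(subrr x); apply: cvgB => //; exact: cvg_cst.
  move=> /(_ _ hA); rewrite !near_simpl => hn.
  by apply: filterS hn => n; apply; rewrite subr_eq0.
have := cvg_comp _ _ h0 hd; apply: cvg_trans; apply: near_eq_cvg; near=> n => /=.
by rewrite subrK mulrC.
Unshelve. all: by end_near.
Qed.

Lemma con_measurable a b f : con a b f -> measurable_fun `[a, b]%classic f.
Proof.
by move=> /con_integrable/measurable_int/measurable_EFinP.
Qed.

(** Bounded convergence. Pointwise convergence may fail at [x0], which will be the instant at which
    a characteristic enters. *)
Lemma bounded_cvg (f : nat -> R -> R) g a b (M x0 : R) : a <= b -> (forall n, con a b (f n)) ->
  (forall n x, a <= x <= b -> `|f n x| <= M) -> measurable_fun `[a, b]%classic g ->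
  (forall x, a <= x <= b -> x != x0 -> f n x @[n --> \oo] --> g x) ->
  intR a b (f n) @[n --> \oo] --> intR a b g.
Proof.
move=> ab cf fM mg fg.
pose mu := @lebesgue_measure R.
have mE : measurable (`[a, b]%classic : set R) by [].
have m1 n : measurable_fun `[a, b]%classic (EFin \o f n).
  by apply/measurable_EFinP; exact: con_measurable.
have m2 : measurable_fun `[a, b]%classic (EFin \o g) by exact/measurable_EFinP.
have m3 : {ae mu, forall x, `[a, b]%classic x -> (EFin \o f n) x @[n --> \oo] --> (EFin \o g) x}.
  exists [set x0]; split => //; first exact: lebesgue_measure_set1.
  move=> x /= h; apply: contrapT => xx0; apply: h; rewrite /= in_itv/= => hx.
  by apply: cvg_EFin; [exact: nearW|apply: fg => //; apply/eqP].
have m4 : mu.-integrable `[a, b]%classic (fun=> M%:E).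
  exact: (@con_integrable R a b (fun=> M) (@con_cst R a b M)).
have m5 : {ae mu, forall x n, `[a, b]%classic x -> (`|(EFin \o f n) x| <= M%:E)%E}.
  by apply: aeW => x n /=; rewrite in_itv/= => hx; rewrite lee_fin; exact: fM.
have [ig _ H] := @dominated_convergence _ _ _ mu _ mE
  (fun n => EFin \o f n) (EFin \o g) (fun=> M%:E) m1 m2 m3 m4 m5.
rewrite /Rintegral; apply: fine_cvg.
by rewrite fineK//; exact: integrable_fin_num.
Qed.

Lemma if_measurable a b c x0 : con a b c ->
  measurable_fun `[a, b]%classic (fun s => if s < x0 then 0 else c s).
Proof.
move=> cc; apply: measurable_fun_if => //.
- by apply: measurable_fun_ltr => //; exact: measurable_id.
- apply: measurable_funS (con_measurable cc) => //.
Qed.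

Lemma int_from a x0 b c : a <= x0 <= b ->
  intR a b (fun s => if s < x0 then 0 else c s) = intR x0 b c.
Proof.
move=> /andP[ax xb].
have -> : (fun s => if s < x0 then 0 else c s) = c \_ `[x0, +oo[%classic.
  apply/funext => s; rewrite patchE; case: ifPn => h; case: ifPn => // h'.
    by move: h'; rewrite inE/= in_itv/= andbT leNgt h.
  by move: h'; rewrite notin_setE/= in_itv/= andbT leNgt => /negP; rewrite negbK (negbTE h).
rewrite -Rintegral_mkcondr; congr (Rintegral _ _ _).
apply/seteqP; split => s /=; rewrite !in_itv/= ?andbT.
  by move=> [/andP[_ ->] ->].
by move=> /andP[h ->]; rewrite h (le_trans ax).
Qed.

Lemma int_split a x b c : a <= x <= b -> con a b c ->
  intR a b c = intR a x c + intR x b c.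
Proof.
move=> /andP[ax xb] cc; have [F [F0 dF]] := primitive (le_trans ax xb) cc.
rewrite !(FTC2 (F := F)) ?(le_trans ax xb)//; first by ring.
- by move=> y /andP[y1 y2]; apply: dF; rewrite y2 (le_trans ax).
- exact: con_sub cc.
- by move=> y /andP[y1 y2]; apply: dF; rewrite y1 (le_trans y2).
- exact: con_sub cc.
Qed.

Lemma cont_pair (T U V : topologicalType) (f : T -> U) (g : T -> V) (x : T) :
  {for x, continuous f} -> {for x, continuous g} -> {for x, continuous (fun w : T => (f w, g w))}.
Proof.
move=> cf cg A [[P Q] [/= hP hQ] PQ]; have h1 : nbhs x (P \o f) by exact: cf.
have h2 : nbhs x (Q \o g) by exact: cg.
by apply: filterS2 h1 h2 => y h3 h4; exact: PQ.
Qed.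

Lemma cont_norm (T : topologicalType) (f : T -> R) (x : T) :
  {for x, continuous f} -> {for x, continuous (fun w => `|f w|)}.
Proof. by move=> cf; exact: (cvg_norm cf). Qed.

Lemma near_itv a x b : a < x < b -> \forall y \near x, a < y < b.
Proof.
move=> /andP[ax xb]; have h1 := lt_nbhsr ax; have h2 := lt_nbhsl xb.
by apply: filterS2 h1 h2 => y -> ->.
Qed.

Section parameters.
Context {T : topologicalType}.
Implicit Types (F : T -> R -> R) (p : T).

Lemma joint_con F p a b : (forall s, a <= s <= b -> {for (p, s), continuous (fun z => F z.1 z.2)}) ->
  con a b (F p).
Proof.
move=> h s /h hs; apply: (cont_comp (f := fun s => (p, s)) hs); exact: pair_contr.
Qed.

(** Compactness of the segment, in its near covering form, turns joint continuity into uniform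
    closeness of [F p'] to [F p]. *)
Lemma int_param_cont F p a b : a <= b ->
  (\forall p' \near p, forall s, a <= s <= b -> {for (p', s), continuous (fun z => F z.1 z.2)}) ->
  {for p, continuous (fun p => intR a b (F p))}.
Proof.
move=> ab H; have Hp := nbhs_singleton H.
apply/cvgrPdist_le => e e0; pose e' := e / (b - a + 1).
have bp : 0 < b - a + 1 by rewrite ltr_wpDl// subr_ge0.
have e'0 : 0 < e' by rewrite divr_gt0.
have e'2 : 0 < e' / 2 by rewrite divr_gt0.
have := @segment_compact R a b; rewrite compact_near_coveringP.
move=> /(_ T (nbhs p) (fun p' s => `|F p s - F p' s| <= e') _).
have cov s : `[a, b]%classic s -> \forall s' \near s & p' \near p, `|F p s' - F p' s'| <= e'.
  rewrite /= in_itv/= => hs; have := Hp s hs => /cvgrPdist_lt /(_ _ e'2) [[P1 P2] [/= h1 h2] h].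
  exists (P2, P1) => // -[s' p'] [/= h3 h4].
  have := h (p', s') (conj h4 h3); have := h (p, s') (conj (nbhs_singleton h1) h3).
  rewrite /= => u v; have := ler_normD (F p s' - F p s) (F p s - F p' s').
  have -> : F p s' - F p s + (F p s - F p' s') = F p s' - F p' s' by ring.
  by move: v; rewrite [`|F p s' - F p s|]distrC; lra.
move=> /(_ cov); apply: filterS2 H => p' H' /= h.
have c1 := joint_con Hp; have c2 := joint_con H'.
rewrite -intB//.
have hb : `|intR a b (fun x => F p x - F p' x)| <= e' * (b - a).
  apply: (int_bound ab); first exact: conB.
  by move=> x hx; apply: h; rewrite /= in_itv.
apply: (le_trans hb).
rewrite /e' mulrAC ler_pdivrMr// ler_pM2l//; lra.
Qed.

Lemma int_rescale f x : 0 <= x -> con 0 x f ->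
  intR 0 x f = x * intR 0 1 (fun s => f (x * s)).
Proof.
move=> x0 cf; have [G [G0 dG]] := primitive x0 cf.
have hx s : 0 <= s <= 1 -> 0 <= x * s <= x.
  by move=> /andP[s0 s1]; rewrite mulr_ge0// ler_piMr.
have cs : con 0 1 (fun s => f (x * s)).
  move=> s hs; apply: (cont_comp (g := f) (f := fun s => x * s)); first by apply: cf; exact: hx.
  by apply: contM; [exact: cvg_cst|exact: cvg_id].
have cxs : con 0 1 (fun s => x * f (x * s)) by apply: conM => //; exact: con_cst.
rewrite -intZ// (@FTC2 _ 0 x G f x0 dG cf).
rewrite (@FTC2 _ 0 1 (fun s => G (x * s)) (fun s => x * f (x * s)))// ?mulr1 ?mulr0//.
move=> s hs; apply: der_eq.
  apply: (der_comp (g := G)); first by apply: dG; exact: hx.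
  by apply: derZ; exact: der_id.
by rewrite mulr1 mulrC.
Qed.

End parameters.

(** Rescaling to the unit interval turns the variable upper bound into a parameter of the integrand;
    a negative bound is replaced by 0. *)
Lemma int_upper_cont (T : topologicalType) (F : T -> R -> R) (p : T) x :
  (\forall p' \near p, forall s, {for (p', s), continuous (fun z => F z.1 z.2)}) ->
  {for (p, x), continuous (fun z : T * R => intR 0 (Num.max z.2 0) (F z.1))}.
Proof.
move=> H.
apply: (cont_near (f := fun z : T * R => Num.max z.2 0 *
    intR 0 1 (fun s => F z.1 (Num.max z.2 0 * s)))).
  have : \forall z \near (p, x), forall s, {for (z.1, s), continuous (fun z => F z.1 z.2)}.
    by exists ([set p' | forall s, {for (p', s), continuous (fun z => F z.1 z.2)}], setT) => [|z []//];
      split => //; exact: filterT.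
  apply: filterS => z hz; have mz : 0 <= Num.max z.2 0 by rewrite le_max lexx orbT.
  by rewrite (int_rescale mz)//; apply: joint_con => s _; exact: hz.
have mc z0 : {for z0, continuous (fun z : T * R => Num.max z.2 0)}.
  by apply: (cont_comp (g := fun y : R => Num.max y 0)); [case: z0 => *; exact: max_cont|exact: cvg_snd].
apply: contM; first exact: mc.
apply: (@int_param_cont (T * R)%type (fun z s => F z.1 (Num.max z.2 0 * s)) (p, x) 0 1 ler01).
exists ([set p' | forall s, {for (p', s), continuous (fun z => F z.1 z.2)}], setT).
  by split => //; exact: filterT.
move=> [p' x'] [/= h _] s _.
apply: (cont_comp (g := fun z : T * R => F z.1 z.2)
  (f := fun z : (T * R) * R => (z.1.1, Num.max z.1.2 0 * z.2))); first exact: h.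
apply: cont_pair.
  by apply: (@continuous_comp _ _ _ fst fst); [exact: cvg_fst|exact: cvg_fst].
apply: contM; last exact: cvg_snd.
by apply: (cont_comp (g := fun z : T * R => Num.max z.2 0)); [exact: mc|exact: cvg_fst].
Qed.


Lemma mvt_any (f f' : R -> R) (x y : R) :
  (forall z, `|z - x| <= `|y - x| -> der f z (f' z)) ->
  exists c : R, `|c - x| <= `|y - x| /\ f y - f x = f' c * (y - x).
Proof.
move=> df; have [xy|yx|->] := ltgtP x y.
- have [|c [c1 c2 e]] := @MVT_der _ f f' _ _ xy.
    by move=> z /andP[z1 z2]; apply: df; rewrite !ger0_norm; lra.
  by exists c; split => //; rewrite !ger0_norm; lra.
- have [|c [c1 c2 e]] := @MVT_der _ f f' _ _ yx.
    by move=> z /andP[z1 z2]; apply: df; rewrite !ler0_norm; lra.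
  exists c; split; first by rewrite !ler0_norm; lra.
  by rewrite -opprB e; ring.
- by exists y; rewrite !subrr mulr0.
Qed.

(** The increment is split into one in the first variable at the displaced time [h + s], where the
    mean value theorem requires the derivative near the point, and one in time at the fixed position
    [X s], where the derivative at the point suffices. *)
Lemma chain2 (F F1 : R -> R -> R) (X : R -> R) s (X' F2 : R) :
  (\forall z \near ((X s, s) : R * R), der (F ^~ z.2) z.1 (F1 z.1 z.2)) ->
  {for (X s, s), continuous (fun z => F1 z.1 z.2)} ->
  der (F (X s)) s F2 -> der X s X' ->
  der (fun u => F (X u) u) s (F1 (X s) s * X' + F2).
Proof.
move=> [[P1 P2] [/= h1 h2] hd] cF1 dF2 dX; have cX := der_cont dX.
have [d /= d0 hP1] : exists2 d : R, 0 < d & forall y, `|y - X s| < d -> P1 y.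
  by case/nbhs_ballP: h1 => d /= d0 h; exists d => // y hy; apply: h; rewrite /ball/= distrC.
have cXh : X (h + s) @[h --> 0] --> X s.
  have c1 : (h + s) @[h --> (0 : R)] --> s.
    by rewrite -[X in _ --> X]add0r; apply: cvgD; [exact: cvg_id|exact: cvg_cst].
  exact: (cvg_comp _ _ c1 cX).
have ch : (h + s) @[h --> (0 : R)] --> s.
  by rewrite -[X in _ --> X]add0r; apply: cvgD; [exact: cvg_id|exact: cvg_cst].
have mv (h : R) : exists y : R, P2 (h + s) -> `|X (h + s) - X s| < d ->
    `|y - X s| <= `|X (h + s) - X s| /\
    F (X (h + s)) (h + s) - F (X s) (h + s) = F1 y (h + s) * (X (h + s) - X s).
  have [[p2 hx]|nh] := pselect (P2 (h + s) /\ `|X (h + s) - X s| < d); last first.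
    by exists 0 => p2 hx; case: nh.
  have [z hz|y hy] := @mvt_any (F ^~ (h + s)) (F1 ^~ (h + s)) (X s) (X (h + s)).
    by apply: (hd (z, h + s)); split => //=; apply: hP1; exact: le_lt_trans hx.
  by exists y.
have [y hy] := choice mv.
have near1 : \forall h \near (0 : R), P2 (h + s) /\ `|X (h + s) - X s| < d.
  apply: filterI; first exact: ch.
  by have /cvgrPdist_lt /(_ _ d0) := cXh; apply: filterS => h; rewrite distrC.
have cy : y h @[h --> 0] --> X s.
  apply/cvgrPdist_le => e e0.
  have /cvgrPdist_le /(_ _ e0) := cXh; apply: filterS2 near1 => h [p2 hx].
  have [h3 _] := hy h p2 hx; by rewrite distrC [`|X s - y h|]distrC; exact: le_trans.
have cF : F1 (y h) (h + s) @[h --> 0] --> F1 (X s) s.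
  move=> A /cF1 [[Q1 Q2] [/= q1 q2] Q12].
  have h3 : nbhs (0 : R) (Q1 \o y) by exact: cy.
  have h4 : nbhs (0 : R) (fun h => Q2 (h + s)) by exact: ch.
  by apply: filterS2 h3 h4 => h q3 q4; exact: (Q12 (y h, h + s)).
apply/derP; move/derP: dX => dX; move/derP: dF2 => dF2.
have L : F1 (y h) (h + s) * (h^-1 * (X (h + s) - X s)) + h^-1 * (F (X s) (h + s) - F (X s) s)
   @[h --> 0^'] --> F1 (X s) s * X' + F2.
  apply: cvgD => //; apply: cvgM => //.
  by move=> A hA; apply: nbhs_dnbhs; exact: (cF A hA).
apply: cvg_trans L; apply: near_eq_cvg.
apply: filterS (nbhs_dnbhs near1) => h [p2 hx].
have [_ h4] := hy h p2 hx; rewrite -[F (X (h + s)) (h + s)](subrK (F (X s) (h + s))) h4; ring.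
Qed.

(** Serves for the intermediate points [x h], [y h] supplied by mean value theorems. *)
Lemma cont_along (G : R -> R -> R) (r t K : R) (x y : R -> R) : 0 < K ->
  {for (r, t), continuous (fun z => G z.1 z.2)} ->
  (\forall h \near 0^', `|x h - r| <= K * `|h| /\ `|y h - t| <= `|h|) ->
  G (x h) (y h) @[h --> 0^'] --> G r t.
Proof.
move=> K0 cG hxy.
have lim (w : R -> R) (c C : R) : 0 < C -> (\forall h \near 0^', `|w h - c| <= C * `|h|) ->
    w h @[h --> 0^'] --> c.
  move=> C0 hw; apply/cvgrPdist_le => e e0.
  have eC : 0 < e / C by rewrite divr_gt0.
  have hn : \forall h \near (0 : R)^', `|h| < e / C by exact: dnbhs0_lt.
  apply: filterS2 hw hn => h h1 h2.
  by rewrite distrC (le_trans h1)// -ler_pdivlMl// mulrC ltW.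
have cx : x h @[h --> 0^'] --> r by apply: (lim _ _ K K0); apply: filterS hxy => h [].
have cy : y h @[h --> 0^'] --> t.
  by apply: (lim _ _ 1 ltr01); apply: filterS hxy => h []; rewrite mul1r.
move=> A /cG [[Q1 Q2] [/= a1 a2] Q12].
have h3 : nbhs 0^' (Q1 \o x) by exact: cx.
have h4 : nbhs 0^' (Q2 \o y) by exact: cy.
by apply: filterS2 h3 h4 => h q3 q4; exact: (Q12 (x h, y h)).
Qed.

End flow_tools.

(** * Flow of a velocity field extended by its side values *)

Section flow.
Context {R : realType}.
Variables (R1 R2 : R).
Hypothesis R12 : R1 < R2.
Implicit Types (g gr : R -> R -> R) (r s t y z : R).

(* [gr] is the derivative in [y] of [g]; it need not vanish at the sides, where [g],
   being constant beyond them, has a corner. *)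
Record slab g gr : Prop := {
  slab_cont : forall y s, {for (y, s), continuous (fun z : R * R => g z.1 z.2)};
  slab_contr : forall y s, {for (y, s), continuous (fun z : R * R => gr z.1 z.2)};
  slab_clamp : forall y s, g y s = g (clamp R1 R2 y) s;
  slab_clampr : forall y s, gr y s = gr (clamp R1 R2 y) s;
  slab_der : forall y s, R1 < y < R2 -> 0 <= s -> der (g ^~ s) y (gr y s)
}.

Lemma rect_bounded g T : 0 <= T ->
  (forall y s, {for (y, s), continuous (fun z : R * R => g z.1 z.2)}) ->
  exists2 M : R, 0 < M & forall y s, R1 <= y <= R2 -> 0 <= s <= T -> `|g y s| <= M.
Proof.
move=> T0 cg; pose A := `[R1, R2]%classic `*` `[0, T]%classic.
have cA : compact A by apply: compact_setX; exact: segment_compact.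
have A0 : A !=set0 by exists (R1, 0); split; rewrite /= in_itv/= lexx ?(ltW R12) ?T0.
have cf : {within A, continuous (fun z : R * R => `|g z.1 z.2|)}.
  apply: continuous_in_subspaceT => -[y s] _.
  exact: (cvg_norm (cg y s)).
have [[y0 s0] _ h] := compact_EVT_max A0 cA cf.
exists (`|g y0 s0| + 1); first by rewrite ltr_wpDl.
move=> y s hy hs; rewrite (le_trans (h (y, s) _)) ?lerDl ?ler01//.
by apply/mem_set; split; rewrite /= in_itv.
Qed.

Lemma slab_slice g gr s : slab g gr -> forall y, {for y, continuous (g ^~ s)}.
Proof.
move=> sg y; apply: (cont_comp (g := fun z : R * R => g z.1 z.2) (f := fun y => (y, s))).
  exact: slab_cont sg y s.
exact: pair_contl.
Qed.

(** Everything is read at the clamped position, so that bounds on a rectangle are global. The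
    Lipschitz bound is the mean value theorem, which asks for the derivative in the open interval
    only and thus tolerates the corners. *)
Lemma slab_bounds g gr T : slab g gr -> 0 <= T -> exists2 K : R, 0 < K &
  forall s, 0 <= s <= T -> forall y, [/\ `|g y s| <= K, `|gr y s| <= K &
    forall z, `|g y s - g z s| <= K * `|y - z|].
Proof.
move=> sg T0; have [M M0 hM] := rect_bounded T0 (slab_cont sg).
have [N N0 hN] := rect_bounded T0 (slab_contr sg).
exists (M + N); first exact: addr_gt0.
move=> s hs y; have cy := clampP y (ltW R12); split.
- by rewrite (slab_clamp sg) (le_trans (hM _ _ cy hs))// lerDl ltW.
- by rewrite (slab_clampr sg) (le_trans (hN _ _ cy hs))// lerDr ltW.
move=> z; apply: (@le_trans _ _ (N * `|y - z|)); last by rewrite ler_wpM2r// lerDr ltW.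
rewrite (slab_clamp sg y) (slab_clamp sg z).
apply: (@le_trans _ _ (N * `|clamp R1 R2 y - clamp R1 R2 z|)); last first.
  by rewrite ler_pM2l// clamp_lip// ltW.
have cz := clampP z (ltW R12); move: cy cz.
move: (clamp R1 R2 y) (clamp R1 R2 z) => {}y {}z cy cz.
wlog yz : y z cy cz / y <= z => [H|].
  by have [|/ltW h] := leP y z; [exact: H|rewrite distrC [`|y - z|]distrC; exact: H].
have [->|ne] := eqVneq y z; first by rewrite !subrr normr0 mulr0.
have ltyz : y < z by rewrite lt_neqAle ne.
have /andP[y1 y2] := cy; have /andP[z1 z2] := cz.
have [||c] := @MVT _ (g ^~ s) (gr ^~ s) y z ltyz.
- move=> x; rewrite in_itv/= => /andP[x1 x2]; apply: (slab_der sg).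
    by rewrite (le_lt_trans y1 x1) (lt_le_trans x2 z2).
  by case/andP: hs.
- have cs : con y z (g ^~ s) by move=> x _; exact: (@slab_slice g gr s sg x).
  exact: con_within cs.
rewrite in_itv/= => /andP[c1 c2]; rewrite distrC => ->.
rewrite normrM [`|y - z|]distrC ler_wpM2r//; apply: hN => //.
by rewrite (le_trans y1 (ltW c1)) (le_trans (ltW c2) z2).
Qed.

Variables (Q Qr : R -> R -> R).
Hypothesis sQ : slab Q Qr.

Definition solution t (X : R -> R) := forall s, 0 <= s <= t -> der X s (Q (X s) s).

Lemma solution_le t t' X : t <= t' -> solution t' X -> solution t X.
Proof. by move=> tt H s /andP[s0 st]; apply: H; rewrite s0 (le_trans st). Qed.

(** The squared difference is differentiable, and the weights [expR (c * v)] with [c = - (2 * K)] or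
    [c = 2 * K] make it monotone. Both directions of time serve, the forward one to show that
    distinct characteristics never meet. *)
Lemma gronwall t K X Y : 0 <= K ->
  (forall s, 0 <= s <= t -> forall y z, `|Q y s - Q z s| <= K * `|y - z|) ->
  solution t X -> solution t Y ->
  forall s u, 0 <= s <= t -> 0 <= u <= t ->
  `|X s - Y s| <= expR (K * `|s - u|) * `|X u - Y u|.
Proof.
move=> K0 hQ hX hY s u hs hu; pose D v := X v - Y v.
have dD v : 0 <= v <= t -> der D v (Q (X v) v - Q (Y v) v).
  by move=> hv; apply: derB; [exact: hX|exact: hY].
have DQ v : 0 <= v <= t -> `|D v * (Q (X v) v - Q (Y v) v)| <= K * D v ^+ 2.
  move=> hv; rewrite normrM -[D v ^+ 2]ger0_norm ?sqr_ge0// normrX.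
  by rewrite expr2 mulrCA ler_wpM2l// hQ.
have dE (c : R) v : 0 <= v <= t -> der (fun v => expR (c * v) * D v ^+ 2) v
    (expR (c * v) * (c * D v ^+ 2 + 2 * (D v * (Q (X v) v - Q (Y v) v)))).
  move=> hv; apply: der_eq.
    apply: derM; first by apply: der_expR; apply: derZ; exact: der_id.
    by apply: (derX 2); exact: dD.
  by rewrite /= expr1; ring.
suff H : expR (- (2 * K * `|s - u|)) * D s ^+ 2 <= D u ^+ 2.
  have e1 : expR (- (2 * K * `|s - u|)) = expR (K * `|s - u|) ^- 2.
    by rewrite expRN -expRM_natl; congr (expR _)^-1; ring.
  move: H; rewrite e1 ler_pdivrMl ?exprn_gt0 ?expR_gt0// -exprMn => H.
  rewrite -(@ler_pXn2r _ 2) ?nnegrE ?mulr_ge0 ?expR_ge0//.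
  by rewrite -normrX ger0_norm ?sqr_ge0// exprMn -normrX [`|_ ^+ 2|]ger0_norm ?sqr_ge0// -exprMn.
have eqle (a b : R) : a = b -> a <= b by move=> ->.
move: hs hu => /andP[s0 st] /andP[u0 ut].
have [us|/ltW su] := leP u s.
  rewrite ger0_norm ?subr_ge0//.
  have hv v : u <= v <= s -> 0 <= v <= t by move=> /andP[a b]; rewrite (le_trans u0 a) (le_trans b st).
  have H := @der_ge0_le _ (fun v => - (expR (- (2 * K) * v) * D v ^+ 2)) _ u s us
    (fun v h => derN (dE (- (2 * K)) v (hv v h))).
  have {H} : expR (- (2 * K) * s) * D s ^+ 2 <= expR (- (2 * K) * u) * D u ^+ 2.
    rewrite -lerN2; apply: H => v /hv hv'; rewrite -mulrN mulr_ge0 ?expR_ge0//.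
    by have := DQ v hv'; rewrite ler_norml => /andP[_]; lra.
  rewrite -ler_pdivlMl ?expR_gt0// mulrA -expRN -expRD => H.
  rewrite expRN ler_pdivrMl ?expR_gt0//; apply: (le_trans H); apply: eqle.
  congr (expR _ * _); ring.
rewrite ler0_norm ?subr_le0//.
have hv v : s <= v <= u -> 0 <= v <= t by move=> /andP[a b]; rewrite (le_trans s0 a) (le_trans b ut).
have := @der_ge0_le _ (fun v => expR (2 * K * v) * D v ^+ 2) _ s u su
  (fun v h => dE (2 * K) v (hv v h)).
move=> H; have {H} : expR (2 * K * s) * D s ^+ 2 <= expR (2 * K * u) * D u ^+ 2.
  apply: H => v /hv hv'; rewrite mulr_ge0 ?expR_ge0//.
  by have := DQ v hv'; rewrite ler_norml => /andP[+ _]; lra.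
rewrite -ler_pdivlMl ?expR_gt0// mulrA -expRN -expRD => H.
rewrite expRN ler_pdivrMl ?expR_gt0//; apply: (le_trans H); apply: eqle.
congr (expR _ * _); ring.
Qed.

(** [B r t] is the characteristic continued down to time 0, [t0 r t] its time of entry, before which
    it stays outside the interval. [T0] expresses this time by the position at time 0, from which
    the continuity of [t0] follows. *)
Variables (B : R -> R -> R -> R) (t0 : R -> R -> R) (T0 : R -> R).
Hypothesis hB : forall r t, R1 < r < R2 -> 0 < t -> B r t t = r /\ solution t (B r t).
Hypothesis hK : forall r t, R1 < r < R2 -> 0 < t -> [/\ 0 <= t0 r t < t,
  forall s, t0 r t < s <= t -> R1 < B r t s < R2 &
  forall s, 0 <= s < t0 r t -> B r t s < R1 \/ R2 < B r t s].
Hypothesis T0c : forall a, {for a, continuous T0}.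
Hypothesis ht0 : forall r t, R1 < r < R2 -> 0 < t -> t0 r t = T0 (B r t 0).

(** Clamping the time makes the characteristics functions on the whole line, jointly continuous in
    end point and time. *)
Definition Bc (p : R * R) s := B p.1 p.2 (clamp 0 p.2 s).

Lemma BcE r t s : 0 <= s <= t -> Bc (r, t) s = B r t s.
Proof. by move=> h; rewrite /Bc /= clamp_id. Qed.

Lemma lt_int r : R1 < r < R2 -> R1 <= r <= R2.
Proof. by move=> /andP[a b]; rewrite (ltW a) (ltW b). Qed.

Lemma solution_lip t K X : solution t X -> (forall s, 0 <= s <= t -> forall y, `|Q y s| <= K) ->
  forall x y, 0 <= x <= t -> 0 <= y <= t -> `|X x - X y| <= K * `|x - y|.
Proof.
move=> sX hQ x y /andP[x0 xt] /andP[y0 yt].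
wlog yx : x y x0 xt y0 yt / y <= x => [H|].
  by have [|/ltW h] := leP y x; [exact: H|rewrite distrC [`|x - y|]distrC; exact: H].
have [->|ne] := eqVneq y x; first by rewrite !subrr normr0 mulr0.
have ltyx : y < x by rewrite lt_neqAle ne.
have [|c [c1 c2 ->]] := @MVT_der _ X (fun s => Q (X s) s) _ _ ltyx.
  by move=> z /andP[z1 z2]; apply: sX; rewrite (le_trans y0 z1) (le_trans z2 xt).
by rewrite normrM ler_wpM2r// hQ// (le_trans y0 (ltW c1)) (le_trans (ltW c2) xt).
Qed.

Lemma clamp_lip2 t t' s : `|clamp 0 t' s - clamp 0 t s| <= `|t' - t|.
Proof.
rewrite /clamp.
have H1 := ler_norm (t' - t); have := ler_norm (t - t'); rewrite distrC => H2.
have [h1|h1] := leP s t'; have [h2|h2] := leP s t;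
have [h3|h3] := leP 0 s; have [h4|h4] := leP 0 t; have [h5|h5] := leP 0 t';
by rewrite ler_norml; apply/andP; split; lra.
Qed.

(** The two characteristics are compared at the smaller of the two end times, where Gronwall's
    inequality applies; the rest is the bound [K] on the speed. *)
Lemma Bc_lip T : 0 < T -> exists2 C : R, 0 < C & forall r t r' t' s s',
  R1 < r < R2 -> R1 < r' < R2 -> 0 < t <= T -> 0 < t' <= T ->
  `|Bc (r', t') s' - Bc (r, t) s| <= C * (`|r' - r| + `|t' - t| + `|s' - s|).
Proof.
move=> Tp; have [K K0 hKb] := slab_bounds sQ (ltW Tp).
have eT : 0 < expR (K * T) by exact: expR_gt0.
pose C := K + K + expR (K * T) * (1 + K).
have C0 : 0 < C by rewrite !addr_gt0 // mulr_gt0// addr_gt0.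
exists C => // r t r' t' s s' hr hr' ht ht'.
wlog tt' : r t r' t' s s' hr hr' ht ht' / t <= t' => [H|].
  have [|/ltW h] := leP t t'; first exact: H.
  by rewrite distrC [`|r' - r|]distrC [`|t' - t|]distrC [`|s' - s|]distrC; exact: H.
case/andP: ht => tp tT; case/andP: ht' => tp' tT'.
have [e1 s1] := hB hr tp; have [e2 s2] := hB hr' tp'.
have b1 u : 0 <= u <= t -> forall y, `|Q y u| <= K.
  by move=> /andP[u0 ut] y; have [] := hKb u _ y => //; rewrite u0 (le_trans ut tT).
have b2 u : 0 <= u <= t' -> forall y, `|Q y u| <= K.
  by move=> /andP[u0 ut] y; have [] := hKb u _ y => //; rewrite u0 (le_trans ut tT').
have lipK u : 0 <= u <= t -> forall y z, `|Q y u - Q z u| <= K * `|y - z|.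
  by move=> /andP[u0 ut] y z; have [_ _] := hKb u (ltac:(by rewrite u0 (le_trans ut tT))) y; exact.
have c1 u := clampP u (ltW tp); have c2 u := clampP u (ltW tp').
have c12 u : 0 <= clamp 0 t u <= t' by have /andP[-> h] := c1 u; rewrite (le_trans h tt').
rewrite /Bc /=.
have E1 := solution_lip s2 b2 (c2 s') (c12 s').
have E2 := solution_lip s1 b1 (c1 s') (c1 s).
have tt : 0 <= t <= t by rewrite lexx ltW.
have tt2 : 0 <= t <= t' by rewrite tt' ltW.
have E3 := gronwall (ltW K0) lipK (solution_le tt' s2) s1 (c1 s') tt.
have E4 := solution_lip s2 b2 tt2 (ltac:(by rewrite lexx ltW) : 0 <= t' <= t').
rewrite e1 in E3; rewrite e2 in E4.
have E5 := clamp_lip2 t t' s'; have E6 := clamp_lip s' s (ltW tp).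
have F1 : `|B r' t' (clamp 0 t' s') - B r' t' (clamp 0 t s')| <= K * `|t' - t|.
  by apply: (le_trans E1); rewrite ler_wpM2l// ltW.
have F2 : `|B r t (clamp 0 t s') - B r t (clamp 0 t s)| <= K * `|s' - s|.
  by apply: (le_trans E2); rewrite ler_wpM2l// ltW.
have F3 : `|B r' t' (clamp 0 t s') - B r t (clamp 0 t s')| <=
    expR (K * T) * (`|r' - r| + K * `|t' - t|).
  apply: (le_trans E3); apply: ler_pM; rewrite ?expR_ge0//.
    rewrite ler_expR ler_pM2l// ler_norml; have /andP[a1 a2] := c1 s'.
    by apply/andP; split; lra.
  have := ler_normD (B r' t' t - r') (r' - r); rewrite addrA subrK distrC [`|t - t'|]distrC in E4 *.
  lra.
have := ler_normD (B r' t' (clamp 0 t' s') - B r' t' (clamp 0 t s')) (B r' t' (clamp 0 t s') - B r t (clamp 0 t s)).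
have := ler_normD (B r' t' (clamp 0 t s') - B r t (clamp 0 t s')) (B r t (clamp 0 t s') - B r t (clamp 0 t s)).
rewrite !addrA !subrK => G1 G2; apply: (le_trans G2); apply: (le_trans (lerD F1 G1)).
apply: (le_trans (lerD (lexx _) (lerD F3 F2))).
have n1 := normr_ge0 (r' - r); have n2 := normr_ge0 (t' - t); have n3 := normr_ge0 (s' - s).
rewrite /C; move: (expR (K * T)) eT n1 n2 n3; move: (`|r' - r|) (`|t' - t|) (`|s' - s|) => x y z e e0 x0 y0 z0.
rewrite -subr_ge0.
have -> : (K + K + e * (1 + K)) * (x + y + z) - (K * y + (e * (x + K * y) + K * z)) =
  K * (2 * x + y + z) + e * (y + z) + e * (K * (x + z)) by ring.
have [K0' e0'] := (ltW K0, ltW e0).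
by rewrite !addr_ge0// !mulr_ge0// !addr_ge0// mulr_ge0.
Qed.

Lemma near_int r t : R1 < r < R2 -> 0 < t ->
  \forall p \near ((r, t) : R * R), [/\ R1 < p.1 < R2, 0 < p.2 & p.2 < t + 1].
Proof.
move=> hr tp.
exists ([set y | R1 < y < R2], [set u | 0 < u < t + 1]); last by move=> p [/= -> /andP[-> ->]].
split; first exact: (near_itv hr).
by apply: (@near_itv _ 0 t (t + 1)); rewrite tp ltrDl ltr01.
Qed.

Lemma Bc_cont r t s : R1 < r < R2 -> 0 < t ->
  {for ((r, t), s), continuous (fun z : (R * R) * R => Bc z.1 z.2)}.
Proof.
move=> hr tp; have t1p : 0 < t + 1 by rewrite addr_gt0.
have [C C0 hC] := Bc_lip t1p.
apply: (squeeze_cont (G := fun z : (R * R) * R =>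
    C * (`|z.1.1 - r| + `|z.1.2 - t| + `|z.2 - s|))).
- have hn : \forall z \near (((r, t), s) : (R * R) * R), [/\ R1 < z.1.1 < R2, 0 < z.1.2 & z.1.2 < t + 1].
    exists ([set p : R * R | [/\ R1 < p.1 < R2, 0 < p.2 & p.2 < t + 1]], setT) => [|z []//].
    by split; [exact: near_int|exact: filterT].
  apply: filterS hn => -[[r' t'] s'] /= [h1 h2 h3]; apply: hC => //.
    by rewrite tp ler_wpDr.
  by rewrite h2 ltW.
- apply: contM; first exact: cvg_cst.
  apply: contD; first apply: contD.
  + apply: cont_norm; apply: contB; last exact: cvg_cst.
    by apply: (@continuous_comp _ _ _ fst fst); exact: cvg_fst.
  + apply: cont_norm; apply: contB; last exact: cvg_cst.
    by apply: (@continuous_comp _ _ _ fst snd); [exact: cvg_fst|exact: cvg_snd].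
  + by apply: cont_norm; apply: contB; [exact: cvg_snd|exact: cvg_cst].
- by rewrite /= !subrr !normr0 !addr0 mulr0.
Qed.


Definition Pint (h : R -> R -> R) (p : R * R) x := intR 0 (Num.max x 0) (fun s => h (Bc p s) s).

Lemma along_cont (h : R -> R -> R) r t s :
  (forall y s, {for (y, s), continuous (fun z : R * R => h z.1 z.2)}) ->
  R1 < r < R2 -> 0 < t ->
  {for ((r, t), s), continuous (fun z : (R * R) * R => h (Bc z.1 z.2) z.2)}.
Proof.
move=> ch hr tp.
apply: (cont_comp (g := fun z : R * R => h z.1 z.2)
  (f := fun z : (R * R) * R => (Bc z.1 z.2, z.2))); first exact: ch.
by apply: cont_pair; [exact: Bc_cont|exact: cvg_snd].
Qed.

Lemma along_con (h : R -> R -> R) r t a b :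
  (forall y s, {for (y, s), continuous (fun z : R * R => h z.1 z.2)}) ->
  R1 < r < R2 -> 0 < t -> con a b (fun s => h (Bc (r, t) s) s).
Proof.
move=> ch hr tp; apply: (joint_con (F := fun p s => h (Bc p s) s)) => s _.
exact: along_cont.
Qed.

Lemma near_joint (F : R * R -> R -> R) r t : R1 < r < R2 -> 0 < t ->
  (forall r t s, R1 < r < R2 -> 0 < t -> {for ((r, t), s), continuous (fun z : (R * R) * R => F z.1 z.2)}) ->
  \forall p \near ((r, t) : R * R), forall s, {for (p, s), continuous (fun z : (R * R) * R => F z.1 z.2)}.
Proof. by move=> hr tp H; apply: filterS (near_int hr tp) => -[r' t'] [/= h1 h2 _] s; exact: H. Qed.

Lemma Pint_cont h r t x : (forall y s, {for (y, s), continuous (fun z : R * R => h z.1 z.2)}) ->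
  R1 < r < R2 -> 0 < t ->
  {for ((r, t), x), continuous (fun z : (R * R) * R => Pint h z.1 z.2)}.
Proof.
move=> ch hr tp; apply: (@int_upper_cont _ (R * R)%type (fun p s => h (Bc p s) s)).
apply: (near_joint (F := fun p s => h (Bc p s) s)) => // r' t' s h1 h2; exact: along_cont.
Qed.

Definition Zint (h : R -> R -> R) r t := intR 0 t (fun s => h (B r t s) s).

Lemma ZintE h r t : 0 <= t -> Zint h r t = Pint h (r, t) t.
Proof.
move=> tp; rewrite /Zint /Pint max_l//; apply: eq_int => s hs.
by rewrite BcE.
Qed.

Lemma snd_pair_cont r t : {for (r, t), continuous (fun p : R * R => (p, p.2))}.
Proof. by apply: cont_pair; [exact: cvg_id|exact: cvg_snd]. Qed.

Lemma Zint_cont h r t : (forall y s, {for (y, s), continuous (fun z : R * R => h z.1 z.2)}) ->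
  R1 < r < R2 -> 0 < t -> {for (r, t), continuous (fun p : R * R => Zint h p.1 p.2)}.
Proof.
move=> ch hr tp; apply: (cont_near (f := fun p : R * R => Pint h p p.2)).
  by apply: filterS (near_int hr tp) => -[r' t'] [/= _ /ltW h2 _]; rewrite ZintE.
apply: (cont_comp (g := fun z : (R * R) * R => Pint h z.1 z.2) (f := fun p : R * R => (p, p.2))).
  exact: Pint_cont.
exact: snd_pair_cont.
Qed.

(** The derivative of [Zint] in [r]. The exponential is the derivative of the position at time [s]
    with respect to the end position. The integral starts at [t0 r t], since before that time the
    extended integrand does not depend on the position. *)
Definition Zr gr r t := intR (t0 r t) t (fun s => gr (B r t s) s *
  expR (- intR s t (fun u => Qr (B r t u) u))).

Lemma Pint_sub h r t s : (forall y s, {for (y, s), continuous (fun z : R * R => h z.1 z.2)}) ->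
  R1 < r < R2 -> 0 < t -> 0 <= s <= t ->
  intR s t (fun u => h (B r t u) u) = Pint h (r, t) t - Pint h (r, t) s.
Proof.
move=> ch hr tp /andP[s0 st]; rewrite /Pint max_l ?(ltW tp)// max_l//.
rewrite (@int_split _ 0 s t) ?s0//; last exact: along_con.
rewrite addrAC subrr add0r; apply: eq_int => u /andP[u1 u2]; rewrite BcE//.
by rewrite (le_trans s0 u1).
Qed.

Definition Zkernel gr (p : R * R) s :=
  gr (Bc p s) s * expR (- (Pint Qr p p.2 - Pint Qr p s)).

Lemma Zkernel_cont gr r t s : (forall y s, {for (y, s), continuous (fun z : R * R => gr z.1 z.2)}) ->
  R1 < r < R2 -> 0 < t ->
  {for ((r, t), s), continuous (fun z : (R * R) * R => Zkernel gr z.1 z.2)}.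
Proof.
move=> cg hr tp; apply: contM; first exact: along_cont.
apply: (cont_comp (g := expR)); first exact: continuous_expR.
have cP x : {for ((r, t), x), continuous (fun z : (R * R) * R => Pint Qr z.1 z.2)}.
  by apply: Pint_cont => //; exact: (slab_contr sQ).
apply: contN; apply: contB; last exact: cP.
apply: (cont_comp (g := fun p : R * R => Pint Qr p p.2) (f := fst)); last exact: cvg_fst.
apply: (cont_comp (g := fun z : (R * R) * R => Pint Qr z.1 z.2) (f := fun p : R * R => (p, p.2))).
  exact: cP.
exact: snd_pair_cont.
Qed.

Lemma ZrE gr r t : (forall y s, {for (y, s), continuous (fun z : R * R => gr z.1 z.2)}) ->
  R1 < r < R2 -> 0 < t ->
  Zr gr r t = intR 0 (Num.max t 0) (Zkernel gr (r, t)) - intR 0 (Num.max (t0 r t) 0) (Zkernel gr (r, t)).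
Proof.
move=> cg hr tp; have [/andP[h1 h2] _ _] := hK hr tp.
rewrite max_l ?(ltW tp)// max_l//.
rewrite (@int_split _ 0 (t0 r t) t) ?h1 ?(ltW h2)//; last first.
  by apply: (joint_con (F := Zkernel gr)) => s _; exact: Zkernel_cont.
rewrite addrAC subrr add0r; apply: eq_int => s /andP[s1 s2].
have hs : 0 <= s <= t by rewrite (le_trans h1 s1).
by rewrite /Zkernel BcE// (Pint_sub (slab_contr sQ) hr tp hs).
Qed.

Lemma B0_cont r t : R1 < r < R2 -> 0 < t -> {for (r, t), continuous (fun p : R * R => B p.1 p.2 0)}.
Proof.
move=> hr tp; apply: (cont_near (f := fun p : R * R => Bc p 0)).
  by apply: filterS (near_int hr tp) => -[r' t'] [/= _ /ltW h _]; rewrite BcE// lexx.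
apply: (cont_comp (g := fun z : (R * R) * R => Bc z.1 z.2) (f := fun p => (p, 0))).
  exact: Bc_cont.
exact: pair_contl.
Qed.

Lemma t0_cont r t : R1 < r < R2 -> 0 < t -> {for (r, t), continuous (fun p : R * R => t0 p.1 p.2)}.
Proof.
move=> hr tp; apply: (cont_near (f := fun p : R * R => T0 (B p.1 p.2 0))).
  by apply: filterS (near_int hr tp) => -[r' t'] [/= h1 h2 _]; rewrite ht0.
by apply: (cont_comp (g := T0)); [exact: T0c|exact: B0_cont].
Qed.

Lemma Zr_cont gr r t : (forall y s, {for (y, s), continuous (fun z : R * R => gr z.1 z.2)}) ->
  R1 < r < R2 -> 0 < t -> {for (r, t), continuous (fun p : R * R => Zr gr p.1 p.2)}.
Proof.
move=> cg hr tp; pose G (z : (R * R) * R) := intR 0 (Num.max z.2 0) (Zkernel gr z.1).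
have cG x : {for ((r, t), x), continuous G}.
  apply: (@int_upper_cont _ (R * R)%type (Zkernel gr)).
  by apply: (near_joint (F := Zkernel gr)) => // r' t' s h1 h2; exact: Zkernel_cont.
apply: (cont_near (f := fun p : R * R => G (p, p.2) - G (p, t0 p.1 p.2))).
  by apply: filterS (near_int hr tp) => -[r' t'] [/= h1 h2 _]; rewrite ZrE.
apply: contB.
  by apply: (cont_comp (g := G) (f := fun p : R * R => (p, p.2))); [exact: cG|exact: snd_pair_cont].
apply: (cont_comp (g := G) (f := fun p : R * R => (p, t0 p.1 p.2))); first exact: cG.
by apply: cont_pair; [exact: cvg_id|exact: t0_cont].
Qed.


Lemma slab_outside g gr y s : slab g gr -> y < R1 \/ R2 < y -> der (g ^~ s) y 0.
Proof.
move=> sg hy; apply: (der_near (f := fun=> g y s)); last exact: der_cst.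
case: hy => hy.
  apply: filterS (lt_nbhsl hy) => z /ltW zR; rewrite (slab_clamp sg y) (slab_clamp sg z).
  by rewrite !clamp_lt// ltW.
apply: filterS (lt_nbhsr hy) => z /ltW zR; rewrite (slab_clamp sg y) (slab_clamp sg z).
by rewrite !clamp_gt// ltW.
Qed.

Lemma int_open r : R1 < r < R2 -> exists2 e : R, 0 < e & forall y, `|r - y| < e -> R1 < y < R2.
Proof.
move=> /andP[r1 r2]; exists (Num.min (r - R1) (R2 - r)); first by rewrite lt_min !subr_gt0 r1.
move=> y; rewrite lt_min !ltr_norml => /andP[/andP[a b] /andP[c e]].
by apply/andP; split; lra.
Qed.

(* The difference of two characteristics at the same time solves D' = k D with
   k a difference quotient of Q; these quotients converge except at the time
   at which the limit characteristic leaves the strip. *)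
Lemma Zint_der_r g gr r t : slab g gr -> R1 < r < R2 -> 0 < t ->
  der (fun r => Zint g r t) r (Zr gr r t).
Proof.
move=> sg hr tp; have [eB sB] := hB hr tp; have [/andP[h0 h0t] hin hout] := hK hr tp.
have [K K0 hKb] := slab_bounds sQ (ltW tp); have [L L0 hLb] := slab_bounds sg (ltW tp).
have lipK s : 0 <= s <= t -> forall y z, `|Q y s - Q z s| <= K * `|y - z|.
  by move=> hs y z; have [_ _] := hKb s hs y; exact.
have [e e0 he] := int_open hr.
have cB0 : con 0 t (B r t) := con_der sB.
have cQr : con 0 t (fun s => Qr (B r t s) s).
  move=> s hs; apply: (cont_comp (g := fun z : R * R => Qr z.1 z.2) (f := fun s => (B r t s, s))).
    exact: (slab_contr sQ).
  by apply: cont_pair; [exact: cB0|exact: cvg_id].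
have [H [H0 dH]] := primitive (ltW tp) cQr.
pose c s := gr (B r t s) s * expR (H s - H t).
have cc : con 0 t c.
  apply: conM.
    move=> s hs; apply: (cont_comp (g := fun z : R * R => gr z.1 z.2) (f := fun s => (B r t s, s))).
      exact: (slab_contr sg).
    by apply: cont_pair; [exact: cB0|exact: cvg_id].
  move=> s hs; apply: (cont_comp (g := expR)); first exact: continuous_expR.
  by apply: contB; [exact: (con_der dH)|exact: cvg_cst].
have intH s : 0 <= s <= t -> intR s t (fun u => Qr (B r t u) u) = H t - H s.
  move=> /andP[s0 st]; apply: FTC2 => //.
    by move=> u /andP[u1 u2]; apply: dH; rewrite (le_trans s0 u1).
  exact: con_sub cQr.
have -> : Zr gr r t = intR 0 t (fun s => if s < t0 r t then 0 else c s).
  have h00 : 0 <= t0 r t <= t by rewrite h0 ltW.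
  rewrite (int_from c h00); apply: eq_int => s /andP[s1 s2].
  by rewrite /c intH ?opprB// (le_trans h0 s1).
apply/derP; apply: (seq_dnbhs e0) => u un ue ucv.
pose rn n := u n + r.
have hrn n : R1 < rn n < R2.
  by apply: he; rewrite /rn opprD addrCA subrr addr0; have := ue n; rewrite sub0r.
have [eBn sBn] : (forall n, B (rn n) t t = rn n) /\ (forall n, solution t (B (rn n) t)).
  by split => n; have [] := hB (hrn n) tp.
have tt : 0 <= t <= t by rewrite lexx ltW.
pose D n s := B (rn n) t s - B r t s.
have Dt n : D n t = u n by rewrite /D eBn eB /rn addrK.
have eK x : 0 <= x <= t -> expR (K * `|x - t|) <= expR (K * t).
  move=> /andP[x0 xt]; rewrite ler_expR ler_pM2l// ler0_norm ?subr_le0//; lra.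
have Dle n s : 0 <= s <= t -> `|D n s| <= expR (K * t) * `|u n|.
  move=> hs; rewrite -Dt; apply: (le_trans (gronwall (ltW K0) lipK (sBn n) sB hs tt)).
  by rewrite ler_wpM2r// eK.
have Dn0 n s : 0 <= s <= t -> D n s != 0.
  move=> hs; apply/eqP => Ds; have := gronwall (ltW K0) lipK (sBn n) sB tt hs.
  rewrite -/(D n s) -/(D n t) Ds normr0 mulr0 Dt normr_le0 => /eqP u0.
  by have := un n; rewrite u0 eqxx.
have Bn_ne n s : 0 <= s <= t -> B (rn n) t s != B r t s.
  by move=> hs; have := Dn0 n s hs; rewrite /D subr_eq0.
have Bcv s : 0 <= s <= t -> B (rn n) t s @[n --> \oo] --> B r t s.
  move=> hs; apply/cvgrPdist_le => d d0.
  have ed : 0 < d / expR (K * t) by rewrite divr_gt0 ?expR_gt0.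
  have /cvgrPdist_le /(_ _ ed) := ucv; apply: filterS => n; rewrite sub0r normrN => h.
  by rewrite distrC (le_trans (Dle n s hs))// mulrC -ler_pdivlMr ?expR_gt0.
have cBn n : con 0 t (B (rn n) t) := con_der (sBn n).
have quot_con (h hr' : R -> R -> R) n : slab h hr' ->
    con 0 t (fun s => (h (B (rn n) t s) s - h (B r t s) s) / D n s).
  move=> sh; have ch X : con 0 t X -> con 0 t (fun s => h (X s) s).
    move=> cX s hs; apply: (cont_comp (g := fun z : R * R => h z.1 z.2) (f := fun s => (X s, s))).
      exact: (slab_cont sh).
    by apply: cont_pair; [exact: cX|exact: cvg_id].
  have c1 := ch _ (cBn n); have c2 := ch _ cB0.
  move=> s hs; apply: contM; first by apply: contB; [exact: c1|exact: c2].
  apply: contV; first exact: Dn0.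
  by apply: contB; [exact: cBn|exact: cB0].
pose k n s := (Q (B (rn n) t s) s - Q (B r t s) s) / D n s.
pose l n s := (g (B (rn n) t s) s - g (B r t s) s) / D n s.
have ck n : con 0 t (k n) := @quot_con _ _ n sQ.
have cl n : con 0 t (l n) := @quot_con _ _ n sg.
have kK n s : 0 <= s <= t -> `|k n s| <= K.
  move=> hs; rewrite normrM normfV ler_pdivrMr ?normr_gt0 ?Dn0//; exact: lipK.
have lL n s : 0 <= s <= t -> `|l n s| <= L.
  move=> hs; rewrite normrM normfV ler_pdivrMr ?normr_gt0 ?Dn0//.
  by have [_ _] := hLb s hs (B (rn n) t s); exact.
have exF n : exists F : R -> R, F 0 = 0 /\ forall s, 0 <= s <= t -> der F s (k n s).
  exact: (primitive (ltW tp) (ck n)).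
have [F hF] := choice exF.
have dF n := (hF n).2.
have FE n s : 0 <= s <= t -> F n t - F n s = intR s t (k n).
  move=> /andP[s0 st]; apply/esym; apply: FTC2 => //.
    by move=> x /andP[x1 x2]; apply: dF; rewrite (le_trans s0 x1).
  exact: con_sub (ck n).
(* [D n] solves the linear equation [D' = k D] with the value [u n] at time [t]. *)
have DE n s : 0 <= s <= t -> D n s = u n * expR (F n s - F n t).
  move=> /andP[s0 st].
  have dD x : s <= x <= t -> der (fun x => D n x * expR (- F n x)) x 0.
    move=> /andP[x1 x2]; have hx : 0 <= x <= t by rewrite (le_trans s0 x1).
    apply: der_eq.
      apply: derM; first by apply: derB; [exact: sBn|exact: sB].
      by apply: der_expR; apply: derN; exact: dF.
    have -> : Q (B (rn n) t x) x - Q (B r t x) x = k n x * D n x by rewrite mulfVK// Dn0.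
    by rewrite -/(D n x); ring.
  have := der_0_cst st dD; rewrite Dt expRD => h.
  transitivity (expR (F n s) * (D n s * expR (- F n s))); last by rewrite h; ring.
  by rewrite mulrCA (expRxMexpNx_1 (F n s)) mulr1.
pose f n s := l n s * expR (F n s - F n t).
have fE n : (u n)^-1 * (Zint g (u n + r) t - Zint g r t) = intR 0 t (f n).
  have cg X : con 0 t X -> con 0 t (fun s => g (X s) s).
    move=> cX s hs; apply: (cont_comp (g := fun z : R * R => g z.1 z.2) (f := fun s => (X s, s))).
      exact: (slab_cont sg).
    by apply: cont_pair; [exact: cX|exact: cvg_id].
  have c1 := cg _ (cBn n); have c2 := cg _ cB0.
  rewrite /Zint -/(rn n) -intB// -intZ; last exact: conB.
  apply: eq_int => s hs; rewrite /f /l DE//; field.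
  by rewrite un gt_eqF ?expR_gt0.
rewrite (_ : (fun n => _) = fun n => intR 0 t (f n)); last by apply/funext => n; rewrite fE.
have cf n : con 0 t (f n).
  apply: conM => // s hs; apply: (cont_comp (g := expR)); first exact: continuous_expR.
  by apply: contB; [exact: (con_der (dF n))|exact: cvg_cst].
have Fb n s : 0 <= s <= t -> expR (F n s - F n t) <= expR (K * t).
  move=> hs; have /andP[s0 st] := hs; rewrite ler_expR -opprB FE//.
  have cks : con s t (k n) by exact: con_sub (ck n).
  have : `|intR s t (k n)| <= K * (t - s).
    by apply: (int_bound st cks) => x /andP[x1 x2]; apply: kK; rewrite (le_trans s0 x1).
  rewrite ler_norml => /andP[h1 h2]; rewrite lerNl (le_trans _ h1)// lerN2 ler_pM2l//; lra.
apply: (@bounded_cvg _ f _ 0 t (L * expR (K * t)) (t0 r t)) => //; first exact: ltW.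
- move=> n s hs; rewrite normrM ler_pM// ?lL// ger0_norm ?expR_ge0// Fb//.
- exact: if_measurable.
(* Before the entry time the limit characteristic is outside, where the quotients tend to 0; after
   it they tend to [gr] and [Qr]. *)
move=> s hs st0; have /andP[s0 st] := hs; have [slt|sge] := ltP s (t0 r t).
  have lcv : l n s @[n --> \oo] --> (0 : R).
    have d0 := @slab_outside g gr (B r t s) s sg (hout s (ltac:(by rewrite s0 slt))).
    exact: (der_seq d0 (fun n => Bn_ne n s hs) (Bcv s hs)).
  apply/cvgrPdist_le => d d0; have ed : 0 < d / expR (K * t) by rewrite divr_gt0 ?expR_gt0.
  have /cvgrPdist_le /(_ _ ed) := lcv; apply: filterS => n; rewrite !sub0r !normrN => h.
  rewrite /f normrM (ger0_norm (expR_ge0 _)).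
  apply: (le_trans (ler_pM (normr_ge0 _) (expR_ge0 _) h (Fb n s hs))).
  by rewrite divfK// gt_eqF ?expR_gt0.
have slt : t0 r t < s by rewrite lt_neqAle eq_sym st0.
have inn x : s <= x <= t -> R1 < B r t x < R2.
  by move=> /andP[x1 x2]; apply: hin; rewrite (lt_le_trans slt x1).
apply: cvgM.
  have dg : der (g ^~ s) (B r t s) (gr (B r t s) s).
    by apply: (slab_der sg) => //; apply: inn; rewrite lexx.
  exact: (der_seq dg (fun n => Bn_ne n s hs) (Bcv s hs)).
apply: (@cvg_comp _ _ _ (fun n => F n s - F n t) expR _ (nbhs (H s - H t))); last exact: continuous_expR.
have -> : H s - H t = - intR s t (fun u => Qr (B r t u) u) by rewrite intH// opprB.
rewrite (_ : (fun n => _) = fun n => - intR s t (k n)); last first.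
  by apply/funext => n; rewrite -FE// opprB.
apply: cvgN; apply: (@bounded_cvg _ k _ s t K (t0 r t)) => //.
- by move=> n; exact: con_sub (ck n).
- by move=> n x /andP[x1 x2]; apply: kK; rewrite (le_trans s0 x1).
- by apply: con_measurable; exact: con_sub cQr.
move=> x hx _; have hx' : 0 <= x <= t by case/andP: hx => x1 x2; rewrite (le_trans s0 x1).
have dq : der (Q ^~ x) (B r t x) (Qr (B r t x) x).
  by apply: (slab_der sQ); [exact: inn|case/andP: hx'].
exact: (der_seq dq (fun n => Bn_ne n x hx') (Bcv x hx')).
Qed.


Lemma flow_semigroup r t t' s : R1 < r < R2 -> 0 < t' -> t' <= t -> R1 < B r t t' < R2 ->
  0 <= s <= t' -> B (B r t t') t' s = B r t s.
Proof.
move=> hr tp' tt hr' hs; have tp := lt_le_trans tp' tt.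
have [e1 s1] := hB hr tp; have [e2 s2] := hB hr' tp'.
have [K K0 hKb] := slab_bounds sQ (ltW tp').
have lipK u : 0 <= u <= t' -> forall y z, `|Q y u - Q z u| <= K * `|y - z|.
  by move=> hu y z; have [_ _] := hKb u hu y; exact.
have h0 : 0 <= t' <= t' by rewrite lexx ltW.
have := gronwall (ltW K0) lipK s2 (solution_le tt s1) hs h0.
by rewrite e2 subrr normr0 mulr0 normr_le0 subr_eq0 => /eqP.
Qed.

(** For times [t1 < t2] the semigroup property splits off the integral over the last stretch and
    leaves [Zint] at time [t1], at the position [y] held there. As [y - r] is about [- Q] times the
    elapsed time, the term [- Q * Zr] appears. *)
Lemma Zint_der_t g gr r t : slab g gr -> R1 < r < R2 -> 0 < t ->
  der (Zint g r) t (g r t - Q r t * Zr gr r t).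
Proof.
move=> sg hr tp; pose T := t + t; have Tp : 0 < T by rewrite addr_gt0.
have [K K0 hKb] := slab_bounds sQ (ltW Tp); have [e e0 he] := int_open hr.
(* The bound [t / 2] keeps the times between 0 and [T], the bound [e / K] the positions inside the
   interval. *)
pose dl := Num.min (t / 2) (e / K).
have dl0 : 0 < dl by rewrite lt_min !divr_gt0.
(* [w] packs three intermediate points: the one of [Zr] in the position, then those of [Q] and of
   [g] along the characteristic. All are within a multiple of [|h|] of [(r, t)]. *)
have key h : exists w : R * R * (R * R * (R * R)), 0 < `|h| -> `|h| < dl ->
    [/\ `|w.1.1 - r| <= K * `|h| /\ `|w.1.2 - t| <= `|h|,
     `|w.2.1.1 - r| <= K * `|h| /\ `|w.2.1.2 - t| <= `|h|,
     `|w.2.2.1 - r| <= K * `|h| /\ `|w.2.2.2 - t| <= `|h| &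
     h^-1 * (Zint g r (h + t) - Zint g r t) =
       g w.2.2.1 w.2.2.2 - Q w.2.1.1 w.2.1.2 * Zr gr w.1.1 w.1.2].
  have [[hh0 hd]|nh] := pselect (0 < `|h| /\ `|h| < dl); last first.
    by exists ((0, 0), ((0, 0), (0, 0))) => a b; case: nh.
  have [hd1 hd2] : `|h| < t / 2 /\ `|h| < e / K.
    by move: hd; rewrite /dl lt_min => /andP[].
  pose t1 := Num.min t (h + t); pose t2 := Num.max t (h + t).
  have h0 : h != 0 by rewrite -normr_gt0.
  have [n1 n2] : - h <= `|h| /\ h <= `|h| by rewrite -{1}normrN !ler_norm.
  have T12 : [/\ 0 < t1, t1 < t2, t2 <= T & t2 - t1 = `|h|] /\
      (t1 <= t <= t2 /\ h^-1 * (Zint g r (h + t) - Zint g r t) =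
      (t2 - t1)^-1 * (Zint g r t2 - Zint g r t1)).
    rewrite /t1 /t2 /T; have [hp|hn] := ltP 0 h.
      rewrite gtr0_norm// in hd1 hd2 n1 n2 *.
      rewrite min_l ?max_r; [|lra..]; split; first by split; lra.
      by split; [apply/andP; split; lra|rewrite addrK].
    have hn' : h < 0 by rewrite lt_neqAle h0.
    rewrite ltr0_norm// in hd1 hd2 n1 n2 *.
    rewrite min_r ?max_l; [|lra..]; split; first by split; lra.
    split; first by apply/andP; split; lra.
    by rewrite opprD addrCA subrr addr0 invrN mulNr -mulrN opprB.
  have [[t1p t12 t2T t21] [/andP[t1t tt2] ->]] := T12.
  have t2p := lt_trans t1p t12.
  have [eB sB] := hB hr t2p.
  have bQ s : 0 <= s <= t2 -> forall y, `|Q y s| <= K.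
    by move=> /andP[s0 st] y; have [] := hKb s _ y => //; rewrite s0 (le_trans st).
  have Bnear s : t1 <= s <= t2 -> `|B r t2 s - r| <= K * `|h|.
    move=> /andP[s1 s2]; rewrite -{2}eB.
    apply: (le_trans (solution_lip sB bQ _ _)); rewrite ?lexx ?(ltW t2p) ?s2 ?andbT//.
      exact: le_trans (ltW t1p) s1.
    by rewrite ler_pM2l// -t21 ler0_norm; lra.
  have y_in z : `|z - r| <= K * `|h| -> R1 < z < R2.
    move=> hz; apply: he; rewrite distrC (le_lt_trans hz)// mulrC -ltr_pdivlMr//.
  pose y := B r t2 t1.
  have yr : `|y - r| <= K * `|h| by apply: Bnear; rewrite lexx ltW.
  have Zspl : Zint g r t2 = Zint g y t1 + intR t1 t2 (fun s => g (B r t2 s) s).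
    have cg : con 0 t2 (fun s => g (B r t2 s) s).
      move=> s hs; apply: (cont_comp (g := fun z : R * R => g z.1 z.2) (f := fun s => (B r t2 s, s))).
        exact: (slab_cont sg).
      by apply: cont_pair; [exact: (con_der sB)|exact: cvg_id].
    rewrite /Zint (@int_split _ 0 t1 t2) ?(ltW t1p) ?(ltW t12)//; congr (_ + _).
    apply: eq_int => s hs; rewrite flow_semigroup//; [exact: ltW|exact: y_in].
  have [c [cr Zc]] := @mvt_any _ (fun z => Zint g z t1) (fun z => Zr gr z t1) r y
    (fun z hz => Zint_der_r sg (y_in z (le_trans hz yr)) t1p).
  have [|x [x1 x2 Bx]] := @MVT_der _ (B r t2) (fun s => Q (B r t2 s) s) t1 t2 t12.
    by move=> s /andP[s1 s2]; apply: sB; rewrite (le_trans (ltW t1p) s1).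
  have cg : con t1 t2 (fun s => g (B r t2 s) s).
    move=> s /andP[s1 s2]; apply: (cont_comp (g := fun z : R * R => g z.1 z.2) (f := fun s => (B r t2 s, s))).
      exact: (slab_cont sg).
    by apply: cont_pair; [apply: (con_der sB); rewrite s2 (le_trans (ltW t1p))|exact: cvg_id].
  have [G [G0 dG]] := primitive (ltW t12) cg.
  have [x' [x1' x2' Gx]] := MVT_der t12 dG.
  have intG : intR t1 t2 (fun s => g (B r t2 s) s) = g (B r t2 x') x' * (t2 - t1).
    by rewrite (FTC2 (ltW t12) dG cg) Gx.
  have hx s : t1 < s -> s < t2 -> `|B r t2 s - r| <= K * `|h| /\ `|s - t| <= `|h|.
    move=> s1 s2; split; first by apply: Bnear; rewrite !ltW.
    by rewrite -t21 ler_norml; apply/andP; split; lra.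
  exists ((c, t1), ((B r t2 x, x), (B r t2 x', x'))) => _ _ /=; split.
  - split; first exact: le_trans yr.
    by rewrite -t21 ler_norml; apply/andP; split; lra.
  - exact: hx.
  - exact: hx.
  have t0' : t2 - t1 != 0 by rewrite subr_eq0 gt_eqF.
  have Yr : y - r = - (Q (B r t2 x) x * (t2 - t1)) by rewrite -Bx /y eB opprB.
  rewrite Zspl intG.
  have -> : Zint g y t1 = Zint g r t1 + Zr gr c t1 * (y - r) by rewrite -Zc addrCA subrr addr0.
  by rewrite Yr; field.
have [w hw] := choice key.
have nw : \forall h \near (0 : R)^', 0 < `|h| /\ `|h| < dl.
  have a1 : \forall h \near (0 : R)^', `|h| < dl by exact: dnbhs0_lt.
  apply: filterI a1; rewrite /dnbhs /within /=; apply: nearW => h h0.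
  by rewrite normr_gt0.
apply/derP.
have L : g (w h).2.2.1 (w h).2.2.2 - Q (w h).2.1.1 (w h).2.1.2 * Zr gr (w h).1.1 (w h).1.2
    @[h --> 0^'] --> g r t - Q r t * Zr gr r t.
  have L1 : g (w h).2.2.1 (w h).2.2.2 @[h --> (0 : R)^'] --> g r t.
    have H : \forall h \near (0 : R)^', `|(w h).2.2.1 - r| <= K * `|h| /\ `|(w h).2.2.2 - t| <= `|h|.
      by apply: filterS nw => h [a b]; have [_ _ ?] := hw h a b.
    exact: (cont_along K0 (@slab_cont _ _ sg r t) H).
  have L2 : Q (w h).2.1.1 (w h).2.1.2 @[h --> (0 : R)^'] --> Q r t.
    have H : \forall h \near (0 : R)^', `|(w h).2.1.1 - r| <= K * `|h| /\ `|(w h).2.1.2 - t| <= `|h|.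
      by apply: filterS nw => h [a b]; have [_ ? _] := hw h a b.
    exact: (cont_along K0 (@slab_cont _ _ sQ r t) H).
  have L3 : Zr gr (w h).1.1 (w h).1.2 @[h --> (0 : R)^'] --> Zr gr r t.
    have H : \forall h \near (0 : R)^', `|(w h).1.1 - r| <= K * `|h| /\ `|(w h).1.2 - t| <= `|h|.
      by apply: filterS nw => h [a b]; have [? _ _] := hw h a b.
    exact: (cont_along K0 (Zr_cont (slab_contr sg) hr tp) H).
  by apply: cvgB => //; apply: cvgM.
apply: cvg_trans L; apply: near_eq_cvg; apply: filterS nw => h [a b].
by have [_ _ _ ->] := hw h a b.
Qed.

End flow.

(** * The velocity as a logarithmic derivative *)

Section profile_velocity.
Context {R : realType}.
Variables (n : nat) (eps R1 R2 q1 q2 : R) (q0 : R -> R) (q ph ps ch th : R -> R -> R).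
Hypothesis hp : heat_profile n eps R1 R2 q1 q2 q0 q ph ps ch th.
Implicit Types (r s t y : R).

Local Notation d := n.-1.
Let eps0 : 0 < eps := hp_eps hp.
Let en : eps != 0. Proof. by rewrite gt_eqF. Qed.
Let R1p : 0 < R1 := hp_R1 hp.
Let R12 : R1 < R2 := hp_R12 hp.
Let R12' : R1 <= R2 := ltW R12.
Let halfR : R1 / 2 < R1. Proof. by rewrite ltr_pdivrMr// ltr_pMr// ltr1n. Qed.
Let half r : R1 <= r -> R1 / 2 < r. Proof. exact: lt_le_trans. Qed.
Let pos r : R1 <= r -> 0 < r. Proof. exact: lt_le_trans. Qed.

Definition vel r t := - eps * (ps r t / ph r t).
(** The second derivative of [ph] is expressed by [ch], and the quotient rule contributes
    [vel ^+ 2 / eps]. *)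
Definition vel_r r t := - (d%:R / r) * vel r t + eps * (ch r t / ph r t) + vel r t ^+ 2 / eps.
Definition vel_rr r t := d%:R / r ^+ 2 * vel r t - d%:R / r * vel_r r t
  + eps * (th r t / ph r t - ch r t * ps r t / ph r t ^+ 2) + 2 * vel r t * vel_r r t / eps.
Definition vel_t r t := eps ^+ 2 / 2 * (th r t / ph r t - ch r t * ps r t / ph r t ^+ 2).

Lemma ph_neq0 r t : R1 <= r <= R2 -> 0 <= t -> ph r t != 0.
Proof. by move=> hr t0; rewrite gt_eqF// (hp_pos hp). Qed.

Lemma vel_der_r r t : R1 <= r <= R2 -> 0 <= t -> der (fun r => vel r t) r (vel_r r t).
Proof.
move=> hr t0; have pn := ph_neq0 hr t0; have /andP[r1 _] := hr.
apply: der_eq.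
  apply: derZ; apply: der_div => //.
  - exact: (hp_rr hp (half r1) t0).
  - exact: (hp_r hp (half r1) t0).
rewrite /vel_r /vel; field.
by rewrite en pn gt_eqF// pos.
Qed.

Lemma vel_r_der_r r t : R1 <= r <= R2 -> 0 < t -> der (fun r => vel_r r t) r (vel_rr r t).
Proof.
move=> hr t0; have pn := ph_neq0 hr (ltW t0); have /andP[r1 _] := hr.
have rn : r != 0 by rewrite gt_eqF// pos.
have dv := vel_der_r hr (ltW t0).
apply: der_eq.
  apply: derD; first apply: derD.
  - apply: derM; last exact: dv.
    apply: derN; apply: derZ; apply: (derV rn); exact: der_id.
  - apply: derZ; apply: der_div => //.
    + exact: (hp_rrr hp (half r1) t0).
    + exact: (hp_r hp (half r1) (ltW t0)).
  - by apply: derM; [exact: (derX 2 dv)|exact: der_cst].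
rewrite /vel_rr /= expr1; move: (vel r t) (vel_r r t) => v v'; field.
by rewrite en pn rn.
Qed.

Lemma vel_der_t r t : R1 <= r <= R2 -> 0 < t -> der (vel r) t (vel_t r t).
Proof.
move=> hr t0; have pn := ph_neq0 hr (ltW t0); have /andP[r1 _] := hr.
apply: der_eq.
  apply: derZ; apply: der_div => //.
  - exact: (hp_rt hp (half r1) t0).
  - exact: (hp_t hp (half r1) t0).
by rewrite /vel_t; field.
Qed.

(** An identity of the expressions: the terms with [d / r] cancel, the bracket with [th] yields
    [vel_t], and the last term of [vel_rr] yields the advection. *)
Lemma vel_equation r t : R1 <= r <= R2 ->
  vel_t r t + vel r t * vel_r r t =
  eps / 2 * (vel_rr r t + d%:R / r * vel_r r t - d%:R / r ^+ 2 * vel r t).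
Proof.
move=> _; rewrite /vel_t /vel_rr.
move: (d%:R / r ^+ 2) (d%:R / r) (th r t / ph r t - _) (vel r t) (vel_r r t) => a b c v v'.
by field.
Qed.

Let time_cont (f : R -> R -> R) r t : 0 < t ->
  {for (r, t), continuous (fun p : R * R => f p.1 (Num.max p.2 0))} ->
  {for (r, t), continuous (fun p : R * R => f p.1 p.2)}.
Proof.
move=> t0; apply: cont_near; apply: filterS (near_snd_gt r t0) => p hp2.
by rewrite max_l// ltW.
Qed.

Section continuity.
Variables (r t : R).
Hypothesis (hr : R1 <= r <= R2) (t0 : 0 < t).
Let r1 : R1 <= r. Proof. by case/andP: hr. Qed.
Let pn : ph r t != 0 := ph_neq0 hr (ltW t0).
Let cph : {for (r, t), continuous (fun p : R * R => ph p.1 p.2)}.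
Proof. by apply: (time_cont t0); apply: (hp_cont hp); exact: half. Qed.
Let cps : {for (r, t), continuous (fun p : R * R => ps p.1 p.2)}.
Proof. by apply: (time_cont t0); apply: (hp_cont_r hp); exact: half. Qed.
Let cch : {for (r, t), continuous (fun p : R * R => ch p.1 p.2)}.
Proof. by apply: (time_cont t0); apply: (hp_cont_rr hp); exact: half. Qed.
Let cth : {for (r, t), continuous (fun p : R * R => th p.1 p.2)}.
Proof. by apply: (hp_cont_rrr hp) => //; exact: half. Qed.
Let ciph : {for (r, t), continuous (fun p : R * R => (ph p.1 p.2)^-1)}.
Proof. exact: contV. Qed.
Let cc (c : R) : {for (r, t), continuous (fun p : R * R => c)}.
Proof. exact: cvg_cst. Qed.
Let crk (c : R) k : {for (r, t), continuous (fun p : R * R => c / p.1 ^+ k)}.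
Proof.
apply: contM; first exact: cc.
apply: contV; first by rewrite expf_neq0// gt_eqF// pos.
by apply: contX; exact: cvg_fst.
Qed.
Let cri (c : R) : {for (r, t), continuous (fun p : R * R => c / p.1)}.
Proof.
apply: (cont_eq (f := fun p : R * R => c / p.1 ^+ 1)); last exact: crk.
by move=> p; rewrite expr1.
Qed.

Lemma vel_cont : {for (r, t), continuous (fun p : R * R => vel p.1 p.2)}.
Proof. by apply: contM; [exact: cc|apply: contM]. Qed.

Lemma vel_r_cont : {for (r, t), continuous (fun p : R * R => vel_r p.1 p.2)}.
Proof.
have cv := vel_cont; apply: contD; first apply: contD.
- by apply: contM => //; apply: contN; exact: cri.
- by apply: contM; [exact: cc|apply: contM].
- by apply: contM; [exact: contX|exact: cc].
Qed.

Let cD : {for (r, t), continuous (fun p : R * R =>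
  th p.1 p.2 / ph p.1 p.2 - ch p.1 p.2 * ps p.1 p.2 / ph p.1 p.2 ^+ 2)}.
Proof.
apply: contB; first exact: contM.
apply: contM; first exact: contM.
by apply: contV; [rewrite expf_neq0|exact: contX].
Qed.

Lemma vel_t_cont : {for (r, t), continuous (fun p : R * R => vel_t p.1 p.2)}.
Proof. by apply: contM; [exact: cc|exact: cD]. Qed.

Lemma vel_rr_cont : {for (r, t), continuous (fun p : R * R => vel_rr p.1 p.2)}.
Proof.
have cv := vel_cont; have cvr := vel_r_cont; apply: contD; first apply: contD; first apply: contB.
- by apply: contM => //; exact: crk.
- by apply: contM => //; exact: cri.
- by apply: contM; [exact: cc|exact: cD].
- by apply: contM; [apply: contM => //; apply: contM => //; exact: cc|exact: cc].
Qed.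

End continuity.

Lemma vel_left t : 0 <= t -> vel R1 t = q1.
Proof.
move=> t0; rewrite /vel mulrA (hp_left hp t0) mulfK// ph_neq0//.
by rewrite lexx R12'.
Qed.

Lemma vel_right t : 0 <= t -> vel R2 t = q2.
Proof.
move=> t0; rewrite /vel mulrA (hp_right hp t0) mulfK// ph_neq0//.
by rewrite lexx R12'.
Qed.

Lemma vel_init r : R1 <= r <= R2 -> vel r 0 = q0 r.
Proof. by move=> hr; rewrite /vel mulrA (hp_init hp hr) mulfK// ph_neq0. Qed.

Lemma vel_q r t : R1 / 2 < r -> 0 < t -> q r t = vel r t.
Proof. exact: (hp_q hp). Qed.

(** Extension by boundary values beyond both sides and before time 0, so that continuity there is
    two-sided. *)
Definition strip (f : R -> R -> R) y s := f (clamp R1 R2 y) (Num.max s 0).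

Lemma strip_cont (f : R -> R -> R) y s :
  (forall r t, R1 / 2 < r -> {for (r, t), continuous (fun p : R * R => f p.1 (Num.max p.2 0))}) ->
  {for (y, s), continuous (fun p : R * R => strip f p.1 p.2)}.
Proof.
move=> cf; have /andP[c1 _] := clampP y R12'.
apply: (cont_comp (g := fun p : R * R => f p.1 (Num.max p.2 0))
  (f := fun p : R * R => (clamp R1 R2 p.1, p.2))); first exact: (cf _ _ (half c1)).
apply: cont_pair; last exact: cvg_snd.
by apply: (cont_comp (g := clamp R1 R2)); [exact: clamp_cont|exact: cvg_fst].
Qed.

Lemma stripE (f : R -> R -> R) y s : R1 <= y <= R2 -> 0 <= s -> strip f y s = f y s.
Proof. by move=> hy s0; rewrite /strip clamp_id// max_l. Qed.

Lemma strip_vel_cont y s :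
  {for (y, s), continuous (fun p : R * R => strip vel p.1 p.2)} /\
  {for (y, s), continuous (fun p : R * R => strip vel_r p.1 p.2)}.
Proof.
have s0 (u : R) : 0 <= Num.max u 0 by rewrite le_max lexx orbT.
have cy u := clampP u R12'.
have cph : {for (y, s), continuous (fun p : R * R => strip ph p.1 p.2)}.
  by apply: strip_cont; exact: (hp_cont hp).
have cps : {for (y, s), continuous (fun p : R * R => strip ps p.1 p.2)}.
  by apply: strip_cont; exact: (hp_cont_r hp).
have cch : {for (y, s), continuous (fun p : R * R => strip ch p.1 p.2)}.
  by apply: strip_cont; exact: (hp_cont_rr hp).
have ciph : {for (y, s), continuous (fun p : R * R => (strip ph p.1 p.2)^-1)}.
  by apply: contV => //; rewrite /strip ph_neq0.
have cc (c : R) : {for (y, s), continuous (fun p : R * R => c)} by exact: cvg_cst.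
have cv : {for (y, s), continuous (fun p : R * R => strip vel p.1 p.2)}.
  by apply: contM; [exact: cc|apply: contM].
split => //; apply: contD; first apply: contD.
- apply: contM => //; apply: contN; apply: contM; first exact: cc.
  apply: contV; first by have /andP[c1 _] := cy y; rewrite /= gt_eqF// pos.
  by apply: (cont_comp (g := clamp R1 R2)); [exact: clamp_cont|exact: cvg_fst].
- by apply: contM; [exact: cc|apply: contM].
- by apply: contM; [exact: contX|exact: cc].
Qed.

Let clampK y : clamp R1 R2 (clamp R1 R2 y) = clamp R1 R2 y.
Proof. by rewrite clamp_id// clampP. Qed.

Lemma slab_vel : slab R1 R2 (strip vel) (strip vel_r).
Proof.
split.
- by move=> y s; have [] := strip_vel_cont y s.
- by move=> y s; have [] := strip_vel_cont y s.
- by move=> y s; rewrite /strip clampK.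
- by move=> y s; rewrite /strip clampK.
- move=> y s hy s0; have hy' : R1 <= y <= R2 by case/andP: hy => a b; rewrite (ltW a) (ltW b).
  rewrite stripE//; apply: (der_near _ (vel_der_r hy' s0)).
  by apply: filterS (near_itv hy) => z /andP[a b]; rewrite stripE// (ltW a) (ltW b).
Qed.

Lemma slab_vel2 : slab R1 R2 (fun y s => strip vel y s ^+ 2)
  (fun y s => 2 * strip vel y s * strip vel_r y s).
Proof.
have [c1 c2 c3 c4 c5] := slab_vel; split.
- by move=> y s; apply: contX; exact: c1.
- by move=> y s; apply: contM; [apply: contM; [exact: cvg_cst|exact: c1]|exact: c2].
- by move=> y s; rewrite c3.
- by move=> y s; rewrite c3 c4.
- move=> y s hy s0; apply: der_eq; first by apply: (derX 2); exact: c5.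
  by rewrite expr1.
Qed.

Lemma strip_left y s : y <= R1 -> strip vel y s = q1.
Proof. by move=> h; rewrite /strip clamp_lt// vel_left// le_max lexx orbT. Qed.

Lemma strip_right y s : R2 <= y -> strip vel y s = q2.
Proof. by move=> h; rewrite /strip clamp_gt// vel_right// le_max lexx orbT. Qed.

End profile_velocity.

(** * Gluing at a point *)

Section gluing.
Context {R : realType}.
Implicit Types (f g : R -> R) (a b c x : R).

Lemma eq_int_open a b f g : con a b g -> (forall x, a < x <= b -> f x = g x) ->
  intR a b f = intR a b g.
Proof.
move=> cg fg; pose mu := @lebesgue_measure R.
have ig : mu.-integrable `]a, b]%classic (EFin \o g).
  apply: integrableS (con_integrable cg) => //.
  by move=> x /=; rewrite !in_itv/= => /andP[/ltW -> ->].
have fg' x : `]a, b]%classic x -> f x = g x by rewrite /= in_itv/=; exact: fg.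
have jf : mu.-integrable `]a, b]%classic (EFin \o f).
  by apply: eq_integrable ig => // x; rewrite inE => /fg' /= ->.
rewrite -(@Rintegral_itv_obnd_cbnd _ a (BRight b) f jf) -(@Rintegral_itv_obnd_cbnd _ a (BRight b) g ig).
by apply: eq_Rintegral => x; rewrite inE => /fg'.
Qed.

Lemma within_clamp a b f : a <= b -> {within `[a, b], continuous f} ->
  forall x, {for x, continuous (fun y => f (clamp a b y))}.
Proof.
move=> ab /subspace_continuousP cf x.
have hx : `[a, b]%classic (clamp a b x) by rewrite /= in_itv/= clampP.
move=> A hA.
have h1 : \forall z \near clamp a b x, `[a, b]%classic z -> A (f z) := cf _ hx A hA.
have h2 : \forall y \near x, `[a, b]%classic (clamp a b y) -> A (f (clamp a b y)).
  exact: (@clamp_cont _ a b x ab _ h1).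
by apply: filterS h2 => y; apply; rewrite /= in_itv/= clampP.
Qed.

Lemma open_der0_cst a b f : a <= b -> con a b f -> (forall x, a < x < b -> der f x 0) -> f a = f b.
Proof.
move=> ab cf df; have [->//|ne] := eqVneq a b.
have ltab : a < b by rewrite lt_neqAle ne.
have [||c _] := @MVT _ f (fun=> 0) a b ltab.
- by move=> x; rewrite in_itv/=; exact: df.
- exact: con_within.
by rewrite mul0r => /eqP; rewrite subr_eq0 => /eqP.
Qed.

Lemma glue_cont f g c : {for c, continuous f} -> {for c, continuous g} -> f c = g c ->
  {for c, continuous (fun x => if x < c then f x else g x)}.
Proof.
move=> cf cg e; apply/cvgrPdist_le => d d0; rewrite ltxx.
have /cvgrPdist_le /(_ _ d0) hf := cf; have /cvgrPdist_le /(_ _ d0) hg := cg.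
by apply: filterS2 hf hg => x; rewrite e; case: ifP.
Qed.

(** The mean value theorem writes the difference quotients at [c] as values of [f'] at points
    tending to [c], where [f'] is continuous. *)
Lemma glue_der f (f' : R -> R) c (e : R) : 0 < e -> {for c, continuous f} -> {for c, continuous f'} ->
  (forall x, x != c -> `|x - c| < e -> der f x (f' x)) -> der f c (f' c).
Proof.
move=> e0 cf cf' df; apply/derP.
have mv (h : R) : exists y : R, h != 0 -> `|h| < e ->
    `|y - c| <= 1 * `|h| /\ h^-1 * (f (h + c) - f c) = f' y.
  have [[h0 he]|nh] := pselect (h != 0 /\ `|h| < e); last by exists 0 => a b; case: nh.
  have sub x : c < x < h + c \/ h + c < x < c -> x != c /\ `|x - c| < e.
    move: he; rewrite ltr_norml => /andP[h1 h2].
    case=> /andP[x1 x2]; rewrite ltr_norml; split; first by rewrite gt_eqF.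
    - by apply/andP; split; lra.
    - by rewrite lt_eqF.
    - by apply/andP; split; lra.
  have cc x : `|x - c| < e -> {for x, continuous f}.
    by have [->//|xc] := eqVneq x c => xe; apply: der_cont; exact: df.
  have [hp|hn] := ltP 0 h.
    have lt : c < h + c by lra.
    have [||y] := @MVT _ f f' c (h + c) lt.
    - by move=> x; rewrite in_itv/= => hx; have [a b] := sub x (or_introl hx); exact: df.
    - have cm : con c (h + c) f.
        move=> x /andP[x1 x2]; apply: cc; move: he; rewrite gtr0_norm// ger0_norm; lra.
      exact: con_within cm.
    rewrite in_itv/= => /andP[y1 y2]; rewrite addrK => ->; exists y => _ _; split; last by field.
    by rewrite mul1r !ger0_norm; lra.
  have hn' : h < 0 by rewrite lt_neqAle h0.
  have lt : h + c < c by lra.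
  have [||y] := @MVT _ f f' (h + c) c lt.
  - by move=> x; rewrite in_itv/= => hx; have [a b] := sub x (or_intror hx); exact: df.
  - have cm : con (h + c) c f.
      move=> x /andP[x1 x2]; apply: cc; move: he; rewrite ltr0_norm// ler0_norm; lra.
    exact: con_within cm.
  rewrite in_itv/= => /andP[y1 y2] E; exists y => _ _; split.
    by rewrite mul1r !ler0_norm; lra.
  by rewrite -opprB E; field.
have [y hy] := choice mv.
have nh : \forall h \near (0 : R)^', h != 0 /\ `|h| < e.
  have a1 : \forall h \near (0 : R)^', `|h| < e by exact: dnbhs0_lt.
  by apply: filterI a1; rewrite /dnbhs /within /=; apply: nearW.
have cG : {for (c, c), continuous (fun z : R * R => f' z.1)}.
  by apply: (cont_comp (g := f')); [exact: cf'|exact: cvg_fst].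
have L : f' (y h) @[h --> 0^'] --> f' c.
  have H : \forall h \near (0 : R)^', `|y h - c| <= 1 * `|h| /\ `|c - c| <= `|h|.
    by apply: filterS nh => h [a b]; have [? _] := hy h a b; split => //; rewrite subrr normr0.
  exact: (@cont_along _ (fun a _ => f' a) c c 1 y (fun=> c) ltr01 cG H).
apply: cvg_trans L; apply: near_eq_cvg; apply: filterS nh => h [a b].
by have [_ ->] := hy h a b.
Qed.

End gluing.

(** * Continuation of the characteristics to time 0 *)

Section trajectories.
Context {R : realType}.
Variables (n : nat) (eps R1 R2 q1 q2 : R) (q0 : R -> R) (q ph ps ch th : R -> R -> R).
Hypothesis hp : heat_profile n eps R1 R2 q1 q2 q0 q ph ps ch th.
Variables (beta : R -> R -> R -> R) (t0 : R -> R -> R).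
Hypothesis hbeta : forall r t, R1 < r < R2 -> 0 < t ->
  [/\ 0 <= t0 r t < t, beta r t t = r, {within `[t0 r t, t], continuous (beta r t)},
      forall s, t0 r t < s < t -> R1 < beta r t s < R2 /\
        is_derive s (1 : R) (beta r t) (q (beta r t s) s)
    & Gamma R1 R2 (beta r t (t0 r t), t0 r t)].
Implicit Types (r s t y : R).

Local Notation d := n.-1.
Local Notation vel := (vel eps ph ps).
Local Notation vel_r := (vel_r n eps ph ps ch).
Local Notation Q := (strip R1 R2 vel).
Local Notation Qr := (strip R1 R2 vel_r).

Let eps0 : 0 < eps := hp_eps hp.
Let R1p : 0 < R1 := hp_R1 hp.
Let R12 : R1 < R2 := hp_R12 hp.
Let R12' : R1 <= R2 := ltW R12.
Let sQ : slab R1 R2 Q Qr := slab_vel hp.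
Let halfR : R1 / 2 < R1. Proof. by rewrite ltr_pdivrMr// ltr_pMr// ltr1n. Qed.

(* Where the characteristic meets the parabolic boundary; at a lateral side it
   is continued by the constant velocity of that side. *)
Definition enters (X : R -> R) u (c qc : R) :=
  X u = c /\ forall s, 0 <= s <= u -> X s = c + qc * (s - u).

(** [X] is a primitive of the velocity along [beta], held at the entry point before entry; so it is
    [beta] after entry and straight before. It solves the extended equation because the speed of the
    side points inwards, which leaves the straight part outside the interval. *)
Lemma trajectory r t : R1 < r < R2 -> 0 < t -> exists X,
  [/\ X t = r, solution Q t X, forall s, t0 r t <= s <= t -> X s = beta r t s &
   [\/ R1 < X (t0 r t) < R2 /\ t0 r t = 0, enters X (t0 r t) R1 q1 /\ 0 < q1 |
       enters X (t0 r t) R2 q2 /\ q2 < 0]].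
Proof.
move=> hr tp; have [/andP[u0 ut] bt cb db gb] := hbeta hr tp.
set u := t0 r t in u0 ut cb db gb *.
(* [beta] is prescribed on [[u, t]] only; clamping holds it at the entry point for earlier times. *)
pose bc s := beta r t (clamp u t s).
have cbc : forall s, {for s, continuous bc} := within_clamp (ltW ut) cb.
have bcE s : u <= s <= t -> bc s = beta r t s by move=> h; rewrite /bc clamp_id.
have bcL s : s <= u -> bc s = bc u.
  by move=> h; rewrite /bc (clamp_lt (ltW ut) h) clamp_id// lexx ltW.
pose c s := Q (bc s) s.
have cc : con 0 t c.
  move=> s _; apply: (cont_comp (g := fun z : R * R => Q z.1 z.2) (f := fun s => (bc s, s))).
    exact: (slab_cont sQ).
  by apply: cont_pair; [exact: cbc|exact: cvg_id].
have [G [G0 dG]] := primitive (ltW tp) cc.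
pose X s := G s - G t + r.
have dX s : 0 <= s <= t -> der X s (c s).
  move=> hs; apply: der_eq; first by apply: derD; [apply: derB; [exact: dG|exact: der_cst]|exact: der_cst].
  by rewrite subr0 addr0.
have Xt : X t = r by rewrite /X subrr add0r.
have Xb s : u <= s <= t -> X s = beta r t s.
  move=> /andP[us st]; rewrite -bcE ?us//; apply/eqP; rewrite -subr_eq0.
  have h0 : X t - bc t = 0 by rewrite Xt bcE ?bt ?subrr// lexx ltW.
  rewrite -h0; apply/eqP; apply: (@open_der0_cst _ s t (fun s => X s - bc s)) => //.
    move=> x /andP[x1 x2]; apply: contB; last exact: cbc.
    by apply: (con_der dX); rewrite x2 (le_trans u0 (le_trans us x1)).
  move=> x /andP[x1 x2]; have ux : u < x := le_lt_trans us x1.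
  have hx : u < x < t by rewrite ux.
  have [bi dbx] := db x hx; have xp : 0 < x := le_lt_trans u0 ux.
  apply: der_eq.
    apply: derB; first by apply: dX; rewrite !ltW.
    apply: (der_near _ dbx); apply: filterS (near_itv hx) => y /andP[y1 y2].
    by rewrite bcE// (ltW y1) (ltW y2).
  have bi' : R1 <= beta r t x <= R2 by apply: lt_int.
  have bi1 : R1 / 2 < beta r t x by case/andP: bi' => h _; exact: lt_le_trans h.
  by rewrite /c bcE ?(ltW ux) ?(ltW x2)// stripE// ?(ltW xp)// (vel_q hp bi1 xp) subrr.
have Xu : X u = bc u by rewrite bcE ?lexx ?(ltW ut)// Xb// lexx ltW.
have lin k qk : bc u = k -> (forall s, Q k s = qk) ->
    forall s, 0 <= s <= u -> X s = k + qk * (s - u).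
  move=> bk Qk s /andP[s0 su].
  have : X s - qk * s = X u - qk * u.
    apply: (@der_0_cst _ (fun s => X s - qk * s)) => // x /andP[x1 x2]; apply: der_eq.
      apply: derB; first by apply: dX; rewrite (le_trans s0 x1) (le_trans x2)// ltW.
      by apply: derZ; exact: der_id.
    by rewrite /c bcL// bk Qk; ring.
  by rewrite Xu bk; lra.
have QR1 s : Q R1 s = q1 by rewrite (strip_left hp).
have QR2 s : Q R2 s = q2 by rewrite (strip_right hp).
have cX : con 0 t X := con_der dX.
have [K K0 hK] := slab_bounds R12 sQ (ltW tp).
have Xin s : u < s -> s <= t -> R1 < X s < R2.
  move=> us st; have [->|ne] := eqVneq s t; first by rewrite Xt.
  have st' : s < t by rewrite lt_neqAle ne.
  by rewrite Xb ?(ltW us)//; have [] := db s (ltac:(by rewrite us)).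
have cX' s : u <= s <= t -> c s = Q (X s) s by move=> hs; rewrite /c bcE// Xb.
(* Gronwall's inequality for the distance to the side rules out a velocity
   directed outwards. *)
have entry k (sg : R) qk : sg = 1 \/ sg = -1 -> (forall s, Q k s = qk) ->
    (forall s, u < s -> s <= t -> 0 < sg * (X s - k)) -> X u = k -> 0 < sg * qk.
  move=> sg1 Qk Xk Xuk; rewrite ltNge; apply/negP => qn.
  have : - (expR (- K * u) * (sg * (X u - k))) <= - (expR (- K * t) * (sg * (X t - k))).
    apply: (@der_ge0_le _ (fun s => - (expR (- K * s) * (sg * (X s - k))))
      (fun s => - (expR (- K * s) * (sg * Q (X s) s - K * (sg * (X s - k))))) _ _ (ltW ut)).
      move=> s /andP[s1 s2]; apply: der_eq.
        apply: derN; apply: derM; first by apply: der_expR; apply: derZ; exact: der_id.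
        by apply: derZ; apply: derB; [apply: dX; rewrite s2 (le_trans u0)|exact: der_cst].
      by rewrite cX' ?s1//; ring.
    move=> s /andP[s1 s2]; rewrite -mulrN mulr_ge0 ?expR_ge0// opprB subr_ge0.
    have hs : 0 <= s <= t by rewrite s2 (le_trans u0).
    have [_ _ /(_ k)] := hK s hs (X s); rewrite Qk.
    have Xs : 0 <= sg * (X s - k).
      have [->|ne] := eqVneq s u; first by rewrite Xuk subrr mulr0.
      by apply: ltW; apply: Xk => //; rewrite lt_neqAle eq_sym ne.
    have -> : `|X s - k| = sg * (X s - k).
      by case: sg1 Xs => ->; rewrite ?mul1r ?mulN1r => h; [rewrite ger0_norm|rewrite ler0_norm//; move: h; lra].
    rewrite ler_norml => /andP[a1 a2]; case: sg1 Xs qn a1 a2 => ->; rewrite ?mul1r ?mulN1r; lra.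
  rewrite Xuk subrr !mulr0 oppr0 oppr_ge0 pmulr_rle0 ?expR_gt0//.
  by rewrite leNgt Xk// .
exists X; split => //.
  move=> s /andP[s0 st]; have hs : 0 <= s <= t by rewrite s0.
  have [us|su] := leP u s; first by rewrite -cX' ?us//; exact: dX.
  have := dX s hs; rewrite /c bcL ?(ltW su)//.
  move: gb => [/= /andP[g1 g2] _ g3].
  have up : 0 < u := le_lt_trans s0 su.
  have : bc u = R1 \/ bc u = R2.
    rewrite bcE ?lexx ?(ltW ut)//; case: g3; [by left|by right|].
    by move=> e; rewrite e ltxx in up.
  case=> e; rewrite e.
    have q1p : 0 < 1 * q1.
      apply: (entry R1 1 q1) => //; [by left| |by rewrite Xu].
      by move=> x x1 x2; rewrite mul1r subr_gt0; have /andP[] := Xin x x1 x2.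
    rewrite mul1r in q1p.
    rewrite (lin R1 q1 e QR1 s) ?s0 ?(ltW su)// QR1 (strip_left hp)//.
    by rewrite gerDl mulr_ge0_le0 ?(ltW q1p)// subr_le0 ltW.
  have q2n : 0 < -1 * q2.
    apply: (entry R2 (-1) q2) => //; [by right| |by rewrite Xu].
    by move=> x x1 x2; rewrite mulN1r opprB subr_gt0; have /andP[] := Xin x x1 x2.
  rewrite mulN1r oppr_gt0 in q2n.
  rewrite (lin R2 q2 e QR2 s) ?s0 ?(ltW su)// QR2 (strip_right hp)//.
  by rewrite lerDl mulr_le0 ?(ltW q2n)// subr_le0 ltW.
move: gb => [/= /andP[g1 g2] _ g3].
have Xu' : X u = beta r t u by apply: Xb; rewrite lexx ltW.
have [e1|n1] := eqVneq (X u) R1.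
  constructor 2; split; first by split => //; apply: lin => //; rewrite -Xu.
  have := entry R1 1 q1 (or_introl erefl) QR1 _ e1; rewrite mul1r; apply.
  by move=> x x1 x2; rewrite mul1r subr_gt0; have /andP[] := Xin x x1 x2.
have [e2|n2] := eqVneq (X u) R2.
  constructor 3; split; first by split => //; apply: lin => //; rewrite -Xu.
  have := entry R2 (-1) q2 (or_intror erefl) QR2 _ e2; rewrite mulN1r oppr_gt0; apply.
  by move=> x x1 x2; rewrite mulN1r opprB subr_gt0; have /andP[] := Xin x x1 x2.
constructor 1; rewrite Xu' in n1 n2 *; split.
  by rewrite !lt_neqAle eq_sym n1 n2 g1 g2.
by case: g3 => // e; [rewrite e eqxx in n1|rewrite e eqxx in n2].
Qed.

End trajectories.

(** * The density *)

Section labels.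
Context {R : realType}.
Variables (n : nat) (eps R1 R2 q1 q2 : R) (q0 : R -> R) (q ph ps ch th : R -> R -> R).
Hypothesis hp : heat_profile n eps R1 R2 q1 q2 q0 q ph ps ch th.
Variables (rho0 rho1 rho2 : R -> R).
Hypothesis hq0 : Ck_on 2 `[R1, R2] q0.
Hypothesis hrho0 : Ck_on 1 `[R1, R2] rho0.
Hypothesis hrho1 : 0 < q1 -> Ck_on 1 `[0, +oo[ rho1.
Hypothesis hrho2 : 0 < - q2 -> Ck_on 1 `[0, +oo[ rho2.
Hypothesis hcrho1 : 0 < q1 -> density_consistent n q0 rho0 R1 rho1.
Hypothesis hcrho2 : 0 < - q2 -> density_consistent n q0 rho0 R2 rho2.
Implicit Types (r s t y a c : R).

Local Notation d := n.-1.
Local Notation vel := (vel eps ph ps).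
Local Notation vel_r := (vel_r n eps ph ps ch).
Local Notation sph := (strip R1 R2 ph).
Local Notation sps := (strip R1 R2 ps).
Local Notation sch := (strip R1 R2 ch).

Let eps0 : 0 < eps := hp_eps hp.
Let en : eps != 0. Proof. by rewrite gt_eqF. Qed.
Let R1p : 0 < R1 := hp_R1 hp.
Let R12 : R1 < R2 := hp_R12 hp.
Let R12' : R1 <= R2 := ltW R12.
Let halfR : R1 / 2 < R1. Proof. by rewrite ltr_pdivrMr// ltr_pMr// ltr1n. Qed.
Let half r : R1 <= r -> R1 / 2 < r. Proof. exact: lt_le_trans. Qed.
Let I1 : R1 <= R1 <= R2. Proof. by rewrite lexx R12'. Qed.
Let I2 : R1 <= R2 <= R2. Proof. by rewrite lexx R12'. Qed.

Lemma sph_neq0 y s : sph y s != 0.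
Proof.
have s0 : 0 <= Num.max s 0 by rewrite le_max lexx orbT.
exact: (ph_neq0 hp (clampP y R12') s0).
Qed.

Let csph y s : {for (y, s), continuous (fun p : R * R => sph p.1 p.2)}.
Proof. by apply: (strip_cont hp); exact: (hp_cont hp). Qed.
Let csps y s : {for (y, s), continuous (fun p : R * R => sps p.1 p.2)}.
Proof. by apply: (strip_cont hp); exact: (hp_cont_r hp). Qed.
Let csch y s : {for (y, s), continuous (fun p : R * R => sch p.1 p.2)}.
Proof. by apply: (strip_cont hp); exact: (hp_cont_rr hp). Qed.

Lemma slice1 (f : R -> R -> R) y s : {for (y, s), continuous (fun p : R * R => f p.1 p.2)} ->
  {for y, continuous (fun y => f y s)}.
Proof.
move=> cf; apply: (cont_comp (g := fun p : R * R => f p.1 p.2) (f := fun y => (y, s)) cf).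
exact: pair_contl.
Qed.

Lemma slice2 (f : R -> R -> R) y s : {for (y, s), continuous (fun p : R * R => f p.1 p.2)} ->
  {for s, continuous (f y)}.
Proof.
move=> cf; apply: (cont_comp (g := fun p : R * R => f p.1 p.2) (f := fun s => (y, s)) cf).
exact: pair_contr.
Qed.

Lemma Ck1_der (D : set R) (f : R -> R) x : Ck_on 1 D f -> D x ->
  [/\ der f x (f^`()%classic x), {for x, continuous f} & {for x, continuous (f^`()%classic)}].
Proof.
move=> hf Dx; have [h1 h2] := hf x Dx; split; [|exact: (h2 0%N)|exact: (h2 1%N)].
by apply: derivable_der; exact: (h1 0%N).
Qed.

Definition pin a := rho0 a / sph a 0 ^+ 2.
Definition pin' a := rho0^`()%classic a / sph a 0 ^+ 2 - 2 * rho0 a * sps a 0 / sph a 0 ^+ 3.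

Lemma pin_cont a : R1 <= a <= R2 -> {for a, continuous pin} /\ {for a, continuous pin'}.
Proof.
move=> ha; have ha' : `[R1, R2]%classic a by rewrite /= in_itv.
have [_ c0 c1] := Ck1_der hrho0 ha'.
have cp := slice1 (@csph a 0); have cs := slice1 (@csps a 0).
have ci k : {for a, continuous (fun a => (sph a 0 ^+ k)^-1)}.
  by apply: contV; [rewrite expf_neq0// sph_neq0|exact: contX].
split; first by apply: contM => //; exact: ci.
apply: contB; first by apply: contM => //; exact: ci.
apply: contM; last exact: ci.
by apply: contM => //; apply: contM => //; exact: cvg_cst.
Qed.

Lemma pin_der a : R1 < a < R2 -> der pin a (pin' a).
Proof.
move=> ha; have ha' := lt_int ha; have hD : `[R1, R2]%classic a by rewrite /= in_itv.
have [d0 _ _] := Ck1_der hrho0 hD.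
have ds : der (fun a => sph a 0) a (sps a 0).
  rewrite stripE//; apply: (der_near _ (hp_r hp (half _) (lexx 0))); last by case/andP: ha'.
  by apply: filterS (near_itv ha) => y hy; rewrite stripE//; exact: lt_int.
have pn := sph_neq0 a 0.
apply: der_eq.
  by apply: der_div; [rewrite expf_neq0|exact: d0|exact: (derX 2 ds)].
by rewrite /pin' /= expr1; field.
Qed.

Section side.
Variables (c qc : R) (rc : R -> R).
Hypotheses (hc : R1 <= c <= R2) (qn : qc != 0) (hrc : Ck_on 1 `[0, +oo[ rc).
Hypothesis vc : vel c 0 = qc.
Hypothesis dcons : density_consistent n q0 rho0 c rc.

Definition hit a := (c - a) / qc.
(** The exponential cancels the amount [qc ^+ 2 * hit a] which the integral of the squared velocity
    gathers before entry. *)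
Definition pside a := rc (hit a) / sph c (hit a) ^+ 2 * expR (- (qc ^+ 2 / eps) * hit a).
Definition pside' a := - qc^-1 * ((rc^`()%classic (hit a) / sph c (hit a) ^+ 2
  + eps * rc (hit a) * sch c (hit a) / sph c (hit a) ^+ 3
  - qc ^+ 2 / eps * rc (hit a) / sph c (hit a) ^+ 2) * expR (- (qc ^+ 2 / eps) * hit a)).

Let dhit a : der hit a (- qc^-1).
Proof.
apply: der_eq.
  by apply: derM; [apply: derB; [exact: der_cst|exact: der_id]|exact: der_cst].
by rewrite mulr0 addr0 sub0r mulN1r.
Qed.

Let hD (s : R) : 0 <= s -> `[0, +oo[%classic s.
Proof. by rewrite /= in_itv/= andbT. Qed.

Lemma pside_der a : 0 < hit a -> der pside a (pside' a).
Proof.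
move=> h0; have [d0 _ _] := Ck1_der hrc (hD (ltW h0)).
have ds : der (sph c) (hit a) (- (eps / 2) * sch c (hit a)).
  rewrite (stripE ch hc (ltW h0)); apply: (der_near _ (hp_t hp (half _) h0)); last by case/andP: hc.
  by apply: filterS (lt_nbhsr h0) => s /ltW hs; rewrite stripE.
have pn := sph_neq0 c (hit a).
apply: der_eq.
  apply: derM.
    apply: der_div; first by rewrite expf_neq0.
      exact: (der_comp d0 (dhit a)).
    apply: (derX 2); exact: (der_comp ds (dhit a)).
  by apply: der_expR; apply: derZ; exact: dhit.
rewrite /pside' /= expr1; move: (expR _) => X; field.
by rewrite en qn pn.
Qed.

Lemma pside_cont a : 0 <= hit a -> {for a, continuous pside} /\ {for a, continuous pside'}.
Proof.
move=> h0; have [_ c0 c1] := Ck1_der hrc (hD h0); have ct := der_cont (dhit a).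
have cp : {for a, continuous (fun a => sph c (hit a))}.
  by apply: (cont_comp (g := sph c)) ct; exact: (slice2 (@csph c (hit a))).
have cc : {for a, continuous (fun a => sch c (hit a))}.
  by apply: (cont_comp (g := sch c)) ct; exact: (slice2 (@csch c (hit a))).
have cr : {for a, continuous (fun a => rc (hit a))} by apply: (cont_comp (g := rc)) ct.
have cr' : {for a, continuous (fun a => rc^`()%classic (hit a))}.
  by apply: (cont_comp (g := rc^`()%classic)) ct.
have cX : {for a, continuous (fun a => expR (- (qc ^+ 2 / eps) * hit a))}.
  apply: (cont_comp (g := expR)); first exact: continuous_expR.
  by apply: contM => //; exact: cvg_cst.
have ci k : {for a, continuous (fun a => (sph c (hit a) ^+ k)^-1)}.
  by apply: contV; [rewrite expf_neq0// sph_neq0|exact: contX].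
split; first by apply: contM => //; apply: contM => //; exact: ci.
apply: contM; first exact: cvg_cst.
apply: contM => //; apply: contB; first apply: contD.
- by apply: contM => //; exact: ci.
- apply: contM; last exact: ci.
  by apply: contM => //; apply: contM => //; exact: cvg_cst.
- apply: contM; last exact: ci.
  by apply: contM => //; exact: cvg_cst.
Qed.

Let hitc : hit c = 0. Proof. by rewrite /hit subrr mul0r. Qed.

Lemma pside_match : pside c = pin c.
Proof. by have [e _] := dcons; rewrite /pside hitc mulr0 expR0 mulr1 /pin e. Qed.

Lemma q0_der_vel r : R1 <= r <= R2 -> q0^`()%classic r = vel_r r 0.
Proof.
have dq x : R1 <= x <= R2 -> der q0 x (q0^`()%classic x) /\ {for x, continuous (q0^`()%classic)}.
  move=> hx; have hx' : `[R1, R2]%classic x by rewrite /= in_itv.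
  have [h1 h2] := hq0 hx'; split; last exact: (h2 1%N).
  by apply: derivable_der; exact: (h1 0%N).
apply: (con_eq (f := q0^`()%classic) (g := fun x => vel_r x 0) R12).
- by move=> x hx; have [] := dq x hx.
- have cv x : {for x, continuous (fun x => strip R1 R2 vel_r x 0)}.
    by apply: slice1; have [] := strip_vel_cont hp x 0.
  move=> x /andP[x1 x2].
  have pn : ph x 0 != 0 by apply: (ph_neq0 hp) => //; rewrite x1.
  have hx := half x1; have xp : x != 0 by rewrite gt_eqF// (lt_le_trans R1p).
  have c1 := der_cont (hp_r hp hx (lexx 0)); have c2 := der_cont (hp_rr hp hx (lexx 0)).
  have c3 : {for x, continuous (fun x => ch x 0)}.
    have := slice1 (f := fun r t => ch r (Num.max t 0)) (@hp_cont_rr _ _ _ _ _ _ _ _ _ _ _ _ _ hp x 0 hx).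
    by apply: cont_eq => y; rewrite max_l.
  have cv1 : {for x, continuous (fun x => vel x 0)}.
    apply: contM; first exact: cvg_cst.
    by apply: contM => //; exact: contV.
  apply: contD; first apply: contD.
  + apply: contM => //; apply: contN; apply: contM; first exact: cvg_cst.
    by apply: contV => //; exact: cvg_id.
  + by apply: contM; [exact: cvg_cst|apply: contM => //; exact: contV].
  + by apply: contM; [exact: contX|exact: cvg_cst].
- move=> x hx; have hx' := lt_int hx; have [d1 _] := dq x hx'.
  apply: (der_uniq_itv hx _ d1 (vel_der_r hp hx' (lexx 0))) => y hy.
  by rewrite (vel_init hp)//; exact: lt_int.
Qed.

(** Consistency of first order gives the derivative of [rc] at 0, and the value [qc] of the velocity
    replaces [ps c 0] by a multiple of [ph c 0]; the equality is then algebraic. *)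
Lemma pside'_match : pside' c = pin' c.
Proof.
have [e0 e1] := dcons; have hD0 : `[R1, R2]%classic c by rewrite /= in_itv.
have [d0 _ _] := Ck1_der hrho0 hD0; have [dr _ _] := Ck1_der hrc (hD (lexx 0)).
have cp : 0 < c by case/andP: hc => h _; exact: lt_le_trans h.
have cn : c != 0 by rewrite gt_eqF.
have dq : der q0 c (vel_r c 0).
  rewrite -q0_der_vel//; apply: derivable_der; have [h1 _] := hq0 hD0; exact: (h1 0%N).
have pn : ph c 0 != 0 := ph_neq0 hp hc (lexx 0).
have p1 : (p_boundary n c rc)^`()%classic 0 = c ^+ d * rc^`()%classic 0.
  by apply: der_derive1; apply: derZ.
have cd : d%:R * c ^+ d.-1 = d%:R / c * c ^+ d.
  by case: d => [|k]; [rewrite !mul0r|rewrite /= exprS; field].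
have p2 : (fun r => q0 r * p_initial n rho0 r)^`()%classic c =
    c ^+ d * (vel_r c 0 * rho0 c + qc * (d%:R / c * rho0 c + rho0^`()%classic c)).
  apply: der_derive1; apply: der_eq.
    apply: derM; first exact: dq.
    apply: derM; last exact: d0.
    by apply: derX; exact: der_id.
  rewrite /p_initial -(vel_init hp hc) vc mulr1 cd; ring.
have cdn : c ^+ d != 0 by rewrite expf_neq0.
have : rc^`()%classic 0 = - (vel_r c 0 * rho0 c + qc * (d%:R / c * rho0 c + rho0^`()%classic c)).
  by apply: (mulfI cdn); rewrite mulrN; apply/eqP; rewrite -addr_eq0 -p1 -p2 e1.
have psE : ps c 0 = - (qc / eps) * ph c 0.
  by rewrite -vc /vel; field; rewrite en pn.
rewrite /pside' hitc mulr0 expR0 mulr1 /pin' !stripE// -e0 => ->.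
rewrite /vel_r vc psE; move: (rho0^`()%classic c) (rho0 c) => u v; field.
by rewrite en qn pn cn.
Qed.

End side.

(* The conserved factor of the density, as a function of the position [a] at time 0
   of the continued characteristic; [hit] is the time at which it enters. *)
Definition Phat a := if a < R1 then pside R1 q1 rho1 a
  else if R2 < a then pside R2 q2 rho2 a else pin a.
Definition Phat' a := if a < R1 then pside' R1 q1 rho1 a
  else if R2 < a then pside' R2 q2 rho2 a else pin' a.

(** The labels that occur: those at or beyond a side only if the flow enters through it. *)
Definition label_dom a := (R1 < a \/ 0 < q1) /\ (a < R2 \/ q2 < 0).

Let v1 : vel R1 0 = q1 := vel_left hp (lexx 0).
Let v2 : vel R2 0 = q2 := vel_right hp (lexx 0).

Lemma Phat_regular a : label_dom a -> a != R1 -> a != R2 ->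
  der Phat a (Phat' a) /\ {for a, continuous Phat'}.
Proof.
move=> [l1 l2] n1 n2.
have [a1|a1] := ltP a R1.
  have q1p : 0 < q1 by case: l1 => // h; have := lt_trans a1 h; rewrite ltxx.
  have h0 : 0 < hit R1 q1 a by rewrite /hit divr_gt0// subr_gt0.
  have nr : \forall x \near a, x < R1 by exact: lt_nbhsl.
  have qn : q1 != 0 by rewrite gt_eqF.
  split.
    rewrite /Phat' a1; apply: (der_near _ (pside_der I1 qn (hrho1 q1p) h0)).
    by apply: filterS nr => x hx; rewrite /Phat hx.
  have [_ cc] := pside_cont (c:=R1) (qc:=q1) (hrho1 q1p) (ltW h0).
  by apply: (cont_near _ cc); apply: filterS nr => x hx; rewrite /Phat' hx.
have [a2|a2] := ltP R2 a.
  have q2n : q2 < 0 by case: l2 => // h; have := lt_trans a2 h; rewrite ltxx.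
  have q2n' : 0 < - q2 by rewrite oppr_gt0.
  have h0 : 0 < hit R2 q2 a by rewrite /hit -mulrNN mulr_gt0 ?opprB ?subr_gt0// -invrN invr_gt0.
  have nr : \forall x \near a, R2 < x by exact: lt_nbhsr.
  have qn : q2 != 0 by rewrite lt_eqF.
  have nx x : R2 < x -> (x < R1) = false by move=> h; apply/negbTE; rewrite -leNgt ltW// (lt_trans R12).
  split.
    rewrite /Phat' nx// a2; apply: (der_near _ (pside_der I2 qn (hrho2 q2n') h0)).
    by apply: filterS nr => x hx; rewrite /Phat nx// hx.
  have [_ cc] := pside_cont (c:=R2) (qc:=q2) (hrho2 q2n') (ltW h0).
  by apply: (cont_near _ cc); apply: filterS nr => x hx; rewrite /Phat' nx// hx.
have ha : R1 < a < R2 by rewrite !lt_neqAle eq_sym n1 n2 a1.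
have nx x : R1 < x < R2 -> (x < R1) = false /\ (R2 < x) = false.
  by move=> /andP[x1 x2]; split; apply/negbTE; rewrite -leNgt ltW.
split.
  rewrite /Phat' !(nx a ha).1 (nx a ha).2; apply: (der_near _ (pin_der ha)).
  by apply: filterS (near_itv ha) => x hx; rewrite /Phat (nx x hx).1 (nx x hx).2.
have [_ cc] := pin_cont (lt_int ha).
by apply: (cont_near _ cc); apply: filterS (near_itv ha) => x hx; rewrite /Phat' (nx x hx).1 (nx x hx).2.
Qed.

(** At a side the two branches agree together with their derivatives, by [pside_match] and
    [pside'_match], and [glue_der] applies. *)
Lemma Phat_C1 a : label_dom a -> der Phat a (Phat' a) /\ {for a, continuous Phat'}.
Proof.
move=> la; have [l1 l2] := la.
have [e1|n1] := eqVneq a R1.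
  rewrite e1 in la l1 l2 *.
  have q1p : 0 < q1 by case: l1 => //; rewrite ltxx.
  have qn : q1 != 0 by rewrite gt_eqF.
  have h0 : 0 <= hit R1 q1 R1 by rewrite /hit subrr mul0r.
  have [c1 c1'] := pside_cont (c:=R1) (qc:=q1) (hrho1 q1p) h0; have [c2 c2'] := pin_cont I1.
  have m := pside_match q1 (hcrho1 q1p).
  have m' := pside'_match I1 qn (hrho1 q1p) v1 (hcrho1 q1p).
  have nr : \forall x \near R1, x < R2 by exact: lt_nbhsl.
  have nx x : x < R2 -> (R2 < x) = false by move=> h; apply/negbTE; rewrite -leNgt ltW.
  have cP' : {for R1, continuous Phat'}.
    apply: (cont_near _ (glue_cont c1' c2' m')).
    by apply: filterS nr => x /nx; rewrite /Phat' => ->.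
  split => //; have e0 : 0 < R2 - R1 by rewrite subr_gt0.
  apply: (glue_der e0 _ cP').
    apply: (cont_near _ (glue_cont c1 c2 m)).
    by apply: filterS nr => x /nx; rewrite /Phat => ->.
  move=> x xn; rewrite ltr_norml => /andP[x1 x2].
  have xR2 : x < R2 by lra.
  by have [] := @Phat_regular x _ xn (negbT (lt_eqF xR2)); [split; [right|left]|].
have [e2|n2] := eqVneq a R2; last exact: Phat_regular.
rewrite e2 in la l1 l2 *.
have q2n : q2 < 0 by case: l2 => //; rewrite ltxx.
have q2n' : 0 < - q2 by rewrite oppr_gt0.
have qn : q2 != 0 by rewrite lt_eqF.
have h0 : 0 <= hit R2 q2 R2 by rewrite /hit subrr mul0r.
have [c1 c1'] := pside_cont (c:=R2) (qc:=q2) (hrho2 q2n') h0; have [c2 c2'] := pin_cont I2.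
have m := pside_match q2 (hcrho2 q2n').
have m' := pside'_match I2 qn (hrho2 q2n') v2 (hcrho2 q2n').
have nr : \forall x \near R2, R1 < x by exact: lt_nbhsr.
have nx x : R1 < x -> (x < R1) = false by move=> h; apply/negbTE; rewrite -leNgt ltW.
have cP' : {for R2, continuous Phat'}.
  apply: (cont_near _ (glue_cont c2' c1' (esym m'))).
  apply: filterS nr => x /nx; rewrite /Phat' => ->.
  by case: ltgtP => // ->; rewrite m'.
split => //; have e0 : 0 < R2 - R1 by rewrite subr_gt0.
apply: (glue_der e0 _ cP').
  apply: (cont_near _ (glue_cont c2 c1 (esym m))).
  apply: filterS nr => x /nx; rewrite /Phat => ->.
  by case: ltgtP => // ->; rewrite m.
move=> x xn; rewrite ltr_norml => /andP[x1 x2].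
have xR1 : R1 < x by lra.
by have [] := @Phat_regular x _ (negbT (gt_eqF xR1)) xn; [split; [left|right]|].
Qed.

End labels.

Lemma dist_squeeze {R : realType} {T : Type} (F : set_system T) (f g : T -> R) (l : R) :
  Filter F -> (\forall x \near F, `|f x - l| <= g x) -> g x @[x --> F] --> (0 : R) -> f x @[x --> F] --> l.
Proof.
move=> FF fg g0; apply/cvgrPdist_lt => e e0.
have ge : \forall x \near F, g x < e by apply: (cvgr_lt _ g0).
by apply: filterS (filterI fg ge) => x [h1 h2]; rewrite distrC (le_lt_trans h1).
Qed.

Lemma cont_cvg {R : realType} {T : Type} {U : topologicalType} (F : set_system T) (f : T -> U) (g : U -> R) (l : U) :
  {for l, continuous g} -> f x @[x --> F] --> l -> g (f x) @[x --> F] --> g l.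
Proof. by move=> cg cf; apply: cvg_comp cf _; exact: cg. Qed.

(** * Regularity, equation and limits of the density *)

Section density.
Context {R : realType}.
Variables (n : nat) (eps R1 R2 q1 q2 : R) (q0 : R -> R) (q ph ps ch th : R -> R -> R).
Hypothesis hp : heat_profile n eps R1 R2 q1 q2 q0 q ph ps ch th.
Variables (rho0 rho1 rho2 : R -> R).
Hypothesis hq0 : Ck_on 2 `[R1, R2] q0.
Hypothesis hrho0 : Ck_on 1 `[R1, R2] rho0.
Hypothesis hrho1 : 0 < q1 -> Ck_on 1 `[0, +oo[ rho1.
Hypothesis hrho2 : 0 < - q2 -> Ck_on 1 `[0, +oo[ rho2.
Hypothesis hcrho1 : 0 < q1 -> density_consistent n q0 rho0 R1 rho1.
Hypothesis hcrho2 : 0 < - q2 -> density_consistent n q0 rho0 R2 rho2.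
Variables (beta : R -> R -> R -> R) (t0 : R -> R -> R).
Hypothesis hbeta : forall r t, R1 < r < R2 -> 0 < t ->
  [/\ 0 <= t0 r t < t, beta r t t = r, {within `[t0 r t, t], continuous (beta r t)},
      forall s, t0 r t < s < t -> R1 < beta r t s < R2 /\
        is_derive s (1 : R) (beta r t) (q (beta r t s) s)
    & Gamma R1 R2 (beta r t (t0 r t), t0 r t)].
Variable B : R -> R -> R -> R.
Implicit Types (r s t y a c : R).

Local Notation d := n.-1.
Local Notation vel := (vel eps ph ps).
Local Notation vel_r := (vel_r n eps ph ps ch).
Local Notation Q := (strip R1 R2 vel).
Local Notation Qr := (strip R1 R2 vel_r).
Local Notation Qph := (strip R1 R2 ph).
Local Notation Q2 := (fun y s => Q y s ^+ 2).
Local Notation Q2r := (fun y s => 2 * Q y s * Qr y s).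
Local Notation Phat := (Phat eps R1 R2 q1 q2 ph rho0 rho1 rho2).
Local Notation Phat' := (Phat' eps R1 R2 q1 q2 ph ps ch rho0 rho1 rho2).
Local Notation enters := (@enters R).

Hypothesis hBt : forall r t, R1 < r < R2 -> 0 < t ->
  [/\ B r t t = r, solution Q t (B r t), forall s, t0 r t <= s <= t -> B r t s = beta r t s &
   [\/ R1 < B r t (t0 r t) < R2 /\ t0 r t = 0, enters (B r t) (t0 r t) R1 q1 /\ 0 < q1 |
       enters (B r t) (t0 r t) R2 q2 /\ q2 < 0]].

Let eps0 : 0 < eps := hp_eps hp.
Let en : eps != 0. Proof. by rewrite gt_eqF. Qed.
Let R1p : 0 < R1 := hp_R1 hp.
Let R12 : R1 < R2 := hp_R12 hp.
Let R12' : R1 <= R2 := ltW R12.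
Let sQ : slab R1 R2 Q Qr := slab_vel hp.
Let sQ2 : slab R1 R2 Q2 Q2r := slab_vel2 hp.
Let halfR : R1 / 2 < R1. Proof. by rewrite ltr_pdivrMr// ltr_pMr// ltr1n. Qed.
Let half r : R1 <= r -> R1 / 2 < r. Proof. exact: lt_le_trans. Qed.

Let hB r t : R1 < r < R2 -> 0 < t -> B r t t = r /\ solution Q t (B r t).
Proof. by move=> hr tp; have [] := hBt hr tp. Qed.

Let t0P r t : R1 < r < R2 -> 0 < t -> 0 <= t0 r t < t.
Proof. by move=> hr tp; have [] := hbeta hr tp. Qed.

Let hK r t : R1 < r < R2 -> 0 < t -> [/\ 0 <= t0 r t < t,
  forall s, t0 r t < s <= t -> R1 < B r t s < R2 &
  forall s, 0 <= s < t0 r t -> B r t s < R1 \/ R2 < B r t s].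
Proof.
move=> hr tp; have [Bt sB bB cB] := hBt hr tp; have [/andP[u0 ut] _ _ db _] := hbeta hr tp.
split; first by rewrite u0.
  move=> s /andP[us st]; have [->|ne] := eqVneq s t; first by rewrite Bt.
  have hs : t0 r t < s < t by rewrite us lt_neqAle ne.
  by rewrite bB ?(ltW us)//; have [] := db s hs.
move=> s /andP[s0 su]; case: cB => -[h1 h2].
- by move: su; rewrite h2 ltNge s0.
- left; have [_ ->] := h1; last by rewrite s0 ltW.
  by rewrite gtrDl nmulr_llt0// subr_lt0.
- right; have [_ ->] := h1; last by rewrite s0 ltW.
  by rewrite ltrDl nmulr_lgt0// subr_lt0.
Qed.

(** The entry time of the label [a]: its distance to the interval divided by the inward speed of the
    side. Both maxima vanish for labels inside, which start at time 0. *)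
Let T0 a := Num.max (R1 - a) 0 / q1 - Num.max (a - R2) 0 / q2.

Let T0c a : {for a, continuous T0}.
Proof.
have ci c : {for c, continuous (fun a : R => a)} by exact: cvg_id.
have cm (f : R -> R) : {for a, continuous f} -> {for a, continuous (fun a => Num.max (f a) 0)}.
  by move=> cf; apply: (cont_comp (g := fun y => Num.max y 0)) cf; exact: max_cont.
apply: contB; (apply: contM; last exact: cvg_cst); apply: cm; apply: contB;
  by [exact: ci|exact: cvg_cst].
Qed.

Let ht0 r t : R1 < r < R2 -> 0 < t -> t0 r t = T0 (B r t 0).
Proof.
move=> hr tp; have [Bt sB bB cB] := hBt hr tp; have /andP[u0 ut] := t0P hr tp.
have I0 : (0 : R) <= 0 <= t0 r t by rewrite lexx u0.
rewrite /T0; case: cB => -[h1 h2].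
- move: h1; rewrite h2 => /andP[a1 a2].
  by rewrite !max_r ?subr_le0 ?(ltW a1) ?(ltW a2)// !mul0r subrr.
- have [_ /(_ 0 I0) ->] := h1; have q1n : q1 != 0 by rewrite gt_eqF.
  have qt : 0 <= q1 * t0 r t by rewrite mulr_ge0// ltW.
  rewrite sub0r mulrN max_l ?max_r ?mul0r; [|move: R12; lra|lra]; field; exact: q1n.
- have [_ /(_ 0 I0) ->] := h1; have q2n : q2 != 0 by rewrite lt_eqF.
  have qt : q2 * t0 r t <= 0 by rewrite mulr_le0_ge0// ltW.
  rewrite sub0r mulrN max_r ?max_l ?mul0r; [|lra|move: R12; lra]; field; exact: q2n.
Qed.

Let Ba r t := B r t 0.
Local Notation V := (Zint B Q2).
Local Notation aR := (Zr Qr B t0 Qr).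
Local Notation VR := (Zr Qr B t0 Q2r).

Lemma label_B r t : R1 < r < R2 -> 0 < t -> label_dom R1 R2 q1 q2 (Ba r t).
Proof.
move=> hr tp; have [Bt sB bB cB] := hBt hr tp; have /andP[u0 ut] := t0P hr tp.
have I0 : (0 : R) <= 0 <= t0 r t by rewrite lexx u0.
rewrite /Ba; case: cB => -[h1 h2].
- by move: h1; rewrite h2 => /andP[a1 a2]; split; left.
- split; [by right|left]; have [_ /(_ 0 I0) ->] := h1.
  have qt : 0 <= q1 * t0 r t by rewrite mulr_ge0// ltW.
  by move: R12; lra.
- split; [left|by right]; have [_ /(_ 0 I0) ->] := h1.
  have qt : q2 * t0 r t <= 0 by rewrite mulr_le0_ge0// ltW.
  by move: R12; lra.
Qed.

Let along (h : R -> R -> R) r t : (forall y s, {for (y, s), continuous (fun z : R * R => h z.1 z.2)}) ->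
  R1 < r < R2 -> 0 < t -> con 0 t (fun s => h (B r t s) s).
Proof.
move=> ch' hr tp s hs; have [_ sB] := hB hr tp.
apply: (cont_comp (g := fun z : R * R => h z.1 z.2) (f := fun s => (B r t s, s))) => //.
by apply: cont_pair; [exact: (con_der sB)|exact: cvg_id].
Qed.

(** Writes the label as an integral along the characteristic, so that its derivatives are obtained
    from those of [Zint]. *)
Lemma BaE r t : R1 < r < R2 -> 0 < t -> Ba r t = r - Zint B Q r t.
Proof.
move=> hr tp; have [Bt sB] := hB hr tp.
by rewrite /Zint (@FTC2 _ 0 t (B r t) _ (ltW tp) sB (along (slab_cont sQ) hr tp)) Bt opprB addrCA subrr addr0.
Qed.

Definition dens r t := Phat (Ba r t) * ph r t ^+ 2 * expR (V r t / eps).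
Definition dens_r r t := (Phat' (Ba r t) * (1 - aR r t) * ph r t ^+ 2
  + Phat (Ba r t) * (2 * ph r t * ps r t) + Phat (Ba r t) * ph r t ^+ 2 * (VR r t / eps))
  * expR (V r t / eps).
Definition dens_t r t := (- Phat' (Ba r t) * (Q r t - Q r t * aR r t) * ph r t ^+ 2
  - Phat (Ba r t) * (eps * ph r t * ch r t)
  + Phat (Ba r t) * ph r t ^+ 2 * ((Q r t ^+ 2 - Q r t * VR r t) / eps))
  * expR (V r t / eps).

Let PC1 a : label_dom R1 R2 q1 q2 a ->
  der Phat a (Phat' a) /\ {for a, continuous Phat'}.
Proof. exact: (Phat_C1 hp hq0 hrho0 hrho1 hrho2 hcrho1 hcrho2). Qed.

Lemma dens_der_r r t : R1 < r < R2 -> 0 < t -> der (fun r => dens r t) r (dens_r r t).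
Proof.
move=> hr tp; have [dP _] := PC1 (label_B hr tp).
have da : der (fun r => Ba r t) r (1 - aR r t).
  apply: (der_near (f := fun r => r - Zint B Q r t)).
    by apply: filterS (near_itv hr) => x hx; rewrite BaE.
  apply: derB; first exact: der_id.
  exact: (Zint_der_r R12 sQ hB hK sQ hr tp).
have dV := Zint_der_r R12 sQ hB hK sQ2 hr tp.
have hr' : R1 / 2 < r by apply: half; case/andP: hr => /ltW.
have dp := hp_r hp hr' (ltW tp).
apply: der_eq.
  apply: derM; first by apply: derM; [exact: (der_comp (f := fun r => Ba r t) dP da)|exact: (derX 2 dp)].
  by apply: der_expR; apply: derM; [exact: dV|exact: der_cst].
by rewrite /dens_r /= expr1 mulr0 addr0; ring.
Qed.

Lemma dens_der_t r t : R1 < r < R2 -> 0 < t -> der (dens r) t (dens_t r t).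
Proof.
move=> hr tp; have [dP _] := PC1 (label_B hr tp).
have da : der (Ba r) t (- (Q r t - Q r t * aR r t)).
  apply: (der_near (f := fun t => r - Zint B Q r t)).
    by apply: filterS (lt_nbhsr tp) => x hx; rewrite BaE.
  apply: der_eq; first by apply: derB; [exact: der_cst|exact: (Zint_der_t R12 sQ hB hK T0c ht0 sQ hr tp)].
  by rewrite sub0r.
have dV := Zint_der_t R12 sQ hB hK T0c ht0 sQ2 hr tp.
have hr' : R1 / 2 < r by apply: half; case/andP: hr => /ltW.
have dp := hp_t hp hr' tp.
apply: der_eq.
  apply: derM; first by apply: derM; [exact: (der_comp (f := Ba r) dP da)|exact: (derX 2 dp)].
  by apply: der_expR; apply: derM; [exact: dV|exact: der_cst].
by rewrite /dens_t /= expr1 mulr0 addr0; field.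
Qed.

(** [aR] and [VR] drop out: the label is constant along characteristics, and [V] grows at the rate
    [Q ^+ 2]. What remains is the expression of [q_r] through the derivative of [ln ph] along the
    characteristic. *)
Lemma dens_equation r t : R1 < r < R2 -> 0 < t ->
  dens_t r t + vel r t * dens_r r t + (vel_r r t + d%:R / r * vel r t) * dens r t = 0.
Proof.
move=> hr tp; have hr' := lt_int hr; have pn := ph_neq0 hp hr' (ltW tp).
have rn : r != 0 by rewrite gt_eqF//; case/andP: hr => h _; exact: lt_trans h.
rewrite /dens_t /dens_r /dens stripE ?(ltW tp)//.
have psE : ps r t = - (vel r t / eps) * ph r t by rewrite /vel; field; rewrite en pn.
rewrite /vel_r; move: (vel r t) psE => v ->.
move: (expR _) (Phat _) (Phat' _) (aR r t) (VR r t) => E P P' x y; field.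
by rewrite en pn rn.
Qed.

Section continuity.
Variables (r t : R).
Hypotheses (hr : R1 < r < R2) (tp : 0 < t).
Let r1 : R1 / 2 < r. Proof. by apply: half; case/andP: hr => /ltW. Qed.

Let cmax (f : R -> R -> R) : {for (r, t), continuous (fun p : R * R => f p.1 (Num.max p.2 0))} ->
  {for (r, t), continuous (fun p : R * R => f p.1 p.2)}.
Proof.
by apply: cont_near; apply: filterS (near_int hr tp) => -[x y] [/= _ h _]; rewrite max_l// ltW.
Qed.

Let cph : {for (r, t), continuous (fun p : R * R => ph p.1 p.2)}.
Proof. by apply: cmax; exact: (hp_cont hp). Qed.
Let cps : {for (r, t), continuous (fun p : R * R => ps p.1 p.2)}.
Proof. by apply: cmax; exact: (hp_cont_r hp). Qed.
Let cch : {for (r, t), continuous (fun p : R * R => ch p.1 p.2)}.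
Proof. by apply: cmax; exact: (hp_cont_rr hp). Qed.
Let cQ : {for (r, t), continuous (fun p : R * R => Q p.1 p.2)} := @slab_cont _ _ _ _ _ sQ r t.
Let ca : {for (r, t), continuous (fun p : R * R => Ba p.1 p.2)} := B0_cont R12 sQ hB hr tp.
Let cP : {for (r, t), continuous (fun p : R * R => Phat (Ba p.1 p.2))}.
Proof. by apply: (cont_comp (g := Phat)) ca; have [h _] := PC1 (label_B hr tp); exact: der_cont h. Qed.
Let cP' : {for (r, t), continuous (fun p : R * R => Phat' (Ba p.1 p.2))}.
Proof. by apply: (cont_comp (g := Phat')) ca; have [_ h] := PC1 (label_B hr tp). Qed.
Let cc k : {for (r, t), continuous (fun p : R * R => k : R)}.
Proof. exact: cvg_cst. Qed.
Let cE : {for (r, t), continuous (fun p : R * R => expR (V p.1 p.2 / eps))}.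
Proof.
apply: (cont_comp (g := expR)); first exact: continuous_expR.
apply: contM; last exact: cc.
exact: (Zint_cont R12 sQ hB (slab_cont sQ2) hr tp).
Qed.
Let caR : {for (r, t), continuous (fun p : R * R => aR p.1 p.2)} :=
  Zr_cont R12 sQ hB hK T0c ht0 (slab_contr sQ) hr tp.
Let cVR : {for (r, t), continuous (fun p : R * R => VR p.1 p.2)} :=
  Zr_cont R12 sQ hB hK T0c ht0 (slab_contr sQ2) hr tp.

Lemma dens_cont : {for (r, t), continuous (fun p : R * R => dens p.1 p.2)}.
Proof. by apply: contM => //; apply: contM => //; exact: contX. Qed.

Lemma dens_r_cont : {for (r, t), continuous (fun p : R * R => dens_r p.1 p.2)}.
Proof.
apply: contM => //; apply: contD; first apply: contD.
- apply: contM; last exact: contX.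
  by apply: contM => //; apply: contB.
- by apply: contM => //; apply: contM => //; exact: contM.
- apply: contM; last exact: contM.
  by apply: contM => //; exact: contX.
Qed.

Lemma dens_t_cont : {for (r, t), continuous (fun p : R * R => dens_t p.1 p.2)}.
Proof.
apply: contM => //; apply: contD; first apply: contB.
- apply: contM; last exact: contX.
  apply: contM; first exact: contN.
  by apply: contB => //; exact: contM.
- by apply: contM => //; apply: contM => //; exact: contM.
- apply: contM; first by apply: contM => //; exact: contX.
  apply: contM; last exact: cc.
  by apply: contB; [exact: contX|exact: contM].
Qed.

End continuity.

Let entry_point r t : R1 < r < R2 -> 0 < t -> R1 <= B r t (t0 r t) <= R2.
Proof.
move=> hr tp; have [_ _ _ cB] := hBt hr tp.
by case: cB => -[h1 h2]; [exact: lt_int|have [-> _] := h1; rewrite lexx R12'..].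
Qed.

(** The product [Y] of [B ^+ d], [ph ^+ 2] and the two exponentials is constant along the
    characteristic: its logarithmic derivative is [d q / r + 2 (ln ph)' + q^2 / eps + q_r = 0]. *)
Lemma transport_identity r t : R1 < r < R2 -> 0 < t ->
  (r ^+ d)^-1 * expR (- intR (t0 r t) t (fun s => Qr (B r t s) s)) =
  ((B r t (t0 r t)) ^+ d * Qph (B r t (t0 r t)) (t0 r t) ^+ 2)^-1 * ph r t ^+ 2
    * expR (intR (t0 r t) t (fun s => Q2 (B r t s) s) / eps).
Proof.
move=> hr tp; have [Bt sB] := hB hr tp; have [/andP[u0 ut] Bi _] := hK hr tp.
set u := t0 r t in u0 ut Bi *.
have sub h : con 0 t h -> con u t h by apply: con_sub.
have ct' (s : R) : u <= s <= t -> 0 <= s <= t by move=> /andP[s1 ->]; rewrite (le_trans u0).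
have c1 := sub _ (along (slab_cont sQ2) hr tp).
have c2 := sub _ (along (slab_contr sQ) hr tp).
have [F1 [F10 dF1]] := primitive (ltW ut) c1; have [F2 [F20 dF2]] := primitive (ltW ut) c2.
rewrite (FTC2 (ltW ut) dF1 c1) (FTC2 (ltW ut) dF2 c2) F10 F20 !subr0.
pose Y s := (B r t s) ^+ d * Qph (B r t s) s ^+ 2 * expR (F1 s / eps + F2 s).
have cY : con u t Y.
  apply: conM; first apply: conM.
  - by apply: conX; apply: sub; exact: (con_der sB).
  - by apply: conX; apply: sub; apply: (along _ hr tp) => y s; apply: (strip_cont hp); exact: (hp_cont hp).
  - move=> s hs; apply: (cont_comp (g := expR)); first exact: continuous_expR.
    apply: contD; last exact: der_cont (dF2 s hs).
    by apply: contM; [exact: der_cont (dF1 s hs)|exact: cvg_cst].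
have YY : Y u = Y t.
  apply: (open_der0_cst (ltW ut) cY) => s /andP[s1 s2].
  have hs : u < s <= t by rewrite s1 ltW.
  have hs' : u <= s <= t by rewrite !ltW.
  have sp : 0 < s := le_lt_trans u0 s1.
  have bi := Bi s hs; have bi' := lt_int bi.
  have b1 : R1 / 2 < B r t s by apply: half; case/andP: bi'.
  have dB : der (B r t) s (vel (B r t s) s).
    by apply: der_eq; [apply: sB; exact: ct'|rewrite stripE// ltW].
  have dp : der (fun s => Qph (B r t s) s) s
      (ps (B r t s) s * vel (B r t s) s + - (eps / 2) * ch (B r t s) s).
    apply: (der_near (f := fun s => ph (B r t s) s)).
      have cb : {for s, continuous (B r t)} := der_cont dB.
      have := cb _ (near_itv bi); rewrite nbhs_filterE /= => nb.
      near=> x; rewrite stripE//; first by apply: lt_int; near: x; exact: nb.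
      by apply: ltW; near: x; exact: lt_nbhsr.
    apply: (@chain2 _ ph ps); [| | |exact: dB].
    - apply: filterS (near_int bi sp) => -[x y] [/= /andP[x1 x2] y1 _].
      by apply: (hp_r hp); [exact: half (ltW x1)|exact: ltW].
    - apply: (cont_near (f := fun p : R * R => ps p.1 (Num.max p.2 0))).
        by apply: filterS (near_int bi sp) => -[x y] [/= _ h _]; rewrite max_l// ltW.
      exact: (hp_cont_r hp).
    - exact: (hp_t hp b1 sp).
  apply: der_eq.
    apply: derM; first apply: derM.
    - apply: derX; exact: dB.
    - exact: (derX 2 dp).
    - apply: der_expR; apply: derD; last exact: (dF2 s hs').
      by apply: derM; [exact: (dF1 s hs')|exact: der_cst].
  rewrite !stripE ?(ltW sp)//= expr1 mulr0 addr0.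
  have pn := ph_neq0 hp bi' (ltW sp).
  have bn : B r t s != 0.
    by rewrite gt_eqF//; case/andP: bi => h _; exact: lt_trans h.
  have cd (b : R) : b != 0 -> d%:R * b ^+ d.-1 = d%:R / b * b ^+ d.
    by move=> hb; case: d => [|k]; [rewrite !mul0r|rewrite /= exprS; field].
  rewrite (cd _ bn).
  have psE : ps (B r t s) s = - (vel (B r t s) s / eps) * ph (B r t s) s.
    by rewrite /vel; field; rewrite en pn.
  rewrite /vel_r psE; move: (expR _) (vel _ _) (B r t s ^+ d) => E v b; field.
  by rewrite en pn bn.
have Bu : R1 <= B r t u <= R2 by exact: entry_point.
have pu : Qph (B r t u) u != 0 by exact: (sph_neq0 hp).
have bu : B r t u != 0 by rewrite gt_eqF//; case/andP: Bu => h _; exact: lt_le_trans h.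
have rn : r != 0 by rewrite gt_eqF//; case/andP: hr => h _; exact: lt_trans h.
have e2 : expR (F2 t) != 0 by rewrite gt_eqF// expR_gt0.
move: YY; rewrite /Y F10 F20 mul0r add0r expR0 mulr1 Bt (stripE ph (lt_int hr) (ltW tp)) expRD expRN => ->.
have e1 : expR (F1 t / eps) != 0 by rewrite gt_eqF// expR_gt0.
have pn := ph_neq0 hp (lt_int hr) (ltW tp).
move: (expR _) e1 (expR _) e2 (r ^+ d) (expf_neq0 d rn) => E1 e1 E2 e2 rd rdn; field.
by rewrite rdn pn e1 e2.
Unshelve. all: by end_near.
Qed.

Lemma dens_formula r t : R1 < r < R2 -> 0 < t ->
  (r ^+ d)^-1 * p_Gamma n R1 R2 rho0 rho1 rho2 (beta r t (t0 r t)) (t0 r t)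
  * expR (- intR (t0 r t) t (fun s => (fun x => q x s)^`()%classic (beta r t s))) = dens r t.
Proof.
move=> hr tp; have [Bt sB bB cB] := hBt hr tp; have [/andP[u0 ut] Bi _] := hK hr tp.
have bu : beta r t (t0 r t) = B r t (t0 r t) by rewrite bB// lexx ltW.
(* The derivative occurring in the formula is identified on the half-open interval only, since at
   the entry time the characteristic may be on a side or at time 0. *)
have -> : intR (t0 r t) t (fun s => (fun x => q x s)^`()%classic (beta r t s)) =
    intR (t0 r t) t (fun s => Qr (B r t s) s).
  apply: eq_int_open; first by apply: (con_sub u0 (lexx t)); exact: (along (slab_contr sQ) hr tp).
  move=> s hs; have bi := Bi s hs; case/andP: hs => s1 s2.
  have sp : 0 < s := le_lt_trans u0 s1.
  rewrite -bB ?s2 ?(ltW s1)// stripE ?(lt_int bi)// ?(ltW sp)//.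
  apply: der_derive1; apply: (der_near _ (vel_der_r hp (lt_int bi) (ltW sp))).
  apply: filterS (near_itv bi) => x /andP[x1 x2].
  by rewrite (vel_q hp _ sp)//; apply: half; exact: ltW.
rewrite mulrAC transport_identity// bu /dens.
have I0 : (0 : R) <= t0 r t <= t by rewrite u0 ltW.
have VE : V r t = intR 0 (t0 r t) (fun s => Q2 (B r t s) s) + intR (t0 r t) t (fun s => Q2 (B r t s) s).
  by apply: int_split I0 _; exact: (along (slab_cont sQ2) hr tp).
have Bu : R1 <= B r t (t0 r t) <= R2 by exact: entry_point.
have pu : Qph (B r t (t0 r t)) (t0 r t) != 0 by exact: (sph_neq0 hp).
have bn : B r t (t0 r t) != 0 by rewrite gt_eqF//; case/andP: Bu => h _; exact: lt_le_trans h.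
(* At the entry point the conserved factor is read off the data. The exponential accounts for the
   part of [V] gathered before entry, which is empty for characteristics that start at time 0. *)
have key : p_Gamma n R1 R2 rho0 rho1 rho2 (B r t (t0 r t)) (t0 r t) =
    B r t (t0 r t) ^+ d * Qph (B r t (t0 r t)) (t0 r t) ^+ 2 * Phat (Ba r t) *
    expR (intR 0 (t0 r t) (fun s => Q2 (B r t s) s) / eps).
  have [t00|tn] := eqVneq (t0 r t) 0.
    have iE : intR 0 0 (fun s => Q2 (B r t s) s) = 0 by rewrite set_itv1 Rintegral_set1.
    rewrite t00 iE mul0r expR0 mulr1 /p_Gamma eqxx /p_initial /Ba.
    rewrite t00 in Bu pu bn; case/andP: (Bu) => b1 b2.
    by rewrite /Phat !ltNge b1 b2 /= /pin; field.
  have up : 0 < t0 r t by rewrite lt_neqAle eq_sym tn.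
  have side c qc rc : qc != 0 -> enters (B r t) (t0 r t) c qc ->
      (forall s, 0 <= s <= t0 r t -> Q (B r t s) s = qc) ->
      Phat (Ba r t) = pside eps R1 R2 ph c qc rc (Ba r t) ->
      p_boundary n c rc (t0 r t) = B r t (t0 r t) ^+ d * Qph (B r t (t0 r t)) (t0 r t) ^+ 2 * Phat (Ba r t) *
      expR (intR 0 (t0 r t) (fun s => Q2 (B r t s) s) / eps).
    move=> qn [e1 e2] e3 ->.
    have iE : intR 0 (t0 r t) (fun s => Q2 (B r t s) s) = qc ^+ 2 * t0 r t.
      by rewrite (@eq_int _ _ _ _ (fun=> qc ^+ 2)) ?int_cst ?subr0// => s hs; rewrite e3.
    have hE : hit c qc (Ba r t) = t0 r t.
      by rewrite /hit /Ba e2 ?lexx// sub0r; field.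
    rewrite iE /pside hE e1 /p_boundary; rewrite e1 in pu.
    have -> : expR (qc ^+ 2 * t0 r t / eps) = (expR (- (qc ^+ 2 / eps) * t0 r t))^-1.
      by rewrite -expRN; congr expR; field.
    have := expR_gt0 (- (qc ^+ 2 / eps) * t0 r t).
    by move: (expR _) => E Ep; field; rewrite pu gt_eqF.
  rewrite /p_Gamma (negbTE tn).
  case: cB => -[h1 h2]; first by rewrite h2 ltxx in up.
  - have [e1 e2] := h1; have q1n : q1 != 0 by rewrite gt_eqF.
    rewrite {1}e1 eqxx; apply: (side _ q1) => //.
      move=> s hs; rewrite (strip_left hp)// e2//.
      by case/andP: hs => _ hs; rewrite gerDl mulr_ge0_le0 ?(ltW h2)// subr_le0.
    rewrite /Phat ifT// /Ba e2 ?lexx// gtrDl sub0r mulrN oppr_lt0; exact: mulr_gt0.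
  - have [e1 e2] := h1; have q2n : q2 != 0 by rewrite lt_eqF.
    rewrite {1}e1 gt_eqF//; apply: (side _ q2) => //.
      move=> s hs; rewrite (strip_right hp)// e2//.
      by case/andP: hs => _ hs; rewrite lerDl mulr_le0 ?(ltW h2)// subr_le0.
    have hb : R2 < Ba r t by rewrite /Ba e2 ?lexx// ltrDl sub0r nmulr_rgt0// oppr_lt0.
    by rewrite /Phat ifF ?ifT//; apply/negbTE; rewrite -leNgt ltW// (lt_trans R12).
rewrite key VE mulrDl expRD; move: (expR _) (expR _) (Phat _) => E1 E2 P; field.
by rewrite pu expf_neq0.
Qed.

(** As the time tends to 0, the label approaches the position, because the speed is bounded, and [V]
    tends to 0. *)
Lemma dens_initial c : R1 < c < R2 ->
  dens p.1 p.2 @[p --> within [set p : R * R | 0 < p.2] (nbhs (c, 0 : R))] --> rho0 c.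
Proof.
move=> hc; have hc' := lt_int hc.
have [K1 K10 hK1] := slab_bounds R12 sQ (@ler01 R).
have [K2 K20 hK2] := slab_bounds R12 sQ2 (@ler01 R).
pose F := within [set p : R * R | 0 < p.2] (nbhs (c, 0 : R)).
have FF : Filter F by exact: within_filter.
have nF : \forall p \near F, R1 < p.1 < R2 /\ 0 < p.2 <= 1.
  have n1 : nbhs ((c, 0) : R * R) [set p | R1 < p.1 < R2 /\ p.2 < 1].
    exists ([set x | R1 < x < R2], [set y | y < 1]); last by move=> -[x y] [].
    by split; [exact: near_itv|exact: lt_nbhsl].
  change (nbhs ((c, 0) : R * R) [set p | 0 < p.2 -> R1 < p.1 < R2 /\ 0 < p.2 <= 1]).
  by apply: filterS n1 => p [h1 h2] p2; rewrite p2 ltW.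
have c1 : p.1 @[p --> F] --> c by apply: cvg_within_filter; exact: cvg_fst.
have c2 : p.2 @[p --> F] --> (0 : R) by apply: cvg_within_filter; exact: cvg_snd.
have La : Ba p.1 p.2 @[p --> F] --> c.
  apply: (dist_squeeze (g := fun p : R * R => `|p.1 - c| + K1 * p.2)).
    apply: filterS nF => -[x y] [/= hx /andP[y0 y1]].
    have [Bt sB] := hB hx y0.
    have h : forall s, 0 <= s <= y -> forall z, `|Q z s| <= K1.
      by move=> s /andP[s0 s1] z; have [] := hK1 s _ z; rewrite ?s0 ?(le_trans s1).
    have := solution_lip sB h (x := 0) (y := y); rewrite !lexx (ltW y0) /= => /(_ isT isT).
    rewrite -/(Ba x y) sub0r normrN (gtr0_norm y0) Bt => h1.
    rewrite -(subrK x (Ba x y)) -addrA addrC; apply: (le_trans (ler_normD _ _)).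
    by rewrite lerD2l.
  have N : p.1 - c @[p --> F] --> c - c by apply: cvgB => //; exact: cvg_cst.
  have H : `|p.1 - c| + K1 * p.2 @[p --> F] --> `|c - c| + K1 * 0.
    by apply: cvgD; [exact: cvg_norm N|apply: cvgM => //; exact: cvg_cst].
  by move: H; rewrite subrr normr0 mulr0 addr0.
have LV : V p.1 p.2 @[p --> F] --> (0 : R).
  apply: (dist_squeeze (g := fun p : R * R => K2 * p.2)).
    apply: filterS nF => -[x y] [/= hx /andP[y0 y1]]; rewrite subr0.
    rewrite -{2}(subr0 y); apply: int_bound; first exact: ltW.
      exact: (along (slab_cont sQ2) hx y0).
    move=> s /andP[s0 s1]; have [] := hK2 s _ (B x y s) => //.
    by rewrite s0 (le_trans s1).
  have H : K2 * p.2 @[p --> F] --> K2 * 0 by apply: cvgM => //; exact: cvg_cst.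
  by rewrite mulr0 in H.
have Lp : ph p.1 p.2 @[p --> F] --> ph c 0.
  have hh : R1 / 2 < c by apply: half; case/andP: hc'.
  have cv : {for (c, 0), continuous (fun p : R * R => ph p.1 (Num.max p.2 0))} by exact: (hp_cont hp).
  have L : ph p.1 (Num.max p.2 0) @[p --> F] --> ph c (Num.max 0 0) by apply: cvg_within_filter; exact: cv.
  rewrite maxxx in L; apply: cvg_trans L; apply: near_eq_cvg.
  by apply: filterS nF => -[x y] [/= _ /andP[h _]]; rewrite max_l// ltW.
have lc : label_dom R1 R2 q1 q2 c by case/andP: hc => h1 h2; split; left.
have [dP _] := PC1 lc; have cP := der_cont dP.
have pn : ph c 0 != 0 by exact: (ph_neq0 hp hc').
have -> : rho0 c = Phat c * ph c 0 ^+ 2 * expR (0 / eps).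
  case/andP: (hc') => h1 h2; rewrite mul0r expR0 mulr1 /Phat !ltNge h1 h2 /= /pin stripE//.
  by field.
apply: cvgM; first apply: cvgM.
- exact: (cont_cvg (g := Phat) cP La).
- by apply: cvgM.
- apply: (cont_cvg (g := expR)); first exact: continuous_expR.
  by apply: cvgM => //; exact: cvg_cst.
Qed.

(** The straight line [Y] of speed [qc] through [(c, t)] solves the extended equation. By Gronwall's
    inequality the characteristics ending at [r] tend to it as [r] tends to [c], and with them their
    labels and their integrals [V]. *)
Let dens_side c qc rc t : 0 < t -> R1 <= c <= R2 -> qc != 0 ->
  (forall s, 0 <= s <= t -> c + qc * (s - t) <= R1 \/ R2 <= c + qc * (s - t)) ->
  (forall s, 0 <= s <= t -> Q (c + qc * (s - t)) s = qc) ->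
  label_dom R1 R2 q1 q2 (c - qc * t) ->
  Phat (c - qc * t) = pside eps R1 R2 ph c qc rc (c - qc * t) ->
  dens r t @[r --> within [set r | R1 < r < R2] (nbhs c)] --> rc t.
Proof.
move=> tp hc qn out Yq lc PE.
have [K1 K10 hK1] := slab_bounds R12 sQ (ltW tp).
have [K2 K20 hK2] := slab_bounds R12 sQ2 (ltW tp).
set F := within _ _; have FF : Filter F by exact: within_filter.
have nF : \forall r \near F, R1 < r < R2 by exact: withinT.
have c1 : r @[r --> F] --> c by exact: cvg_within.
pose Y s := c + qc * (s - t).
have sY : solution Q t Y.
  move=> s hs; apply: der_eq.
    apply: derD; first exact: der_cst.
    by apply: derZ; apply: derB; [exact: der_id|exact: der_cst].
  by rewrite Yq// add0r subr0 mulr1.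
have Yt : Y t = c by rewrite /Y subrr mulr0 addr0.
have Y0 : Y 0 = c - qc * t by rewrite /Y sub0r mulrN.
pose C := expR (K1 * t).
have dist r s : R1 < r < R2 -> 0 <= s <= t -> `|B r t s - Y s| <= C * `|r - c|.
  move=> hr hs; have [Bt sB] := hB hr tp.
  have h : forall s, 0 <= s <= t -> forall y z, `|Q y s - Q z s| <= K1 * `|y - z|.
    by move=> x hx y z; have [_ _ ] := hK1 x hx y.
  have tI : 0 <= t <= t by rewrite lexx ltW.
  have := gronwall (ltW K10) h sB sY hs tI; rewrite Bt Yt => /le_trans; apply.
  rewrite ler_wpM2r// ler_expR ler_pM2l// ler_norml; case/andP: hs => h1 h2.
  by apply/andP; split; lra.
have Ld : forall k : R, k * `|r - c| @[r --> F] --> (0 : R).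
  have N : r - c @[r --> F] --> c - c by apply: cvgB => //; exact: cvg_cst.
  move=> k; have H : k * `|r - c| @[r --> F] --> k * `|c - c|.
    by apply: cvgM; [exact: cvg_cst|exact: cvg_norm N].
  by move: H; rewrite subrr normr0 mulr0.
have La : Ba r t @[r --> F] --> c - qc * t.
  apply: (dist_squeeze FF _ (Ld C)); apply: filterS nF => r hr.
  by rewrite -Y0; apply: dist => //; rewrite lexx ltW.
have LV : V r t @[r --> F] --> qc ^+ 2 * t.
  apply: (dist_squeeze FF _ (Ld (K2 * C * t))); apply: filterS nF => r hr.
  have -> : qc ^+ 2 * t = intR 0 t (fun s => qc ^+ 2) by rewrite int_cst ?subr0// ltW.
  have cq : con 0 t (fun s => Q (B r t s) s ^+ 2) by exact: (along (slab_cont sQ2) hr tp).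
  rewrite /Zint -intB//; last exact: con_cst.
  have -> : K2 * C * t * `|r - c| = K2 * C * `|r - c| * (t - 0) by rewrite subr0 mulrAC.
  apply: int_bound; first exact: ltW.
    by apply: conB => //; exact: con_cst.
  move=> s hs; have [_ _ /(_ (Y s))] := hK2 s hs (B r t s); rewrite /= Yq// => /le_trans; apply.
  by rewrite -mulrA ler_pM2l// dist.
have pn : ph c t != 0 := ph_neq0 hp hc (ltW tp).
have Lp : ph r t @[r --> F] --> ph c t.
  have hh : R1 / 2 < c by apply: half; case/andP: hc.
  by apply: cvg_within_filter; exact: der_cont (hp_r hp hh (ltW tp)).
have [dP _] := PC1 lc; have cP := der_cont dP.
have -> : rc t = Phat (c - qc * t) * ph c t ^+ 2 * expR (qc ^+ 2 * t / eps).
  have hE : hit c qc (c - qc * t) = t by rewrite /hit; field.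
  rewrite PE /pside hE stripE ?(ltW tp)//.
  have -> : expR (qc ^+ 2 * t / eps) = (expR (- (qc ^+ 2 / eps) * t))^-1.
    by rewrite -expRN; congr expR; field.
  have := expR_gt0 (- (qc ^+ 2 / eps) * t).
  by move: (expR _) => E Ep; field; rewrite pn gt_eqF.
apply: cvgM; first apply: cvgM.
- exact: (cont_cvg (g := Phat) cP La).
- by apply: cvgM.
- apply: (cont_cvg (g := expR)); first exact: continuous_expR.
  by apply: cvgM => //; exact: cvg_cst.
Qed.

Lemma dens_left t : 0 < q1 -> 0 < t ->
  dens r t @[r --> within [set r | R1 < r < R2] (nbhs R1)] --> rho1 t.
Proof.
move=> qp tp; have qt : 0 < q1 * t by exact: mulr_gt0.
have qs s : 0 <= s <= t -> R1 + q1 * (s - t) <= R1.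
  by move=> /andP[_ hs]; rewrite gerDl mulr_ge0_le0 ?(ltW qp)// subr_le0.
apply: (dens_side (qc := q1)) => //.
- by rewrite lexx R12'.
- by rewrite gt_eqF.
- by move=> s hs; left; exact: qs.
- by move=> s hs; rewrite (strip_left hp)//; exact: qs.
- by split; [right|left; move: R12; lra].
- by rewrite /Phat ifT// gtrBl.
Qed.

Lemma dens_right t : 0 < - q2 -> 0 < t ->
  dens r t @[r --> within [set r | R1 < r < R2] (nbhs R2)] --> rho2 t.
Proof.
rewrite oppr_gt0 => qp tp; have qt : q2 * t < 0 by rewrite pmulr_llt0.
have qs s : 0 <= s <= t -> R2 <= R2 + q2 * (s - t).
  by move=> /andP[_ hs]; rewrite lerDl mulr_le0 ?(ltW qp)// subr_le0.
apply: (dens_side (qc := q2)) => //.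
- by rewrite lexx R12'.
- by rewrite lt_eqF.
- by move=> s hs; right; exact: qs.
- by move=> s hs; rewrite (strip_right hp)//; exact: qs.
- by split; [left; move: R12; lra|right].
- rewrite /Phat ifF ?ifT//; first by move: qt; lra.
  by apply/negbTE; rewrite -leNgt; move: R12 qt; lra.
Qed.

End density.

Record density_profile {R : realType} (n : nat) (R1 R2 q1 q2 : R) (rho0 rho1 rho2 : R -> R)
    (v vr g gr gt : R -> R -> R) : Prop := {
  dp_r : forall r t : R, R1 < r < R2 -> 0 < t -> der (fun r => g r t) r (gr r t);
  dp_t : forall r t : R, R1 < r < R2 -> 0 < t -> der (g r) t (gt r t);
  dp_cont : forall r t : R, R1 < r < R2 -> 0 < t ->
    {for (r, t), continuous (fun p : R * R => g p.1 p.2)};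
  dp_cont_r : forall r t : R, R1 < r < R2 -> 0 < t ->
    {for (r, t), continuous (fun p : R * R => gr p.1 p.2)};
  dp_cont_t : forall r t : R, R1 < r < R2 -> 0 < t ->
    {for (r, t), continuous (fun p : R * R => gt p.1 p.2)};
  dp_equation : forall r t : R, R1 < r < R2 -> 0 < t ->
    gt r t + v r t * gr r t + (vr r t + n.-1%:R / r * v r t) * g r t = 0;
  dp_initial : forall c : R, R1 < c < R2 ->
    g p.1 p.2 @[p --> within [set p : R * R | 0 < p.2] (nbhs (c, 0 : R))] --> rho0 c;
  dp_left : forall t : R, 0 < q1 -> 0 < t ->
    g r t @[r --> within [set r | R1 < r < R2] (nbhs R1)] --> rho1 t;
  dp_right : forall t : R, 0 < - q2 -> 0 < t ->
    g r t @[r --> within [set r | R1 < r < R2] (nbhs R2)] --> rho2 t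
}.

Theorem formula_density_profile {R : realType} (n : nat) (eps R1 R2 q1 q2 : R) (q0 : R -> R)
    (q ph ps ch th : R -> R -> R) (rho0 rho1 rho2 : R -> R)
    (beta : R -> R -> R -> R) (t0 : R -> R -> R) :
  heat_profile n eps R1 R2 q1 q2 q0 q ph ps ch th ->
  Ck_on 2 `[R1, R2] q0 -> Ck_on 1 `[R1, R2] rho0 ->
  (0 < q1 -> Ck_on 1 `[0, +oo[ rho1) -> (0 < - q2 -> Ck_on 1 `[0, +oo[ rho2) ->
  (0 < q1 -> density_consistent n q0 rho0 R1 rho1) ->
  (0 < - q2 -> density_consistent n q0 rho0 R2 rho2) ->
  (forall r t : R, R1 < r < R2 -> 0 < t ->
    [/\ 0 <= t0 r t < t, beta r t t = r, {within `[t0 r t, t], continuous (beta r t)},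
      forall s : R, t0 r t < s < t -> R1 < beta r t s < R2 /\
        is_derive s (1 : R) (beta r t) (q (beta r t s) s)
    & Gamma R1 R2 (beta r t (t0 r t), t0 r t)]) ->
  exists g gr gt, density_profile n R1 R2 q1 q2 rho0 rho1 rho2
      (vel eps ph ps) (vel_r n eps ph ps ch) g gr gt /\
    forall r t : R, R1 < r < R2 -> 0 < t ->
      (r ^+ n.-1)^-1 * p_Gamma n R1 R2 rho0 rho1 rho2 (beta r t (t0 r t)) (t0 r t)
      * expR (- intR (t0 r t) t (fun s => (fun x => q x s)^`()%classic (beta r t s))) = g r t.
Proof.
move=> hp hq0 hrho0 hrho1 hrho2 hc1 hc2 hbeta.
(* Outside the domain the function [id] is a placeholder, so that [choice] yields a total family of
   characteristics. *)
have hX (p : R * R) : exists X, R1 < p.1 < R2 -> 0 < p.2 ->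
    [/\ X p.2 = p.1, solution (strip R1 R2 (vel eps ph ps)) p.2 X,
     forall s, t0 p.1 p.2 <= s <= p.2 -> X s = beta p.1 p.2 s &
     [\/ R1 < X (t0 p.1 p.2) < R2 /\ t0 p.1 p.2 = 0, enters X (t0 p.1 p.2) R1 q1 /\ 0 < q1 |
       enters X (t0 p.1 p.2) R2 q2 /\ q2 < 0]].
  have [[h1 h2]|nh] := pselect (R1 < p.1 < R2 /\ 0 < p.2).
    by have [X hX] := trajectory hp hbeta h1 h2; exists X.
  by exists id => h1 h2; case: nh.
have [B0 hB0] := choice hX; pose B r t := B0 (r, t).
have hB : forall r t : R, R1 < r < R2 -> 0 < t ->
    [/\ B r t t = r, solution (strip R1 R2 (vel eps ph ps)) t (B r t),
     forall s : R, t0 r t <= s <= t -> B r t s = beta r t s &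
     [\/ R1 < B r t (t0 r t) < R2 /\ t0 r t = 0, enters (B r t) (t0 r t) R1 q1 /\ 0 < q1 |
       enters (B r t) (t0 r t) R2 q2 /\ q2 < 0]].
  by move=> r t; exact: (hB0 (r, t)).
exists (dens eps R1 R2 q1 q2 ph ps rho0 rho1 rho2 B).
exists (dens_r n eps R1 R2 q1 q2 ph ps ch rho0 rho1 rho2 t0 B).
exists (dens_t n eps R1 R2 q1 q2 ph ps ch rho0 rho1 rho2 t0 B).
split; last exact: (dens_formula hp rho0 rho1 rho2 hbeta hB).
split.
- exact: (dens_der_r hp hq0 hrho0 hrho1 hrho2 hc1 hc2 hbeta hB).
- exact: (dens_der_t hp hq0 hrho0 hrho1 hrho2 hc1 hc2 hbeta hB).
- exact: (dens_cont hp hq0 hrho0 hrho1 hrho2 hc1 hc2 hbeta hB).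
- exact: (dens_r_cont hp hq0 hrho0 hrho1 hrho2 hc1 hc2 hbeta hB).
- exact: (dens_t_cont hp hq0 hrho0 hrho1 hrho2 hc1 hc2 hbeta hB).
- exact: (dens_equation hp rho0 rho1 rho2).
- exact: (dens_initial hp hq0 hrho0 hrho1 hrho2 hc1 hc2 hB).
- exact: (dens_left hp hq0 hrho0 hrho1 hrho2 hc1 hc2 hB).
- exact: (dens_right hp hq0 hrho0 hrho1 hrho2 hc1 hc2 hB).
Qed.

(** * Radial fields *)

Section directional_derivatives.
Context {R : realType}.

Lemma is_deriveP (U V : normedModType R) (F : U -> V) (x v : U) (D : V) :
  is_derive x v F D <-> h^-1 *: (F (h *: v + x) - F x) @[h --> 0^'] --> D.
Proof.
split => [[ex <-]|cv]; first exact: ex.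
by apply: DeriveDef; [exact: (cvgP D cv)|exact: (cvg_lim _ cv)].
Qed.

(** Reduces a directional derivative to a derivative of one variable along the line through [x], at
    0. *)
Lemma is_derive_line (U : normedModType R) (F : U -> R) (x v : U) (D : R) :
  is_derive x v F D <-> der (fun h : R => F (h *: v + x)) 0 D.
Proof.
rewrite is_deriveP -derP scale0r add0r.
have -> // : (fun h : R => h^-1 * (F ((h + 0) *: v + x) - F x)) =
  (fun h : R => h^-1 *: (F (h *: v + x) - F x)).
by apply/funext => h; rewrite addr0.
Qed.

Lemma is_derive_mul (U : normedModType R) (F H : U -> R) (x v : U) (a b : R) :
  is_derive x v F a -> is_derive x v H b ->
  is_derive x v (fun y => F y * H y) (a * H x + F x * b).
Proof.
move=> /is_derive_line dF /is_derive_line dH; apply/is_derive_line.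
by apply: der_eq; [exact: (derM dF dH)|rewrite /= scale0r add0r].
Qed.

Lemma line_cont (U : normedModType R) (x v : U) : h *: v + x @[h --> (0 : R)^'] --> x.
Proof.
have H : h *: v + x @[h --> (0 : R)^'] --> (0 : R) *: v + x.
  by apply: cvgD; [apply: cvgZ; [exact: nbhs_dnbhs|exact: cvg_cst]|exact: cvg_cst].
by rewrite scale0r add0r in H.
Qed.

Lemma is_derive_scale (U : normedModType R) (F : U -> R) (x v : U) (a : R) :
  is_derive x v F a -> is_derive x v (fun y => F y *: y) (a *: x + F x *: v).
Proof.
move=> /is_deriveP dF; apply/is_deriveP.
have H : (h^-1 *: (F (h *: v + x) - F x)) *: (h *: v + x) + F x *: v @[h --> (0 : R)^'] --> a *: x + F x *: v.
  by apply: cvgD; [apply: cvgZ => //; exact: line_cont|exact: cvg_cst].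
apply: cvg_trans H; apply: near_eq_cvg.
have n0 : \forall h \near (0 : R)^', h != 0 by exact: nbhs_dnbhs_neq.
apply: filterS n0 => h h0.
have -> : F (h *: v + x) *: (h *: v + x) - F x *: x =
    (F (h *: v + x) - F x) *: (h *: v + x) + h *: (F x *: v).
  rewrite scalerBl [in F x *: (h *: v + x)]scalerDr opprD -!addrA; congr (_ + _).
  have -> : h *: (F x *: v) = F x *: (h *: v) by rewrite !scalerA mulrC.
  by rewrite [RHS]addrC addrK.
by rewrite [RHS]scalerDr; congr (_ + _); rewrite [RHS]scalerA// mulVf// scale1r.
Qed.

Lemma is_derive_scale_cst (U V : normedModType R) (F : U -> R) (x v : U) (a : R) (c : V) :
  is_derive x v F a -> is_derive x v (fun y => F y *: c) (a *: c).
Proof.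
move=> /is_deriveP dF; apply/is_deriveP.
have H : (h^-1 *: (F (h *: v + x) - F x)) *: c @[h --> (0 : R)^'] --> a *: c.
  by apply: cvgZ => //; exact: cvg_cst.
by apply: cvg_trans H; apply: near_eq_cvg; apply: nearW => h; rewrite -scalerA scalerBl.
Qed.

Lemma continuous_near (T U : topologicalType) (f g : T -> U) (x : T) :
  (\near x, f x = g x) -> {for x, continuous f} -> {for x, continuous g}.
Proof.
move=> fg cf; rewrite /prop_for /continuous_at -(nbhs_singleton fg).
by apply: cvg_trans cf; exact: near_eq_cvg.
Qed.

Lemma continuous_scale (T : topologicalType) (V : normedModType R) (f : T -> R) (g : T -> V) (x : T) :
  {for x, continuous f} -> {for x, continuous g} -> {for x, continuous (fun y => f y *: g y)}.
Proof. by move=> cf cg; exact: cvgZ. Qed.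

Lemma continuous_add (T : topologicalType) (V : normedModType R) (f g : T -> V) (x : T) :
  {for x, continuous f} -> {for x, continuous g} -> {for x, continuous (fun y => f y + g y)}.
Proof. by move=> cf cg; exact: cvgD. Qed.

End directional_derivatives.

(** * The Euclidean norm and the filters of the problem *)

Section euclidean_norm.
Context {R : realType} {n : nat}.
Local Notation E := 'rV[R]_n.
Implicit Types (x y : E) (i j : 'I_n).

Lemma enorm_sq x : enorm x ^+ 2 = \sum_i x 0 i ^+ 2.
Proof. by rewrite sqr_sqrtr// sumr_ge0// => i _; exact: sqr_ge0. Qed.

Lemma is_derive_coord x i j : is_derive x (evec i) (fun y : E => y 0 j) (i == j)%:R.
Proof.
apply/is_derive_line.
have -> : (fun h : R => (h *: evec i + x) 0 j) = (fun h => h * (i == j)%:R + x 0 j).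
  by apply/funext => h; rewrite !mxE eqxx eq_sym.
apply: der_eq; first by apply: derD; [apply: derM; [exact: der_id|exact: der_cst]|exact: der_cst].
by rewrite mul1r mulr0 !addr0.
Qed.

Lemma is_derive_enorm x i : 0 < enorm x -> is_derive x (evec i) (@enorm R n) (x 0 i / enorm x).
Proof.
move=> x0; have sx : 0 < \sum_j x 0 j ^+ 2 by rewrite -enorm_sq exprn_gt0.
apply/is_derive_line.
have dS : der (fun h : R => \sum_j (h *: evec i + x) 0 j ^+ 2) 0 (2 * x 0 i).
  apply: der_eq.
    apply: (@der_sum R 'I_n _ (fun j (h : R) => (h *: evec i + x) 0 j ^+ 2) 0
      (fun j => 2 * x 0 j * (i == j)%:R)) => j.
    have /is_derive_line dj := is_derive_coord x i j.
    apply: der_eq; first exact: (derX 2 dj).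
    by rewrite /= expr1 scale0r add0r.
  rewrite (bigD1 i)//= eqxx mulr1 big1 ?addr0// => j /negbTE ji.
  by rewrite eq_sym ji mulr0.
have dq : der Num.sqrt (\sum_j ((0 : R) *: evec i + x) 0 j ^+ 2) (2 * enorm x)^-1.
  by rewrite scale0r add0r; exact: is_derive1_sqrt.
apply: der_eq; first exact: (der_comp (f := fun h : R => \sum_j (h *: evec i + x) 0 j ^+ 2) dq dS).
by field; rewrite gt_eqF.
Qed.

Lemma is_derive_radial (f : R -> R) x i (a : R) : 0 < enorm x -> der f (enorm x) a ->
  is_derive x (evec i) (fun y : E => f (enorm y)) (a * (x 0 i / enorm x)).
Proof.
move=> x0 df; apply/is_derive_line.
have /is_derive_line dn := is_derive_enorm i x0.
apply: (der_comp (f := fun h : R => enorm (h *: evec i + x)) _ dn).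
by rewrite scale0r add0r.
Qed.

Lemma coord_cont x i : {for x, continuous (fun y : E => y 0 i)}.
Proof. exact: coord_continuous. Qed.

Lemma enorm_cont x : {for x, continuous (@enorm R n)}.
Proof.
apply: (cont_comp (g := Num.sqrt)); first exact: sqrt_continuous.
apply: (cont_sum (f := fun i (y : E) => y 0 i ^+ 2)) => i; apply: contX; exact: coord_cont.
Qed.

Lemma enorm_fst_cont x (t : R) : {for (x, t), continuous (fun p : E * R => enorm p.1)}.
Proof. by apply: (cont_comp (g := @enorm R n)); [exact: enorm_cont|exact: cvg_fst]. Qed.

Lemma coord_fst_cont x (t : R) i : {for (x, t), continuous (fun p : E * R => p.1 0 i)}.
Proof. by apply: (cont_comp (g := fun y : E => y 0 i)); [exact: coord_cont|exact: cvg_fst]. Qed.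

Lemma radial_cont (f : R -> R -> R) x t : {for (enorm x, t), continuous (fun p : R * R => f p.1 p.2)} ->
  {for (x, t), continuous (fun p : E * R => f (enorm p.1) p.2)}.
Proof.
move=> cf; apply: (cont_comp (g := fun p : R * R => f p.1 p.2) (f := fun p : E * R => (enorm p.1, p.2))) => //.
by apply: cont_pair; [exact: enorm_fst_cont|exact: cvg_snd].
Qed.

Lemma annulus_near R1 R2 x : annulus R1 R2 x -> \forall y \near x, annulus R1 R2 y.
Proof. by move=> hx; have := enorm_cont (near_itv hx); apply. Qed.

Lemma annulus_near_time R1 R2 x t : annulus R1 R2 x -> 0 < t ->
  \forall p \near ((x, t) : E * R), annulus R1 R2 p.1 /\ 0 < p.2.
Proof.
move=> hx tp; exists (annulus R1 R2, [set s | 0 < s]); last by move=> -[y s] [].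
by split; [exact: annulus_near|exact: lt_nbhsr].
Qed.

Lemma enorm_to_cvg R1 R2 a :
  enorm x @[x --> @enorm_to R n R1 R2 a] --> within [set r | R1 < r < R2] (nbhs a).
Proof.
move=> P [e /= e0 he]; exists e => // x [xA xe].
by apply: he => //=; rewrite distrC.
Qed.

Lemma to_initial_cvg R1 R2 x : annulus R1 R2 x ->
  (enorm p.1, p.2) @[p --> to_initial x] --> within [set p : R * R | 0 < p.2] (nbhs (enorm x, 0 : R)).
Proof.
move=> hx P hP.
have c : {for (x, 0 : R), continuous (fun p : E * R => (enorm p.1, p.2))}.
  by apply: cont_pair; [exact: enorm_fst_cont|exact: cvg_snd].
exact: (c _ hP).
Qed.

End euclidean_norm.

(** * Differential operators on radial fields *)

Section radial_fields.
Context {R : realType} {n : nat}.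
Local Notation E := 'rV[R]_n.
(** [G1] and [G2] arise from [G] by applying [(1/r) d/dr]: the partial derivatives of [G(|x|)] are
    then [G1 x_i], without division by the norm. *)
Variables (R1 R2 : R) (G G1 G2 Gt : R -> R -> R).
Hypothesis R1p : 0 < R1.
Hypothesis dG : forall r t : R, R1 < r < R2 -> 0 < t -> der (fun r => G r t) r (r * G1 r t).
Hypothesis dG1 : forall r t : R, R1 < r < R2 -> 0 < t -> der (fun r => G1 r t) r (r * G2 r t).
Hypothesis dGt : forall r t : R, R1 < r < R2 -> 0 < t -> der (G r) t (Gt r t).
Hypothesis cG : forall r t : R, R1 < r < R2 -> 0 < t -> {for (r, t), continuous (fun p : R * R => G p.1 p.2)}.
Hypothesis cG1 : forall r t : R, R1 < r < R2 -> 0 < t -> {for (r, t), continuous (fun p : R * R => G1 p.1 p.2)}.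
Hypothesis cG2 : forall r t : R, R1 < r < R2 -> 0 < t -> {for (r, t), continuous (fun p : R * R => G2 p.1 p.2)}.
Hypothesis cGt : forall r t : R, R1 < r < R2 -> 0 < t -> {for (r, t), continuous (fun p : R * R => Gt p.1 p.2)}.
Implicit Types (x y : E) (i j : 'I_n) (t : R).

Let pos x : annulus R1 R2 x -> 0 < enorm x.
Proof. by case/andP => h _; exact: lt_trans h. Qed.

Lemma scalar_dx (f f' : R -> R -> R) x t i : annulus R1 R2 x ->
  der (fun r => f r t) (enorm x) (enorm x * f' (enorm x) t) ->
  is_derive x (evec i) (fun y : E => f (enorm y) t) (f' (enorm x) t * x 0 i).
Proof.
move=> hx df; have x0 := pos hx.
have := is_derive_radial i x0 df.
by rewrite mulrAC mulrCA divff ?mulr1 1?mulrC// gt_eqF.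
Qed.

Definition field x t : E := G (enorm x) t *: x.
Definition field_x i x t : E := (G1 (enorm x) t * x 0 i) *: x + G (enorm x) t *: evec i.
Definition field_xx j i x t : E :=
  ((G2 (enorm x) t * x 0 j * x 0 i + G1 (enorm x) t * (j == i)%:R) *: x
   + (G1 (enorm x) t * x 0 i) *: evec j) + (G1 (enorm x) t * x 0 j) *: evec i.

Lemma field_dx x t i : annulus R1 R2 x -> 0 < t -> is_derive x (evec i) (field ^~ t) (field_x i x t).
Proof. by move=> hx tp; apply: is_derive_scale; apply: scalar_dx => //; exact: dG. Qed.

Lemma partial_field x t i : annulus R1 R2 x -> 0 < t -> partial_x i field x t = field_x i x t.
Proof. by move=> hx tp; have [_ <-] := field_dx i hx tp. Qed.

Lemma field_dxx x t i j : annulus R1 R2 x -> 0 < t ->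
  is_derive x (evec j) (partial_x i field ^~ t) (field_xx j i x t).
Proof.
move=> hx tp; apply: (near_eq_is_derive (f := field_x i ^~ t)).
  by apply: filterS (annulus_near hx) => y hy; rewrite partial_field.
have d1 := scalar_dx j hx (dG1 hx tp); have d0 := scalar_dx j hx (dG hx tp).
have dm := is_derive_mul d1 (is_derive_coord x j i).
exact: (is_deriveD (is_derive_scale dm) (is_derive_scale_cst (evec i) d0)).
Qed.

Lemma partial_field2 x t i j : annulus R1 R2 x -> 0 < t ->
  partial_x j (partial_x i field) x t = field_xx j i x t.
Proof. by move=> hx tp; have [_ <-] := field_dxx i j hx tp. Qed.

Lemma field_dt x t : annulus R1 R2 x -> 0 < t ->
  is_derive t (1 : R) (field x) (Gt (enorm x) t *: x).
Proof. by move=> hx tp; apply: is_derive_scale_cst; exact: dGt. Qed.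

Lemma partial_field_t x t : annulus R1 R2 x -> 0 < t -> partial_t field x t = Gt (enorm x) t *: x.
Proof. by move=> hx tp; rewrite /partial_t derive1E; have [_ <-] := field_dt hx tp. Qed.

Lemma field_jointly (F F' : E -> R -> E) :
  (forall x t, annulus R1 R2 x -> 0 < t -> F x t = F' x t) ->
  (forall x t, annulus R1 R2 x -> 0 < t ->
    {for (x, t), continuous (fun p : E * R => F' p.1 p.2)}) ->
  jointly_continuous (annulus R1 R2) F.
Proof.
move=> FF' cF' x t hx tp.
apply: (continuous_near (f := fun p : E * R => F' p.1 p.2)); last exact: cF'.
by apply: filterS (annulus_near_time hx tp) => -[y s] [/= hy sp]; rewrite FF'.
Qed.

Lemma field_C21 : C21 (annulus R1 R2) field.
Proof.
have cfst x t : {for (x, t), continuous (fun p : E * R => p.1)} by exact: cvg_fst.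
have cc (V : normedModType R) (c : V) x t : {for (x, t), continuous (fun p : E * R => c)} by exact: cvg_cst.
have c0 x t (hx : annulus R1 R2 x) (tp : 0 < t) := radial_cont (cG hx tp).
have c1 x t (hx : annulus R1 R2 x) (tp : 0 < t) := radial_cont (cG1 hx tp).
have c2 x t (hx : annulus R1 R2 x) (tp : 0 < t) := radial_cont (cG2 hx tp).
have ct x t (hx : annulus R1 R2 x) (tp : 0 < t) := radial_cont (cGt hx tp).
have cx x t i : {for (x, t), continuous (fun p : E * R => p.1 0 i)}  by exact: coord_fst_cont.
split; first split.
- move=> x t hx tp; split; first by have [] := field_dt hx tp.
  by move=> i; have [] := field_dx i hx tp.
- apply: (@field_jointly field field (fun x t _ _ => erefl)) => x t hx tp.
  by apply: continuous_scale; [exact: c0|exact: cfst].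
- apply: (field_jointly partial_field_t) => x t hx tp.
  by apply: continuous_scale; [exact: ct|exact: cfst].
- move=> i; apply: (field_jointly (fun x t => @partial_field x t i)) => x t hx tp.
  apply: continuous_add; apply: continuous_scale; [|exact: cfst|exact: c0|exact: cc].
  by apply: contM; [exact: c1|exact: cx].
- by move=> x t i j hx tp; have [] := field_dxx i j hx tp.
- move=> i j; apply: (field_jointly (fun x t => @partial_field2 x t i j)) => x t hx tp.
  apply: continuous_add; [apply: continuous_add|]; apply: continuous_scale;
    [|exact: cfst| |exact: cc| |exact: cc].
  + apply: contD; last by apply: contM; [exact: c1|exact: cc].
    by apply: contM; [apply: contM; [exact: c2|exact: cx]|exact: cx].
  + by apply: contM; [exact: c1|exact: cx].
  + by apply: contM; [exact: c1|exact: cx].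
Qed.

Let sum_evec x : \sum_i x 0 i *: evec i = x.
Proof. by rewrite [RHS]row_sum_delta. Qed.

(** On the field [G(|x|) x] the Laplacian acts on [G] as the radial Laplacian of dimension
    [n + 2]. *)
Lemma field_laplacian x t : annulus R1 R2 x -> 0 < t -> laplacian field x t =
  (G2 (enorm x) t * enorm x ^+ 2 + n.+2%:R * G1 (enorm x) t) *: x.
Proof.
move=> hx tp; rewrite /laplacian.
have -> : \sum_i partial_x i (partial_x i field) x t = \sum_i
    ((G2 (enorm x) t * x 0 i ^+ 2 + G1 (enorm x) t) *: x + (2 * G1 (enorm x) t) *: (x 0 i *: evec i)).
  apply: eq_bigr => i _; rewrite partial_field2// /field_xx eqxx mulr1 -addrA -scalerDl -!mulrA.
  by congr (_ + _); rewrite scalerA; congr (_ *: _); ring.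
rewrite big_split /= -scaler_suml -scaler_sumr sum_evec -scalerDl big_split /= -mulr_sumr -enorm_sq.
by rewrite sumr_const card_ord; congr (_ *: _); rewrite -mulr_natl -addn2 natrD; ring.
Qed.

Lemma field_directional x t : annulus R1 R2 x -> 0 < t -> directional (field x t) field x t =
  (G (enorm x) t * (G1 (enorm x) t * enorm x ^+ 2 + G (enorm x) t)) *: x.
Proof.
move=> hx tp; rewrite /directional.
have -> : \sum_i field x t 0 i *: partial_x i field x t = \sum_i
    ((G (enorm x) t * G1 (enorm x) t * x 0 i ^+ 2) *: x + G (enorm x) t ^+ 2 *: (x 0 i *: evec i)).
  apply: eq_bigr => i _; rewrite partial_field// /field_x /field mxE scalerDr !scalerA.
  by congr (_ *: _ + _ *: _); ring.
rewrite big_split /= -scaler_suml -(scaler_sumr (G (enorm x) t ^+ 2)) sum_evec -scalerDl -mulr_sumr -enorm_sq.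
by congr (_ *: _); ring.
Qed.

Section density.
Variables (g gr gt : R -> R -> R).
Hypothesis dg : forall r t : R, R1 < r < R2 -> 0 < t -> der (fun r => g r t) r (gr r t).
Hypothesis dgt : forall r t : R, R1 < r < R2 -> 0 < t -> der (g r) t (gt r t).
Hypothesis cg : forall r t : R, R1 < r < R2 -> 0 < t -> {for (r, t), continuous (fun p : R * R => g p.1 p.2)}.
Hypothesis cgr : forall r t : R, R1 < r < R2 -> 0 < t -> {for (r, t), continuous (fun p : R * R => gr p.1 p.2)}.
Hypothesis cgt : forall r t : R, R1 < r < R2 -> 0 < t -> {for (r, t), continuous (fun p : R * R => gt p.1 p.2)}.

Definition radial x t : R := g (enorm x) t.

Lemma radial_dx x t i : annulus R1 R2 x -> 0 < t ->
  is_derive x (evec i) (radial ^~ t) (gr (enorm x) t * (x 0 i / enorm x)).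
Proof. by move=> hx tp; exact: (is_derive_radial (f := g ^~ t) i (pos hx) (dg hx tp)). Qed.

Lemma radial_dt x t : annulus R1 R2 x -> 0 < t -> is_derive t (1 : R) (radial x) (gt (enorm x) t).
Proof. by move=> hx tp; exact: dgt. Qed.

Lemma radial_C1 : C1 (annulus R1 R2) radial.
Proof.
split.
- move=> x t hx tp; split; first by have [] := radial_dt hx tp.
  by move=> i; have [] := radial_dx i hx tp.
- by move=> x t hx tp; exact: radial_cont (cg hx tp).
- move=> x t hx tp.
  apply: (cont_near (f := fun p : E * R => gt (enorm p.1) p.2)); last exact: radial_cont (cgt hx tp).
  apply: filterS (annulus_near_time hx tp) => -[y s] [/= hy sp].
  by rewrite /partial_t derive1E; have [_ ->] := radial_dt hy sp.
- move=> i x t hx tp.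
  apply: (cont_near (f := fun p : E * R => gr (enorm p.1) p.2 * (p.1 0 i / enorm p.1))).
    apply: filterS (annulus_near_time hx tp) => -[y s] [/= hy sp].
    by rewrite /partial_x; have [_ ->] := radial_dx i hy sp.
  apply: contM; first exact: radial_cont (cgr hx tp).
  apply: contM; first exact: coord_fst_cont.
  by apply: contV; [rewrite gt_eqF//; exact: pos|exact: enorm_fst_cont].
Qed.

Lemma radial_divergence x t : annulus R1 R2 x -> 0 < t ->
  divergence (fun y s => radial y s *: field y s) x t =
  gr (enorm x) t * G (enorm x) t * enorm x +
  g (enorm x) t * (G1 (enorm x) t * enorm x ^+ 2 + n%:R * G (enorm x) t).
Proof.
move=> hx tp; have xn : enorm x != 0 by rewrite gt_eqF// pos.
have -> : divergence (fun y s => radial y s *: field y s) x t = \sum_i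
    ((gr (enorm x) t * G (enorm x) t / enorm x + g (enorm x) t * G1 (enorm x) t) * x 0 i ^+ 2
     + g (enorm x) t * G (enorm x) t).
  apply: eq_bigr => i _; rewrite /partial_x.
  have -> : (fun y : E => (radial y t *: field y t) 0 i) =
      (fun y => radial y t * (G (enorm y) t * y 0 i)).
    by apply/funext => y; rewrite !mxE.
  have [_ ->] := is_derive_mul (radial_dx i hx tp)
    (is_derive_mul (scalar_dx i hx (dG hx tp)) (is_derive_coord x i i)).
  by rewrite eqxx mulr1 /radial; field.
rewrite big_split /= -mulr_sumr -enorm_sq sumr_const card_ord -mulr_natl; field; exact: xn.
Qed.

End density.
End radial_fields.

(** * From the radial profiles to the fields in the annulus *)

Section assembly.
Context {R : realType}.
Variables (n : nat) (eps R1 R2 q1 q2 : R) (q0 : R -> R) (q ph ps ch th : R -> R -> R).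
Hypothesis hp : heat_profile n eps R1 R2 q1 q2 q0 q ph ps ch th.
Local Notation E := 'rV[R]_n.
Implicit Types (x : E) (r t : R).

Local Notation v := (vel eps ph ps).
Local Notation vr := (vel_r n eps ph ps ch).
Local Notation vrr := (vel_rr n eps ph ps ch th).
Local Notation vt := (vel_t eps ph ps ch th).

Let R1p : 0 < R1 := hp_R1 hp.
Let R12' : R1 <= R2 := ltW (hp_R12 hp).
Let half r : R1 < r < R2 -> R1 / 2 < r.
Proof.
by case/andP => h _; apply: (lt_trans _ h); rewrite ltr_pdivrMr// ltr_pMr// ltr1n.
Qed.
Let pos r : R1 < r < R2 -> 0 < r.
Proof. by case/andP => h _; exact: lt_trans h. Qed.

(* The functions obtained from [slope] by applying [(1/r) d/dr] repeatedly. *)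
Definition slope r t := q r t / r.
Definition slope1 r t := vr r t / r ^+ 2 - v r t / r ^+ 3.
Definition slope2 r t := vrr r t / r ^+ 3 - 3 * vr r t / r ^+ 4 + 3 * v r t / r ^+ 5.
Definition slope_t r t := vt r t / r.

Let near_slope r t : R1 < r < R2 -> 0 < t ->
  \forall p \near ((r, t) : R * R), v p.1 p.2 / p.1 = slope p.1 p.2.
Proof.
move=> hr tp; apply: filterS (near_int hr tp) => -[x y] [/= hx y0 _].
by rewrite /slope (vel_q hp (half hx) y0).
Qed.

Lemma slope_der r t : R1 < r < R2 -> 0 < t -> der (fun r => slope r t) r (r * slope1 r t).
Proof.
move=> hr tp; have rn : r != 0 by rewrite gt_eqF// pos.
apply: (der_near (f := fun r => v r t / r)).
  by apply: filterS (near_itv hr) => x hx; rewrite /slope (vel_q hp (half hx) tp).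
apply: der_eq; first by apply: (der_div rn (vel_der_r hp (lt_int hr) (ltW tp))); exact: der_id.
by rewrite /slope1; field.
Qed.

Lemma slope1_der r t : R1 < r < R2 -> 0 < t -> der (fun r => slope1 r t) r (r * slope2 r t).
Proof.
move=> hr tp; have rn : r != 0 by rewrite gt_eqF// pos.
apply: der_eq.
  apply: derB.
    apply: der_div; [by rewrite expf_neq0|exact: (vel_r_der_r hp (lt_int hr) tp)|exact: (derX 2 (der_id r))].
  apply: der_div; [by rewrite expf_neq0|exact: (vel_der_r hp (lt_int hr) (ltW tp))|exact: (derX 3 (der_id r))].
by rewrite /slope2 /= expr1; field.
Qed.

Lemma slope_der_t r t : R1 < r < R2 -> 0 < t -> der (slope r) t (slope_t r t).
Proof.
move=> hr tp; apply: (der_near (f := fun t => v r t / r)).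
  by apply: filterS (lt_nbhsr tp) => s sp; rewrite /slope (vel_q hp (half hr) sp).
apply: der_eq; first by apply: derM; [exact: (vel_der_t hp (lt_int hr) tp)|exact: der_cst].
by rewrite mulr0 addr0.
Qed.

Let cdiv (f : R -> R -> R) k r t : R1 < r < R2 ->
  {for (r, t), continuous (fun p : R * R => f p.1 p.2)} ->
  {for (r, t), continuous (fun p : R * R => f p.1 p.2 / p.1 ^+ k)}.
Proof.
move=> hr cf; apply: contM => //; apply: contV; first by rewrite expf_neq0// gt_eqF// pos.
by apply: contX; exact: cvg_fst.
Qed.

Let ccst (f : R -> R -> R) (c : R) r t : {for (r, t), continuous (fun p : R * R => f p.1 p.2)} ->
  {for (r, t), continuous (fun p : R * R => c * f p.1 p.2)}.
Proof. by apply: contM; exact: cvg_cst. Qed.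

Lemma slope_cont r t : R1 < r < R2 -> 0 < t -> {for (r, t), continuous (fun p : R * R => slope p.1 p.2)}.
Proof.
move=> hr tp; apply: (cont_near (near_slope hr tp)).
apply: (@cdiv (v) 1 r t hr); exact: (vel_cont hp (lt_int hr) tp).
Qed.

Lemma slope1_cont r t : R1 < r < R2 -> 0 < t -> {for (r, t), continuous (fun p : R * R => slope1 p.1 p.2)}.
Proof.
move=> hr tp; apply: contB.
  apply: (@cdiv (vr) 2 r t hr); exact: (vel_r_cont hp (lt_int hr) tp).
apply: (@cdiv (v) 3 r t hr); exact: (vel_cont hp (lt_int hr) tp).
Qed.

Lemma slope2_cont r t : R1 < r < R2 -> 0 < t -> {for (r, t), continuous (fun p : R * R => slope2 p.1 p.2)}.
Proof.
move=> hr tp; have hr' := lt_int hr; apply: contD; first apply: contB.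
- apply: (@cdiv (vrr) 3 r t hr); exact: (vel_rr_cont hp hr' tp).
- apply: (@cdiv (fun r t => 3 * vr r t) 4 r t hr); apply: (ccst (f := vr)); exact: (vel_r_cont hp hr' tp).
- apply: (@cdiv (fun r t => 3 * v r t) 5 r t hr); apply: (ccst (f := v)); exact: (vel_cont hp hr' tp).
Qed.

Lemma slope_t_cont r t : R1 < r < R2 -> 0 < t -> {for (r, t), continuous (fun p : R * R => slope_t p.1 p.2)}.
Proof.
by move=> hr tp; apply: (@cdiv (vt) 1 r t hr); exact: (vel_t_cont hp (lt_int hr) tp).
Qed.

(** This is [vel_equation] divided by [r], with [q = r * slope] and [n.+2] written as [n.-1 + 3]. *)
Lemma slope_equation r t : (0 < n)%N -> R1 < r < R2 -> 0 < t ->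
  slope_t r t + slope r t * (slope1 r t * r ^+ 2 + slope r t) =
  eps / 2 * (slope2 r t * r ^+ 2 + n.+2%:R * slope1 r t).
Proof.
move=> n0 hr tp; have rn : r != 0 by rewrite gt_eqF// pos.
have := vel_equation hp t (lt_int hr).
have -> : n.+2%:R = n.-1%:R + 3 :> R by rewrite -{1}(prednK n0) -addn3 natrD.
rewrite /slope_t /slope (vel_q hp (half hr) tp) /slope1 /slope2.
move: (v r t) (vr r t) (vrr r t) (vt r t) (n.-1%:R : R) => a b c e k h.
have -> : e = eps / 2 * (c + k / r * b - k / r ^+ 2 * a) - a * b by rewrite -h addrK.
by field.
Qed.

Lemma velocity_limit0 x : annulus R1 R2 x ->
  field slope p.1 p.2 @[p --> to_initial x] --> (q0 (enorm x) / enorm x) *: x.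
Proof.
move=> hx; have x0 : 0 < enorm x := pos hx.
have cf : {for (x, 0 : R), continuous (fun p : E * R =>
    (strip R1 R2 v (enorm p.1) p.2 / enorm p.1) *: p.1)}.
  apply: continuous_scale; last exact: cvg_fst.
  apply: contM; last by apply: contV; [rewrite gt_eqF|exact: enorm_fst_cont].
  by apply: (radial_cont (f := strip R1 R2 v)); have [] := strip_vel_cont hp (enorm x) 0.
rewrite -(vel_init hp (lt_int hx)) -(stripE v (lt_int hx) (lexx 0)).
have L : (strip R1 R2 v (enorm p.1) p.2 / enorm p.1) *: p.1 @[p --> to_initial x] -->
    (strip R1 R2 v (enorm x) 0 / enorm x) *: x by apply: cvg_within_filter; exact: cf.
apply: cvg_trans L; apply: near_eq_cvg.
have nA : nbhs ((x, 0) : E * R) [set p | annulus R1 R2 p.1].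
  by exists (annulus R1 R2, setT); [split; [exact: annulus_near|exact: filterT]|move=> -[y s] []].
change (nbhs ((x, 0) : E * R) [set p : E * R | 0 < p.2 ->
  (strip R1 R2 v (enorm p.1) p.2 / enorm p.1) *: p.1 = field slope p.1 p.2]).
apply: filterS nA => -[y s] /= hy sp.
by rewrite /field /slope (vel_q hp (half hy) sp) stripE ?(lt_int hy)// ltW.
Qed.

Lemma enorm_to_lim (f : E -> R) (h : R -> R) (a l : R) :
  (forall x, annulus R1 R2 x -> f x = h (enorm x)) ->
  h r @[r --> within [set r | R1 < r < R2] (nbhs a)] --> l ->
  f x @[x --> enorm_to R1 R2 a] --> l.
Proof.
move=> fh hl P hP.
have hw : within [set r | R1 < r < R2] (nbhs a) (h @^-1` P) := hl P hP.
have [e e0 he] : enorm_to R1 R2 a (@enorm R n @^-1` (h @^-1` P)) := enorm_to_cvg hw.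
by exists e => // x hx; have [hA _] := hx; rewrite /preimage/= fh//; exact: he.
Qed.

Lemma velocity_limit (a : R) t : 0 < t -> R1 <= a <= R2 ->
  radial_component (@field R n slope ^~ t) x @[x --> enorm_to R1 R2 a] --> v a t.
Proof.
move=> tp ha; apply: (enorm_to_lim (h := v ^~ t)).
  move=> x hx; have xn : enorm x != 0 by rewrite gt_eqF// pos.
  rewrite -(vel_q hp (half hx) tp).
  have -> : radial_component (@field R n slope ^~ t) x = \sum_i (q (enorm x) t / enorm x ^+ 2) * x 0 i ^+ 2.
    by apply: eq_bigr => i _; rewrite /field /slope mxE; field.
  by rewrite -mulr_sumr -enorm_sq; field.
by apply: cvg_within_filter; exact: der_cont (vel_der_r hp ha (ltW tp)).
Qed.

End assembly.
Theorem theorem5p2 (R : realType) (n : nat) (eps R1 R2 q1 q2 : R)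
  (q0 rho0 rho1 rho2 : R -> R)
  (lam : nat -> R) (beta : R -> R -> R -> R) (t0 : R -> R -> R)
  (hn : n = 2%N \/ n = 3%N) (heps : 0 < eps) (hR1 : 0 < R1) (hR12 : R1 < R2)
  (hq0 : Ck_on 2 `[R1, R2] q0)
  (hrho0 : Ck_on 1 `[R1, R2] rho0)
  (hrho1 : 0 < q1 -> Ck_on 1 `[0, +oo[ rho1)
  (hrho2 : 0 < - q2 -> Ck_on 1 `[0, +oo[ rho2)
  (hcu1 : velocity_consistent n eps q0 R1 q1)
  (hcu2 : velocity_consistent n eps q0 R2 q2)
  (hcrho1 : 0 < q1 -> density_consistent n q0 rho0 R1 rho1)
  (hcrho2 : 0 < - q2 -> density_consistent n q0 rho0 R2 rho2)
  (hlam : enumerates_positive_roots n eps R1 R2 q1 q2 lam)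
  (hq : q_well_defined n eps R1 R2 q1 q2 q0 lam)
  (hbeta : backward_characteristics n eps R1 R2 q1 q2 q0 lam beta t0) :
  classical_solution eps R1 R2 q1 q2 q0 rho0 rho1 rho2
    (@u_formula R n eps R1 R2 q1 q2 q0 lam)
    (@rho_formula R n eps R1 R2 q1 q2 q0 rho0 rho1 rho2 lam beta t0).

Proof.
have [hc1 _] := hcu1; have [hc2 _] := hcu2.
have [ph [ps [ch [th hp]]]] := velocity_heat_profile hn heps hR1 hR12 hlam hq hq0 hc1 hc2.
have [g [gr [gt [dp gE]]]] := formula_density_profile hp hq0 hrho0 hrho1 hrho2 hcrho1 hcrho2 hbeta.
(* The literal formula agrees with the regular [g] inside the annulus at positive times; derivatives
   and continuity carry over because the agreement holds in neighbourhoods. *)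
pose g0 r t := (r ^+ n.-1)^-1 * p_Gamma n R1 R2 rho0 rho1 rho2 (beta r t (t0 r t)) (t0 r t)
  * expR (- intR (t0 r t) t (fun s =>
      (fun x => q_formula n eps R1 R2 q1 q2 q0 lam x s)^`()%classic (beta r t s))).
pose q := q_formula n eps R1 R2 q1 q2 q0 lam.
have n0 : (0 < n)%N by case: hn => ->.
have pos (r : R) : R1 < r < R2 -> 0 < r by case/andP => h _; exact: lt_trans h.
have dg0 (r t : R) : R1 < r < R2 -> 0 < t -> der (fun r => g0 r t) r (gr r t).
  move=> hr tp; apply: (der_near _ (dp_r dp hr tp)).
  by apply: filterS (near_itv hr) => x hx; rewrite /g0 gE.
have dg0t (r t : R) : R1 < r < R2 -> 0 < t -> der (g0 r) t (gt r t).
  move=> hr tp; apply: (der_near _ (dp_t dp hr tp)).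
  by apply: filterS (lt_nbhsr tp) => s sp; rewrite /g0 gE.
have cg0 (r t : R) : R1 < r < R2 -> 0 < t -> {for (r, t), continuous (fun p : R * R => g0 p.1 p.2)}.
  move=> hr tp; apply: (cont_near _ (dp_cont dp hr tp)).
  by apply: filterS (near_int hr tp) => -[x y] [/= hx hy _]; rewrite /g0 gE.
have uE : @u_formula R n eps R1 R2 q1 q2 q0 lam = field (slope q) by [].
have rE : @rho_formula R n eps R1 R2 q1 q2 q0 rho0 rho1 rho2 lam beta t0 = radial g0 by [].
have d0 := slope_der hp; have d1 := slope1_der hp; have dt := slope_der_t hp.
have rhoE (t : R) : 0 < t -> forall x : 'rV[R]_n, annulus R1 R2 x -> radial g0 x t = g (enorm x) t.
  by move=> tp x hx; rewrite /radial /g0 gE.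
rewrite uE rE; split.
- exact: (field_C21 hR1 d0 d1 dt (slope_cont hp) (slope1_cont hp) (slope2_cont hp) (slope_t_cont hp)).
- exact: (radial_C1 hR1 dg0 dg0t cg0 (dp_cont_r dp) (dp_cont_t dp)).
- move=> x t hx tp; rewrite (partial_field_t dt hx tp) (field_directional hR1 d0 hx tp).
  rewrite (field_laplacian hR1 d0 d1 hx tp) -scalerDl scalerA; congr (_ *: _).
  exact: (slope_equation hp n0 hx tp).
- move=> x t hx tp.
  rewrite (radial_divergence hR1 d0 dg0 hx tp) /partial_t derive1E.
  have [_ ->] := radial_dt dg0t hx tp.
  have hr : R1 < enorm x < R2 := hx; have r0 := pos _ hr.
  have := dp_equation dp hr tp; rewrite /g0 gE//.
  have h2 : R1 / 2 < enorm x.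
    by case/andP: hr => h _; apply: (lt_trans _ h); rewrite ltr_pdivrMr// ltr_pMr// ltr1n.
  rewrite /slope (vel_q hp h2 tp) /slope1.
  have -> : n%:R = n.-1%:R + 1 :> R by rewrite -{1}(prednK n0) -addn1 natrD.
  move: (vel eps ph ps (enorm x) t) (vel_r n eps ph ps ch (enorm x) t) => a b.
  move: (g (enorm x) t) (gr (enorm x) t) (gt (enorm x) t) (n.-1%:R) (enorm x) r0 => c e f k r r0 <-; field.
  by rewrite gt_eqF.
- by move=> x hx; exact: (velocity_limit0 hp hx).
- move=> x hx.
  have L : g (enorm p.1) p.2 @[p --> to_initial x] --> rho0 (enorm x).
    exact: (cvg_comp (fun p : 'rV[R]_n * R => (enorm p.1, p.2)) (fun p : R * R => g p.1 p.2) (to_initial_cvg hx) (dp_initial dp hx)).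
  apply: cvg_trans L; apply: near_eq_cvg.
  have nA : nbhs ((x, 0) : 'rV[R]_n * R) [set p | annulus R1 R2 p.1].
    by exists (annulus R1 R2, setT); [split; [exact: annulus_near|exact: filterT]|move=> -[y s] []].
  change (nbhs ((x, 0) : 'rV[R]_n * R) [set p : 'rV[R]_n * R | 0 < p.2 ->
    g (enorm p.1) p.2 = radial g0 p.1 p.2]).
  by apply: filterS nA => -[y s] /= hy sp; rewrite rhoE.
- move=> t tp; rewrite -(vel_left hp (ltW tp)); apply: (velocity_limit hp tp).
  by rewrite lexx ltW.
- move=> t tp; rewrite -(vel_right hp (ltW tp)); apply: (velocity_limit hp tp).
  by rewrite lexx ltW.
- move=> qp t tp; apply: (enorm_to_lim (h := g ^~ t)); first exact: rhoE.
  exact: (dp_left dp qp tp).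
- move=> qp t tp; apply: (enorm_to_lim (h := g ^~ t)); first exact: rhoE.
  exact: (dp_right dp qp tp).
Qed.
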